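(* Let $N\ge1$ and suppose that $(p,a,b)$ satisfies one of the following conditions: (A) $p=2$, $0\le b<\frac{N-2}{2}$, $a<\frac{Nb}{N-2}$ and $a+b+1=\frac{2bN}{N-2}$; (B) $p=2$, $\frac{N-2}{2}<b\le N-2$ and $N(b-a+3)=2(3b-a+3)$; (C) $p>2$, $0\le b<\frac{N-p}{p}$, $a<\frac{Nb}{N-p}$ and $(p-1)a+b+1=\frac{pbN}{N-p}$. Then there exists a constant $C>0$ depending only on $p,a,b,N$ such that for any $u\in H^p_b(\mathbb{R}^N)\cap L^p_a(\mathbb{R}^N)$, $u\neq 0$, $$\inf_{v\in\mathcal{M}_{p,a,b}}\frac{\|u-v\|_{H^p_b}^p+(p-1)\|u-v\|_{L^p_a}^p}{\|u\|_{H^p_b}^p+(p-1)\|u\|_{L^p_a}^p}\le C\,\tilde\delta_{p,a,b}(u)^{1/p}\qquad\text{if }p>2,$$ and $$\inf_{v\in\mathcal{M}_{2,a,b}}\frac{\|u-v\|_{H^2_b}^2+\|u-v\|_{L^2_a}^2}{\|u\|_{H^2_b}^2+\|u\|_{L^2_a}^2}\le C\,\tilde\delta_{2,a,b}(u)\qquad\text{if }p=2.$$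
   Context: For $p>1$ and $a,b\in\mathbb{R}$, $H^p_b(\mathbb{R}^N)$ is the closure of $C_c^\infty(\mathbb{R}^N\setminus\{0\})$ under the norm $\|u\|_{H^p_b}=\left(\int_{\mathbb{R}^N}|x|^{-pb}|\nabla u|^p\,dx\right)^{1/p}$, and $L^p_a(\mathbb{R}^N)$ is the closure of $C_c^\infty(\mathbb{R}^N\setminus\{0\})$ under the norm $\|u\|_{L^p_a}=\left(\int_{\mathbb{R}^N}|x|^{-pa}|u|^p\,dx\right)^{1/p}$. Put $c=\frac{(p-1)a+b+1}{p}$. For $u\ne0$, $$\tilde\delta_{p,a,b}(u)=\frac{\|u\|_{H^p_b}^p+(p-1)\|u\|_{L^p_a}^p}{\|u\|_{L^p_c}^p}-pS_{p,a,b},$$ where $S_{p,a,b}$ is the best (largest) constant $S$ in the Caffarelli-Kohn-Nirenberg inequality $\|u\|_{H^p_b}\|u\|_{L^p_a}^{p-1}\ge S\|u\|_{L^p_c}^p$. Its known value is $S_{p,a,b}=\frac{N-1-(p-1)a-b}{p}$ in cases (A) and (C), and $S_{2,a,b}=\frac{3b-a-N+3}{2}$ in case (B). $\mathcal{M}_{p,a,b}$ is the set of minimizers of this inequality: in cases (A) and (C), $$\mathcal{M}_{p,a,b}=\left\{k\exp\left(-\tfrac{\lambda}{b+1-a}|x|^{b+1-a}\right):k\in\mathbb{R},\ \lambda>0\right\},$$ and in case (B), $$\mathcal{M}_{2,a,b}=\left\{k|x|^{2b+2-N}\exp\left(-\tfrac{\lambda}{b+1-a}|x|^{b+1-a}\right):k\in\mathbb{R},\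 \lambda>0\right\}.$$ *)

(* Defs.v *)
From HB Require Import structures.
From mathcomp Require Import all_boot all_order all_algebra.
From mathcomp Require Import all_classical all_reals all_analysis.
Set Implicit Arguments. Unset Strict Implicit. Unset Printing Implicit Defensive.
Import Order.TTheory GRing.Theory Num.Theory.
Import numFieldNormedType.Exports.
Local Open Scope classical_set_scope.
Local Open Scope ring_scope.

(* The product sigma-algebra on row vectors, set up as the library does for
   tuples; over the reals it is the Borel sigma-algebra of R^n. *)
Definition measure_rV_display : measure_display -> measure_display.
Proof. exact. Qed.

Section measurable_rV.
Context {d} {T : sigmaRingType d}.
Variable n : nat.

Let coors : 'I_n -> 'rV[T]_n -> T := fun i x => x ord0 i.

Let rV_set0 : g_sigma_preimage coors set0.
Proof. exact: sigma_algebra0. Qed.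

Let rV_setC A : g_sigma_preimage coors A -> g_sigma_preimage coors (~` A).
Proof. exact: sigma_algebraC. Qed.

Let rV_bigcup (F : _^nat) : (forall i, g_sigma_preimage coors (F i)) ->
  g_sigma_preimage coors (\bigcup_i (F i)).
Proof. exact: sigma_algebra_bigcup. Qed.

HB.instance Definition _ := @isMeasurable.Build (measure_rV_display d)
  'rV[T]_n (g_sigma_preimage coors) rV_set0 rV_setC rV_bigcup.
End measurable_rV.

Section measurable_fun_rV.
Context {d1 d2} {T1 : measurableType d1} {T2 : measurableType d2}.

Lemma measurable_coord n (i : 'I_n) :
  measurable_fun [set: 'rV[T2]_n] (fun x => x ord0 i).
Proof.
move=> _ Y mY; rewrite setTI; apply: sub_sigma_algebra => /=.
rewrite -bigcup_seq/=; exists i => /=; first by rewrite mem_index_enum.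
by exists Y => //; rewrite setTI.
Qed.

Lemma measurable_fun_rVP n (f : T1 -> 'rV[T2]_n) :
  (forall i, measurable_fun [set: T1] (fun x => f x ord0 i)) ->
  measurable_fun [set: T1] f.
Proof.
move=> mf _ A mA; rewrite setTI.
pose S : set (set 'rV[T2]_n) := [set B | measurable (f @^-1` B)].
suff : S A by [].
move: A mA; apply: smallest_sub.
  split; rewrite /S /=.
  - by rewrite preimage_set0.
  - by move=> B mB; rewrite setTD preimage_setC; exact: measurableC.
  - by move=> F mF; rewrite preimage_bigcup; exact: bigcupT_measurable.
move=> B; rewrite -bigcup_seq => -[i _] [C mC <-].
by rewrite /S /= setTI -[X in measurable X]setTI; exact: mf.
Qed.
End measurable_fun_rV.

Section lebesgue_rV_cons.
Context {R : realType}.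
Variable n : nat.
Variable mu : {sigma_finite_measure set 'rV[R]_n -> \bar R}.

Definition consrV (z : measurableTypeR R * 'rV[R]_n) : 'rV[R]_n.+1 :=
  \row_i oapp (fun j => z.2 ord0 j) z.1 (unlift ord0 i).

Definition unconsrV (x : 'rV[R]_n.+1) : measurableTypeR R * 'rV[R]_n :=
  (x ord0 ord0, \row_j x ord0 (lift ord0 j)).

Lemma consrV0 z : consrV z ord0 ord0 = z.1.
Proof. by rewrite mxE unlift_none. Qed.

Lemma consrVS z i : consrV z ord0 (lift ord0 i) = z.2 ord0 i.
Proof. by rewrite mxE liftK. Qed.

Lemma consrVK : cancel consrV unconsrV.
Proof.
move=> [t v]; rewrite /unconsrV consrV0/=; congr pair.
by apply/rowP => j; rewrite mxE consrVS.
Qed.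

Lemma unconsrVK : cancel unconsrV consrV.
Proof.
move=> x; apply/rowP => i; case: (unliftP ord0 i) => [j|] ->.
  by rewrite consrVS mxE.
by rewrite consrV0.
Qed.

Lemma measurable_consrV :
  measurable_fun [set: measurableTypeR R * 'rV[R]_n] consrV.
Proof.
apply: measurable_fun_rVP => i.
case: (unliftP ord0 i) => [j|] ->.
  under eq_fun do rewrite consrVS.
  exact: (measurableT_comp (measurable_coord j) measurable_snd).
under eq_fun do rewrite consrV0.
exact: measurable_fst.
Qed.

Lemma measurable_unconsrV : measurable_fun [set: 'rV[R]_n.+1] unconsrV.
Proof.
apply: measurable_fun_pair; first exact: measurable_coord.
apply: measurable_fun_rVP => i.
under eq_fun do rewrite mxE.
exact: measurable_coord.
Qed.

HB.instance Definition _ := @isMeasurableFun.Build _ _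
  (measurableTypeR R * 'rV[R]_n)%type 'rV[R]_n.+1 consrV measurable_consrV.

Definition lebesgue_rV_cons : set 'rV[R]_n.+1 -> \bar R :=
  pushforward (@lebesgue_measure R \x mu)%E consrV.

Let lebesgue_rV_cons0 : lebesgue_rV_cons set0 = 0%E.
Proof. exact: measure0. Qed.

Let lebesgue_rV_cons_ge0 A : (0 <= lebesgue_rV_cons A)%E.
Proof. exact: measure_ge0. Qed.

Let lebesgue_rV_cons_sigma_additive : semi_sigma_additive lebesgue_rV_cons.
Proof. exact: measure_semi_sigma_additive. Qed.

HB.instance Definition _ := isMeasure.Build _ _ _ lebesgue_rV_cons
  lebesgue_rV_cons0 lebesgue_rV_cons_ge0 lebesgue_rV_cons_sigma_additive.

Let lebesgue_rV_cons_sigma_finite : sigma_finite setT lebesgue_rV_cons.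
Proof.
have /sigma_finiteP[F [TF ndF Foo]] := sigma_finiteT (@lebesgue_measure R).
have /sigma_finiteP[G [TG ndG Goo]] := sigma_finiteT mu.
exists (fun k => unconsrV @^-1` (F k `*` G k)).
  rewrite -preimage_bigcup -(preimage_setT unconsrV); congr (_ @^-1` _).
  rewrite -setXTT TF TG predeqE => -[x y]; split.
    move=> [/= [k _ Fkx] [l _ Gly]]; exists (maxn k l) => //; split.
    - by move: x Fkx; exact/subsetPset/ndF/leq_maxl.
    - by move: y Gly; exact/subsetPset/ndG/leq_maxr.
  by move=> [k _ []/= ? ?]; split; exists k.
move=> k; have [mF Fk] := Foo k; have [mG Gk] := Goo k; split.
  by rewrite -[X in measurable X]setTI; apply: measurable_unconsrV => //;
    exact: measurableX.
rewrite /lebesgue_rV_cons /pushforward -comp_preimage.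
rewrite (_ : unconsrV \o consrV = id); last exact/funext/consrVK.
by rewrite preimage_id product_measure1E// lte_mul_pinfty// ge0_fin_numE.
Qed.

HB.instance Definition _ := Measure_isSigmaFinite.Build _ _ _ lebesgue_rV_cons
  lebesgue_rV_cons_sigma_finite.
End lebesgue_rV_cons.

Fixpoint lebesgue_rV (R : realType) (n : nat) :
    {sigma_finite_measure set 'rV[R]_n -> \bar R} :=
  if n is n'.+1 then lebesgue_rV_cons (lebesgue_rV R n')
  else dirac (0 : 'rV[R]_0).

Section CKN.
Context {R : realType} {N : nat}.
Implicit Types (u v f phi : 'rV[R]_N -> R) (p a b c : R).

(* The library's norm on row vectors is the sup norm, hence this Euclidean one. *)
Definition l2norm (x : 'rV[R]_N) : R := Num.sqrt (\sum_i x ord0 i ^+ 2).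

Definition partial (i : 'I_N) f : 'rV[R]_N -> R :=
  fun x => 'D_(delta_mx ord0 i) f x.

Definition smooth f :=
  forall (s : seq 'I_N) x, differentiable (foldr partial f s) x.

(* C_c^oo(R^N \ {0}) *)
Definition test_fun phi :=
  let supp := closure [set x | phi x != 0] in
  [/\ smooth phi, compact supp & ~ supp 0].

(* L^1_loc(R^N \ {0}) *)
Definition loc_integrable f :=
  forall K : set 'rV[R]_N, compact K -> ~ K 0 ->
  (lebesgue_rV R N).-integrable K (EFin \o f).

Definition cvg_L1loc (f_ : nat -> 'rV[R]_N -> R) f :=
  forall K : set 'rV[R]_N, compact K -> ~ K 0 ->
  (\int[lebesgue_rV R N]_(x in K) `|f x - f_ n x|%:E)%E @[n --> \oo] --> 0%E.

(* Distributional gradient on R^N \ {0}; it is unique up to null sets. *)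
Definition is_weak_gradient u (G : 'rV[R]_N -> 'rV[R]_N) :=
  loc_integrable u /\
  forall i, loc_integrable (fun x => G x ord0 i) /\
    forall phi, test_fun phi ->
      \int[lebesgue_rV R N]_x (u x * partial i phi x) =
      - \int[lebesgue_rV R N]_x (G x ord0 i * phi x).

Definition weak_gradient u : 'rV[R]_N -> 'rV[R]_N :=
  get [set G | is_weak_gradient u G].

Definition normL p a u : \bar R :=
  ((\int[lebesgue_rV R N]_x
      (l2norm x `^ (- (p * a)) * `|u x| `^ p)%:E) `^ p^-1)%E.

Definition normH p b u : \bar R :=
  ((\int[lebesgue_rV R N]_x
      (l2norm x `^ (- (p * b)) * l2norm (weak_gradient u x) `^ p)%:E)
   `^ p^-1)%E.

Definition spaceL p a : set ('rV[R]_N -> R) :=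
  [set u : 'rV[R]_N -> R | measurable_fun setT u /\
    exists phi : nat -> 'rV[R]_N -> R, (forall n, test_fun (phi n)) /\
      normL p a (u \- phi n) @[n --> \oo] --> 0%E].

(* An element of the closure is realized as the L^1_loc(R^N \ {0}) limit of
   the approximating test functions. Convergence of the gradients alone would
   not do: normH vanishes on constants, and would let in functions such as
   1 + w with w in the closure. *)
Definition spaceH p b : set ('rV[R]_N -> R) :=
  [set u | [/\ measurable_fun setT u, exists G, is_weak_gradient u G &
    exists phi : nat -> 'rV[R]_N -> R, [/\ forall n, test_fun (phi n),
      cvg_L1loc phi u &
      normH p b (u \- phi n) @[n --> \oo] --> 0%E]]].

Definition CKN_exponent p a b : R := ((p - 1) * a + b + 1) / p.

(* S_{p,a,b} *)
Definition CKN_constant p a b : R :=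
  sup [set S : R | forall u, (spaceH p b `&` spaceL p a) u ->
    (S%:E * normL p (CKN_exponent p a b) u `^ p
       <= normH p b u * normL p a u `^ (p - 1))%E].

(* M_{p,a,b}: the equality cases, the zero function included. *)
Definition CKN_minimizers p a b : set ('rV[R]_N -> R) :=
  [set v : 'rV[R]_N -> R | (spaceH p b `&` spaceL p a) v /\
    ((CKN_constant p a b)%:E * normL p (CKN_exponent p a b) v `^ p
       = normH p b v * normL p a v `^ (p - 1))%E].

Definition CKN_energy p a b u : R :=
  fine (normH p b u) `^ p + (p - 1) * fine (normL p a u) `^ p.

Definition CKN_deficit p a b u : R :=
  CKN_energy p a b u / fine (normL p (CKN_exponent p a b) u) `^ p
  - p * CKN_constant p a b.

End CKN.

(* Main.v *)
(* For a test function u, expanding |x|^-pb |grad u|^p around -u k(x) x, where k is the radial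
   kernel for which grad phi = - phi k(x) x holds for the extremal profile
   phi = |x|^al exp (- |x|^(b + 1 - a) / (b + 1 - a)), and integrating the cross term by parts
   shows that the excess Q(u) = |u|_H^p + (p - 1) |u|_L^p - p S |u|_c^p dominates
   D(u) = int |x|^-pb |grad u + u k(x) x|^p; here al = 0 in cases (A), (C) and al = 2 b + 2 - N in
   case (B), where the expansion is exact. Since grad u + u k(x) x = phi grad (u / phi), the Poincare
   inequality on a cube bounds u - k phi on an annulus by D(u); outside a large annulus the weight
   |x|^-pc is small against |x|^-pa + |x|^-p(b+1), so the reverse expansion and Hardy's inequality
   bound the whole energy of u - k phi by D(u) and its mass on the annulus. This gives
   E(u - k phi) <= C Q(u), hence the case p = 2; for p > 2 the power 1/p follows because taking v = 0
   bounds the infimum by 1. *)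
From HB Require Import structures.
Require Import Defs.
From mathcomp Require Import all_boot all_order all_algebra.
From mathcomp Require Import all_classical all_reals all_analysis.
From mathcomp Require Import measurable_realfun ring lra.
Set Implicit Arguments. Unset Strict Implicit. Unset Printing Implicit Defensive.
Import Order.TTheory GRing.Theory Num.Theory.
Import numFieldNormedType.Exports.
Local Open Scope classical_set_scope.
Local Open Scope ring_scope.

(** * Real inequalities *)

(** The constant S is defined as a supremum and the minimizers as equality cases, so both are
    computed on the way: optimizing the expansion over the scale lambda gives the product
    inequality, and the reverse expansion along cut-offs of phi shows that phi has excess 0, hence
    attains equality. The competitors are multiples of the profile with lambda = 1, the scale at
    which Q is taken. The expansions hold for functions supported off the origin, and u - k phi is
    not one. It is replaced by u - k chi_j phi with a smooth cut-off chi_j; since grad phi + phi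
    k(x) x = 0, D(chi_j phi) contains only the gradient of the cut-off and tends to 0. The profile
    is singular at the origin, but a test function vanishes there and phi^-p is at most a constant
    times |x|^-pb on a cube, so Poincare can be applied across the origin to u / phi. Integrability
    of phi comes from radial integration by parts and Fatou's lemma, in place of polar coordinates.
    Norms enter through their p-th powers, and convexity with a free weight replaces the triangle
    inequality. *)

Section powR_inequalities.
Context {R : realType}.
Implicit Types p q x y m t : R.

(** Young's inequality for [x / m] and 1, multiplied by [m ^ p]. The exponent [p = 1], whose
    conjugate is infinite, and the base point [m = 0] are treated apart. *)
Lemma powR_tangent p x m : 1 <= p -> 0 <= x -> 0 <= m ->
  m `^ p + p * m `^ (p - 1) * (x - m) <= x `^ p.
Proof.
move=> p1 x0 m0; have [->|pn1] := eqVneq p 1.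
  by rewrite subrr powRr0 !powRr1//; lra.
have {pn1 p1}p1 : 1 < p by rewrite lt_neqAle eq_sym pn1.
have [->|mn0] := eqVneq m 0.
  rewrite powR0; last by lra.
  by rewrite powR0 ?subr_eq0 ?gt_eqF// mulr0 mul0r addr0 powR_ge0.
have {mn0 m0}m0 : 0 < m by rewrite lt_neqAle eq_sym mn0.
have H := @conjugate_powR R (x / m) 1 p (p / (p - 1)) (divr_ge0 x0 (ltW m0)) ler01
   ltac:(lra) ltac:(apply: divr_gt0; lra) ltac:(field; lra).
have {H}H : 1 + p * (x / m - 1) <= (x / m) `^ p.
  move: H; rewrite mulr1 powR1 mul1r invf_div -(ler_pM2l (_ : 0 < p)); last lra.
  rewrite (_ : p * (_ `^ p / p + _) = (x / m) `^ p + (p - 1)); last by field; lra.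
  lra.
have mp : 0 < m `^ p by rewrite powR_gt0.
move: H; rewrite -(ler_pM2l mp) -(@powRM _ m (x / m) p (ltW m0) (divr_ge0 x0 (ltW m0))).
rewrite (_ : m * (x / m) = x); last by field; lra.
apply: le_trans; rewrite -(@mulr_powRB1 _ m p (ltW m0)); last by lra.
rewrite le_eqVlt; apply/orP; left; apply/eqP; field; lra.
Qed.

(** Weighted sum of the tangent inequalities based at [x + y] for the points [x / (1 - t)] and
    [y / t]. The weight [t] stays free so that the coefficient of [x ^ p] can be brought close to
    1. *)
Lemma powRD_convex p x y t : 1 <= p -> 0 <= x -> 0 <= y -> 0 < t < 1 ->
  (x + y) `^ p <= (1 - t) `^ (1 - p) * x `^ p + t `^ (1 - p) * y `^ p.
Proof.
move=> p1 x0 y0 t01.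
have sc (s z : R) : 0 < s -> 0 <= z -> s `^ (1 - p) * z `^ p = s * (z / s) `^ p.
  move=> s0 z0; rewrite powRM ?invr_ge0 ?(ltW s0)// -powR_inv1 ?(ltW s0)// -powRrM mulN1r.
  rewrite powRD; last by apply/implyP => _; rewrite gt_eqF.
  by rewrite powRr1 ?(ltW s0)//; ring.
rewrite !sc//; [|lra..].
have H1 := powR_tangent p1 (divr_ge0 x0 (_ : 0 <= 1 - t)) (addr_ge0 x0 y0).
have H2 := powR_tangent p1 (divr_ge0 y0 (_ : 0 <= t)) (addr_ge0 x0 y0).
have {}H1 := H1 ltac:(lra); have {}H2 := H2 ltac:(lra).
have K1 := ler_wpM2l (_ : 0 <= 1 - t) H1; have {}K1 := K1 ltac:(lra).
have K2 := ler_wpM2l (_ : 0 <= t) H2; have {}K2 := K2 ltac:(lra).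
apply: le_trans (lerD K1 K2); rewrite le_eqVlt; apply/orP; left; apply/eqP.
field; lra.
Qed.

Lemma powRD_le p x y : 1 <= p -> 0 <= x -> 0 <= y ->
  (x + y) `^ p <= 2 `^ (p - 1) * (x `^ p + y `^ p).
Proof.
move=> p1 x0 y0; have := @powRD_convex p x y 2^-1 p1 x0 y0 ltac:(lra).
rewrite (_ : 1 - 2^-1 = 2^-1 :> R); last by field.
by rewrite -powR_inv1// -powRrM mulN1r opprB -mulrDr.
Qed.

Lemma powR_young p x y t : 1 < p -> 0 <= x -> 0 <= y -> 0 < t ->
  p * (x * y `^ (p - 1)) <= t `^ (1 - p) * x `^ p + (p - 1) * (t * y `^ p).
Proof.
move=> p1 x0 y0 t0.
have q0 : p - 1 != 0 by lra.
(* This scale satisfies [s ^ (- p) = t ^ (1 - p)] and [s ^ (p / (p - 1)) = t], so Young's inequality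
   for [x / s] and [s * y ^ (p - 1)] has the wanted coefficients. *)
have [s s0 sE] : exists2 s, 0 < s & s = t `^ ((p - 1) / p).
  by exists (t `^ ((p - 1) / p)) => //; rewrite powR_gt0.
have H := @conjugate_powR R (x / s) (s * y `^ (p - 1)) p (p / (p - 1))
  (divr_ge0 x0 (ltW s0)) (mulr_ge0 (ltW s0) (powR_ge0 _ _))
   ltac:(lra) ltac:(apply: divr_gt0; lra) ltac:(field; lra).
move: H; rewrite -(ler_pM2l (_ : 0 < p)); last by lra.
have -> : p * (x / s * (s * y `^ (p - 1))) = p * (x * y `^ (p - 1)).
  by field; lra.
move/le_trans; apply.
rewrite !powRM ?powR_ge0 ?invr_ge0 ?(ltW s0)// -(powRrM y).
rewrite (_ : (p - 1) * (p / (p - 1)) = p); last by field; lra.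
have -> : s^-1 `^ p = t `^ (1 - p).
  rewrite -(powR_inv1 (ltW s0)) sE -!powRrM; congr (_ `^ _); field; lra.
have -> : s `^ (p / (p - 1)) = t.
  rewrite sE -powRrM (_ : _ * _ = 1) ?powRr1 ?(ltW t0)//; field; lra.
rewrite le_eqVlt; apply/orP; left; apply/eqP; field; lra.
Qed.
End powR_inequalities.

(** * Continuity and differentiability of powers of the absolute value *)

Section powR_calculus.
Context {R : realType}.
Implicit Types p q x y m t : R.

Lemma continuous_powR q x : 0 < x -> {for x, continuous (fun t => t `^ q)}.
Proof.
move=> x0; have [d _] := is_derive1_powR q x0.
by apply: differentiable_continuous; apply/derivable1_diffP.
Qed.

Lemma continuous_norm_powR q : 0 < q -> continuous (fun t : R => `|t| `^ q).
Proof.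
move=> q0 t; have [->|t0] := eqVneq t 0; last first.
  apply: (@continuous_comp _ _ _ (fun s : R => `|s|) (fun s => s `^ q)).
    exact: norm_continuous.
  by apply: continuous_powR; rewrite normr_gt0.
rewrite /continuous_at normr0 powR0 ?gt_eqF//.
apply/cvgr0Pnorm_lt => e e0; near=> s.
rewrite ger0_norm ?powR_ge0//.
have -> : e = (e `^ q^-1) `^ q by rewrite -powRrM mulVf ?gt_eqF// powRr1 ?ltW.
rewrite gt0_ltr_powR ?nnegrE ?powR_ge0//.
near: s; apply/nbhs_ballP; exists (e `^ q^-1); first by rewrite /= powR_gt0.
by move=> s; rewrite /ball/= sub0r normrN.
Unshelve. all: by end_near. Qed.

(* the derivative of [|t|^p / p] *)
Definition spow p t := Num.sg t * `|t| `^ (p - 1).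

Lemma spowE p t : t * spow p t = `|t| * `|t| `^ (p - 1).
Proof. by rewrite /spow mulrA normrEsg [t * _]mulrC. Qed.

Lemma norm_spow_le p t : `|spow p t| <= `|t| `^ (p - 1).
Proof.
rewrite /spow normrM (ger0_norm (powR_ge0 _ _)) ler_piMl ?powR_ge0//.
by rewrite normr_sg; case: eqP.
Qed.

Lemma continuous_spow p : 1 < p -> continuous (spow p).
Proof.
move=> p1; have q0 : 0 < p - 1 by lra.
(* Written through positive and negative parts, the function is visibly continuous at 0. *)
have -> : spow p = fun t => `|Num.max t 0| `^ (p - 1) - `|Num.max (- t) 0| `^ (p - 1).
  apply/funext => t; rewrite /spow; have [t0|t0|->] := ltgtP t 0.
  - rewrite ltr0_sg// ltr0_norm// (max_idPl _); last by lra.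
    by rewrite normr0 powR0 ?gt_eqF// sub0r mulN1r gtr0_norm ?oppr_gt0.
  - rewrite gtr0_sg// gtr0_norm// (max_idPr _); last by lra.
    by rewrite normr0 powR0 ?gt_eqF// subr0 mul1r.
  - by rewrite sgr0 mul0r oppr0 maxxx subrr.
move=> t; apply: cvgB.
  apply: (@continuous_comp _ _ _ (fun s : R => Num.max s 0) (fun s => `|s| `^ (p - 1))).
    by apply: continuous_max => //; exact: cst_continuous.
  exact: continuous_norm_powR.
apply: (@continuous_comp _ _ _ (fun s : R => Num.max (- s) 0) (fun s => `|s| `^ (p - 1))).
  by apply: continuous_max; [exact: opp_continuous|exact: cst_continuous].
exact: continuous_norm_powR.
Qed.

(** Away from 0 this is the derivative of a power. At 0 the difference quotient of [|s| ^ p] is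
    [spow p h] itself, which tends to 0. *)
Lemma is_derive_norm_powR p t : 1 < p ->
  is_derive t 1 (fun s : R => `|s| `^ p) (p * spow p t).
Proof.
move=> p1; rewrite /spow; have [t0|t0|->] := ltgtP t 0.
- have E : \forall s \near t, (- s) `^ p = `|s| `^ p.
    near=> s; rewrite ltr0_norm//; near: s; exact: lt_nbhsl.
  apply: (near_eq_is_derive E).
  rewrite ltr0_sg// ltr0_norm//.
  have d1 : is_derive t (1 : R) (fun s : R => - s) (-1) by exact: is_deriveNid.
  have d2 := @is_derive1_powR R p (- t) ltac:(by rewrite oppr_gt0).
  have := @is_derive1_comp _ (fun s => s `^ p) (fun s : R => - s) t _ _ d2 d1.
  by move/is_derive_eq; apply; ring.
- have E : \forall s \near t, s `^ p = `|s| `^ p.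
    near=> s; rewrite gtr0_norm//; near: s; exact: lt_nbhsr.
  apply: (near_eq_is_derive E).
  rewrite gtr0_sg// gtr0_norm// mul1r; exact: is_derive1_powR.
- rewrite sgr0 mul0r mulr0.
  suff H : (fun h : R => h^-1 *: (((fun s : R => `|s| `^ p) \o shift 0) (h *: 1) - `|0 : R| `^ p)) @ 0^' --> (0 : R).
    by apply: DeriveDef; [apply/cvg_ex; exists 0|exact/cvg_lim].
  have q0 : 0 < p - 1 by lra.
  have C : (fun h : R => spow p h) @ 0^' --> (0 : R).
    have := @continuous_spow p p1 0; rewrite /continuous_at {2}/spow sgr0 mul0r.
    exact: cvg_within_filter.
  apply: cvg_trans C; apply: near_eq_cvg; near=> h.
  have h0 : h != 0 by near: h; exact: nbhs_dnbhs_neq.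
  rewrite /= addr0 normr0 powR0 ?gt_eqF//; last by lra.
  rewrite subr0 [h *: 1]mulr1 -(@mulr_powRB1 _ `|h| p) ?normr_ge0//; last by lra.
  by rewrite -spowE [_ *: _]mulrA mulVf// mul1r.
Unshelve. all: by end_near. Qed.
End powR_calculus.

(** * Integration on row vectors *)

Section rV_measurable.
Context {R : realType}.

(** An open set is the union of the boxes with rational end points that it contains, and there are
    countably many. This links the norm topology to the product sigma-algebra. *)
Lemma open_measurable_rV n (U : set 'rV[R]_n) : open U -> measurable U.
Proof.
move=> oU.
pose box (k : {ffun 'I_n -> rat * rat}) : set 'rV[R]_n :=
  [set x | forall i, ratr (k i).1 < x ord0 i < ratr (k i).2].
have mbox k : measurable (box k).
  rewrite (_ : box k = \bigcap_(i in [set: 'I_n])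
     ((fun x : 'rV[R]_n => x ord0 i) @^-1` `]ratr (k i).1, ratr (k i).2[)); last first.
    apply/seteqP; split => x /= H i; first by move=> _; rewrite /= in_itv/= H.
    by have := H i I; rewrite /= in_itv.
  apply: fin_bigcap_measurable => // i _.
  by rewrite -[X in measurable X]setTI; apply: measurable_coord.
have -> : U = \bigcup_(k in [set k | box k `<=` U]) box k.
  apply/seteqP; split=> [x Ux|x [k kU kx]]; last exact: kU.
  have [P Px PU] : nbhs x U by exact: open_nbhs_nbhs.
  have /choice[k hk] : forall i : 'I_n, exists q : rat * rat,
      ratr q.1 < x ord0 i < ratr q.2 /\
      (forall t, ratr q.1 < t < ratr q.2 -> P ord0 i t).
    move=> i; have /nbhs_ballP[e /= e0 he] := Px ord0 i.
    have [q1 /andP[h1 h2]] : exists q, x ord0 i - e < ratr q < x ord0 i.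
      have [q] := @rat_in_itvoo R (x ord0 i - e) (x ord0 i) ltac:(lra).
      by rewrite in_itv /=; exists q.
    have [q2 /andP[h3 h4]] : exists q, x ord0 i < ratr q < x ord0 i + e.
      have [q] := @rat_in_itvoo R (x ord0 i) (x ord0 i + e) ltac:(lra).
      by rewrite in_itv /=; exists q.
    exists (q1, q2); split => /=; first by rewrite h2 h3.
    move=> t /andP[t1 t2]; apply: he; rewrite /ball/= ltr_norml; lra.
  exists (finfun k) => [y yk|i]; last by rewrite ffunE; have [] := hk i.
  apply: PU => i j; rewrite (ord1 i); have := yk j; rewrite ffunE.
  by have [_] := hk j; apply.
rewrite bigcup_mkcond; apply: countable_bigcupT_measurable => // k.
by case: ifPn => // _; exact: mbox.
Qed.

Lemma continuous_measurable_rV n (f : 'rV[R]_n -> R) :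
  continuous f -> measurable_fun setT f.
Proof.
move=> cf; apply: (measurability _ (RGenOInfty.measurableE R)).
move=> _ [_ [a ->] <-]; rewrite setTI; apply: open_measurable_rV.
by apply: open_comp => // x _; exact: cf.
Qed.

Lemma cvg_rV (T : Type) (F : set_system T) {FF : Filter F} n
    (f : T -> 'rV[R]_n) (l : 'rV[R]_n) :
  (forall i, f x ord0 i @[x --> F] --> l ord0 i) -> f x @[x --> F] --> l.
Proof.
move=> fl A [P Pl PA]; apply: (@filterS _ F _ (fun x => forall i, P ord0 i (f x ord0 i))).
  by move=> x Px; apply: PA => i j; rewrite (ord1 i).
by apply: filter_forall => i; apply: fl; exact: Pl.
Qed.

Lemma continuous_consrVr n t : continuous (fun y : 'rV[R]_n => consrV (t, y)).
Proof.
move=> y; apply: (@cvg_rV _ (nbhs y) _) => i; case: (unliftP ord0 i) => [j|] ->.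
  under eq_cvg do rewrite consrVS.
  by rewrite consrVS; exact: coord_continuous.
under eq_cvg do rewrite consrV0.
by rewrite consrV0; exact: cvg_cst.
Qed.

Lemma continuous_consrVl n (y : 'rV[R]_n) :
  continuous (fun t : R => consrV (t, y) : 'rV[R]_n.+1).
Proof.
move=> t; apply: (@cvg_rV _ (nbhs t) _) => i; case: (unliftP ord0 i) => [j|] ->.
  under eq_cvg do rewrite consrVS.
  by rewrite consrVS; exact: cvg_cst.
under eq_cvg do rewrite consrV0.
by rewrite consrV0.
Qed.

Definition cube n (M : R) : set 'rV[R]_n := [set x | forall i, `|x ord0 i| <= M].
Arguments cube : clear implicits.

Lemma compact_cube n M : compact (cube n M).
Proof.
rewrite (_ : cube n M = [set v | forall i : 'I_n, `[- M, M]%classic (v ord0 i)]).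
  by apply: (@rV_compact _ _ (fun=> `[- M, M]%classic)) => i; exact: segment_compact.
by apply/seteqP; split => x /= xM i; have := xM i; rewrite /= in_itv/= ler_norml.
Qed.

Lemma measurable_cube n M : measurable (cube n M).
Proof.
rewrite (_ : cube n M = \bigcap_(i in [set: 'I_n])
   ((fun x : 'rV[R]_n => x ord0 i) @^-1` `[- M, M])).
  apply: fin_bigcap_measurable => // i _.
  by rewrite -[X in measurable X]setTI; apply: measurable_coord.
by apply/seteqP; split => x /= H i; [move=> _|]; have := H i;
  rewrite /= in_itv/= ler_norml => // /(_ I).
Qed.

Lemma preimage_consrV_cube n M :
  (@consrV R n) @^-1` (cube n.+1 M) = `[- M, M] `*` cube n M.
Proof.
apply/seteqP; split => -[t y] /=.
  move=> H; split; first by have := H ord0; rewrite consrV0 in_itv/= ler_norml.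
  by move=> j /=; have := H (lift ord0 j); rewrite consrVS.
move=> [/= tM yM] i; case: (unliftP ord0 i) => [j|] ->; first by rewrite consrVS.
by move: tM; rewrite consrV0 in_itv/= ler_norml.
Qed.

Lemma lebesgue_rV_cube n M : (lebesgue_rV R n (cube n M) < +oo)%E.
Proof.
elim: n => [|n IH].
  by rewrite /= diracE; case: (_ \in _) => //=; rewrite ltry.
rewrite /= /lebesgue_rV_cons /pushforward preimage_consrV_cube.
rewrite product_measure1E//; last exact: measurable_cube.
have h : (lebesgue_measure `[(- M)%R, M] < +oo :> \bar R)%E.
  by rewrite lebesgue_measure_itv/=; case: ifP => _; rewrite ?ltry.
by apply: lte_mul_pinfty => //; rewrite ge0_fin_numE.
Qed.

Lemma ge0_integral_rVS1 n (f : 'rV[R]_n.+1 -> \bar R) :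
  measurable_fun setT f -> (forall x, 0 <= f x)%E ->
  (\int[lebesgue_rV R n.+1]_x f x =
   \int[@lebesgue_measure R]_t \int[lebesgue_rV R n]_y f (consrV (t, y)))%E.
Proof.
move=> mf f0; rewrite (ge0_integral_pushforward (@measurable_consrV R n))//.
rewrite preimage_setT fubini_tonelli1//; last by move=> z; exact: f0.
by apply: measurableT_comp => //; exact: measurable_consrV.
Qed.

Lemma ge0_integral_rVS2 n (f : 'rV[R]_n.+1 -> \bar R) :
  measurable_fun setT f -> (forall x, 0 <= f x)%E ->
  (\int[lebesgue_rV R n.+1]_x f x =
   \int[lebesgue_rV R n]_y \int[@lebesgue_measure R]_t f (consrV (t, y)))%E.
Proof.
move=> mf f0; rewrite (ge0_integral_pushforward (@measurable_consrV R n))//.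
rewrite preimage_setT fubini_tonelli2//; last by move=> z; exact: f0.
by apply: measurableT_comp => //; exact: measurable_consrV.
Qed.

Lemma integrable_rVS n (f : 'rV[R]_n.+1 -> \bar R) :
  (lebesgue_rV R n.+1).-integrable setT f ->
  (@lebesgue_measure R \x lebesgue_rV R n)%E.-integrable setT (f \o @consrV R n).
Proof.
move=> /integrableP[mf fi]; apply/integrableP; split.
  by apply: measurableT_comp => //; exact: measurable_consrV.
move: fi; rewrite /= (ge0_integral_pushforward (@measurable_consrV R n))//.
exact: measurableT_comp.
Qed.

Lemma integral_rVS1 n (f : 'rV[R]_n.+1 -> \bar R) :
  (lebesgue_rV R n.+1).-integrable setT f ->
  (\int[lebesgue_rV R n.+1]_x f x =
   \int[@lebesgue_measure R]_t \int[lebesgue_rV R n]_y f (consrV (t, y)))%E.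
Proof.
move=> fi; have fi' := integrable_rVS fi.
rewrite (integral_pushforward (@measurable_consrV R n)) ?preimage_setT//.
  by rewrite -fubini1.
by case/integrableP : fi.
Qed.

Lemma integral_rVS2 n (f : 'rV[R]_n.+1 -> \bar R) :
  (lebesgue_rV R n.+1).-integrable setT f ->
  (\int[lebesgue_rV R n.+1]_x f x =
   \int[lebesgue_rV R n]_y \int[@lebesgue_measure R]_t f (consrV (t, y)))%E.
Proof.
move=> fi; have fi' := integrable_rVS fi.
rewrite (integral_pushforward (@measurable_consrV R n)) ?preimage_setT//.
  by rewrite -fubini2.
by case/integrableP : fi.
Qed.

Lemma continuous_cube_integrable n M (f : 'rV[R]_n -> R) : continuous f ->
  (lebesgue_rV R n).-integrable (cube n M) (EFin \o f).
Proof.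
move=> cf; apply: measurable_bounded_integrable.
- exact: measurable_cube.
- exact: lebesgue_rV_cube.
- by apply: measurable_funTS; exact: continuous_measurable_rV.
- rewrite -(image_id (cube n M)); have := @continuous_compact _ _ f (cube n M) (continuous_subspaceT cf) (@compact_cube n M).
  move=> /compact_bounded[r [rr rf]]; exists r; split => // x rx y [z zM <-].
  by apply: rf => //; exists z.
Qed.

Lemma continuous_support_integrable n M (f : 'rV[R]_n -> R) : continuous f ->
  (forall x, ~ cube n M x -> f x = 0) ->
  (lebesgue_rV R n).-integrable setT (EFin \o f).
Proof.
move=> cf f0; rewrite -[setT]/([set: 'rV[R]_n]).
have -> : EFin \o f = (EFin \o f) \_ (cube n M).
  by apply/funext => x; rewrite patchE; case: ifPn => // /negP; rewrite inE => /f0 /= ->.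
by apply/(integrable_mkcond _ (@measurable_cube n M)); exact: continuous_cube_integrable.
Qed.
End rV_measurable.
Arguments cube {R} n M.

(** * Integrals of partial derivatives of compactly supported functions *)

Section C1_rV.
Context {R : realType}.

Definition C1 n (f : 'rV[R]_n -> R) := continuous f /\
  forall i, (forall x, derivable f x (delta_mx ord0 i)) /\ continuous (partial i f).

Lemma consrV_line0 n t (y : 'rV[R]_n) h :
  consrV (h + t, y) = h *: delta_mx ord0 ord0 + consrV (t, y).
Proof.
apply/rowP => i; rewrite !mxE eqxx/=; case: (unliftP ord0 i) => [j|] -> /=.
  by rewrite mulr0 add0r.
by rewrite mulr1.
Qed.

Lemma consrV_lineS n t (y : 'rV[R]_n) j h :
  consrV (t, h *: delta_mx ord0 j + y) =
  h *: delta_mx ord0 (lift ord0 j) + consrV (t, y).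
Proof.
apply/rowP => i; rewrite !mxE eqxx/=; case: (unliftP ord0 i) => [k|] -> /=.
  by rewrite !mxE eqxx/= (inj_eq lift_inj).
by rewrite mulr0 add0r.
Qed.

Lemma is_derive_slice0 n (f : 'rV[R]_n.+1 -> R) y t : C1 f ->
  is_derive (t : R) 1 (fun s : R => f (consrV (s, y))) (partial ord0 f (consrV (t, y))).
Proof.
move=> [_ /(_ ord0)[df _]]; have df' := df (consrV (t, y)).
have E : (fun h : R => h^-1 *: (((fun s : R => f (consrV (s, y))) \o shift t) (h *: 1) - f (consrV (t, y))))
   = (fun h : R => h^-1 *: ((f \o shift (consrV (t, y))) (h *: delta_mx ord0 ord0) - f (consrV (t, y)))).
  by apply/funext => h /=; rewrite -consrV_line0 [h *: 1]mulr1.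
apply: DeriveDef; first by rewrite /derivable E.
by rewrite /partial /derive E.
Qed.

Lemma is_derive_sliceS n (f : 'rV[R]_n.+1 -> R) t y j : C1 f ->
  is_derive y (delta_mx ord0 j) (fun z => f (consrV (t, z)))
    (partial (lift ord0 j) f (consrV (t, y))).
Proof.
move=> [_ /(_ (lift ord0 j))[df _]]; have df' := df (consrV (t, y)).
have E : (fun h : R => h^-1 *: (((fun z => f (consrV (t, z))) \o shift y) (h *: delta_mx ord0 j) - f (consrV (t, y))))
   = (fun h : R => h^-1 *: ((f \o shift (consrV (t, y))) (h *: delta_mx ord0 (lift ord0 j)) - f (consrV (t, y)))).
  by apply/funext => h /=; rewrite -consrV_lineS.
apply: DeriveDef; first by rewrite /derivable E.
by rewrite /partial /derive E.
Qed.

Lemma partial_sliceS n (f : 'rV[R]_n.+1 -> R) t j : C1 f ->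
  partial j (fun z => f (consrV (t, z))) =
  (fun y => partial (lift ord0 j) f (consrV (t, y))).
Proof. by move=> cf; apply/funext => y; have [_ <-] := is_derive_sliceS t y j cf. Qed.

Lemma C1_sliceS n (f : 'rV[R]_n.+1 -> R) t : C1 f ->
  C1 (fun y => f (consrV (t, y))).
Proof.
move=> cf; split.
  by move=> y; apply: continuous_comp; [exact: continuous_consrVr|exact: (proj1 cf)].
move=> j; split; first by move=> y; have [] := is_derive_sliceS t y j cf.
rewrite partial_sliceS// => y.
by apply: continuous_comp; [exact: continuous_consrVr|exact: (proj2 (proj2 cf _))].
Qed.

Lemma continuous_slice0 n (f : 'rV[R]_n.+1 -> R) y :
  continuous f -> continuous (fun t : R => f (consrV (t, y))).
Proof.
by move=> cf t; apply: continuous_comp; [exact: continuous_consrVl|exact: cf].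
Qed.

Lemma partial_near0 n (f : 'rV[R]_n -> R) i x :
  (\forall y \near x, f y = 0) -> partial i f x = 0.
Proof.
move=> f0; rewrite /partial (@near_eq_derive _ _ _ _ (cst 0)) ?derive_cst//.
Qed.

Lemma partial_cube0 n M (f : 'rV[R]_n -> R) i :
  (forall x, ~ cube n M x -> f x = 0) -> forall x, ~ cube n M x -> partial i f x = 0.
Proof.
move=> f0 x xM; apply: partial_near0.
have : open (~` cube n M).
  by apply: closed_openC; apply: compact_closed; [exact: norm_hausdorff|exact: compact_cube].
by move=> oM; apply: filterS (open_nbhs_nbhs (conj oM xM)) => y; exact: f0.
Qed.

(* One variable at a time: the fundamental theorem of calculus for the first
   coordinate, and Fubini with the induction hypothesis for the others. *)
Lemma integral_partial n M (f : 'rV[R]_n -> R) i : C1 f ->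
  (forall x, ~ cube n M x -> f x = 0) ->
  (\int[lebesgue_rV R n]_x (partial i f x)%:E = 0)%E.
Proof.
elim: n f i => [|n IH] f i cf f0; first by case: i.
have fi : (lebesgue_rV R n.+1).-integrable setT (EFin \o partial i f).
  apply: (@continuous_support_integrable _ _ M); first exact: (proj2 (proj2 cf i)).
  exact: partial_cube0.
case: (unliftP ord0 i) fi => [j|] -> fi.
  rewrite (integral_rVS1 fi) integral0_eq// => t _ /=.
  rewrite -[RHS](IH (fun y => f (consrV (t, y))) j (C1_sliceS t cf)).
    by rewrite partial_sliceS.
  by move=> y yM; apply: f0 => H; apply: yM => k; have := H (lift ord0 k); rewrite consrVS.
rewrite (integral_rVS2 fi) integral0_eq// => y _ /=.
pose g (t : R) := f (consrV (t, y)); pose g' (t : R) := partial ord0 f (consrV (t, y)).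
have [L ML L0] : exists2 L : R, M < L & 0 < L.
  by exists (`|M| + 1); [have := ler_norm M; lra|have := normr_ge0 M; lra].
have g0 t : M < `|t| -> ~ cube n.+1 M (consrV (t, y)).
  by move=> Mt /(_ ord0); rewrite consrV0/= => ?; lra.
have -> : (fun t : R => (g' t)%:E) = (EFin \o g') \_ `[- L, L].
  apply/funext => t; rewrite patchE; case: ifPn => // /negP; rewrite inE/= in_itv/=.
  rewrite -ler_norml => /negP; rewrite -ltNge => Lt.
  by rewrite /g' (partial_cube0 ord0 f0)//; apply: g0; lra.
have LL : - L < L by lra.
rewrite -integral_mkcond (@continuous_FTC2 _ g' g)//.
- by rewrite /g !f0 ?subee//; apply: g0; rewrite ?normrN gtr0_norm.
- by apply: continuous_subspaceT; apply: continuous_slice0; exact: (proj2 (proj2 cf _)).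
- have cg : continuous g by apply: continuous_slice0; exact: (proj1 cf).
  split => [t _||].
  + by have [] := is_derive_slice0 y t cf.
  + exact: cvg_at_right_filter (cg _).
  + exact: cvg_at_left_filter (cg _).
- by move=> t _; rewrite derive1E; have [_ ->] := is_derive_slice0 y t cf.
Qed.
End C1_rV.

Lemma EFin_Rintegral d (T : measurableType d) (R : realType)
    (mu : {measure set T -> \bar R}) (D : set T) (f : T -> R) : measurable D ->
  mu.-integrable D (EFin \o f) ->
  (\int[mu]_(x in D) (f x)%:E = (\int[mu]_(x in D) f x)%:E)%E.
Proof. by move=> mD fi; rewrite /Rintegral fineK//; exact: integrable_fin_num. Qed.

(** * Poincare inequality on a cube *)

Section poincare.
Context {R : realType}.
Local Notation leb := (@lebesgue_measure R).

(** The increment is at most the integral of [|g'|] over the whole interval; Jensen's inequality,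
    obtained by integrating a tangent inequality, then moves the power [p] inside. *)
Lemma increment_powR_le (p M : R) (g g' : R -> R) a b : 1 <= p -> 0 < M ->
  (forall t : R, is_derive t 1 g (g' t)) -> continuous g' ->
  `|a| <= M -> `|b| <= M ->
  ((`|g a - g b| `^ p)%:E <= ((2 * M) `^ (p - 1))%:E *
    \int[leb]_(t in `[(- M)%R, M]) (`|g' t| `^ p)%:E)%E.
Proof.
move=> p1 M0 dg cg' aM bM.
wlog ba : a b aM bM / b < a.
  move=> H; have [//|ab|->] := ltgtP a b; [|exact: H|].
    by rewrite distrC; apply: H.
  rewrite subrr normr0 powR0 ?mule_ge0// ?lee_fin ?powR_ge0//; last by lra.
  by apply: integral_ge0 => t _; rewrite lee_fin powR_ge0.
pose I : set R := `[- M, M]%classic.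
have mI : measurable (I : set (measurableTypeR R)) by exact: measurable_itv.
have ic (h : R -> R) : continuous h -> leb.-integrable I (EFin \o h).
  move=> ch; apply: continuous_compact_integrable; first exact: segment_compact.
  exact: continuous_subspaceT.
have c1 : continuous (fun t => `|g' t|).
  by move=> t; apply: continuous_comp; [exact: cg'|exact: norm_continuous].
have cp : continuous (fun t => `|g' t| `^ p).
  move=> t; apply: (@continuous_comp _ _ _ g' (fun s => `|s| `^ p)); first exact: cg'.
  by apply: continuous_norm_powR; lra.
pose m0 := \int[leb]_(t in I) `|g' t|.
have m0E : (\int[leb]_(t in I) (`|g' t|)%:E = m0%:E)%E.
  exact: EFin_Rintegral mI (ic _ c1).
have mp : (\int[leb]_(t in I) (`|g' t| `^ p)%:E =
    (\int[leb]_(t in I) (`|g' t| `^ p))%:E)%E.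
  exact: EFin_Rintegral mI (ic _ cp).
have gab : `|g a - g b| <= m0.
  rewrite -lee_fin -m0E.
  have -> : (`|g a - g b|%:E = `|\int[leb]_(t in `[b, a]) (g' t)%:E|)%E.
    rewrite (@continuous_FTC2 _ g' g)//.
    - by apply: continuous_subspaceT.
    - have cg : continuous g.
        by move=> t; apply: differentiable_continuous; apply/derivable1_diffP; have [] := dg t.
      split => [t _||].
      + by have [] := dg t.
      + exact: cvg_at_right_filter (cg _).
      + exact: cvg_at_left_filter (cg _).
    - by move=> t _; rewrite derive1E; have [_ ->] := dg t.
  apply: (@le_trans _ _ (\int[leb]_(t in `[b, a]) (`|g' t|)%:E)%E).
    apply: le_abse_integral => //.
    apply: measurable_funTS; apply: measurableT_comp => //; exact: continuous_measurable_fun.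
  apply: ge0_subset_integral => //.
    apply: measurable_funTS; apply: measurableT_comp => //; exact: continuous_measurable_fun.
  move=> t; rewrite /I /= !in_itv/=; move: aM bM; rewrite !ler_norml.
  by move=> /andP[a1 a2] /andP[b1 b2] /andP[t1 t2]; rewrite (le_trans b1 t1) (le_trans t2 a2).
have m00 : 0 <= m0 by apply: le_trans gab.
rewrite mp -EFinM lee_fin.
(* The mean of [|g'|]: at this base point the linear term of the tangent inequality integrates to
   0. *)
pose m := m0 / (2 * M).
have mm : 0 <= m by apply: divr_ge0 => //; lra.
have lI : fine (leb I) = 2 * M.
  rewrite /I lebesgue_measure_itv/= lte_fin ifT; last by lra.
  by rewrite -EFinD/=; ring.
have J : 2 * M * m `^ p <= \int[leb]_(t in I) (`|g' t| `^ p).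
  have i1 : leb.-integrable I (EFin \o (fun=> m `^ p)) by apply: ic => ?; exact: cst_continuous.
  have i2 : leb.-integrable I (EFin \o (fun t => `|g' t| - m)).
    by apply: ic => t; apply: cvgB; [exact: c1|exact: cst_continuous].
  have i3 : leb.-integrable I (EFin \o (fun t => p * m `^ (p - 1) * (`|g' t| - m))).
    apply: ic => t; apply: cvgM; first exact: cst_continuous.
    by apply: cvgB; [exact: c1|exact: cst_continuous].
  have <- : \int[leb]_(t in I) (m `^ p + p * m `^ (p - 1) * (`|g' t| - m)) = 2 * M * m `^ p.
    rewrite RintegralD// Rintegral_cst// RintegralZl// RintegralB//.
    - rewrite Rintegral_cst// lI -/m0 (_ : m0 - _ = 0); last by rewrite /m; field; lra.
      by rewrite mulr0 addr0 mulrC.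
    - exact: ic.
    - by apply: ic => ?; exact: cst_continuous.
  apply: le_Rintegral => //.
  - apply: ic => t; apply: cvgD; first exact: cst_continuous.
    apply: cvgM; first exact: cst_continuous.
    by apply: cvgB; [exact: c1|exact: cst_continuous].
  - exact: ic.
  - by move=> t _; apply: powR_tangent.
have M2 : 0 < 2 * M by lra.
apply: (@le_trans _ _ (m0 `^ p)).
  by rewrite ge0_ler_powR ?nnegrE//; lra.
apply: le_trans (ler_wpM2l (powR_ge0 _ _) J).
have -> : (2 * M) `^ (p - 1) * (2 * M * m `^ p) = 2 * M * (2 * M) `^ (p - 1) * m `^ p.
  by ring.
rewrite (@mulr_powRB1 _ (2 * M) p (ltW M2)); last by lra.
by rewrite -(powRM p (ltW M2) mm) (_ : 2 * M * m = m0)// /m; field; lra.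
Qed.
End poincare.

Section poincare_cube.
Context {R : realType}.
Local Notation leb := (@lebesgue_measure R).

Lemma patch_consrV n M (f : 'rV[R]_n.+1 -> \bar R) (t : R) (y : 'rV[R]_n) :
  (f \_ (cube n.+1 M)) (consrV (t, y)) =
  ((fun t : R => ((fun y => f (consrV (t, y))) \_ (cube n M)) y) \_ `[- M, M]) t.
Proof.
rewrite !patchE (_ : (consrV (t, y) \in cube n.+1 M) =
  (t \in `[- M, M]%classic) && (y \in cube n M)); first by do 2![case: (_ \in _)].
have /seteqP[H1 H2] := @preimage_consrV_cube R n M.
apply/idP/andP; first by rewrite inE => /(H1 (t, y))[/= tI yc]; rewrite !inE.
by rewrite !inE => -[tI yc]; apply: (H2 (t, y)); split.
Qed.

Lemma ge0_integral_cubeS1 n M (f : 'rV[R]_n.+1 -> \bar R) :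
  measurable_fun setT f -> (forall x, 0 <= f x)%E ->
  (\int[lebesgue_rV R n.+1]_(x in cube n.+1 M) f x =
   \int[leb]_(t in `[(- M)%R, M]) \int[lebesgue_rV R n]_(y in cube n M) f (consrV (t, y)))%E.
Proof.
move=> mf f0; rewrite integral_mkcond ge0_integral_rVS1; last first.
  by move=> x; rewrite patchE; case: ifP.
  by apply/(measurable_restrictT _ (@measurable_cube R _ _)); exact: measurable_funTS.
rewrite [RHS]integral_mkcond; apply: eq_integral => t _.
under eq_integral do rewrite patch_consrV.
rewrite [RHS]patchE; case: ifPn => tI.
  rewrite [RHS]integral_mkcond; apply: eq_integral => y _; rewrite patchE.
  by rewrite tI.
by rewrite integral0_eq// => y _; rewrite patchE (negbTE tI).
Qed.

Lemma ge0_integral_cubeS2 n M (f : 'rV[R]_n.+1 -> \bar R) :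
  measurable_fun setT f -> (forall x, 0 <= f x)%E ->
  (\int[lebesgue_rV R n.+1]_(x in cube n.+1 M) f x =
   \int[lebesgue_rV R n]_(y in cube n M) \int[leb]_(t in `[(- M)%R, M]) f (consrV (t, y)))%E.
Proof.
move=> mf f0; rewrite integral_mkcond ge0_integral_rVS2; last first.
  by move=> x; rewrite patchE; case: ifP.
  by apply/(measurable_restrictT _ (@measurable_cube R _ _)); exact: measurable_funTS.
rewrite [RHS]integral_mkcond; apply: eq_integral => y _.
under eq_integral do rewrite patch_consrV.
rewrite [RHS]patchE; case: ifPn => yc.
  rewrite [RHS]integral_mkcond; apply: eq_integral => t _; rewrite !patchE.
  by rewrite yc.
by rewrite integral0_eq// => t _; rewrite !patchE (negbTE yc); case: ifP.
Qed.

Lemma measurable_integral_cubeS2 n M (f : 'rV[R]_n.+1 -> \bar R) :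
  measurable_fun setT f -> (forall x, 0 <= f x)%E ->
  measurable_fun (cube n M) (fun y => (\int[leb]_(t in `[(- M)%R, M]) f (consrV (t, y))))%E.
Proof.
move=> mf f0; apply/(measurable_restrictT _ (@measurable_cube R _ _)).
pose F (z : measurableTypeR R * 'rV[R]_n) := (f \_ (cube n.+1 M)) (consrV z).
have mF : measurable_fun setT F.
  apply: measurableT_comp; last exact: measurable_consrV.
  by apply/(measurable_restrictT _ (@measurable_cube R _ _)); exact: measurable_funTS.
have F0 z : (0 <= F z)%E by rewrite /F patchE; case: ifP.
have := @measurable_fun_fubini_tonelli_G _ _ _ _ R leb F mF F0.
apply: eq_measurable_fun => y _; rewrite /fubini_G /F.
under eq_integral do rewrite patch_consrV.
rewrite [RHS]patchE; case: ifPn => yc.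
  rewrite [RHS]integral_mkcond; apply: eq_integral => t _; rewrite !patchE.
  by rewrite yc.
by rewrite integral0_eq// => t _; rewrite !patchE (negbTE yc); case: ifP.
Qed.

Lemma measurable_integral_cubeS1 n M (f : 'rV[R]_n.+1 -> \bar R) :
  measurable_fun setT f -> (forall x, 0 <= f x)%E ->
  measurable_fun (`[- M, M]%classic : set (measurableTypeR R))
    (fun t => (\int[lebesgue_rV R n]_(y in cube n M) f (consrV (t, y))))%E.
Proof.
move=> mf f0; apply/(measurable_restrictT _ (measurable_itv _)).
pose F (z : measurableTypeR R * 'rV[R]_n) := (f \_ (cube n.+1 M)) (consrV z).
have mF : measurable_fun setT F.
  apply: measurableT_comp; last exact: measurable_consrV.
  by apply/(measurable_restrictT _ (@measurable_cube R _ _)); exact: measurable_funTS.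
have F0 z : (0 <= F z)%E by rewrite /F patchE; case: ifP.
have := @measurable_fun_fubini_tonelli_F _ _ _ _ R (lebesgue_rV R n) F mF F0.
apply: eq_measurable_fun => t _; rewrite /fubini_F /F.
under eq_integral do rewrite patch_consrV.
rewrite [RHS]patchE; case: ifPn => tI.
  by rewrite [RHS]integral_mkcond; apply: eq_integral => y _; rewrite patchE tI.
by rewrite integral0_eq// => y _; rewrite patchE (negbTE tI).
Qed.
End poincare_cube.

Lemma sum_partial_sliceS (R : realType) n (w : 'rV[R]_n.+1 -> R) p s y : C1 w ->
  \sum_(j < n) `|partial j (fun y => w (consrV (s, y))) y| `^ p =
  \sum_(j < n) `|partial (lift ord0 j) w (consrV (s, y))| `^ p.
Proof.
move=> cw.
have H (j : 'I_n) : `|partial j (fun y => w (consrV (s, y))) y| `^ p =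
   `|partial (lift ord0 j) w (consrV (s, y))| `^ p by rewrite partial_sliceS.
exact: (eq_bigr _ (fun j _ => H j)).
Qed.

Lemma integral_sum_partial_sliceS (R : realType) n (w : 'rV[R]_n.+1 -> R) p M s : C1 w ->
  (\int[lebesgue_rV R n]_(y in cube n M)
     (\sum_(j < n) `|partial j (fun y => w (consrV (s, y))) y| `^ p)%:E =
   \int[lebesgue_rV R n]_(y in cube n M)
     (\sum_(j < n) `|partial (lift ord0 j) w (consrV (s, y))| `^ p)%:E)%E.
Proof.
move=> cw; apply: eq_integral => y _.
exact (f_equal EFin (sum_partial_sliceS p s y cw)).
Qed.

Section poincare_cube2.
Context {R : realType}.
Local Notation leb := (@lebesgue_measure R).

Lemma continuous_sum (T : topologicalType) I (r : seq I) (P : pred I) (F : I -> T -> R) :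
  (forall i, continuous (F i)) -> continuous (fun x => \sum_(i <- r | P i) F i x).
Proof.
move=> cF; elim: r => [|i r IH].
  by under eq_fun do rewrite big_nil; exact: cst_continuous.
under eq_fun do rewrite big_cons; case: (P i) => // x.
by apply: cvgD; [exact: cF|exact: IH].
Qed.

Lemma continuous_subc (T : topologicalType) (f : T -> R) k :
  continuous f -> continuous (fun x => f x - k).
Proof. by move=> cf x; apply: cvgB; [exact: cf|exact: cst_continuous]. Qed.

Lemma continuous_norm_powRc n (f : 'rV[R]_n -> R) p : 0 < p -> continuous f ->
  continuous (fun x => `|f x| `^ p).
Proof.
move=> p0 cf x; apply: (@continuous_comp _ _ _ f (fun s => `|s| `^ p)); first exact: cf.
exact: continuous_norm_powR.
Qed.

(** If every value were more than [e] above the average, the integral would be at least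
    [r + 2 * M * e]. *)
Lemma exists_le_average (M e r : R) (g : R -> \bar R) : 0 < M -> 0 < e ->
  measurable_fun `[- M, M] (g : measurableTypeR R -> \bar R) -> (forall t, 0 <= g t)%E ->
  (\int[leb]_(t in `[(- M)%R, M]) g t <= r%:E)%E ->
  exists2 t, `|t| <= M & (g t <= (r / (2 * M) + e)%:E)%E.
Proof.
move=> M0 e0 mg g0 gr; apply: contrapT => H.
have : ((r + 2 * M * e)%:E <= \int[leb]_(t in `[(- M)%R, M]) g t)%E.
  have -> : (r + 2 * M * e)%:E = (\int[leb]_(t in `[(- M)%R, M]) (r / (2 * M) + e)%:E)%E.
    rewrite integral_cst//= lebesgue_measure_itv/= lte_fin ifT; last by lra.
    by rewrite -EFinD -EFinM; congr (_%:E); field; lra.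
  have r0 : 0 <= r by rewrite -lee_fin; apply: le_trans gr; apply: integral_ge0.
  apply: ge0_le_integral => //.
    by move=> t _; rewrite lee_fin addr_ge0 ?divr_ge0//; lra.
  move=> t; rewrite /= in_itv/= -ler_norml => tM; rewrite leNgt; apply/negP => gt.
  by apply: H; exists t => //; exact: ltW.
move=> /le_trans /(_ gr); rewrite lee_fin.
have : 0 < 2 * M * e by apply: mulr_gt0 => //; lra.
lra.
Qed.

(* Pick a hyperplane section [t] on which the tangential gradient is at most
   its average, apply the induction hypothesis there, and compare every other
   section with it along the first coordinate. *)
Lemma poincare_cube n (p M : R) : 1 <= p -> 0 < M ->
  exists2 C, 0 <= C & forall (w : 'rV[R]_n -> R), C1 w -> forall eta, 0 < eta ->
  exists k : R, (\int[lebesgue_rV R n]_(x in cube n M) (`|w x - k| `^ p)%:E <=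
    C%:E * \int[lebesgue_rV R n]_(x in cube n M) (\sum_i `|partial i w x| `^ p)%:E
    + eta%:E)%E.
Proof.
move=> p1 M0; have p0 : 0 < p by lra.
elim: n => [|n [C C0 IH]].
  exists 0 => // w cw eta eta0; exists (w 0).
  rewrite integral0_eq ?mul0e ?add0e ?lee_fin ?(ltW eta0)// => x _.
  by rewrite (_ : x = 0) ?subrr ?normr0 ?powR0 ?gt_eqF//; apply/rowP; case.
have M2 : 0 < 2 * M by lra.
pose A := 2 `^ (p - 1); have A0 : 0 < A by rewrite powR_gt0.
pose B := (2 * M) `^ (p - 1); have B0 : 0 < B by rewrite powR_gt0.
exists (A * (2 * M * B + C)); first by apply: mulr_ge0; [exact: ltW|]; apply: addr_ge0 => //; apply: mulr_ge0; lra.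
move=> w cw eta eta0.
pose mu := lebesgue_rV R n; pose Q := cube (R:=R) n M.
have mQ : measurable Q by exact: measurable_cube.
have cp i := @continuous_norm_powRc n.+1 (partial i w) p p0 (proj2 (proj2 cw i)).
pose h0 x := `|partial ord0 w x| `^ p.
pose h1 x := \sum_(j < n) `|partial (lift ord0 j) w x| `^ p.
have ch1 : continuous h1.
  by apply: continuous_sum => j; exact: cp.
have h10 x : 0 <= h1 x by apply: sumr_ge0 => j _; exact: powR_ge0.
have mh0 : measurable_fun setT (EFin \o h0).
  by apply/measurable_EFinP; exact: continuous_measurable_rV (cp ord0).
have mh1 : measurable_fun setT (EFin \o h1).
  by apply/measurable_EFinP; exact: continuous_measurable_rV ch1.
have fin (h : 'rV[R]_n.+1 -> R) : continuous h -> (forall x, 0 <= h x) ->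
    exists2 r : R, 0 <= r & (\int[lebesgue_rV R n.+1]_(x in cube n.+1 M) (h x)%:E = r%:E)%E.
  move=> ch hp; exists (\int[lebesgue_rV R n.+1]_(x in cube n.+1 M) h x).
    exact: Rintegral_ge0.
  apply: EFin_Rintegral; first exact: measurable_cube.
  exact: continuous_cube_integrable.
have [r0 r00 E0] := fin _ (cp ord0) (fun x => powR_ge0 _ _).
have [r1 r10 E1] := fin _ ch1 h10.
have -> : (\int[lebesgue_rV R n.+1]_(x in cube n.+1 M) (\sum_i `|partial i w x| `^ p)%:E
    = (r0 + r1)%:E)%E.
  rewrite EFinD -E0 -E1 -ge0_integralD//.
  - by apply: eq_integral => x _; rewrite big_ord_recl EFinD.
  - exact: measurable_cube.
  - exact: measurable_funTS.
  - by move=> x _; rewrite lee_fin.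
  - exact: measurable_funTS.
(* Two errors share [eta]: the choice of the section costs [C * e1], kept below [e2], and the
   induction hypothesis costs [e2]. Both are multiplied by [A * (2 * M)] in the end. *)
pose e2 := eta / (A * (2 * M) * 2).
have e20 : 0 < e2 by apply: divr_gt0 => //; do !apply: mulr_gt0 => //.
pose e1 := e2 / (C + 1).
have e10 : 0 < e1 by apply: divr_gt0 => //; lra.
have C01 : C * e1 <= e2.
  rewrite /e1 mulrA ler_pdivrMr; last by lra.
  by rewrite mulrC ler_pM2l//; lra.
have [|||s sM gs] := @exists_le_average M e1 r1
  (fun t => (\int[mu]_(y in Q) (h1 (consrV (t, y)))%:E)%E) M0 e10.
- by apply: (@measurable_integral_cubeS1 _ _ _ (EFin \o h1)) => // x; rewrite lee_fin.
- by move=> t; apply: integral_ge0 => y _; rewrite lee_fin.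
- by rewrite -E1 ge0_integral_cubeS1// => x; rewrite lee_fin.
have [k Hk] := IH _ (C1_sliceS s cw) e2 e20.
exists k.
have cw0 : continuous (fun x => w x - k).
  by apply: continuous_subc; case: cw.
have mw : measurable_fun setT (fun x => (`|w x - k| `^ p)%:E).
  by apply/measurable_EFinP; apply: continuous_measurable_rV; exact: continuous_norm_powRc.
have mws : measurable_fun setT (fun y => (`|w (consrV (s, y)) - k| `^ p)%:E).
  apply/measurable_EFinP; apply: continuous_measurable_rV; apply: continuous_norm_powRc => //.
  by apply: continuous_subc; have [] := C1_sliceS s cw.
pose J y := (\int[leb]_(t in `[(- M)%R, M]) (h0 (consrV (t, y)))%:E)%E.
have J0 y : (0 <= J y)%E by apply: integral_ge0 => t _; rewrite lee_fin powR_ge0.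
have mJ : measurable_fun Q J.
  by apply: (@measurable_integral_cubeS2 _ _ _ (EFin \o h0)) => // x; rewrite lee_fin powR_ge0.
have JE : (\int[mu]_(y in Q) J y = r0%:E)%E.
  by rewrite -E0 ge0_integral_cubeS2// => x; rewrite lee_fin powR_ge0.
have {}Hk : (\int[mu]_(y in Q) (`|w (consrV (s, y)) - k| `^ p)%:E <=
    (C * (r1 / (2 * M) + e1) + e2)%:E)%E.
  rewrite (integral_sum_partial_sliceS p M s cw) in Hk; apply: (le_trans Hk); rewrite EFinD; apply: leeD => //.
  by rewrite EFinM; apply: lee_wpmul2l; rewrite ?lee_fin.
rewrite ge0_integral_cubeS1//.
pose K := A * (B * r0 + (C * (r1 / (2 * M) + e1) + e2)).
have K0 : 0 <= K.
  apply: mulr_ge0; first exact: ltW.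
  apply: addr_ge0; first by apply: mulr_ge0 => //; exact: ltW.
  apply: addr_ge0; last exact: ltW.
  by apply: mulr_ge0 => //; apply: addr_ge0; [apply: divr_ge0 => //; exact: ltW|exact: ltW].
apply: (@le_trans _ _ (\int[leb]_(t in `[(- M)%R, M]) K%:E)%E); last first.
  rewrite integral_cst//= lebesgue_measure_itv/= lte_fin ifT; last by lra.
  rewrite -EFinD -EFinM -EFinM -EFinD lee_fin.
  have -> : K * (M - - M) = A * (2 * M * B) * r0 + A * C * r1 + A * (2 * M) * (C * e1 + e2).
    by rewrite /K; field; lra.
  have -> : A * (2 * M * B + C) * (r0 + r1) + eta = A * (2 * M * B) * r0 + A * C * r1
     + (A * (2 * M * B) * r1 + A * C * r0) + eta by ring.
  have H1 : 0 <= A * (2 * M * B) * r1 + A * C * r0.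
    by apply: addr_ge0; do ?[apply: mulr_ge0 => //]; exact: ltW.
  have H2 : A * (2 * M) * (C * e1 + e2) <= eta.
    apply: (@le_trans _ _ (A * (2 * M) * (e2 + e2))).
      by rewrite ler_wpM2l ?lerD2r// mulr_ge0// ltW.
    by rewrite le_eqVlt; apply/orP; left; apply/eqP; rewrite /e2; field; lra.
  lra.
have mslice t : measurable_fun Q (fun y => (`|w (consrV (t, y)) - k| `^ p)%:E).
  apply: measurable_funTS; apply/measurable_EFinP; apply: continuous_measurable_rV.
  apply: continuous_norm_powRc => //.
  by apply: continuous_subc; have [] := C1_sliceS t cw.
apply: ge0_le_integral => //.
- by move=> t _; apply: integral_ge0 => y _; rewrite lee_fin powR_ge0.
- by apply: (measurable_integral_cubeS1 mw) => x; rewrite lee_fin powR_ge0.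
move=> t; rewrite /= in_itv/= -ler_norml => tM.
apply: (@le_trans _ _ (\int[mu]_(y in Q)
    (A%:E * (B%:E * J y + (`|w (consrV (s, y)) - k| `^ p)%:E)))%E).
  apply: ge0_le_integral => //.
  - apply: measurable_funeM; apply: emeasurable_funD; first exact: measurable_funeM.
    exact: measurable_funTS.
  move=> y _; apply: (@le_trans _ _ (A * (`|w (consrV (t, y)) - w (consrV (s, y))| `^ p
      + `|w (consrV (s, y)) - k| `^ p))%:E).
    rewrite lee_fin; apply: le_trans (powRD_le p1 (normr_ge0 _) (normr_ge0 _)).
    by rewrite ge0_ler_powR ?nnegrE ?addr_ge0 ?(ltW p0)//; exact: ler_distD.
  rewrite EFinM; apply: lee_wpmul2l; first by rewrite lee_fin ltW.
  rewrite EFinD; apply: leeD => //.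
  apply: (@increment_powR_le _ p M (fun t => w (consrV (t, y)))
    (fun t => partial ord0 w (consrV (t, y))) t s) => //.
    by move=> z; exact: is_derive_slice0.
  by apply: continuous_slice0; exact: (proj2 (proj2 cw _)).
have nn y : (0 <= (`|w (consrV (s, y)) - k| `^ p)%:E)%E by rewrite lee_fin powR_ge0.
have BJ0 y : (0 <= B%:E * J y)%E by rewrite mule_ge0// lee_fin ltW.
rewrite ge0_integralZl_EFin ?(ltW A0)//; last first.
- apply: emeasurable_funD; [exact: measurable_funeM|exact: measurable_funTS].
- by move=> y _; rewrite adde_ge0.
rewrite EFinM; apply: lee_wpmul2l; first by rewrite lee_fin ltW.
rewrite ge0_integralD//; last exact: measurable_funeM.
by rewrite ge0_integralZl_EFin ?(ltW B0)// JE EFinD EFinM; apply: leeD.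
Qed.
End poincare_cube2.

(** * Differential calculus with explicit partial derivatives *)

Section C1_calculus.
Context {R : realType}.

(** Restriction to the line [h *: v + x] reduces the directional derivative to the chain rule in one
    variable. *)
Lemma is_derive_chain (V : normedModType R) (f : V -> R) (g : R -> R) x v df dg :
  is_derive x v f df -> is_derive (f x) 1 g dg ->
  is_derive x v (g \o f) (dg * df).
Proof.
move=> [fd fD] gd.
pose F (h : R) := f (h *: v + x).
have F0 : F 0 = f x by rewrite /F scale0r add0r.
have E (k : V -> R) : (fun h : R => h^-1 *: (((fun s : R => k (s *: v + x)) \o shift 0) (h *: (1 : R)) - k (0 *: v + x)))
   = (fun h : R => h^-1 *: ((k \o shift x) (h *: v) - k x)).
  by apply/funext => h /=; rewrite addr0 [h *: 1]mulr1 scale0r add0r.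
have dF : is_derive (0 : R) (1 : R) F df.
  by apply: DeriveDef; [rewrite /derivable E|rewrite /derive E].
rewrite -F0 in gd.
have [H1 H2] := is_derive1_comp gd dF.
move: H1 H2; rewrite /derivable /derive; have := E (g \o f); rewrite /= => -> H1 H2.
exact: DeriveDef.
Qed.

Definition hasC1 n (f : 'rV[R]_n -> R) (df : 'I_n -> 'rV[R]_n -> R) :=
  continuous f /\ forall i, (forall x, is_derive x (delta_mx ord0 i) f (df i x)) /\
    continuous (df i).

Lemma hasC1P n (f : 'rV[R]_n -> R) df : hasC1 f df ->
  C1 f /\ forall i, partial i f = df i.
Proof.
move=> [cf H].
have P i : partial i f = df i by apply/funext => x; have [_ <-] := (H i).1 x.
by split => //; split => // i; split; [move=> x; have [] := (H i).1 x|rewrite P; exact: (H i).2].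
Qed.

Lemma hasC1M n (f g : 'rV[R]_n -> R) df dg : hasC1 f df -> hasC1 g dg ->
  hasC1 (fun x => f x * g x) (fun i x => f x * dg i x + g x * df i x).
Proof.
move=> [cf Hf] [cg Hg]; split; first by move=> x; exact: continuousM (cf x) (cg x).
move=> i; split; first by move=> x; exact: (is_deriveM ((Hf i).1 x) ((Hg i).1 x)).
by move=> x; exact: continuousD (continuousM (cf x) ((Hg i).2 x)) (continuousM (cg x) ((Hf i).2 x)).
Qed.

Lemma hasC1_comp n (f : 'rV[R]_n -> R) df (g g' : R -> R) : hasC1 f df ->
  (forall t : R, is_derive t 1 g (g' t)) -> continuous g' ->
  hasC1 (fun x => g (f x)) (fun i x => g' (f x) * df i x).
Proof.
move=> [cf Hf] dg cg'.
have cg : continuous g.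
  by move=> t; apply: differentiable_continuous; apply/derivable1_diffP; have [] := dg t.
split; first by move=> x; exact: continuous_comp (cf x) (cg _).
move=> i; split; first by move=> x; exact: is_derive_chain ((Hf i).1 x) (dg _).
by move=> x; exact: continuousM (continuous_comp (cf x) (cg' _)) ((Hf i).2 x).
Qed.

Lemma is_derive_coord n (x v : 'rV[R]_n) j :
  is_derive x v (fun y : 'rV[R]_n => y ord0 j) (v ord0 j).
Proof.
have E : (fun h : R => h^-1 *: (((fun y : 'rV[R]_n => y ord0 j) \o shift x) (h *: v) - x ord0 j))
   = fun h : R => h^-1 * h * v ord0 j.
  by apply/funext => h /=; rewrite !mxE addrK -[LHS]/(_ * _) mulrA.
suff H : (fun h : R => h^-1 * h * v ord0 j) @ 0^' --> v ord0 j.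
  by apply: DeriveDef; [rewrite /derivable E; apply/cvg_ex; exists (v ord0 j)
    |rewrite /derive E; exact/cvg_lim].
apply: cvg_near_cst; near=> h; rewrite mulVf ?mul1r//.
by near: h; exact: nbhs_dnbhs_neq.
Unshelve. all: by end_near. Qed.

Lemma hasC1_coord n j : hasC1 (fun x : 'rV[R]_n => x ord0 j) (fun i _ => (i == j)%:R).
Proof.
split; first exact: coord_continuous.
move=> i; split; last exact: cst_continuous.
by move=> x; have := is_derive_coord x (delta_mx ord0 i) j; rewrite mxE eqxx/= eq_sym.
Qed.

Definition sqn n (x : 'rV[R]_n) : R := \sum_i x ord0 i ^+ 2.

Lemma sqn_ge0 n (x : 'rV[R]_n) : 0 <= sqn x.
Proof. by apply: sumr_ge0 => i _; exact: sqr_ge0. Qed.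

Lemma sqn_eq0 n (x : 'rV[R]_n) : (sqn x == 0) = (x == 0).
Proof.
rewrite /sqn psumr_eq0; last by move=> i _; exact: sqr_ge0.
apply/allP/eqP => [H|-> i _]; last by rewrite mxE expr0n eqxx.
apply/rowP => i; rewrite mxE; apply/eqP; rewrite -sqrf_eq0.
by apply: (implyP (H i _)) => //; rewrite mem_index_enum.
Qed.

Lemma sqn_gt0 n (x : 'rV[R]_n) : (0 < sqn x) = (x != 0).
Proof. by rewrite lt_def sqn_ge0 sqn_eq0 andbT. Qed.

Lemma sqn0 n : sqn (0 : 'rV[R]_n) = 0.
Proof. by apply/eqP; rewrite sqn_eq0. Qed.

Lemma sqr_coord_le n (x : 'rV[R]_n) i : x ord0 i ^+ 2 <= sqn x.
Proof.
rewrite /sqn (bigD1 i)//= lerDl; apply: sumr_ge0 => j _; exact: sqr_ge0.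
Qed.

Lemma continuous_coord2 n i : continuous (fun x : 'rV[R]_n => 2 * x ord0 i).
Proof.
move=> x; apply: (@continuousM _ _ (fun=> 2) (fun x : 'rV[R]_n => x ord0 i)).
  exact: cst_continuous.
exact: coord_continuous.
Qed.

Lemma hasC1_sqn n : hasC1 (@sqn n) (fun i x => 2 * x ord0 i).
Proof.
have S j := hasC1M (@hasC1_coord n j) (@hasC1_coord n j).
split.
  by apply: continuous_sum => j; have [] := S j.
move=> i; split; last first.
  exact: continuous_coord2.
move=> x.
have D := @is_derive_sum _ _ _ n (fun j (y : 'rV[R]_n) => y ord0 j * y ord0 j) x (delta_mx ord0 i) _
  (fun j => ((S j).2 i).1 x).
rewrite (_ : @sqn n = \sum_(j < n) (fun y : 'rV[R]_n => y ord0 j * y ord0 j)).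
  apply: (is_derive_eq D); rewrite (bigD1 i)//= eqxx big1 ?addr0 => [|j /negbTE ji].
    by rewrite mulr1 mulr2n mulrDl mul1r.
  by rewrite eq_sym ji !mulr0 addr0.
by apply/funext => y; rewrite fct_sumE; apply: eq_bigr => j _; rewrite expr2.
Qed.

Lemma continuous_sqn n : continuous (@sqn n).
Proof. by have [] := @hasC1_sqn n. Qed.

Lemma open_sqn_lt n l : open [set x : 'rV[R]_n | sqn x < l].
Proof.
rewrite (_ : mkset _ = @sqn n @^-1` `]-oo, l[%classic).
  by apply: open_comp => // x _; exact: continuous_sqn.
by apply/seteqP; split => x /=; rewrite in_itv.
Qed.

Lemma near_sqn_lt n l (x : 'rV[R]_n) : sqn x < l -> \forall y \near x, sqn y < l.
Proof. by move=> xl; apply: open_nbhs_nbhs; split => //; exact: open_sqn_lt. Qed.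

Lemma continuous_near0 (T : topologicalType) (f : T -> R) x :
  (\forall y \near x, f y = 0) -> {for x, continuous f}.
Proof.
move=> f0; have fx : f x = 0 := nbhs_singleton f0.
by rewrite /prop_for /continuous_at fx; exact: cvg_near_cst.
Qed.

Lemma hasC1_near0 n (u : 'rV[R]_n -> R) du l : hasC1 u du ->
  (forall x, sqn x < l -> u x = 0) -> forall i x, sqn x < l -> du i x = 0.
Proof.
move=> /hasC1P[_ H] u0 i x xl; rewrite -H; apply: partial_near0.
by apply: filterS (near_sqn_lt xl) => y; exact: u0.
Qed.

(** The factor [m] is differentiable on positive arguments only; as [u] vanishes near the origin,
    the product is identically 0 there. Radial factors are functions of [|x| ^ 2], which is a
    polynomial in the coordinates. *)
Lemma hasC1_mul_radial n (u : 'rV[R]_n -> R) du l (m m' : R -> R) : 0 < l ->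
  hasC1 u du -> (forall x, sqn x < l -> u x = 0) ->
  (forall t : R, 0 < t -> is_derive t 1 m (m' t)) ->
  (forall t, 0 < t -> {for t, continuous m'}) ->
  hasC1 (fun x => u x * m (sqn x))
    (fun i x => u x * (m' (sqn x) * (2 * x ord0 i)) + m (sqn x) * du i x).
Proof.
move=> l0 hu u0 dm cm'; have [cu Hu] := hu.
have du0 := hasC1_near0 hu u0.
have cm t : 0 < t -> {for t, continuous m}.
  by move=> t0; apply: differentiable_continuous; apply/derivable1_diffP; have [] := dm t t0.
have csq := @continuous_sqn n.
have cms (k : R -> R) (x : 'rV[R]_n) : {for (sqn x), continuous k} -> {for x, continuous (fun y => k (sqn y))}.
  by move=> ck; exact: continuous_comp (csq x) ck.
split.
  move=> x; have [xl|lx] := ltP (sqn x) l; last first.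
    have x0 : 0 < sqn x by apply: lt_le_trans lx.
    by exact: continuousM (cu x) (cms _ _ (cm _ x0)).
  apply: continuous_near0.
  by apply: filterS (near_sqn_lt xl) => y yl; rewrite u0// mul0r.
move=> i; split => x.
  have [xl|lx] := ltP (sqn x) l; last first.
    have x0 : 0 < sqn x by apply: lt_le_trans lx.
    apply: (is_deriveM ((Hu i).1 x)).
    exact: is_derive_chain (((hasC1_sqn n).2 i).1 x) (dm _ x0).
  rewrite u0// du0// mul0r mulr0 addr0.
  apply: (@near_eq_is_derive _ _ _ (cst 0)).
    by apply: filterS (near_sqn_lt xl) => y yl; rewrite u0// mul0r.
have [xl|lx] := ltP (sqn x) l; last first.
  have x0 : 0 < sqn x by apply: lt_le_trans lx.
  have H1 := cms m x (cm _ x0); have H2 := cms m' x (cm' _ x0).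
  have H3 := continuousM H2 (@continuous_coord2 n i x).
  exact: (continuousD (continuousM (cu x) H3) (continuousM H1 ((Hu i).2 x))).
apply: continuous_near0.
by apply: filterS (near_sqn_lt xl) => y yl; rewrite u0// du0// mul0r mulr0 addr0.
Qed.
End C1_calculus.

(** * Functions supported off the origin and radial integration by parts *)

Section off_origin.
Context {R : realType}.

Lemma powRD_gt0 (a r t : R) : 0 < a -> a `^ (r + t) = a `^ r * a `^ t.
Proof. by move=> a0; rewrite powRD//; apply/implyP => _; rewrite gt_eqF. Qed.

Lemma powR_mulr1 (a r : R) : 0 < a -> a `^ r * a = a `^ (r + 1).
Proof. by move=> a0; rewrite powRD_gt0// powRr1// ltW. Qed.

Lemma l2normE n (x : 'rV[R]_n) : l2norm x = sqn x `^ 2^-1.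
Proof. by rewrite powR12_sqrt// sqn_ge0. Qed.

Lemma l2norm_ge0 n (x : 'rV[R]_n) : 0 <= l2norm x.
Proof. exact: sqrtr_ge0. Qed.

Lemma l2norm_powR n (x : 'rV[R]_n) s : l2norm x `^ s = sqn x `^ (s / 2).
Proof. by rewrite l2normE -powRrM mulrC. Qed.

Lemma sqr_l2norm n (x : 'rV[R]_n) : l2norm x ^+ 2 = sqn x.
Proof. by rewrite sqr_sqrtr// sqn_ge0. Qed.

Lemma l2norm_gt0 n (x : 'rV[R]_n) : (0 < l2norm x) = (x != 0).
Proof. by rewrite sqrtr_gt0 -sqn_gt0. Qed.

Lemma continuous_l2norm n : continuous (@l2norm R n).
Proof.
move=> x; apply: (@continuous_comp _ _ _ (@sqn R n) (@Num.sqrt R)).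
  exact: continuous_sqn.
exact: sqrt_continuous.
Qed.

(** A quantitative form of compact support in the complement of the origin. *)
Definition off0 n (l M : R) (f : 'rV[R]_n -> R) :=
  forall x, sqn x < l \/ ~ cube n M x -> f x = 0.

Lemma off0_continuous n l M (f : 'rV[R]_n -> R) : 0 < l -> off0 l M f ->
  (forall x, 0 < sqn x -> {for x, continuous f}) -> continuous f.
Proof.
move=> l0 f0 cf x; have [xl|lx] := ltP (sqn x) l; last by apply: cf; apply: lt_le_trans lx.
apply: continuous_near0.
by apply: filterS (near_sqn_lt xl) => y yl; apply: f0; left.
Qed.

Lemma off0_integrable n l M (f : 'rV[R]_n -> R) : 0 < l -> off0 l M f ->
  (forall x, 0 < sqn x -> {for x, continuous f}) ->
  (lebesgue_rV R n).-integrable setT (EFin \o f).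
Proof.
move=> l0 f0 cf; apply: (@continuous_support_integrable _ _ M).
  exact: off0_continuous f0 cf.
by move=> x xM; apply: f0; right.
Qed.

Lemma off0_partial n l M (u : 'rV[R]_n -> R) du i : hasC1 u du -> off0 l M u ->
  off0 l M (du i).
Proof.
move=> hu u0 x [xl|xM].
  by apply: (hasC1_near0 hu _ i xl) => y yl; apply: u0; left.
have [_ <-] := hasC1P hu; apply: (@partial_cube0 _ _ M) xM => y yM.
by apply: u0; right.
Qed.

Lemma continuous_sqn_powR n s (x : 'rV[R]_n) : 0 < sqn x ->
  {for x, continuous (fun y => sqn y `^ s)}.
Proof.
move=> x0; apply: (@continuous_comp _ _ _ (@sqn R n) (fun t => t `^ s)).
  exact: continuous_sqn.
exact: continuous_powR.
Qed.

Lemma continuous_powR_derive q (t : R) : 0 < t -> {for t, continuous (fun t => q * t `^ (q - 1))}.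
Proof.
move=> t0; apply: (@continuousM _ _ (fun=> q) (fun t => t `^ (q - 1))).
  exact: cst_continuous.
exact: continuous_powR.
Qed.

Lemma hasC1_norm_powR n (u : 'rV[R]_n -> R) du p : 1 < p -> hasC1 u du ->
  hasC1 (fun x => `|u x| `^ p) (fun i x => p * spow p (u x) * du i x).
Proof.
move=> p1 hu; apply: (hasC1_comp hu (fun t => is_derive_norm_powR t p1)) => t.
exact: continuousM (@cst_continuous _ _ _ _) (@continuous_spow _ p p1 t).
Qed.

(** The integrand is the divergence of the field [|x| ^ s |u| ^ p x]. Its components are
    continuously differentiable with compact support, so every partial derivative integrates to
    0. *)
Lemma integral_by_parts_radial n l M (u : 'rV[R]_n -> R) du p s :
  0 < l -> 1 < p -> hasC1 u du -> off0 l M u ->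
  (\int[lebesgue_rV R n]_x (sqn x `^ (s / 2) *
    (p * (spow p (u x) * \sum_i x ord0 i * du i x) +
     (n%:R + s) * `|u x| `^ p))%:E = 0)%E.
Proof.
move=> l0 p1 hu u0.
have up0 : off0 l M (fun x => `|u x| `^ p).
  by move=> x /u0 ->; rewrite normr0 powR0//; lra.
pose m (t : R) := t `^ (s / 2); pose m' (t : R) := s / 2 * t `^ (s / 2 - 1).
pose v i x := `|u x| `^ p * x ord0 i.
pose dv i j (x : 'rV[R]_n) := `|u x| `^ p * (j == i)%:R + x ord0 i * (p * spow p (u x) * du j x).
have hv i : hasC1 (v i) (dv i) := hasC1M (hasC1_norm_powR p1 hu) (@hasC1_coord _ n i).
have v0 i : off0 l M (v i) by move=> x /up0; rewrite /v => ->; rewrite mul0r.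
have hF i := hasC1_mul_radial l0 (hv i) (fun x xl => v0 i x (or_introl xl))
  (fun t t0 => is_derive1_powR (s / 2) t0 : is_derive t 1 m (m' t))
  (fun t t0 => @continuous_powR_derive (s / 2) t t0).
pose F i (x : 'rV[R]_n) := v i x * (m' (sqn x) * (2 * x ord0 i)) + m (sqn x) * dv i i x.
have F0 i : off0 l M (fun x => v i x * m (sqn x)) by move=> x /v0 ->; rewrite mul0r.
have [FC1 FE] := all_and2 (fun i => hasC1P (hF i)).
have {}FE i : partial i (fun x => v i x * m (sqn x)) = F i by rewrite FE.
have intF i : (\int[lebesgue_rV R n]_x (F i x)%:E = 0)%E.
  by rewrite -FE (@integral_partial _ _ M)// => x xM; apply: F0; right.
have iF i : (lebesgue_rV R n).-integrable setT (EFin \o F i).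
  apply: (@continuous_support_integrable _ _ M); first exact: ((hF i).2 i).2.
  by move=> x xM; apply: (off0_partial i (hF i) (F0 i)); right.
transitivity (\int[lebesgue_rV R n]_x (\sum_(i < n) (F i x)%:E))%E; last first.
  by rewrite (integral_sum _ iF)//; apply: big1 => i _; exact: intF.
apply: eq_integral => x _; rewrite sumEFin; congr EFin.
pose a1 := s * sqn x `^ (s / 2 - 1) * `|u x| `^ p.
pose a2 := sqn x `^ (s / 2) * `|u x| `^ p.
pose a3 := sqn x `^ (s / 2) * p * spow p (u x).
have -> : \sum_(i < n) F i x =
    \sum_(i < n) (a1 * x ord0 i ^+ 2 + (a2 + a3 * (x ord0 i * du i x))).
  by apply: eq_bigr => i _; rewrite /F /v /dv /m /m' eqxx mulr1 /a1 /a2 /a3; field.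
rewrite !big_split/= -!mulr_sumr sumr_const card_ord -/(sqn x).
have -> : a1 * sqn x = s * a2.
  rewrite /a1 /a2; have [x0|x0] := eqVneq (sqn x) 0.
    have -> : u x = 0 by apply: u0; left; rewrite x0.
    by rewrite normr0 powR0 ?gt_eqF ?mulr0 ?mul0r//; lra.
  have {}x0 : 0 < sqn x by rewrite lt_def x0 sqn_ge0.
  have -> : sqn x `^ (s / 2) = sqn x `^ (s / 2 - 1) * sqn x.
    by rewrite powR_mulr1// subrK.
  by ring.
by rewrite /a2 /a3 -[_ *+ n]mulr_natr; ring.
Qed.
End off_origin.

(** * Pointwise and integral energy inequalities *)

Section euclid.
Context {R : realType} {n : nat}.
Implicit Types x y z : 'rV[R]_n.

Definition dot x y : R := \sum_i x ord0 i * y ord0 i.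

Lemma dotC x y : dot x y = dot y x.
Proof. by apply: eq_bigr => i _; rewrite mulrC. Qed.

Lemma dotDl x y z : dot (x + y) z = dot x z + dot y z.
Proof. by rewrite /dot -big_split/=; apply: eq_bigr => i _; rewrite mxE mulrDl. Qed.

Lemma dotZl (k : R) x y : dot (k *: x) y = k * dot x y.
Proof. by rewrite /dot mulr_sumr; apply: eq_bigr => i _; rewrite mxE mulrA. Qed.

Lemma dotxx x : dot x x = sqn x.
Proof. by apply: eq_bigr => i _; rewrite expr2. Qed.

Lemma sqnD x y : sqn (x + y) = sqn x + 2 * dot x y + sqn y.
Proof. by rewrite -!dotxx !dotDl ![dot _ (x + y)]dotC !dotDl [dot y x]dotC; ring. Qed.

Lemma sqnZ (k : R) x : sqn (k *: x) = k ^+ 2 * sqn x.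
Proof. by rewrite -!dotxx dotZl dotC dotZl mulrA expr2. Qed.

Lemma l2normZ (k : R) x : l2norm (k *: x) = `|k| * l2norm x.
Proof. by rewrite /l2norm -/(sqn (k *: x)) sqnZ sqrtrM ?sqr_ge0// sqrtr_sqr. Qed.

Lemma l2normN x : l2norm (- x) = l2norm x.
Proof. by rewrite -scaleN1r l2normZ normrN1 mul1r. Qed.

Lemma l2norm0 : l2norm (0 : 'rV[R]_n) = 0.
Proof. by rewrite -(scale0r 0) l2normZ normr0 mul0r. Qed.

Lemma cauchy_schwarz x y : `|dot x y| <= l2norm x * l2norm y.
Proof.
rewrite -ler_sqr ?nnegrE ?mulr_ge0 ?l2norm_ge0// exprMn !sqr_l2norm.
rewrite real_normK ?num_real//.
have [/eqP|y0] := eqVneq (sqn y) 0.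
  rewrite sqn_eq0 => /eqP ->.
  by rewrite dotC -(scale0r 0) dotZl mul0r expr0n/= scale0r sqn0 mulr0.
have {}y0 : 0 < sqn y by rewrite lt_def y0 sqn_ge0.
(* The vector is [sqn y] times the component of [x] orthogonal to [y]. *)
have := sqn_ge0 (sqn y *: x + (- dot x y) *: y).
rewrite sqnD !sqnZ dotZl [dot x _]dotC dotZl [dot y x]dotC sqrrN => H.
have : 0 <= sqn y * (sqn x * sqn y - dot x y ^+ 2) by apply: (le_trans H); rewrite le_eqVlt; apply/orP; left; apply/eqP; ring.
by rewrite pmulr_rge0// subr_ge0.
Qed.

Lemma l2normD x y : l2norm (x + y) <= l2norm x + l2norm y.
Proof.
rewrite -ler_sqr ?nnegrE ?addr_ge0 ?l2norm_ge0// sqrrD !sqr_l2norm sqnD lerD2r lerD2l.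
rewrite -[leRHS]mulr_natl ler_pM2l//; apply: le_trans (cauchy_schwarz x y); exact: ler_norm.
Qed.

Lemma l2norm_coord x i : `|x ord0 i| <= l2norm x.
Proof.
rewrite -ler_sqr ?nnegrE ?l2norm_ge0// real_normK ?num_real// sqr_l2norm.
exact: sqr_coord_le.
Qed.

(* With [Z = A + B] the tangent inequality for [t^(p/2)] bounds the right-hand
   side below by [p/2 |B|^(p-2) |Z|^2]; when [|B|] is small compared with [|Z|]
   the term [|A|^p] dominates. *)
Lemma young_remainder (p : R) : 2 <= p -> exists2 c, 0 < c & forall A B : 'rV[R]_n,
  c * l2norm (A + B) `^ p <= l2norm A `^ p + (p - 1) * l2norm B `^ p +
    p * (l2norm B `^ (p - 2) * dot B A).
Proof.
move=> p2.
have [q qE] : exists q, q = p / 2 by exists (p / 2).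
(* The threshold for [|B| / |Z|] between the two regimes. Below it [|A| >= |Z| / 2] and
   [|B| <= |A| / (2 p)], so the cross term is at most [|A| ^ p / 2] in absolute value. *)
have [th thE] : exists th : R, th = (4 * p)^-1 by exists ((4 * p)^-1).
have q1 : 1 <= q by rewrite qE; lra.
have p40 : 0 < 4 * p by lra.
have th0 : 0 < th by rewrite thE invr_gt0.
have pth : p * th = 4^-1 by rewrite thE; field; lra.
have th1 : th <= 8^-1 by rewrite thE lef_pV2 ?posrE; lra.
exists (Num.min (q * th `^ (p - 2)) (2 `^ (- p) / 2)).
  by rewrite lt_min mulr_gt0 ?powR_gt0 ?divr_gt0 ?powR_gt0//; lra.
move=> A B; set Z := A + B.
have A0 := l2norm_ge0 A; have B0 := l2norm_ge0 B; have Z0 := l2norm_ge0 Z.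
have [BZ|ZB] := ltP (l2norm B) (th * l2norm Z); last first.
  have T := @powR_tangent R q (sqn A) (sqn B) q1 (sqn_ge0 _) (sqn_ge0 _).
  have pE (x : 'rV[R]_n) : l2norm x `^ p = sqn x `^ q by rewrite l2norm_powR qE.
  have pE2 (x : 'rV[R]_n) : l2norm x `^ (p - 2) = sqn x `^ (q - 1).
    by rewrite l2norm_powR qE; congr (_ `^ _); field.
  have BB : sqn B `^ (q - 1) * sqn B = sqn B `^ q by rewrite mulrC mulr_powRB1 ?sqn_ge0//; lra.
  have ZE : sqn Z = sqn A + 2 * dot B A + sqn B by rewrite /Z sqnD dotC.
  apply: (@le_trans _ _ (q * sqn B `^ (q - 1) * sqn Z)); last first.
    have -> : q * sqn B `^ (q - 1) * sqn Z = q * sqn B `^ (q - 1) * (sqn A - sqn B) +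
        2 * q * (sqn B `^ (q - 1) * dot B A) + 2 * q * (sqn B `^ (q - 1) * sqn B).
      by rewrite ZE; ring.
    rewrite BB !pE pE2 (_ : 2 * q = p); last by rewrite qE; field.
    lra.
  apply: (@le_trans _ _ (q * th `^ (p - 2) * l2norm Z `^ p)).
    by rewrite ler_wpM2r ?powR_ge0// ge_min lexx.
  rewrite -!mulrA ler_wpM2l//; first lra.
  rewrite -pE2 -[sqn Z]sqr_l2norm.
  have -> : l2norm Z `^ p = l2norm Z `^ (p - 2) * l2norm Z ^+ 2.
    have [->|ZN] := eqVneq (l2norm Z) 0; first by rewrite powR0 ?expr0n ?mulr0//; lra.
    by rewrite -powR_mulrn// -powRD_gt0 ?subrK// lt_def ZN.
  rewrite mulrA ler_wpM2r ?sqr_ge0// -powRM ?(ltW th0)//.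
  by rewrite ge0_ler_powR ?nnegrE ?mulr_ge0 ?(ltW th0)//; lra.
have AZ : (1 - th) * l2norm Z <= l2norm A.
  have : l2norm Z <= l2norm A + l2norm B by exact: l2normD.
  lra.
have Ahalf : 2^-1 * l2norm Z <= l2norm A.
  by apply: le_trans AZ; rewrite ler_wpM2r//; lra.
have BA : l2norm B <= (2 * p)^-1 * l2norm A.
  have -> : (2 * p)^-1 = 2 * th by rewrite thE; field; lra.
  have H2 : th * l2norm Z <= th * (2 * l2norm A) by rewrite ler_pM2l//; lra.
  lra.
have p20 : 0 < (2 * p)^-1 by rewrite invr_gt0; lra.
have p21 : (2 * p)^-1 <= 1 by rewrite invf_le1; lra.
have Bp : l2norm B `^ (p - 1) <= (2 * p)^-1 * l2norm A `^ (p - 1).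
  apply: (@le_trans _ _ (((2 * p)^-1 * l2norm A) `^ (p - 1))).
    by rewrite ge0_ler_powR ?nnegrE ?mulr_ge0 ?(ltW p20)//; lra.
  rewrite powRM ?(ltW p20)// ler_wpM2r ?powR_ge0//.
  by apply: ge1r_powR; [rewrite p20|lra].
have dBA : - (l2norm B `^ (p - 1) * l2norm A) <= l2norm B `^ (p - 2) * dot B A.
  have -> : l2norm B `^ (p - 1) = l2norm B `^ (p - 2) * l2norm B.
    have [->|BN] := eqVneq (l2norm B) 0; first by rewrite mulr0 powR0//; lra.
    by rewrite powR_mulr1 ?lt_def ?BN//; congr (_ `^ _); ring.
  rewrite -mulrA -mulrN ler_wpM2l ?powR_ge0//.
  have := cauchy_schwarz B A; rewrite ler_norml => /andP[]; lra.
apply: (@le_trans _ _ (2 `^ (- p) / 2 * l2norm Z `^ p)).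
  by rewrite ler_wpM2r ?powR_ge0// ge_min lexx orbT.
apply: (@le_trans _ _ (l2norm A `^ p / 2)).
  have -> : 2 `^ (- p) / 2 * l2norm Z `^ p = (2^-1 * l2norm Z) `^ p / 2.
    rewrite powRM//.
    by rewrite -powR_inv1// -powRrM mulN1r; ring.
  rewrite ler_wpM2r//.
  by rewrite ge0_ler_powR ?nnegrE ?mulr_ge0//; lra.
have AA : l2norm A `^ (p - 1) * l2norm A = l2norm A `^ p by rewrite mulrC mulr_powRB1//; lra.
have K3 := powR_ge0 (l2norm B) p; have K4 := powR_ge0 (l2norm A) p.
have K1 := ler_wpM2r A0 Bp; rewrite -mulrA AA in K1.
have K5 : p * ((2 * p)^-1 * l2norm A `^ p) = l2norm A `^ p / 2.
  by clear -p2; field; lra.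
clear qE thE q1 p40 th0 pth th1 Z0 BZ AZ Ahalf BA p20 p21 Bp AA.
move: K1 K3 K4 K5 dBA; move: (l2norm A `^ p) (l2norm B `^ p) (l2norm B `^ (p - 1) * l2norm A)
  (l2norm B `^ (p - 2) * dot B A) => x y z w K1 K3 K4 K5 dBA.
have p0 : 0 <= p by lra.
have K2 := ler_wpM2l p0 dBA; have {}K1 := ler_wpM2l p0 K1.
have K6 : 0 <= (p - 1) * y by rewrite mulr_ge0//; lra.
lra.
Qed.
End euclid.

(** * Weighted integrals of functions supported off the origin *)

Section test_integrals.
Context {R : realType} {n : nat}.
Implicit Types (u : 'rV[R]_n -> R) (x : 'rV[R]_n).
Local Notation mu := (lebesgue_rV R n).

Definition grad u x : 'rV[R]_n := \row_i partial i u x.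

Definition C1c (l M : R) u := [/\ 0 < l, hasC1 u (partial^~ u) & off0 l M u].

Lemma continuous_l2norm_powR p : 0 < p -> continuous (fun x => l2norm x `^ p).
Proof.
move=> p0; rewrite (_ : (fun x => _) = fun x => `|l2norm x| `^ p).
  exact: continuous_norm_powRc p0 (@continuous_l2norm R n).
by apply/funext => x; rewrite ger0_norm ?l2norm_ge0.
Qed.

Lemma continuous_l2norm_weight s x : 0 < sqn x -> {for x, continuous (fun y => l2norm y `^ s)}.
Proof.
move=> x0; rewrite (_ : (fun y => _) = fun y => sqn y `^ (s / 2)).
  exact: continuous_sqn_powR.
by apply/funext => y; rewrite l2norm_powR.
Qed.

Lemma continuous_coord i : continuous (fun x => x ord0 i).
Proof. exact: coord_continuous. Qed.

Lemma grad_off0 l M u : C1c l M u -> forall x, sqn x < l \/ ~ cube n M x -> grad u x = 0.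
Proof.
move=> [_ hu u0] x hx; apply/rowP => i; rewrite !mxE.
exact: (off0_partial i hu u0 hx).
Qed.

Lemma C1c_integrable l M u s (f : 'rV[R]_n -> R) : C1c l M u ->
  (forall x, 0 < sqn x -> {for x, continuous f}) -> off0 l M f ->
  mu.-integrable setT (EFin \o (fun x => l2norm x `^ s * f x)).
Proof.
move=> [l0 _ _] cf f0; apply: (@off0_integrable _ _ l M) => //.
  by move=> x /f0 ->; rewrite mulr0.
move=> x x0; have H1 := @continuous_l2norm_weight s x x0.
exact: (continuousM H1 (cf x x0)).
Qed.

Lemma C1c_int_fun l M u s p : 0 < p -> C1c l M u ->
  mu.-integrable setT (EFin \o (fun x => l2norm x `^ s * `|u x| `^ p)).
Proof.
move=> p0 hu; apply: (@C1c_integrable l M u s (fun x => `|u x| `^ p) hu); have [_ h u0] := hu.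
  by move=> x _; exact: continuous_norm_powRc p0 h.1 x.
by move=> x /u0 ->; rewrite normr0 powR0// gt_eqF.
Qed.

Lemma C1c_int_grad l M u s p (k : 'rV[R]_n -> R) : 0 < p -> C1c l M u ->
  (forall x, 0 < sqn x -> {for x, continuous k}) ->
  mu.-integrable setT (EFin \o
    (fun x => l2norm x `^ s * l2norm (grad u x + (u x * k x) *: x) `^ p)).
Proof.
move=> p0 hu ck; apply: (@C1c_integrable l M u s (fun x => l2norm (grad u x + (u x * k x) *: x) `^ p) hu); have [_ h u0] := hu.
  move=> x x0.
  apply: (@continuous_comp _ _ _ (fun x => grad u x + (u x * k x) *: x) (fun y => l2norm y `^ p));
    last exact: continuous_l2norm_powR.
  apply: (@cvg_rV _ _ (nbhs x) _) => i.
  under eq_cvg do rewrite !mxE; rewrite !mxE.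
  have H1 := continuousM (h.1 x) (ck x x0).
  have H2 := continuousM H1 (@continuous_coord i x).
  exact: (continuousD ((h.2 i).2 x) H2).
move=> x hx; rewrite (grad_off0 hu hx) (u0 x hx) mul0r scale0r addr0 l2norm0 powR0//.
by rewrite gt_eqF.
Qed.

Lemma C1c_int_grad0 l M u s p : 0 < p -> C1c l M u ->
  mu.-integrable setT (EFin \o (fun x => l2norm x `^ s * l2norm (grad u x) `^ p)).
Proof.
move=> p0 hu; have := @C1c_int_grad l M u s p (cst 0) p0 hu.
rewrite (_ : (fun x => l2norm x `^ s * l2norm (grad u x + (u x * cst 0 x) *: x) `^ p) =
    fun x => l2norm x `^ s * l2norm (grad u x) `^ p).
  by apply => x _; exact: cst_continuous.
by apply/funext => x; rewrite /= mulr0 scale0r addr0.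
Qed.

Lemma C1c_int_dot l M u s p : 1 < p -> C1c l M u ->
  mu.-integrable setT (EFin \o
    (fun x => l2norm x `^ s * (spow p (u x) * dot x (grad u x)))).
Proof.
move=> p1 hu; apply: (@C1c_integrable l M u s (fun x => spow p (u x) * dot x (grad u x)) hu); have [_ h u0] := hu.
  move=> x _; apply: (@continuousM _ _ (fun x => spow p (u x)) (fun x => dot x (grad u x))).
    apply: (@continuous_comp _ _ _ u (spow p)); [exact: h.1|exact: continuous_spow].
  apply: continuous_sum => i y.
  apply: (@continuousM _ _ (fun x : 'rV[R]_n => x ord0 i) (fun x => grad u x ord0 i)).
    exact: coord_continuous.
  by rewrite (_ : (fun x => grad u x ord0 i) = partial i u);
    [exact: (h.2 i).2|apply/funext => z; rewrite mxE].
move=> x /u0 ->; rewrite /spow normr0 sgr0 !mul0r//.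
Qed.

Lemma C1c_by_parts l M u s p : 1 < p -> C1c l M u ->
  \int[mu]_x (l2norm x `^ s * (spow p (u x) * dot x (grad u x))) =
  - ((n%:R + s) / p) * \int[mu]_x (l2norm x `^ s * `|u x| `^ p).
Proof.
move=> p1 hu; have [l0 h u0] := hu.
have p0 : 0 < p by lra.
have i1 := C1c_int_dot s p1 hu; have i2 := C1c_int_fun s p0 hu.
have H := integral_by_parts_radial s l0 p1 h u0.
have : \int[mu]_x (p * (l2norm x `^ s * (spow p (u x) * dot x (grad u x))) +
    (n%:R + s) * (l2norm x `^ s * `|u x| `^ p)) = 0.
  rewrite /Rintegral -[RHS]/(fine 0%E) -H; congr fine; apply: eq_integral => x _.
  rewrite l2norm_powR; congr EFin.
  have -> : \sum_i x ord0 i * partial i u x = dot x (grad u x).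
    by apply: eq_bigr => i _; rewrite mxE.
  by ring.
have j1 : mu.-integrable setT (EFin \o (fun x => p * (l2norm x `^ s * (spow p (u x) * dot x (grad u x))))).
  exact: (integrableZl measurableT p i1).
have j2 : mu.-integrable setT (EFin \o (fun x => (n%:R + s) * (l2norm x `^ s * `|u x| `^ p))).
  exact: (integrableZl measurableT (n%:R + s) i2).
rewrite RintegralD// !RintegralZl// => E.
apply: (@mulfI _ p); first by lra.
move: E; set I1 := Rintegral _ _ _; set I2 := Rintegral _ _ _ => E.
have -> : p * (- ((n%:R + s) / p) * I2) = - ((n%:R + s) * I2) by field; lra.
by apply/eqP; rewrite -addr_eq0 E.
Qed.
End test_integrals.

Section real_integrable.
Context d (T : measurableType d) (R : realType) (mu : {measure set T -> \bar R}).
Implicit Types f g : T -> R.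

Definition rint f := mu.-integrable setT (EFin \o f).

Lemma rintD f g : rint f -> rint g -> rint (fun x => f x + g x).
Proof. by move=> h1 h2; exact: (integrableD measurableT h1 h2). Qed.

Lemma rintZ k f : rint f -> rint (fun x => k * f x).
Proof. by move=> h1; exact: (integrableZl measurableT k h1). Qed.

Lemma rint_norm f : rint f -> rint (fun x => `|f x|).
Proof. by move=> h1; exact: (integrable_abse h1). Qed.

Lemma rintegralD f g : rint f -> rint g ->
  \int[mu]_x (f x + g x) = \int[mu]_x f x + \int[mu]_x g x.
Proof. by move=> h1 h2; rewrite RintegralD. Qed.

Lemma rintegralZ k f : rint f -> \int[mu]_x (k * f x) = k * \int[mu]_x f x.
Proof. by move=> h1; rewrite RintegralZl. Qed.

Lemma le_rintegral f g : rint f -> rint g -> (forall x, f x <= g x) ->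
  \int[mu]_x f x <= \int[mu]_x g x.
Proof. by move=> h1 h2 fg; exact: le_Rintegral. Qed.

Lemma le_normr_rintegral f : rint f -> `|\int[mu]_x f x| <= \int[mu]_x `|f x|.
Proof. by move=> h1; exact: le_normr_Rintegral. Qed.
End real_integrable.

Section test_inequalities.
Context {R : realType} {n : nat}.
Implicit Types (u : 'rV[R]_n -> R) (x : 'rV[R]_n) (p a b : R).
Local Notation mu := (lebesgue_rV R n).

Definition wint s p (f : 'rV[R]_n -> R) := \int[mu]_x (l2norm x `^ s * f x `^ p).
Definition intL p a u := wint (- (p * a)) p (fun x => `|u x|).
Definition intH p b u := wint (- (p * b)) p (fun x => l2norm (grad u x)).

Lemma wint_ge0 s p f : 0 <= wint s p f.
Proof. by apply: Rintegral_ge0 => x _; rewrite mulr_ge0 ?powR_ge0. Qed.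

Lemma CKN_exponentE p a b : p != 0 -> p * CKN_exponent p a b = (p - 1) * a + b + 1.
Proof. by move=> p0; rewrite /CKN_exponent; field. Qed.

Lemma l2norm_powRM (r s : R) x : x != 0 -> l2norm x `^ r * l2norm x `^ s = l2norm x `^ (r + s).
Proof. by move=> x0; rewrite powRD_gt0// l2norm_gt0. Qed.

Lemma weight_powR p b x y : 0 <= y ->
  l2norm x `^ (- (p * b)) * y `^ p = (l2norm x `^ (- b) * y) `^ p.
Proof.
by move=> y0; rewrite powRM ?powR_ge0// -powRrM; congr (_ `^ _ * _); ring.
Qed.

Lemma young_weighted p a b x (v g t : R) : 1 < p -> 0 < t -> x != 0 -> 0 <= v -> 0 <= g ->
  p * (l2norm x `^ (- ((p - 1) * a + b)) * (v `^ (p - 1) * g)) <=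
  t `^ (1 - p) * (l2norm x `^ (- (p * b)) * g `^ p) +
  (p - 1) * (t * (l2norm x `^ (- (p * a)) * v `^ p)).
Proof.
move=> p1 t0 x0 v0 g0; rewrite (weight_powR p b x g0) (weight_powR p a x v0).
have := @powR_young R p (l2norm x `^ (- b) * g) (l2norm x `^ (- a) * v) t p1
  (mulr_ge0 (powR_ge0 _ _) g0) (mulr_ge0 (powR_ge0 _ _) v0) t0.
congr (p * _ <= _).
rewrite powRM ?powR_ge0// -powRrM mulrACA l2norm_powRM//; congr (_ `^ _ * _); last exact: mulrC.
by ring.
Qed.

Lemma dot_spow_le p (v : R) x (y : 'rV[R]_n) s : x != 0 ->
  `|l2norm x `^ s * (spow p v * dot x y)| <=
  l2norm x `^ (s + 1) * (`|v| `^ (p - 1) * l2norm y).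
Proof.
move=> x0; rewrite normrM (ger0_norm (powR_ge0 _ _)) powRD_gt0 ?l2norm_gt0// -mulrA.
rewrite ler_wpM2l ?powR_ge0// powRr1 ?l2norm_ge0// mulrCA normrM.
by rewrite ler_pM// ?norm_spow_le ?cauchy_schwarz.
Qed.

Lemma C1c_origin l M u : C1c l M u -> u 0 = 0 /\ grad u 0 = 0.
Proof.
move=> hu; have [l0 _ u0] := hu.
by split; [apply: u0; left; rewrite sqn0|apply: (grad_off0 hu); left; rewrite sqn0].
Qed.

(** Integration by parts with the weight [|x| ^ (- p (b + 1))] bounds [|n - p (b + 1)|] times the
    left side by a mixed integral. Young's inequality splits that integral, and the part containing
    the left side is absorbed. *)
Lemma hardy p b : 1 < p -> n%:R != p * (b + 1) -> exists2 C, 0 < C &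
  forall l M u, C1c l M u -> intL p (b + 1) u <= C * intH p b u.
Proof.
move=> p1 nb; have p0 : 0 < p by lra.
have [k kE] : exists k, k = `|n%:R - p * (b + 1)| by eexists.
have k0 : 0 < k by rewrite kE normr_gt0 subr_eq0.
(* With this weight the absorbed part [(p - 1) * t] is half of [k]. *)
have [t tE] : exists t, t = k / (2 * (p - 1)) by eexists.
have t0 : 0 < t by rewrite tE; apply: divr_gt0 => //; lra.
have tp : (p - 1) * t = k / 2 by rewrite tE; field; lra.
exists (2 * t `^ (1 - p) / k); first by rewrite divr_gt0 ?mulr_gt0 ?powR_gt0.
move=> l M u hu.
have E := C1c_by_parts (- (p * (b + 1))) p1 hu.
have iB := C1c_int_fun (- (p * (b + 1))) p0 hu; have iH := C1c_int_grad0 (- (p * b)) p0 hu.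
have iX := C1c_int_dot (- (p * (b + 1))) p1 hu.
have j1 := rintZ (t `^ (1 - p)) iH; have j2 := rintZ ((p - 1) * t) iB.
have jX := rintZ p iX.
have K : k * intL p (b + 1) u <= t `^ (1 - p) * intH p b u + (p - 1) * t * intL p (b + 1) u.
  have <- : `|\int[mu]_x (p * (l2norm x `^ (- (p * (b + 1))) * (spow p (u x) * dot x (grad u x))))|
      = k * intL p (b + 1) u.
    rewrite rintegralZ// E -/(wint _ _ _) -/(intL _ _ _) mulrA.
    rewrite (_ : p * _ = - (n%:R - p * (b + 1))); last by field; lra.
    by rewrite mulNr normrN normrM -kE (ger0_norm (wint_ge0 _ _ _)).
  apply: le_trans (le_normr_rintegral jX) _.
  rewrite /intL /intH /wint -!rintegralZ// -rintegralD//.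
  apply: le_rintegral; [exact: rint_norm|exact: rintD|move=> x].
  have [->|x0] := eqVneq x 0.
    have [-> ->] := C1c_origin hu.
    rewrite /spow sgr0 !mul0r !mulr0 normr0 addr_ge0// ?mulr_ge0 ?powR_ge0//; lra.
  rewrite normrM gtr0_norm//.
  have := @young_weighted p (b + 1) b x `|u x| (l2norm (grad u x)) t p1 t0 x0 (normr_ge0 _) (l2norm_ge0 _).
  move=> Y; rewrite -[(p - 1) * t * _]mulrA; apply: le_trans Y; rewrite ler_pM2l//.
  apply: le_trans (dot_spow_le _ _ _ _ x0) _.
  by rewrite (_ : - (p * (b + 1)) + 1 = - ((p - 1) * (b + 1) + b)); [|ring].
rewrite tp in K; move: K; move: (intL _ _ _) (intH _ _ _) (t `^ (1 - p)) => X Y Z K.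
rewrite (_ : 2 * Z / k * Y = (k / 2)^-1 * (Z * Y)); last by field; lra.
rewrite ler_pdivlMl; last by lra.
lra.
Qed.
End test_inequalities.

Section real_combinations.
Context d (T : measurableType d) (R : realType) (mu : {measure set T -> \bar R}).
Implicit Types (s : seq (R * (T -> R))).

(** Linear combinations are kept as lists of coefficients and functions, so that a pointwise
    identity or inequality with many terms passes to the integrals in one step. *)
Fixpoint lin s x := if s is z :: s' then z.1 * z.2 x + lin s' x else 0.
Fixpoint all_rint s := if s is z :: s' then rint mu z.2 /\ all_rint s' else True.
Fixpoint ilin s := if s is z :: s' then z.1 * \int[mu]_x z.2 x + ilin s' else 0.

Lemma rint_lin s : all_rint s -> rint mu (lin s).
Proof.
elim: s => [_|[k f] s IH /= [fi /IH]]; first exact: (integrable0 _ _).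
by move=> h; apply: rintD => //; exact: rintZ.
Qed.

Lemma rintegral_lin s : all_rint s -> \int[mu]_x lin s x = ilin s.
Proof.
elim: s => [_|[k f] s IH /= [fi si]]; first by rewrite /Rintegral /= integral0.
rewrite -(IH si) -(rintegralZ k fi); apply: rintegralD; first exact: rintZ.
exact: rint_lin.
Qed.

Lemma le_ilin s1 s2 : all_rint s1 -> all_rint s2 ->
  (forall x, lin s1 x <= lin s2 x) -> ilin s1 <= ilin s2.
Proof.
by move=> h1 h2 H; rewrite -!rintegral_lin//; apply: le_rintegral H; exact: rint_lin.
Qed.

Lemma eq_ilin s1 s2 : all_rint s1 -> all_rint s2 ->
  (forall x, lin s1 x = lin s2 x) -> ilin s1 = ilin s2.
Proof.
by move=> h1 h2 H; apply/eqP; rewrite eq_le !le_ilin// => x; rewrite H.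
Qed.
End real_combinations.

Section energy_inequalities.
#[local] Opaque powR l2norm partial.
Context {R : realType} {n : nat}.
Implicit Types (u : 'rV[R]_n -> R) (x : 'rV[R]_n) (p a b al lam : R).
Local Notation mu := (lebesgue_rV R n).

(* minus the radial logarithmic derivative, over |x|, of
   |x|^al exp(- lam |x|^(b + 1 - a) / (b + 1 - a)) *)
Definition kern al lam a b x : R :=
  lam * l2norm x `^ (b - a - 1) - al * l2norm x `^ (- 2).

Definition intD p b (k : 'rV[R]_n -> R) u :=
  wint (- (p * b)) p (fun x => l2norm (grad u x + (u x * k x) *: x)).

Lemma continuous_kern al lam a b x : 0 < sqn x -> {for x, continuous (kern al lam a b)}.
Proof.
move=> x0.
have H1 := @continuous_l2norm_weight R n (b - a - 1) x x0.
have H2 := @continuous_l2norm_weight R n (- 2) x x0.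
exact: continuousB (continuousM (@cst_continuous _ _ lam x) H1)
  (continuousM (@cst_continuous _ _ al x) H2).
Qed.

Lemma spow_powR p (v : R) : 2 <= p -> `|v| `^ (p - 2) * v = spow p v.
Proof.
move=> p2; rewrite /spow; have [->|v0] := eqVneq v 0; first by rewrite sgr0 mulr0 mul0r.
have -> : `|v| `^ (p - 1) = `|v| `^ (p - 2) * `|v|.
  by rewrite powR_mulr1 ?normr_gt0//; congr (_ `^ _); ring.
by rewrite mulrCA mulr_sg_norm.
Qed.

(** With [A = |x| ^ (- b) G] and [B = lam |x| ^ (- a - 1) v x] the weights disappear, and the
    weighted inequalities become inequalities between two vectors. The exponent c is exactly the one
    that the cross term [|B| ^ (p - 2) B . A] produces. *)
Lemma weighted_vectors p a b lam x (v : R) (G : 'rV[R]_n) : 2 <= p -> 0 < lam -> x != 0 ->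
  exists A B : 'rV[R]_n,
  [/\ l2norm x `^ (- (p * b)) * l2norm (G + (v * kern 0 lam a b x) *: x) `^ p =
        l2norm (A + B) `^ p,
      l2norm x `^ (- (p * b)) * l2norm G `^ p = l2norm A `^ p,
      lam `^ p * (l2norm x `^ (- (p * a)) * `|v| `^ p) = l2norm B `^ p &
      lam `^ (p - 1) *
        (l2norm x `^ (- (p * CKN_exponent p a b)) * (spow p v * dot x G)) =
        l2norm B `^ (p - 2) * dot B A].
Proof.
move=> p2 lam0 x0.
have p0 : p != 0 by lra.
pose A := l2norm x `^ (- b) *: G.
pose B := (lam * l2norm x `^ (- a - 1) * v) *: x; exists A, B.
have r0 : 0 < l2norm x by rewrite l2norm_gt0.
have ra : l2norm x `^ (- a) = l2norm x `^ (- a - 1) * l2norm x by rewrite powR_mulr1// subrK.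
have nA : l2norm A = l2norm x `^ (- b) * l2norm G.
  by rewrite l2normZ ger0_norm ?powR_ge0.
have nB : l2norm B = lam * (l2norm x `^ (- a) * `|v|).
  rewrite l2normZ !normrM (gtr0_norm lam0) (ger0_norm (powR_ge0 _ _)).
  by rewrite ra; ring.
split.
- rewrite weight_powR ?l2norm_ge0//; congr (_ `^ _).
  rewrite -[X in X * _](@ger0_norm _ (l2norm x `^ (- b))) ?powR_ge0// -l2normZ.
  congr l2norm; rewrite scalerDr scalerA; congr (_ + _ *: _).
  rewrite /kern mul0r subr0 (_ : - a - 1 = - b + (b - a - 1)); last by ring.
  by rewrite (powRD_gt0 (- b) (b - a - 1) r0); ring.
- by rewrite nA weight_powR ?l2norm_ge0.
- by rewrite nB powRM ?(ltW lam0) ?mulr_ge0 ?powR_ge0// weight_powR.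
- rewrite nB !powRM ?(ltW lam0) ?mulr_ge0 ?powR_ge0// -powRrM.
  rewrite dotZl [dot x A]dotC dotZl [dot G x]dotC -spow_powR// CKN_exponentE//.
  have -> : lam `^ (p - 1) = lam `^ (p - 2) * lam.
    by rewrite powR_mulr1//; congr (_ `^ _); ring.
  have -> : - ((p - 1) * a + b + 1) = - a * (p - 2) + ((- a - 1) + - b) by ring.
  rewrite (powRD_gt0 (- a * (p - 2)) _ r0) (powRD_gt0 (- a - 1) (- b) r0); ring.
Qed.

Definition lfun p b (v : R) x : R := l2norm x `^ (- (p * b)) * `|v| `^ p.
Definition gfun p b (G : 'rV[R]_n) x : R := l2norm x `^ (- (p * b)) * l2norm G `^ p.
Definition xfun p c (v : R) (G : 'rV[R]_n) x : R :=
  l2norm x `^ (- (p * c)) * (spow p v * dot x G).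

(** Comparing integrals through lists asks for every point. At the origin, where the powers of [|x|]
    take conventional values, the terms vanish because the function and its gradient do. *)
Lemma weighted_origin p b c : p != 0 ->
  [/\ lfun p b 0 0 = 0, gfun p b 0 0 = 0 & xfun p c 0 0 0 = 0].
Proof.
move=> p0; rewrite /lfun /gfun /xfun normr0 l2norm0 /spow sgr0 !mul0r.
by rewrite [0 `^ p]powR0// !mulr0.
Qed.

Lemma remainder_weighted p : 2 <= p -> exists2 c : R, 0 < c &
  forall a b lam x (v : R) (G : 'rV[R]_n), 0 < lam -> (x = 0 -> v = 0 /\ G = 0) ->
  c * gfun p b (G + (v * kern 0 lam a b x) *: x) x + 0 <=
  1 * gfun p b G x + ((p - 1) * lam `^ p * lfun p a v x +
    (p * lam `^ (p - 1) * xfun p (CKN_exponent p a b) v G x + 0)).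
Proof.
move=> p2; have [c c0 H] := @young_remainder R n p p2; exists c; first exact: c0.
move=> a b lam x v G lam0 h0; have p0 : p != 0 by lra.
have [xE|x0] := eqVneq x 0.
  have [-> ->] := h0 xE; rewrite xE mul0r scale0r !addr0.
  have [-> -> ->] : [/\ lfun p a 0 0 = 0, gfun p b 0 0 = 0 & xfun p (CKN_exponent p a b) 0 0 0 = 0].
    by have [] := weighted_origin a (CKN_exponent p a b) p0; have [] := weighted_origin b b p0.
  by rewrite !mulr0 ?addr0.
have [A [B [E1 E2 E3 E4]]] := weighted_vectors a b v G p2 lam0 x0.
rewrite -/(gfun p b _ x) in E1; rewrite -/(gfun p b _ x) in E2.
rewrite -/(lfun p a v x) in E3; rewrite -/(xfun p _ v G x) in E4.
move: (H A B); rewrite -E1 -E2 -E3 -E4.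
move: (gfun _ _ _ _) (gfun _ _ _ _) (lfun _ _ _ _) (xfun _ _ _ _ _) => D X Y Z.
by rewrite !addr0 mul1r -addrA !mulrA.
Qed.

(** Integrated form of [remainder_weighted]. Integration by parts turns the mixed term into
    [- lam ^ (p - 1) * (n - p c)] times the integral with exponent c, which is the origin of the
    best constant for [al = 0]. *)
Lemma energy_lower p : 2 <= p -> exists2 c : R, 0 < c &
  forall a b lam l M u, 0 < lam -> C1c l M u ->
  c * intD p b (kern 0 lam a b) u <=
  intH p b u + (p - 1) * lam `^ p * intL p a u
  - lam `^ (p - 1) * (n%:R - p * CKN_exponent p a b) * intL p (CKN_exponent p a b) u.
Proof.
move=> p2; have [c c0 H] := remainder_weighted p2; exists c; first exact: c0.
move=> a b lam l M u lam0 hu.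
have p0 : 0 < p by lra. have p1 : 1 < p by lra.
have iH := C1c_int_grad0 (- (p * b)) p0 hu.
have iA := C1c_int_fun (- (p * a)) p0 hu.
have iX := C1c_int_dot (- (p * CKN_exponent p a b)) p1 hu.
have iD := C1c_int_grad (- (p * b)) p0 hu (fun x => @continuous_kern 0 lam a b x).
have E := C1c_by_parts (- (p * CKN_exponent p a b)) p1 hu.
have H0 x : x = 0 -> u x = 0 /\ grad u x = 0 by move=> ->; exact: C1c_origin hu.
have K : c * intD p b (kern 0 lam a b) u + 0 <= 1 * intH p b u +
    ((p - 1) * lam `^ p * intL p a u + (p * lam `^ (p - 1) *
    (\int[mu]_x (l2norm x `^ (- (p * CKN_exponent p a b)) *
       (spow p (u x) * dot x (grad u x)))) + 0)).
  exact (@le_ilin _ _ _ mu [:: (c, _)] [:: (1, _); ((p - 1) * lam `^ p, _);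
    (p * lam `^ (p - 1), _)] (conj iD I) (conj iH (conj iA (conj iX I)))
    (fun x => H a b lam x (u x) (grad u x) lam0 (H0 x))).
have alg (D H' A X L k1 k2 e : R) : c * D + 0 <= 1 * H' + (k1 * A + (k2 * X + 0)) ->
    X = e * L -> c * D <= H' + k1 * A - (- (k2 * e)) * L.
  by move=> H1 XE; move: H1; rewrite XE !addr0 mul1r mulNr opprK addrA mulrA.
have := alg _ _ _ _ _ _ _ _ K E.
by rewrite (_ : - (p * lam `^ (p - 1) * - _) =
  lam `^ (p - 1) * (n%:R - p * CKN_exponent p a b)); last by field; lra.
Qed.

(** Substitute [A = Z - B] with [Z = A + B]. Convexity with weight [t] for [|A| ^ p] and Young's
    inequality for [B . Z] leave [|B| ^ p] with the coefficient [(1 - t) ^ (1 - p) - 1 + (p - 1) t],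
    which tends to 0 with [t]; the price is a large multiple of [|Z| ^ p]. *)
Lemma young_remainder_upper p : 2 <= p -> forall e : R, 0 < e -> exists2 C : R, 0 <= C &
  forall A B : 'rV[R]_n,
  l2norm A `^ p + (p - 1) * l2norm B `^ p + p * (l2norm B `^ (p - 2) * dot B A) <=
  e * l2norm B `^ p + C * l2norm (A + B) `^ p.
Proof.
move=> p2 e e0; have p0 : 0 < p by lra. have p1 : 1 < p by lra.
have [t t01 te] : exists2 t : R, 0 < t < 1 & (1 - t) `^ (1 - p) - 1 + (p - 1) * t <= e.
  have cf : {for 0, continuous (fun t : R => (1 - t) `^ (1 - p) - 1 + (p - 1) * t)}.
    have H1 : {for 0, continuous (fun t : R => (1 - t) `^ (1 - p))}.
      apply: (@continuous_comp _ _ _ (fun t : R => 1 - t) (fun s => s `^ (1 - p))).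
        by apply: continuousB; [exact: cst_continuous|].
      by apply: continuous_powR; rewrite subr0.
    have H2 : {for 0, continuous (fun t : R => (p - 1) * t)}.
      by apply: (@continuousM _ _ (fun=> p - 1) id); [exact: cst_continuous|].
    exact: (continuousD (continuousB H1 (@cst_continuous _ _ (1 : R) 0)) H2).
  have : \forall t \near (0 : R)^'+, (1 - t) `^ (1 - p) - 1 + (p - 1) * t < e.
    have := cf; rewrite /prop_for /continuous_at subr0 powR1 subrr mulr0 addr0 => cf0.
    have /cvgr_lt : (fun t : R => (1 - t) `^ (1 - p) - 1 + (p - 1) * t) @ 0^'+ --> (0 : R).
      exact: cvg_within_filter cf0.
    by apply.
  move=> H; have H1 : \forall t \near (0 : R)^'+, 0 < t < 1.
    by near=> t; apply/andP; split; near: t; [exact: nbhs_right_gt|exact: nbhs_right_lt].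
  have [t [] ] := @filter_ex _ _ _ _ (filterI H H1).
  by move=> h1 h2; exists t => //; exact: ltW.
exists (2 * t `^ (1 - p)); first by rewrite mulr_ge0 ?powR_ge0.
move=> A B; have /andP[t0 t1] := t01.
set Z := A + B; have AE : A = Z - B by rewrite /Z addrK.
have A0 := l2norm_ge0 A; have B0 := l2norm_ge0 B; have Z0 := l2norm_ge0 Z.
have K1 : l2norm A `^ p <= (1 - t) `^ (1 - p) * l2norm B `^ p + t `^ (1 - p) * l2norm Z `^ p.
  apply: le_trans (powRD_convex (ltW p1) B0 Z0 t01).
  rewrite ge0_ler_powR ?nnegrE ?addr_ge0 ?(ltW p0)//.
  by rewrite AE addrC -[l2norm B]l2normN l2normD.
have K2 : p * (l2norm B `^ (p - 2) * dot B A) <=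
    - (p * l2norm B `^ p) + (t `^ (1 - p) * l2norm Z `^ p + (p - 1) * (t * l2norm B `^ p)).
  have Bp : l2norm B `^ (p - 2) * sqn B = l2norm B `^ p.
    rewrite -sqr_l2norm; have [->|BN] := eqVneq (l2norm B) 0.
      by rewrite expr0n mulr0 powR0// gt_eqF.
    by rewrite -powR_mulrn// -powRD_gt0 ?lt_def ?BN// subrK.
  have Bq : l2norm B `^ (p - 2) * l2norm B = l2norm B `^ (p - 1).
    have [->|BN] := eqVneq (l2norm B) 0; first by rewrite mulr0 powR0// subr_eq0 gt_eqF.
    by rewrite powR_mulr1 ?lt_def ?BN//; congr (_ `^ _); ring.
  have -> : l2norm B `^ (p - 2) * dot B A = l2norm B `^ (p - 2) * dot B Z - l2norm B `^ p.
    by rewrite [dot B Z]dotC dotDl dotxx dotC mulrDr Bp addrK.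
  have Y := powR_young p1 Z0 B0 t0.
  have : p * (l2norm B `^ (p - 2) * dot B Z) <= p * (l2norm Z * l2norm B `^ (p - 1)).
    rewrite ler_pM2l// -Bq mulrCA ler_wpM2l ?powR_ge0// mulrC.
    by apply: le_trans (cauchy_schwarz B Z); exact: ler_norm.
  rewrite mulrBr; move: Y; move: (l2norm B `^ (p - 2) * dot B Z) (l2norm Z * l2norm B `^ (p - 1)) => x y.
  by move: (t `^ (1 - p) * l2norm Z `^ p) (l2norm B `^ p) => v w; clear; lra.
have K3 := ler_wpM2r (powR_ge0 (l2norm B) p) te.
move: K1 K2 K3; move: (l2norm A `^ p) (l2norm B `^ p) (l2norm Z `^ p) (t `^ (1 - p))
  ((1 - t) `^ (1 - p)) (l2norm B `^ (p - 2) * dot B A) => X Y W V S T.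
clear; lra.
Unshelve. all: by end_near. Qed.

Lemma remainder_weighted_upper p : 2 <= p -> forall e : R, 0 < e -> exists2 C : R, 0 <= C &
  forall a b x (v : R) (G : 'rV[R]_n), (x = 0 -> v = 0 /\ G = 0) ->
  1 * gfun p b G x + ((p - 1) * lfun p a v x +
    (p * xfun p (CKN_exponent p a b) v G x + 0)) <=
  e * lfun p a v x + (C * gfun p b (G + (v * kern 0 1 a b x) *: x) x + 0).
Proof.
move=> p2 e e0; have [C C0 H] := young_remainder_upper p2 e0; exists C; first exact: C0.
move=> a b x v G h0; have p0 : p != 0 by lra.
have [xE|x0] := eqVneq x 0.
  have [-> ->] := h0 xE; rewrite xE mul0r scale0r !addr0.
  have [-> -> ->] : [/\ lfun p a 0 0 = 0, gfun p b 0 0 = 0 & xfun p (CKN_exponent p a b) 0 0 0 = 0].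
    by have [] := weighted_origin a (CKN_exponent p a b) p0; have [] := weighted_origin b b p0.
  by rewrite !mulr0 ?addr0.
have [A [B [E1 E2 E3 E4]]] := weighted_vectors a b v G p2 ltr01 x0.
rewrite -/(gfun p b _ x) in E1; rewrite -/(gfun p b _ x) in E2.
rewrite powR1 mul1r -/(lfun p a v x) in E3; rewrite powR1 mul1r -/(xfun p _ v G x) in E4.
move: (H A B); rewrite -E1 -E2 -E3 -E4.
move: (gfun _ _ _ _) (gfun _ _ _ _) (lfun _ _ _ _) (xfun _ _ _ _ _) => D X Y Z.
by rewrite !addr0 mul1r -addrA.
Qed.

Lemma energy_upper p : 2 <= p -> forall e : R, 0 < e -> exists2 C : R, 0 <= C &
  forall a b l M u, C1c l M u ->
  intH p b u + (p - 1) * intL p a u <=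
  (n%:R - p * CKN_exponent p a b) * intL p (CKN_exponent p a b) u
  + e * intL p a u + C * intD p b (kern 0 1 a b) u.
Proof.
move=> p2 e e0; have [C C0 H] := remainder_weighted_upper p2 e0; exists C; first exact: C0.
move=> a b l M u hu.
have p0 : 0 < p by lra. have p1 : 1 < p by lra.
have iH := C1c_int_grad0 (- (p * b)) p0 hu.
have iA := C1c_int_fun (- (p * a)) p0 hu.
have iX := C1c_int_dot (- (p * CKN_exponent p a b)) p1 hu.
have iD := C1c_int_grad (- (p * b)) p0 hu (fun x => @continuous_kern 0 1 a b x).
have E := C1c_by_parts (- (p * CKN_exponent p a b)) p1 hu.
have H0 x : x = 0 -> u x = 0 /\ grad u x = 0 by move=> ->; exact: C1c_origin hu.
have K : 1 * intH p b u + ((p - 1) * intL p a u + (p *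
    (\int[mu]_x (l2norm x `^ (- (p * CKN_exponent p a b)) *
       (spow p (u x) * dot x (grad u x)))) + 0)) <=
    e * intL p a u + (C * intD p b (kern 0 1 a b) u + 0).
  exact (@le_ilin _ _ _ mu [:: (1, _); (p - 1, _); (p, _)] [:: (e, _); (C, _)]
    (conj iH (conj iA (conj iX I))) (conj iA (conj iD I))
    (fun x => H a b x (u x) (grad u x) (H0 x))).
have alg (D H' A X L q : R) : 1 * H' + ((p - 1) * A + (p * X + 0)) <= e * A + (C * D + 0) ->
    X = - (q / p) * L -> H' + (p - 1) * A <= q * L + e * A + C * D.
  move=> H1 XE; move: H1; rewrite XE !addr0 mul1r.
  by rewrite (_ : p * (- (q / p) * L) = - (q * L)); [clear; lra|clear -p2; field; lra].
exact: alg K E.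
Qed.

Lemma square_weighted a b al lam x (v : R) (G : 'rV[R]_n) : (x = 0 -> v = 0 /\ G = 0) ->
  1 * gfun 2 b (G + (v * kern al lam a b x) *: x) x + 0 =
  1 * gfun 2 b G x + (lam ^+ 2 * lfun 2 a v x +
   (- (2 * lam * al) * lfun 2 (CKN_exponent 2 a b) v x + (al ^+ 2 * lfun 2 (b + 1) v x +
   (2 * lam * xfun 2 (CKN_exponent 2 a b) v G x +
   (- (2 * al) * xfun 2 (b + 1) v G x + 0))))).
Proof.
move=> h0; have p20 : 2 != 0 :> R by [].
rewrite !addr0 !mul1r.
have [xE|x0] := eqVneq x 0.
  have [-> ->] := h0 xE; rewrite xE mul0r scale0r !addr0.
  have [h1 h2 h3] := weighted_origin a (CKN_exponent 2 a b) p20.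
  have [h4 h5 h6] := weighted_origin (b + 1) (b + 1) p20.
  have [h7 h8 h9] := weighted_origin (CKN_exponent 2 a b) b p20.
  have [h10 h11 h12] := weighted_origin b b p20.
  by rewrite h1 h3 h4 h6 h7 h11 !mulr0 ?addr0.
have r0 : 0 < l2norm x by rewrite l2norm_gt0.
rewrite /gfun /lfun /xfun !(powR_mulrn 2)// ?l2norm_ge0// !sqr_l2norm sqnD sqnZ.
rewrite [dot _ (_ *: _)]dotC dotZl real_normK ?num_real//.
have -> : spow 2 v = v by rewrite -spow_powR// subrr powRr0 mul1r.
rewrite CKN_exponentE// /kern.
have [T TE] : exists T, T = l2norm x `^ (- 2) by eexists.
have T0 : T != 0 by rewrite TE gt_eqF// powR_gt0.
have r2 : sqn x = T^-1.
  by rewrite TE powRN invrK powR_mulrn ?l2norm_ge0// sqr_l2norm.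
have -> : - (2 * (b + 1)) = - (2 * b) + - 2 by ring.
have -> : - ((2 - 1) * a + b + 1) = - (2 * b) + (b - a - 1) by ring.
have -> : - (2 * a) = - (2 * b) + ((b - a - 1) + ((b - a - 1) + 2)) by ring.
rewrite !(powRD_gt0 (- (2 * b)) _ r0) (powRD_gt0 _ ((b - a - 1) + 2) r0)
  (powRD_gt0 (b - a - 1) 2 r0) powR_mulrn ?l2norm_ge0// sqr_l2norm -TE r2.
move: (sqn G) (dot x G) (l2norm x `^ _) (l2norm x `^ _) => gg dd ee ff.
by field.
Qed.

(** The second cross term integrates to [al * (n - 2 (b + 1))] times the Hardy integral, and this
    value of [al] makes it cancel the term with [al ^ 2]. What remains with exponent c has the
    coefficient [- lam * (2 al + n - 2 c)]. *)
Lemma energy_square a b al lam l M u : C1c l M u -> al = 2 * b + 2 - n%:R ->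
  intD 2 b (kern al lam a b) u = intH 2 b u + lam ^+ 2 * intL 2 a u
  - lam * (3 * b - a - n%:R + 3) * intL 2 (CKN_exponent 2 a b) u.
Proof.
move=> hu alE.
have p0 : 0 < 2 :> R by []. have p1 : 1 < 2 :> R by lra.
pose c := CKN_exponent 2 a b.
have iH := C1c_int_grad0 (- (2 * b)) p0 hu.
have iA := C1c_int_fun (- (2 * a)) p0 hu.
have iC := C1c_int_fun (- (2 * c)) p0 hu.
have iB := C1c_int_fun (- (2 * (b + 1))) p0 hu.
have iX := C1c_int_dot (- (2 * c)) p1 hu.
have iY := C1c_int_dot (- (2 * (b + 1))) p1 hu.
have EX := C1c_by_parts (- (2 * c)) p1 hu; have EY := C1c_by_parts (- (2 * (b + 1))) p1 hu.
have iD := C1c_int_grad (- (2 * b)) p0 hu (fun x => @continuous_kern al lam a b x).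
have H0 x : x = 0 -> u x = 0 /\ grad u x = 0 by move=> ->; exact: C1c_origin hu.
have K : 1 * intD 2 b (kern al lam a b) u + 0 =
    1 * intH 2 b u + (lam ^+ 2 * intL 2 a u + (- (2 * lam * al) * intL 2 c u
    + (al ^+ 2 * intL 2 (b + 1) u
    + (2 * lam * (\int[mu]_x (l2norm x `^ (- (2 * c)) * (spow 2 (u x) * dot x (grad u x))))
    + (- (2 * al) * (\int[mu]_x (l2norm x `^ (- (2 * (b + 1))) * (spow 2 (u x) * dot x (grad u x)))) + 0))))).
  exact (@eq_ilin _ _ _ mu [:: (1, _)] [:: (1, _); (lam ^+ 2, _); (- (2 * lam * al), _);
    (al ^+ 2, _); (2 * lam, _); (- (2 * al), _)] (conj iD I)
    (conj iH (conj iA (conj iC (conj iB (conj iX (conj iY I))))))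
    (fun x => @square_weighted a b al lam x (u x) (grad u x) (H0 x))).
have c2 : 2 * c = a + b + 1 by rewrite CKN_exponentE//; ring.
have alg (D H' A C B X Y : R) : 1 * D + 0 = 1 * H' + (lam ^+ 2 * A + (- (2 * lam * al) * C +
    (al ^+ 2 * B + (2 * lam * X + (- (2 * al) * Y + 0))))) ->
    X = - ((n%:R - 2 * c) / 2) * C -> Y = - ((n%:R - 2 * (b + 1)) / 2) * B ->
    D = H' + lam ^+ 2 * A - lam * (3 * b - a - n%:R + 3) * C.
  rewrite c2 alE => H XE YE; move: H; rewrite XE YE !addr0 !mul1r => ->; by field.
exact: alg K EX EY.
Qed.
End energy_inequalities.

(** * Test functions and cut-offs *)

Section smooth_rV.
Context {R : realType} {n : nat}.
Implicit Types f g : 'rV[R]_n -> R.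

(** Closure of smoothness under products and compositions is proved by induction on the order;
    [smooth], which quantifies over lists of indices, is the conjunction of all orders. *)
Fixpoint Ck k f : Prop :=
  if k is k'.+1 then (forall x, differentiable f x) /\ forall i, Ck k' (partial i f)
  else forall x, differentiable f x.

Lemma CkP f : (forall k, Ck k f) <-> smooth f.
Proof.
split => [H s x|H k].
  elim/last_ind: s f H => [|s i IH] f H /=; first exact: (H 0%N).
  by rewrite foldr_rcons; apply: IH => k; have [_] := H k.+1; apply.
elim: k f H => [|k IH] f H /=; first exact: (H [::]).
split; first exact: (H [::]).
by move=> i; apply: IH => s x; rewrite -foldr_rcons; exact: H.
Qed.

Lemma CkS k f : Ck k.+1 f -> Ck k f.
Proof. by elim: k f => [|k IH] f [h H] //; split => // i; exact: IH (H i). Qed.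

Lemma Ck_diff k f : Ck k f -> forall x, differentiable f x.
Proof. by case: k => // k []. Qed.

Lemma is_derive_partial f i x : differentiable f x ->
  is_derive x (delta_mx ord0 i) f (partial i f x).
Proof. by move=> h; apply/derivableP; exact: diff_derivable. Qed.

Definition has_partial f i df := forall x, is_derive x (delta_mx ord0 i) f (df x).

Lemma partialE f i df : has_partial f i df -> partial i f = df.
Proof. by move=> H; apply/funext => x; have [_ <-] := H x. Qed.

Lemma Ck_partial k f i df : has_partial f i df ->
  Ck k df -> Ck k (partial i f).
Proof. by move=> /partialE ->. Qed.

Lemma CkD k f g : Ck k f -> Ck k g -> Ck k (fun x => f x + g x).
Proof.
elim: k f g => [|k IH] f g; first by move=> hf hg x; exact: differentiableD.
move=> [df Hf] [dg Hg]; split; first by move=> x; exact: differentiableD.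
move=> i; apply: (@Ck_partial _ _ i (fun x => partial i f x + partial i g x)); last exact: IH (Hf i) (Hg i).
by move=> x; apply: is_deriveD; exact: is_derive_partial.
Qed.

Lemma CkM k f g : Ck k f -> Ck k g -> Ck k (fun x => f x * g x).
Proof.
elim: k f g => [|k IH] f g; first by move=> hf hg x; exact: differentiableM.
move=> hf hg; have [[df Hf] [dg Hg]] := (hf, hg); split; first by move=> x; exact: differentiableM.
move=> i; apply: (@Ck_partial _ _ i (fun x => f x * partial i g x + g x * partial i f x)).
  by move=> x; apply: is_deriveM; exact: is_derive_partial.
by apply: CkD; [exact: IH (CkS hf) (Hg i)|exact: IH (CkS hg) (Hf i)].
Qed.

Lemma Ck_cst k (c : R) : Ck k (fun=> c).
Proof.
elim: k c => [|k IH] c; first by move=> x; exact: differentiable_cst.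
split; first by move=> x; exact: differentiable_cst.
by move=> i; apply: (@Ck_partial _ _ i (fun=> 0)) => // x; exact: is_derive_cst.
Qed.

Lemma Ck_coord k j : Ck k (fun x : 'rV[R]_n => x ord0 j).
Proof.
case: k => [|k]; first by move=> x; exact: differentiable_coord.
split; first by move=> x; exact: differentiable_coord.
move=> i; apply: (@Ck_partial _ _ i (fun=> (delta_mx ord0 i : 'rV[R]_n) ord0 j)); last exact: Ck_cst.
by move=> x; exact: is_derive_coord.
Qed.

Lemma Ck_sum k (I : Type) (s : seq I) (F : I -> 'rV[R]_n -> R) :
  (forall i, Ck k (F i)) -> Ck k (fun x => \sum_(i <- s) F i x).
Proof.
move=> H; elim: s => [|i s IH].
  by under eq_fun do rewrite big_nil; exact: Ck_cst.
by under eq_fun do rewrite big_cons; exact: CkD.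
Qed.

Lemma Ck_prod k (I : Type) (s : seq I) (F : I -> 'rV[R]_n -> R) :
  (forall i, Ck k (F i)) -> Ck k (fun x => \prod_(i <- s) F i x).
Proof.
move=> H; elim: s => [|i s IH].
  by under eq_fun do rewrite big_nil; exact: Ck_cst.
by under eq_fun do rewrite big_cons; exact: CkM.
Qed.

Lemma Ck_sqn k : Ck k (@sqn R n).
Proof. by apply: Ck_sum => i; apply: CkM; exact: Ck_coord. Qed.

(** Derivatives are asked for on [U] only, so that powers can be treated on the positive half-line
    before a cut-off extends them by 0. *)
Fixpoint dk (U : set R) k (h : R -> R) : Prop :=
  if k is k'.+1 then exists2 h', (forall t : R, U t -> is_derive t 1 h (h' t)) & dk U k' h'
  else True.

Lemma dkS U k h : dk U k.+1 h -> dk U k h.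
Proof. by elim: k h => [//|k IH] h [h' H1 H2]; exists h' => //; exact: IH. Qed.

(** The shift by one order arises because [Ck 0] already asks for differentiability, while [dk U 0]
    asks for nothing. *)
Lemma Ck_comp k h f : dk setT k.+1 h -> Ck k f -> Ck k (fun x => h (f x)).
Proof.
have D h1 h2 g : (forall t : R, setT t -> is_derive t 1 h1 (h2 t)) ->
    (forall x, differentiable g x) -> forall x, differentiable (fun x => h1 (g x)) x.
  move=> H dg x; apply: (@differentiable_comp _ _ _ _ g h1); first exact: dg.
  by apply/derivable1_diffP; have [] := H (g x) Logic.I.
elim: k h f => [|k IH] h f [h' H1 H2] hf; first exact: D hf.
split; first exact: D (Ck_diff hf).
move=> i; apply: (@Ck_partial _ _ i (fun x => h' (f x) * partial i f x)); last first.
  by apply: CkM; [apply: IH => //; exact: CkS|have [_] := hf; apply].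
by move=> x; apply: is_derive_chain (H1 _ _) => //; exact: is_derive_partial (Ck_diff hf x).
Qed.

Lemma eq_dk U k h h1 : open U -> (forall t, U t -> h t = h1 t) -> dk U k h -> dk U k h1.
Proof.
move=> oU; case: k => [//|k] E [h' H1 H2]; exists h' => // t Ut.
have hd := H1 t Ut; apply: (@near_eq_is_derive _ _ _ h) hd => //.
by apply: filterS (open_nbhs_nbhs (conj oU Ut)) => s /E.
Qed.

Lemma dkD U k (g h : R -> R) : dk U k g -> dk U k h -> dk U k (fun t => g t + h t).
Proof.
elim: k g h => [//|k IH] g h [g' G1 G2] [h' H1 H2].
by exists (fun t => g' t + h' t); [move=> t Ut; apply: is_deriveD; [exact: G1|exact: H1]|exact: IH].
Qed.

Lemma dkM U k (g h : R -> R) : dk U k g -> dk U k h -> dk U k (fun t => g t * h t).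
Proof.
elim: k g h => [//|k IH] g h hg hh; have [[g' G1 G2] [h' H1 H2]] := (hg, hh).
exists (fun t => g t * h' t + h t * g' t).
  by move=> t Ut; apply: is_deriveM; [exact: G1|exact: H1].
by apply: dkD; apply: IH => //; exact: dkS.
Qed.

Lemma dk_cst U k (c : R) : dk U k (fun=> c).
Proof.
by elim: k c => [//|k IH] c; exists (fun=> 0) => // t _; exact: is_derive_cst.
Qed.

Lemma dk_comp U V k (g h : R -> R) : (forall t, U t -> V (h t)) -> dk V k g -> dk U k h ->
  dk U k (fun t => g (h t)).
Proof.
move=> UV; elim: k g => [//|k IH] g [g' G1 G2] hh; have [h' H1 H2] := hh.
exists (fun t => g' (h t) * h' t).
  by move=> t Ut; apply: is_derive_chain (H1 t Ut) (G1 _ (UV _ Ut)).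
by apply: dkM => //; apply: IH => //; exact: dkS.
Qed.

Lemma dk_id U k : dk U k id.
Proof.
case: k => [//|k]; exists (fun=> 1); last exact: dk_cst.
by move=> t _; exact: is_derive_id.
Qed.

Lemma dk_powR k q : dk [set t | 0 < t] k (fun t => t `^ q).
Proof.
elim: k q => [//|k IH] q; exists (fun t => q * t `^ (q - 1)).
  by move=> t t0; exact: is_derive1_powR.
by apply: dkM; [exact: dk_cst|exact: IH].
Qed.

Lemma dk_expR U k : dk U k expR.
Proof. by elim: k => [//|k IH]; exists expR => // t _; exact: is_derive_expR. Qed.

(** The derivative vanishes on [0 < t < l], so it can be redefined as 0 on all of [t < l]; the new
    derivative satisfies the same hypothesis and the induction goes on. *)
Lemma dk_extend k l h : 0 < l -> (forall t, t < l -> h t = 0) ->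
  dk [set t | 0 < t] k h -> dk setT k h.
Proof.
move=> l0; elim: k h => [//|k IH] h h0 [h' H1 H2].
have near0 (t : R) : t < l -> is_derive t 1 h 0.
  move=> tl; apply: (@near_eq_is_derive _ _ _ (fun=> 0)) (is_derive_cst _ _ _).
  by have := lt_nbhsl tl; apply: filterS => s /h0.
pose h2 t := if t < l then 0 else h' t.
have E t : 0 < t -> h' t = h2 t.
  rewrite /h2; case: (ltP t l) => [tl t0|_ _]; last by [].
  by have [_ <-] := H1 t t0; have [_ ->] := near0 t tl.
exists h2.
  move=> t _; rewrite /h2; case: (ltP t l) => [|tl]; first exact: near0.
  by apply: H1; exact: lt_le_trans l0 tl.
apply: IH; first by move=> t tl; rewrite /h2 tl.
by apply: eq_dk H2 => //; exact: open_gt.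
Qed.
End smooth_rV.

(** * A smooth bump on the line *)

Section bump.
Context {R : realType}.

Lemma poly_le_expR (q : {poly R}) (e : R) : 0 < e ->
  exists2 C, 0 <= C & forall s : R, 0 < s -> `|q.[s]| <= C * expR (e * s).
Proof.
elim/poly_ind: q e => [|q c IH] e e0.
  by exists 0 => // s _; rewrite horner0 normr0 mul0r.
have [|C C0 H] := IH (e / 2); first by rewrite divr_gt0.
exists (C * (2 / e) + `|c|); first by rewrite addr_ge0// mulr_ge0// divr_ge0// ltW.
move=> s s0; rewrite hornerMXaddC; apply: le_trans (ler_normD _ _) _.
rewrite mulrDl lerD//; last first.
  by rewrite ler_peMr// -expR0 ler_expR mulr_ge0// ltW.
rewrite normrM (gtr0_norm s0) (_ : e * s = e / 2 * s + e / 2 * s); last by field.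
rewrite expRD [C * _ * _](_ : _ = (C * expR (e / 2 * s)) * (2 / e * expR (e / 2 * s))); last by ring.
apply: ler_pM => //; first exact: ltW.
  exact: H.
have : s = 2 / e * (e / 2 * s) by field; rewrite gt_eqF.
move=> {1}->; rewrite ler_wpM2l ?divr_ge0 ?(ltW e0)//.
by apply: le_trans (expR_ge1Dx _); rewrite lerDr.
Qed.

Definition bumpq (q : {poly R}) (t : R) : R :=
  if 0 < t then q.[t^-1] * expR (- t^-1) else 0.

Lemma is_derive_bumpq q (t : R) : is_derive t 1 (bumpq q) (bumpq ('X^2 * (q - q^`())) t).
Proof.
rewrite {2}/bumpq; have [t0|] := ltP 0 t.
  have H : is_derive t 1 (fun t => q.[t^-1] * expR (- t^-1))
      (('X^2 * (q - q^`())).[t^-1] * expR (- t^-1)).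
    have dV : is_derive t 1 (fun t : R => t^-1) (- t^-1 ^+ 2).
      have := @is_deriveV R id t 1 1 (lt0r_neq0 t0) (is_derive_id _ _).
      by rewrite /= exprVn [_%:A]mulr1.
    have dq := is_derive_chain dV (is_derive_poly q t^-1).
    have dE := is_derive_chain (is_deriveN dV) (is_derive_expR (- t^-1)).
    have [D1 D2] := is_deriveM dq dE; apply: (DeriveDef D1); apply: (etrans D2).
    rewrite hornerM hornerXn hornerD hornerN -![_ *: _]/(_ * _) /=.
    move: (q.[t^-1]) (q^`().[t^-1]) (expR (- t^-1)) => A B C.
    by move: (t^-1) => s; ring.
  apply: near_eq_is_derive H.
  by near=> s; rewrite /bumpq ifT//; near: s; exact: lt_nbhsr.
rewrite le_eqVlt => /predU1P[->|t0]; last first.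
  apply: (@near_eq_is_derive _ _ _ (fun=> 0)) (is_derive_cst _ _ _).
  by have := lt_nbhsl t0; apply: filterS => s s0; rewrite /bumpq ltNge (ltW s0).
(* Of the two extra factors [1 / h], one pays for the difference quotient and the other yields the
   bound [C * |h|]. *)
have [C C0 HC] := poly_le_expR (q * 'X^2) (@ltr01 R).
suff K : (fun h : R => h^-1 *: ((bumpq q \o shift 0) (h *: 1) - bumpq q 0)) @ 0^' --> (0 : R).
  by apply: DeriveDef; [apply/cvg_ex; exists 0|exact/cvg_lim].
apply/cvgr0Pnorm_le => e e0; near=> h => /=.
rewrite addr0 [h *: 1]mulr1 {2}/bumpq ltxx subr0 /bumpq -[_ *: _]/(_ * _).
have hC : C * `|h| <= e.
  apply: (@le_trans _ _ ((C + 1) * `|h|)); first by rewrite ler_wpM2r// lerDl.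
  rewrite mulrC -ler_pdivlMr ?ltr_wpDl// ltW//.
  by near: h; apply: dnbhs0_lt; rewrite divr_gt0// ltr_wpDl.
case: ifPn => [h0|]; last by rewrite mulr0 normr0 (ltW e0).
have := HC h^-1; rewrite invr_gt0 => /(_ h0).
rewrite hornerM hornerXn mul1r -ler_pdivrMr ?expR_gt0// -expRN => K.
apply: le_trans hC; rewrite (gtr0_norm h0) -ler_pdivrMr//; apply: le_trans K.
rewrite [h^-1 * _]mulrCA mulrA normrM [`|q.[_] * _ ^+ 2|]normrM [`|_ ^+ 2|]ger0_norm ?exprn_ge0 ?invr_ge0 ?(ltW h0)//.
rewrite (ger0_norm (expR_ge0 _)) normrM [`|h^-1|]gtr0_norm ?invr_gt0//.
by rewrite le_eqVlt; apply/orP; left; apply/eqP; ring.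
Unshelve. all: by end_near. Qed.

Lemma dk_bumpq k q : dk setT k (bumpq q).
Proof.
elim: k q => [//|k IH] q; exists (bumpq ('X^2 * (q - q^`()))) => // t _.
exact: is_derive_bumpq.
Qed.

Definition bump := bumpq 1.

Lemma bumpE (t : R) : bump t = if 0 < t then expR (- t^-1) else 0.
Proof. by rewrite /bump /bumpq hornerC mul1r. Qed.

Lemma bump_ge0 t : 0 <= bump t.
Proof. by rewrite bumpE; case: ifP => // _; exact: expR_ge0. Qed.

Lemma bump_le1 t : bump t <= 1.
Proof.
by rewrite bumpE; case: ifP => // t0; rewrite -expR0 ler_expR oppr_le0 invr_ge0 ltW.
Qed.

Lemma bump_gt0 t : (0 < bump t) = (0 < t).
Proof. by rewrite bumpE; case: ifP => t0; rewrite ?expR_gt0 ?ltxx. Qed.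

Lemma bump0 t : t <= 0 -> bump t = 0.
Proof. by rewrite bumpE leNgt; case: ifP. Qed.
End bump.

(** * Test functions and their supports *)

Section test_functions.
Context {R : realType} {n : nat}.
Implicit Types (f phi : 'rV[R]_n -> R).

Lemma smooth_hasC1 f : smooth f -> hasC1 f (partial^~ f).
Proof.
move=> sf; split; first by move=> x; apply: differentiable_continuous; exact: (sf [::]).
move=> i; split => x; first by apply: is_derive_partial; exact: (sf [::]).
by apply: differentiable_continuous; exact: (sf [:: i]).
Qed.

Definition annulus (l M : R) : set 'rV[R]_n := [set x | l <= sqn x] `&` cube n M.

Lemma closed_sqn_ge (l : R) : closed [set x : 'rV[R]_n | l <= sqn x].
Proof.
rewrite (_ : mkset _ = @sqn R n @^-1` [set t | l <= t]); last by [].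
by apply: closed_comp => [x _|]; [exact: continuous_sqn|exact: closed_ge].
Qed.

Lemma compact_annulus l M : compact (annulus l M).
Proof.
apply: (@subclosed_compact _ _ (cube n M)); [|exact: compact_cube|by move=> x []].
apply: closedI; first exact: closed_sqn_ge.
exact: compact_closed (@norm_hausdorff _ _) (@compact_cube R n M).
Qed.

Lemma annulus_off0 l M : 0 < l -> ~ annulus l M 0.
Proof. by move=> l0 [/=]; rewrite sqn0 leNgt l0. Qed.

Lemma compact_sub_annulus (S : set 'rV[R]_n) : compact S -> ~ S 0 ->
  exists l M, 0 < l /\ S `<=` annulus l M.
Proof.
move=> cS S0.
have cI : compact (@sqn R n @` S).
  by apply: continuous_compact => //; apply: continuous_subspaceT; exact: continuous_sqn.
have [M HM] : exists M : R, forall x, S x -> sqn x <= M ^+ 2.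
  have [M [Mr HM]] := compact_bounded cI.
  pose B := Num.max 1 (M + 1).
  have MB : M < B by rewrite lt_max ltrDl ltr01 orbT.
  have B1 : 1 <= B by rewrite le_max lexx.
  exists B => x Sx; have := HM _ MB _ (imageP _ Sx).
  rewrite /= ger0_norm ?sqn_ge0// => /le_trans; apply.
  by rewrite expr2 ler_peMr// (le_trans ler01).
have [l l0 Hl] : exists2 l, 0 < l & forall x, S x -> l <= sqn x.
  have cK := compact_closed (@Rhausdorff R) cI.
  have N0 : ~ (@sqn R n @` S) 0.
    by move=> [x Sx /eqP]; rewrite sqn_eq0 => /eqP x0; apply: S0; rewrite -x0.
  have : nbhs (0 : R) (~` (@sqn R n @` S)).
    by apply: open_nbhs_nbhs; split => //; exact: closed_openC.
  move=> /nbhs_ballP[e e0 He]; exists e => // x Sx; rewrite leNgt; apply/negP => xe.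
  apply: (He (sqn x)); last exact: imageP.
  by rewrite /ball /= sub0r normrN ger0_norm ?sqn_ge0.
exists l, `|M|; split => // x Sx; split; first exact: Hl.
move=> i; rewrite -(@ler_pXn2r _ 2)// ?nnegrE// !real_normK ?num_real//.
by apply: le_trans (sqr_coord_le x i) _; exact: HM.
Qed.

Lemma annulus_off0P l M f : (forall x, ~ annulus l M x -> f x = 0) -> off0 l M f.
Proof.
by move=> H x h; apply: H => -[h1 h2]; case: h => //; rewrite ltNge h1.
Qed.

Lemma test_C1c phi : test_fun phi -> exists l M, C1c l M phi.
Proof.
move=> [sphi cS S0]; have [l [M [l0 H]]] := compact_sub_annulus cS S0.
exists l, M; split => //; first exact: smooth_hasC1.
apply: annulus_off0P => x xA; apply: contrapT => /eqP h; apply: xA; apply: H.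
exact: subset_closure.
Qed.

Lemma C1c_test l M f : smooth f -> 0 < l -> off0 l M f -> test_fun f.
Proof.
move=> sf l0 f0.
have cC := @closed_sqn_ge l.
have sub : closure [set x | f x != 0] `<=` [set x | l <= sqn x] `&` cube n M.
  have cM := compact_closed (@norm_hausdorff _ _) (@compact_cube R n M).
  rewrite (iffLR (closure_id _) (closedI cC cM)).
  apply: closureS => x /= fx; split.
    by rewrite /= leNgt; apply: contra fx => xl; rewrite f0//; left.
  by apply: contrapT => xM; move: fx; rewrite f0 ?eqxx//; right.
split => //; last first.
  by move=> /sub[] /=; rewrite sqn0 leNgt l0.
apply: (@subclosed_compact _ _ (cube n M)) => //; first exact: closed_closure.
  exact: compact_cube.
by apply: subset_trans sub _ => x [].
Qed.

Lemma smoothM f g : smooth f -> smooth g -> smooth (fun x => f x * g x).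
Proof. by move=> /CkP hf /CkP hg; apply/CkP => k; exact: CkM. Qed.

Lemma smoothD f g : smooth f -> smooth g -> smooth (fun x => f x + g x).
Proof. by move=> /CkP hf /CkP hg; apply/CkP => k; exact: CkD. Qed.

Lemma smooth_cst (c : R) : smooth (fun _ : 'rV[R]_n => c).
Proof. by apply/CkP => k; exact: Ck_cst. Qed.

Lemma smooth_radial (g : R -> R) : (forall k, dk setT k g) ->
  smooth (fun x : 'rV[R]_n => g (sqn x)).
Proof. by move=> H; apply/CkP => k; exact: (@Ck_comp _ _ _ _ (@sqn R n) (H _) (Ck_sqn _)). Qed.

Lemma test_mulr f phi : smooth f -> test_fun phi -> test_fun (fun x => f x * phi x).
Proof.
move=> sf tphi; have [l [M [l0 _ phi0]]] := test_C1c tphi.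
apply: (C1c_test (l := l) (M := M)) => //; first by apply: smoothM => //; case: tphi.
by move=> x /phi0 ->; rewrite mulr0.
Qed.

Lemma testD phi psi : test_fun phi -> test_fun psi -> test_fun (fun x => phi x + psi x).
Proof.
move=> tphi tpsi; have [l [M [l0 _ phi0]]] := test_C1c tphi.
have [l' [M' [l0' _ psi0]]] := test_C1c tpsi.
apply: (C1c_test (l := Num.min l l') (M := Num.max M M')).
- by apply: smoothD; [case: tphi|case: tpsi].
- by rewrite lt_min l0.
- move=> x [|xM]; first by rewrite lt_min => /andP[h1 h2]; rewrite phi0 ?psi0 ?addr0//; left.
  rewrite phi0 ?psi0 ?addr0//; right => H; apply: xM => i; rewrite le_max H ?orbT//.
Qed.
End test_functions.

(** * Radial cut-offs near the origin and near infinity *)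

Section cutoff.
Context {R : realType}.
Implicit Types (s t : R) (q : {poly R}).

Lemma bumpq_bounded q : exists2 C : R, 0 <= C & forall t, `|bumpq q t| <= C.
Proof.
have [C C0 H] := poly_le_expR q (@ltr01 R); exists C; first exact: C0.
move=> t; rewrite /bumpq; case: ifP => t0; last by rewrite normr0.
rewrite normrM (ger0_norm (expR_ge0 _)) expRN ler_pdivrMr ?expR_gt0//.
by rewrite -[X in expR X]mul1r H ?invr_gt0.
Qed.

Lemma continuous_bumpq q : continuous (bumpq q).
Proof.
by move=> t; apply: differentiable_continuous; apply/derivable1_diffP; have [] := is_derive_bumpq q t.
Qed.

Definition dbump := bumpq ('X^2 : {poly R}).

Lemma is_derive_bump t : is_derive t 1 bump (dbump t).
Proof.
have := is_derive_bumpq 1 t; rewrite (_ : 'X^2 * _ = 'X^2)//.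
by rewrite derivC subr0 mulr1.
Qed.

Lemma dbumpE t : dbump t = if 0 < t then t^-1 ^+ 2 * expR (- t^-1) else 0.
Proof. by rewrite /dbump /bumpq hornerXn. Qed.

(* Equal to 1 in the limit s -> 0 for t > 0, and supported in s <= t <= 1 / s *)
Definition cutf s t := expR 1 * (bump (t / s - 1) * bump (1 - t * s)).

Definition dcutf s t := expR 1 *
  (bump (t / s - 1) * (dbump (1 - t * s) * (- s)) + bump (1 - t * s) * (dbump (t / s - 1) * s^-1)).

Lemma is_derive_cutf s t : is_derive t 1 (cutf s) (dcutf s t).
Proof.
have d1 : is_derive t 1 (fun t => t / s - 1) s^-1.
  have := is_deriveB (is_deriveZ s^-1 (is_derive_id t 1)) (is_derive_cst (1 : R) t 1).
  rewrite subr0 [_%:A]mulr1 (_ : _ - _ = fun t => t / s - 1)//.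
  by apply/funext => r /=; rewrite -[LHS]/(s^-1 * r - 1) mulrC.
have d2 : is_derive t 1 (fun t => 1 - t * s) (- s).
  have := is_deriveB (is_derive_cst (1 : R) t 1) (is_deriveZ s (is_derive_id t 1)).
  rewrite sub0r [_%:A]mulr1 (_ : _ - _ = fun t => 1 - t * s)//.
  by apply/funext => r /=; rewrite -[LHS]/(1 - s * r) mulrC.
have := is_deriveZ (expR 1) (is_deriveM (is_derive_chain d1 (is_derive_bump _))
  (is_derive_chain d2 (is_derive_bump _))).
exact.
Qed.

Lemma dk_cutf s k : dk setT k (cutf s).
Proof.
have dl (c : R) : dk setT k (fun t => t * c) by apply: dkM; [exact: dk_id|exact: dk_cst].
apply: dkM; first exact: dk_cst.
apply: dkM; apply: (@dk_comp R setT setT k bump) => //; try exact: dk_bumpq.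
  by apply: dkD; [exact: dl|exact: dk_cst].
apply: (@dkD R setT k (fun=> 1)); first exact: dk_cst.
by under eq_fun do rewrite -mulrN; exact: dl.
Qed.

Lemma cutf_ge0 s t : 0 <= cutf s t.
Proof. by rewrite mulr_ge0 ?expR_ge0// mulr_ge0// bump_ge0. Qed.

Lemma cutf_le s t : cutf s t <= expR 1.
Proof.
by rewrite ler_piMr ?expR_ge0// mulr_ile1 ?bump_ge0 ?bump_le1.
Qed.

Lemma cutf0l s t : 0 < s -> t < s -> cutf s t = 0.
Proof.
by move=> s0 ts; rewrite /cutf bump0 ?mul0r ?mulr0// subr_le0 ler_pdivrMr// mul1r ltW.
Qed.

Lemma cutf0r s t : 0 < s -> 1 / s < t -> cutf s t = 0.
Proof.
move=> s0 ts; rewrite /cutf [bump (1 - _)]bump0 ?mulr0// subr_le0.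
by rewrite ltW// -ltr_pdivrMr.
Qed.

(** Both edges of the cut-off depend on [t / s] or [t * s], so the bound is uniform in [s] by
    scaling. It makes the gradient of [chi k] of order [1 / |x|], the size that the Hardy weight
    controls. *)
Lemma dcutf_bounded : exists2 C : R, 0 <= C & forall s t, 0 < s -> 0 <= t -> t * `|dcutf s t| <= C.
Proof.
(* The second polynomial serves the inner edge: with [r = t / s - 1], the factor [t / s = r + 1]
   times [r ^ (- 2)] is [r ^ (- 1) + r ^ (- 2)]. *)
have [C1 C10 H1] := bumpq_bounded 'X^2; have [C2 C20 H2] := bumpq_bounded ('X + 'X^2).
exists (expR 1 * (C1 + C2)); first by rewrite mulr_ge0 ?expR_ge0 ?addr_ge0.
move=> s t s0 t0; rewrite normrM (ger0_norm (expR_ge0 _)) mulrCA ler_wpM2l ?expR_ge0//.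
apply: le_trans (ler_wpM2l t0 (ler_normD _ _)) _; rewrite mulrDr lerD//.
  rewrite normrM (ger0_norm (bump_ge0 _)) normrM normrN (gtr0_norm s0).
  rewrite mulrCA [t * (_ * s)]mulrCA.
  rewrite -[C1]mul1r ler_pM ?mulr_ge0 ?bump_ge0 ?bump_le1 ?(ltW s0)//.
  have [ts|ts] := lerP 1 (t * s).
    by rewrite dbumpE ifF ?normr0 ?mul0r//; apply/negbTE; rewrite -leNgt subr_le0.
  by rewrite -[C1]mulr1 ler_pM ?H1 ?mulr_ge0 ?(ltW s0)// ltW.
rewrite normrM (ger0_norm (bump_ge0 _)) normrM [`|s^-1|]gtr0_norm ?invr_gt0//.
rewrite mulrCA [t * (_ / s)]mulrCA.
rewrite -[C2]mul1r ler_pM ?mulr_ge0 ?bump_ge0 ?bump_le1 ?invr_ge0 ?(ltW s0)//.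
apply: le_trans (H2 (t / s - 1)); rewrite dbumpE /bumpq; case: ifP => r0; last first.
  by rewrite normr0 mul0r.
set r := t / s - 1 in r0 *; rewrite (_ : t / s = r + 1); last by rewrite /r subrK.
rewrite !normrM (ger0_norm (expR_ge0 _)) mulrAC ler_wpM2r ?expR_ge0//.
rewrite hornerD hornerX hornerXn !ger0_norm ?addr_ge0 ?exprn_ge0 ?invr_ge0 ?(ltW r0)//.
by rewrite le_eqVlt; apply/orP; left; apply/eqP; field; rewrite gt_eqF.
Qed.

Let near_lt t : 0 < t -> \forall s \near (0 : R)^'+, 0 < s < t.
Proof.
move=> t0; near=> s; apply/andP; split; near: s; first exact: nbhs_right_gt.
exact: nbhs_right_lt.
Unshelve. all: by end_near. Qed.

Let continuous_frac t : 0 < t -> {for 0, continuous (fun s => expR (- (s / (t - s))))}.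
Proof.
move=> t0; apply: (@continuous_comp _ _ _ (fun s => - (s / (t - s))) expR); last exact: continuous_expR.
have c1 : {for 0, continuous (fun s : R => t - s)}.
  exact: continuousB (@cst_continuous _ _ t 0) _.
have c2 : {for 0, continuous (fun s : R => (t - s)^-1)}.
  by apply: continuousV => //; rewrite subr0 gt_eqF.
by apply: continuousN; apply: (@continuousM _ _ id (fun s => (t - s)^-1)).
Qed.

Let continuous_lin t : {for 0, continuous (fun s => 1 - t * s)}.
Proof.
have h : {for 0, continuous (fun s => t * s)}.
  by apply: (@continuousM _ _ (fun=> t) id); [exact: cst_continuous|].
exact: continuousB (@cst_continuous _ _ (1 : R) 0) h.
Qed.

Lemma cutf_cvg t : 0 < t -> cutf s t @[s --> 0^'+] --> (1 : R).
Proof.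
(* For [0 < s < t] the number [1 / (t / s - 1)] equals [s / (t - s)], which is continuous at
   [s = 0]; [F] is the cut-off in this form. *)
move=> t0; pose F s := expR 1 * (expR (- (s / (t - s))) * bump (1 - t * s)).
have cF : {for 0, continuous F}.
  have c1 := continuous_frac t0.
  have c2 : {for 0, continuous (fun s => bump (1 - t * s))}.
    by apply: (@continuous_comp _ _ _ (fun s => 1 - t * s) bump);
      [exact: continuous_lin|exact: continuous_bumpq].
  exact: continuousM (@cst_continuous _ _ (expR 1 : R) 0) (continuousM c1 c2).
have F0 : F 0 = 1.
  by rewrite /F mul0r oppr0 expR0 mulr0 subr0 bumpE ltr01 invr1 mul1r -expRD subrr expR0.
have : F s @[s --> 0^'+] --> F 0 by apply: cvg_within_filter; exact: cF.
rewrite F0; apply: cvg_trans; apply: near_eq_cvg.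
near=> s; have /andP[s0 st] : 0 < s < t by near: s; exact: near_lt.
rewrite /cutf /F [bump (t / s - 1)]bumpE ifT; last by rewrite subr_gt0 ltr_pdivlMr ?mul1r.
congr (_ * (expR _ * _)); field.
by rewrite ?mulN1r subr_eq0 !gt_eqF.
Unshelve. all: by end_near. Qed.

Lemma dcutf_cvg t : 0 < t -> dcutf s t @[s --> 0^'+] --> (0 : R).
Proof.
move=> t0; pose F s := expR 1 * (expR (- (s / (t - s))) * (dbump (1 - t * s) * (- s)) +
   bump (1 - t * s) * ((s / ((t - s) * (t - s))) * expR (- (s / (t - s))))).
have c1 := continuous_frac t0.
have cb q : {for 0, continuous (fun s => bumpq q (1 - t * s))}.
  by apply: (@continuous_comp _ _ _ (fun s => 1 - t * s) (bumpq q));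
      [exact: continuous_lin|exact: continuous_bumpq].
have c2 : {for 0, continuous (fun s : R => t - s)}.
  exact: continuousB (@cst_continuous _ _ t 0) _.
have c3 : {for 0, continuous (fun s : R => s / ((t - s) * (t - s)))}.
  have c4 : {for 0, continuous (fun s : R => ((t - s) * (t - s))^-1)}.
    apply: continuousV; first by rewrite subr0 mulf_neq0// gt_eqF.
    have c2b := c2; exact: (continuousM c2 c2b).
  by apply: (@continuousM _ _ id (fun s => ((t - s) * (t - s))^-1)).
have cN : {for 0, continuous (fun s : R => - s)} by apply: continuousN.
have cF : {for 0, continuous F}.
  have c1b := c1; have h1 := continuousM c1 (continuousM (cb 'X^2) cN).
  have h2 := continuousM (cb 1) (continuousM c3 c1b).
  exact: continuousM (@cst_continuous _ _ (expR 1 : R) 0) (continuousD h1 h2).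
have F0 : F 0 = 0 by rewrite /F oppr0 !(mulr0, mul0r) addr0 mulr0.
have : F s @[s --> 0^'+] --> F 0 by apply: cvg_within_filter; exact: cF.
rewrite F0; apply: cvg_trans; apply: near_eq_cvg.
near=> s; have /andP[s0 st] : 0 < s < t by near: s; exact: near_lt.
have ts : 0 < t / s - 1 by rewrite subr_gt0 ltr_pdivlMr ?mul1r.
have E : (t / s - 1)^-1 = s / (t - s) by field; rewrite ?mulN1r subr_eq0 !gt_eqF.
rewrite /dcutf /F [bump (t / s - 1)]bumpE [dbump (t / s - 1)]dbumpE ts E.
congr (_ * (_ + _ * _)); move: (expR _) => e; field.
by rewrite ?mulN1r subr_eq0 !gt_eqF.
Unshelve. all: by end_near. Qed.

Definition chi n k (x : 'rV[R]_n) := cutf (k.+1%:R^-1) (sqn x).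
(** The gradient of [chi k] at [x] is [dchi k x *: x]; the factor 2 comes from differentiating
    [|x| ^ 2]. *)
Definition dchi n k (x : 'rV[R]_n) := 2 * dcutf (k.+1%:R^-1) (sqn x).

Let s_cvg : (fun k : nat => (k.+1%:R^-1 : R)) @ \oo --> (0 : R)^'+.
Proof.
move=> P; rewrite /= /at_right /within /= => H.
have := @cvg_harmonic R _ H; rewrite /= /nbhs /= => -[M _ HM]; exists M => // k Mk.
by apply: HM => //=; rewrite invr_gt0.
Qed.

Lemma chi_cvg n (x : 'rV[R]_n) : x != 0 -> chi k x @[k --> \oo] --> (1 : R).
Proof.
rewrite -sqn_eq0 => x0; have h : 0 < sqn x by rewrite lt_def x0 sqn_ge0.
exact: (@cvg_comp _ _ _ (fun k : nat => (k.+1%:R^-1 : R)) (fun s => cutf s (sqn x)) \oo (0 : R)^'+ (nbhs (1 : R)) s_cvg (cutf_cvg h)).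
Qed.

Lemma dchi_cvg n (x : 'rV[R]_n) : x != 0 -> sqn x * dchi k x @[k --> \oo] --> (0 : R).
Proof.
rewrite -sqn_eq0 => x0; rewrite -[0 in X in _ --> X](mulr0 (sqn x)).
apply: cvgM; first exact: cvg_cst.
rewrite -[0 in X in _ --> X](mulr0 2); apply: cvgM; first exact: cvg_cst.
have h : 0 < sqn x by rewrite lt_def x0 sqn_ge0.
exact: (@cvg_comp _ _ _ (fun k : nat => (k.+1%:R^-1 : R)) (fun s => dcutf s (sqn x)) \oo (0 : R)^'+ (nbhs (0 : R)) s_cvg (dcutf_cvg h)).
Qed.

Lemma dchi_bounded n : exists2 C : R, 0 <= C &
  forall k (x : 'rV[R]_n), `|sqn x * dchi k x| <= C.
Proof.
have [C C0 H] := dcutf_bounded; exists (2 * C); first by rewrite mulr_ge0.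
move=> k x; rewrite /dchi mulrCA normrM ger0_norm// ler_wpM2l// normrM ger0_norm ?sqn_ge0//.
by apply: H; rewrite ?invr_gt0 ?sqn_ge0.
Qed.

Lemma smooth_chi n k : smooth (@chi n k).
Proof. by apply: smooth_radial => j; exact: dk_cutf. Qed.

Lemma partial_chi n k i (x : 'rV[R]_n) : partial i (chi k) x = dchi k x * x ord0 i.
Proof.
have [_ E] := is_derive_chain (((hasC1_sqn n).2 i).1 x) (is_derive_cutf k.+1%:R^-1 (sqn x)).
by apply: (etrans E); rewrite /dchi; ring.
Qed.

Lemma chi_ge0 n k (x : 'rV[R]_n) : 0 <= chi k x.
Proof. exact: cutf_ge0. Qed.

Lemma chi_le n k (x : 'rV[R]_n) : chi k x <= expR 1.
Proof. exact: cutf_le. Qed.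

Lemma chi_off0 n k : off0 k.+1%:R^-1 k.+1%:R (@chi n k).
Proof.
have k0 : 0 < (k.+1%:R^-1 : R) by rewrite invr_gt0.
move=> x [xl|xM]; first exact: cutf0l.
apply: cutf0r => //; rewrite div1r invrK ltNge; apply/negP => H; apply: xM => i.
rewrite -(@ler_pXn2r _ 2)// ?nnegrE// real_normK ?num_real//.
apply: le_trans (sqr_coord_le x i) _; apply: (le_trans H).
by rewrite expr2 ler_peMr// ler1n.
Qed.

Lemma test_chi n k : test_fun (@chi n k).
Proof. by apply: C1c_test (@smooth_chi n k) _ (@chi_off0 n k); rewrite invr_gt0. Qed.
End cutoff.

(** * Weak gradients *)

Section fundamental_lemma.
Context {R : realType}.

(** The measurable sets over which [h] integrates to 0 form a lambda-system: increasing unions are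
    handled by dominated convergence. It contains the generating pi-system [G], hence every
    measurable set. *)
Lemma integral_zero_ae d (T : measurableType d) (mu : {measure set T -> \bar R})
    (G : set (set T)) (h : T -> \bar R) :
  setI_closed G -> G `<=` measurable -> measurable `<=` <<s G >> ->
  mu.-integrable setT h -> (\int[mu]_x h x = 0)%E ->
  (forall A, G A -> \int[mu]_(x in A) h x = 0)%E -> ae_eq mu setT h (cst 0%E).
Proof.
move=> GI Gm mG hi hT hG.
pose L : set (set T) := [set A | measurable A /\ (\int[mu]_(x in A) h x = 0)%E].
have mh : measurable_fun setT h := measurable_int _ hi.
have LL : lambda_system setT L.
  split => //.
  - move=> A B BA [mA hA] [mB hB]; have mAB := measurableD mA mB; split=> //.
    have dAB : [disjoint A `\` B & B] by rewrite disj_set2E; apply/eqP; rewrite setDKI.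
    have := integral_setU mu mAB mB (measurable_funS measurableT (@subsetT _ _) mh) dAB.
    by rewrite setUC setDUK// hA hB adde0.
  - move=> F ndF HF; have mF k : measurable (F k) by have [] := HF k.
    have mU : measurable (\bigcup_i F i) by exact: bigcupT_measurable.
    split => //; rewrite integral_mkcond.
    have mp (A : set T) : measurable A -> measurable_fun setT (h \_ A).
      by move=> mA; apply/measurable_restrict => //; exact: measurable_funS mh.
    have := @dominated_convergence _ _ _ mu setT measurableT (fun k => h \_ (F k))
      (h \_ (\bigcup_i F i)) (fun x => `|h x|)%E (fun k => mp _ (mF k)) (mp _ mU).
    case=> //.
    + apply: aeW => x _; have [[k _ Fk]|nF] := pselect ((\bigcup_i F i) x); last first.
        rewrite (_ : (fun k => _) = fun=> (h \_ (\bigcup_i F i)) x); first exact: cvg_cst.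
        apply/funext => k; rewrite !patchE !memNset// => Fk; apply: nF; by exists k.
      apply: cvg_near_cst; exists k => // j /= kj.
      by rewrite !patchE !mem_set//; [exists k|exact: (subsetPset _ _ (ndF _ _ kj))].
    + exact: integrable_abse.
    + by apply: aeW => x k _; rewrite patchE; case: ifP => // _; rewrite abse0.
    move=> _ _; under eq_fun do rewrite -integral_mkcond (HF _).2.
    by move=> /(cvg_unique (@ereal_hausdorff R)) E; have := E _ (cvg_cst _) => <-.
have GL : G `<=` L by move=> A GA; split; [exact: Gm|exact: hG].
have H := lambda_system_subset GI LL GL (fun X _ => @subsetT _ X).
apply: integral_ae_eq => //.
by move=> E _ mE; have [_ ->] := H _ (mG _ mE); rewrite integral_cst// mul0e.
Qed.
End fundamental_lemma.

Section halfspaces.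
Context {R : realType} {n : nat}.
Implicit Types (s : seq ('I_n * R)) (x : 'rV[R]_n).

(** Intersections of open coordinate half-spaces: stable under intersection, generating the product
    sigma-algebra, and with indicators that are limits of smooth functions. *)
Definition halfs s : set 'rV[R]_n := [set x | forall z, z \in s -> z.2 < x ord0 z.1].

Lemma halfs_cons z s : halfs (z :: s) =
  ((fun x => x ord0 z.1) @^-1` `]z.2, +oo[) `&` halfs s.
Proof.
apply/seteqP; split => x /=; rewrite in_itv/= andbT.
  move=> H; split; first by apply: H; rewrite inE eqxx.
  by move=> y ys; apply: H; rewrite inE ys orbT.
by move=> [H1 H2] y; rewrite inE => /predU1P[->//|]; exact: H2.
Qed.

Lemma measurable_halfs s : measurable (halfs s).
Proof.
elim: s => [|z s IH].
  by rewrite (_ : halfs [::] = setT)//; apply/seteqP; split => x.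
rewrite halfs_cons; apply: measurableI => //.
by rewrite -[X in measurable X]setTI; apply: measurable_coord.
Qed.

Lemma halfs_setI : setI_closed (range halfs).
Proof.
move=> _ _ [s _ <-] [t _ <-]; exists (s ++ t) => //.
apply/seteqP; split => x /=.
  by move=> H; split => z zs; apply: H; rewrite mem_cat zs ?orbT.
by move=> [H1 H2] z; rewrite mem_cat => /orP[]; [exact: H1|exact: H2].
Qed.

Lemma measurable_sub_halfs : (measurable : set (set 'rV[R]_n)) `<=` <<s range halfs >>.
Proof.
apply: smallest_sub; first exact: smallest_sigma_algebra.
move=> A; rewrite -bigcup_seq => -[i _] [B mB <-]; rewrite setTI.
have sa := smallest_sigma_algebra setT (range halfs).
pose S : set (set R) := [set B | <<s range halfs >> ((fun x => x ord0 i) @^-1` B)].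
suff : S B by [].
have mB' : (@ocitv R).-sigma.-measurable B by exact: mB.
move: mB'; rewrite RGenOInfty.measurableE; apply: smallest_sub.
  case: sa => s0 sD sU; split; rewrite /S /=.
  - by rewrite preimage_set0.
  - by move=> C hC; rewrite setTD preimage_setC -setTD; exact: sD.
  - by move=> F hF; rewrite preimage_bigcup; exact: sU.
move=> _ [a ->]; apply: sub_sigma_algebra; exists [:: (i, a)] => //.
apply/seteqP; split => x /=; rewrite in_itv/= andbT.
  by move=> /(_ (i, a)); apply; rewrite inE.
by move=> H z; rewrite inE => /eqP ->.
Qed.

Definition hbump m s x : R := \prod_(z <- s) bump (m.+1%:R * (x ord0 z.1 - z.2)).

Lemma smooth_hbump m s : smooth (hbump m s).
Proof.
apply/CkP => k; apply: Ck_prod => z.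
apply: (@Ck_comp _ _ _ bump (fun x => m.+1%:R * (x ord0 z.1 - z.2))).
  exact: dk_bumpq.
apply: CkM; first exact: Ck_cst.
by apply: CkD; [exact: Ck_coord|exact: Ck_cst].
Qed.

Lemma hbump_ge0 m s x : 0 <= hbump m s x.
Proof. by apply: prodr_ge0 => z _; exact: bump_ge0. Qed.

Lemma hbump_le1 m s x : hbump m s x <= 1.
Proof. by apply: prodr_ile1 => z _; rewrite bump_ge0 bump_le1. Qed.

Lemma bump_cvg (r : R) : bump (m.+1%:R * r) @[m --> \oo] --> (if 0 < r then 1 else 0 : R).
Proof.
case: ifPn => r0; last first.
  apply: cvg_near_cst; apply: nearW => m; apply: bump0.
  by rewrite mulr_ge0_le0// leNgt.
have H : expR (- (r^-1 * harmonic m)) @[m --> \oo] --> (expR (- (r^-1 * 0)) : R).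
  apply: (@cvg_comp _ _ _ (fun m => - (r^-1 * harmonic m)) expR _ (nbhs (- (r^-1 * 0)))).
    apply: cvgN; apply: cvgM; [exact: cvg_cst|exact: cvg_harmonic].
  exact: continuous_expR.
move: H; rewrite mulr0 oppr0 expR0; apply: cvg_trans; apply: near_eq_cvg.
by apply: nearW => m; rewrite bumpE mulr_gt0// /= invfM mulrC.
Qed.

Lemma hbump_cvg s x : hbump m s x @[m --> \oo] --> (\1_(halfs s) x : R).
Proof.
elim: s => [|z s IH].
  under eq_fun do rewrite /hbump big_nil.
  rewrite indicE mem_set//; exact: cvg_cst.
have -> : (fun m => hbump m (z :: s) x) = fun m => bump (m.+1%:R * (x ord0 z.1 - z.2)) * hbump m s x.
  by apply/funext => m; rewrite /hbump big_cons.
have -> : (\1_(halfs (z :: s)) x : R) = (if 0 < x ord0 z.1 - z.2 then 1 else 0) * \1_(halfs s) x.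
  rewrite halfs_cons indicI /= subr_gt0; congr (_ * _); rewrite indicE.
  case: ifPn => H; first by rewrite mem_set//= in_itv/= H.
  by rewrite memNset//= in_itv/= (negbTE H).
by apply: cvgM IH; exact: bump_cvg.
Qed.
End halfspaces.

(** * Local integrability off the origin *)

Section loc_integrable.
Context {R : realType} {n : nat}.
Implicit Types (f g psi : 'rV[R]_n -> R) (x : 'rV[R]_n).
Local Notation mu := (lebesgue_rV R n).

Lemma measurable_annulus l M : measurable (@annulus R n l M).
Proof.
apply: measurableI; last exact: measurable_cube.
have -> : [set x | l <= sqn x] = ~` [set x : 'rV[R]_n | sqn x < l].
  by apply/seteqP; split => x /=; [move/le_gtF ->|move/negP; rewrite -leNgt].
by apply: measurableC; apply: open_measurable_rV; exact: open_sqn_lt.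
Qed.

Lemma setT_annulus : [set: 'rV[R]_n] = [set 0] `|` \bigcup_k annulus k.+1%:R^-1 k.+1%:R.
Proof.
apply/seteqP; split => // x _; have [->|x0] := eqVneq x 0; [by left|right].
have s0 : 0 < sqn x by rewrite lt_def sqn_ge0 sqn_eq0 x0.
pose k := (Num.trunc (sqn x) + Num.trunc (sqn x)^-1)%N.
have h1 : sqn x <= k.+1%:R.
  apply: ltW; apply: lt_le_trans (Num.Theory.truncnS_gt _) _.
  by rewrite ler_nat ltnS leq_addr.
have h2 : (sqn x)^-1 <= k.+1%:R.
  apply: ltW; apply: lt_le_trans (Num.Theory.truncnS_gt _) _.
  by rewrite ler_nat ltnS leq_addl.
exists k => //; split => /=; first by rewrite -[leRHS]invrK lef_pV2 ?posrE ?invr_gt0.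
move=> i; rewrite -(@ler_pXn2r _ 2)// ?nnegrE// real_normK ?num_real//.
apply: le_trans (sqr_coord_le x i) _; apply: le_trans h1 _.
by rewrite expr2 ler_peMr// ler1n.
Qed.

Lemma measurable_set0 : measurable [set (0 : 'rV[R]_n)].
Proof.
rewrite (_ : [set 0] = ~` [set x | sqn x < 0] `&` [set x : 'rV[R]_n | sqn x <= 0]); last first.
  apply/seteqP; split => x /=; first by move=> ->; rewrite sqn0 ltxx; split.
  by move=> [_ h]; apply/eqP; rewrite -sqn_eq0 eq_le h sqn_ge0.
apply: measurableI; first by apply: measurableC; apply: open_measurable_rV; exact: open_sqn_lt.
rewrite (_ : mkset _ = ~` [set x : 'rV[R]_n | 0 < sqn x]); last first.
  by apply/seteqP; split => x /=; [move/le_gtF ->|move/negP; rewrite -leNgt].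
apply: measurableC; apply: open_measurable_rV.
rewrite (_ : mkset _ = @sqn R n @^-1` `]0, +oo[%classic).
  by apply: open_comp => // x _; exact: continuous_sqn.
by apply/seteqP; split => x /=; rewrite in_itv/= andbT.
Qed.

Lemma measurable_off f : (forall k, measurable_fun (annulus k.+1%:R^-1 k.+1%:R) f) ->
  measurable_fun setT f.
Proof.
move=> H; rewrite setT_annulus; apply/measurable_funU.
- exact: measurable_set0.
- by apply: bigcupT_measurable => k; exact: measurable_annulus.
split; first by apply: measurable_fun_set1; exact: measurable_set0.
by apply/measurable_fun_bigcup => // k; exact: measurable_annulus.
Qed.

Lemma loc_integrable_measurable f : loc_integrable f -> measurable_fun setT f.
Proof.
move=> lf; apply: measurable_off => k; apply/measurable_EFinP.
have k0 : 0 < (k.+1%:R^-1 : R) by rewrite invr_gt0.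
have h := lf _ (@compact_annulus R n k.+1%:R^-1 k.+1%:R) (@annulus_off0 R n _ _ k0).
exact: (measurable_int mu h).
Qed.

Lemma off_loc_integrable f : (forall x, 0 < sqn x -> {for x, continuous f}) -> loc_integrable f.
Proof.
move=> cf K cK K0; have [l [M [l0 KA]]] := compact_sub_annulus cK K0.
have mK : measurable K.
  rewrite -[K]setCK; apply: measurableC; apply: open_measurable_rV; apply: closed_openC.
  exact: compact_closed (@norm_hausdorff _ _) cK.
apply: (integrableS (measurable_annulus l M) mK KA).
(* This factor is 0 for [|x| ^ 2 <= l / 2] and at least [exp (- 1)] for [|x| ^ 2 >= l]: the product
   [f * c] is continuous everywhere, and dividing by [c] recovers [f] on the annulus. *)
pose c x := bump (2 / l * sqn x - 1).
have cc : continuous c.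
  move=> x; apply: (@continuous_comp _ _ _ (fun x => 2 / l * sqn x - 1) bump); last exact: continuous_bumpq.
  have h := continuousM (@cst_continuous _ _ (2 / l : R) x) (@continuous_sqn R n x).
  exact: continuousB h (@cst_continuous _ _ (1 : R) x).
have c1 x : annulus l M x -> expR (- 1) <= c x.
  move=> [/= lx _]; have h : 1 <= 2 / l * sqn x - 1.
    have : 1 <= sqn x / l by rewrite ler_pdivlMr// mul1r.
    by rewrite mulrAC -mulrA; lra.
  have h0 := lt_le_trans ltr01 h.
  by rewrite /c bumpE h0 ler_expR lerN2 invf_le1.
have cg : continuous (fun x => f x * c x).
  move=> x; have [xl|xl] := ltP (sqn x) (l / 2); last first.
    have x0 : 0 < sqn x by apply: lt_le_trans xl; rewrite divr_gt0.
    exact: continuousM (cf x x0) (cc x).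
  apply: continuous_near0; apply: filterS (near_sqn_lt xl) => y yl.
  rewrite /c bump0 ?mulr0//.
  have : sqn y / l <= 2^-1 by rewrite ler_pdivrMr// mulrC ltW.
  by rewrite mulrAC -mulrA; lra.
have fE x : annulus l M x -> f x = (f x * c x) / c x.
  by move=> xA; rewrite mulfK// gt_eqF// (lt_le_trans (expR_gt0 _) (c1 x xA)).
have mf : measurable_fun (annulus l M) f.
  apply: (eq_measurable_fun (fun x => (f x * c x) * c x `^ (- 1))).
    by move=> x; rewrite inE powR_inv1 ?bump_ge0// => /fE <-.
  apply: measurable_funM.
    by apply: measurable_funTS; exact: continuous_measurable_rV.
  apply: measurable_funTS.
  apply: (@measurableT_comp _ _ _ _ _ _ (fun t : R => t `^ (- 1))).
    exact: measurable_powR.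
  exact: continuous_measurable_rV.
have ig : mu.-integrable (annulus l M) (EFin \o (fun x => expR 1 * (f x * c x))).
  apply: (integrableS (measurable_cube M) (measurable_annulus l M)); first by move=> x [].
  apply: continuous_cube_integrable => x.
  exact: continuousM (@cst_continuous _ _ (expR 1 : R) x) (cg x).
apply: le_integrable ig => //; first exact: measurable_annulus.
  exact/measurable_EFinP.
move=> x xA /=; rewrite lee_fin !normrM (ger0_norm (expR_ge0 _)) mulrCA ler_peMr//.
have cx := c1 x xA; rewrite ger0_norm; last by apply: le_trans cx; exact: expR_ge0.
by rewrite -ler_pdivrMl ?expR_gt0// mulr1 -expRN.
Qed.

Lemma loc_integrableM f psi l M : loc_integrable f -> continuous psi -> 0 < l ->
  off0 l M psi -> mu.-integrable setT (EFin \o (fun x => f x * psi x)).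
Proof.
move=> lf cpsi l0 psi0; have mA := measurable_annulus l M.
have -> : EFin \o (fun x => f x * psi x) = (EFin \o (fun x => f x * psi x)) \_ (annulus l M).
  apply/funext => x; rewrite patchE; case: ifPn => // /negP; rewrite inE => xA /=.
  rewrite psi0 ?mulr0//; apply: contrapT => /not_orP[/negP]; rewrite -leNgt => h1 /contrapT h2.
  exact: xA.
apply/(integrable_mkcond _ mA).
have [B HB] : exists B : R, forall x, cube n M x -> `|psi x| <= B.
  have := @continuous_compact _ _ psi (cube n M) (continuous_subspaceT cpsi) (@compact_cube R n M).
  move=> /compact_bounded[r [rr rf]]; exists (r + 1) => x xM.
  by apply: (rf (r + 1)); [rewrite ltrDl|exact: imageP].
have ia := lf _ (@compact_annulus R n l M) (@annulus_off0 R n _ _ l0).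
apply: (le_integrable mA _ _ (integrableZl mA B ia)).
  apply/measurable_EFinP; apply: measurable_funM; first exact: measurable_funTS (loc_integrable_measurable lf).
  by apply: measurable_funTS; exact: continuous_measurable_rV.
move=> x [_ xM]; rewrite /= lee_fin !normrM mulrC ler_wpM2r//.
by apply: le_trans (HB x xM) _; exact: ler_norm.
Qed.
End loc_integrable.

Section weak_gradients.
Context {R : realType} {n : nat}.
Implicit Types (f g psi u : 'rV[R]_n -> R) (x : 'rV[R]_n).
Local Notation mu := (lebesgue_rV R n).

Lemma loc_integrable_test f psi : loc_integrable f -> test_fun psi ->
  rint mu (fun x => f x * psi x).
Proof.
move=> lf tpsi; have [l [M [l0 [cpsi _] psi0]]] := test_C1c tpsi.
exact: loc_integrableM lf cpsi l0 psi0.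
Qed.

Lemma loc_integrable_test_ereal f psi : loc_integrable f -> test_fun psi ->
  (\int[mu]_x (f x * psi x) = 0) -> (\int[mu]_x (f x * psi x)%:E = 0)%E.
Proof. by move=> lf tpsi h; rewrite EFin_Rintegral ?h//; exact: loc_integrable_test. Qed.

Lemma ae_neq0 : (0 < n)%N -> {ae mu, forall x, x != 0}.
Proof.
move=> n0; exists [set 0]; split; first exact: measurable_set0.
  case: n n0 => // m _; rewrite [LHS]/= /lebesgue_rV_cons /pushforward.
  rewrite (_ : _ @^-1` _ = [set (0 : R)] `*` [set (0 : 'rV[R]_m)]); last first.
    apply/seteqP; split => -[t y] /=.
      move=> h; split; first by rewrite -[t](consrV0 (t, y)) h mxE.
      by apply/rowP => j; rewrite -(consrVS (t, y)) h !mxE.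
    move=> [-> ->]; apply/rowP => i; case: (unliftP ord0 i) => [j|] ->.
      by rewrite consrVS !mxE.
    by rewrite consrV0 mxE.
  rewrite product_measure1E//; last exact: measurable_set0.
  by apply/eqP; rewrite mule_eq0; apply/orP; left; apply/eqP; exact: (@lebesgue_measure_set1 R 0).
by move=> x /= /negP; rewrite negbK => /eqP.
Qed.

(* The test functions chi_k prod bump(m (x_i - a_i)) tend to chi_k times the indicator
   of an intersection of half-spaces, and those generate the Borel sets. *)
Lemma weak_zero_ae g : (0 < n)%N -> loc_integrable g ->
  (forall psi, test_fun psi -> \int[mu]_x (g x * psi x) = 0) ->
  {ae mu, forall x, g x = 0}.
Proof.
move=> n0 lg H.
have key k : {ae mu, forall x, g x * chi k x = 0}.
  have ik : mu.-integrable setT (EFin \o (fun x => g x * chi k x)).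
    exact: loc_integrable_test lg (test_chi _ _).
  have hT : (\int[mu]_x (g x * chi k x)%:E = 0)%E.
    by apply: loc_integrable_test_ereal => //; [exact: test_chi|exact: H (test_chi _ _)].
  suff : ae_eq mu setT (EFin \o (fun x => g x * chi k x)) (cst 0%E).
    by apply: filterS => x /(_ I) /= [].
  apply: (integral_zero_ae (@halfs_setI R n)) => //.
  - by move=> _ [s _ <-]; exact: measurable_halfs.
  - exact: measurable_sub_halfs.
  move=> _ [s _ <-]; rewrite integral_mkcond.
  have mg := loc_integrable_measurable lg.
  have mk (h : 'rV[R]_n -> R) : continuous h -> measurable_fun setT (fun x => g x * h x).
    by move=> ch; apply: measurable_funM => //; exact: continuous_measurable_rV.
  have tt m : test_fun (fun x => hbump m s x * chi k x).
    by apply: test_mulr; [exact: smooth_hbump|exact: test_chi].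
  have ct psi : test_fun psi -> continuous psi by move=> /test_C1c[l [M [_ []]]].
  have mh : measurable_fun setT (EFin \o (fun x => g x * chi k x)) := measurable_int _ ik.
  have := @dominated_convergence _ _ _ mu setT measurableT
    (fun m x => (g x * (hbump m s x * chi k x))%:E)
    ((EFin \o (fun x => g x * chi k x)) \_ (halfs s))
    (fun x => `|(g x * chi k x)%:E|)%E.
  case.
  - by move=> m; apply/measurable_EFinP; apply: mk; exact: ct.
  - apply/measurable_restrict => //; first exact: measurable_halfs.
    exact: measurable_funTS.
  - apply: aeW => x _.
    rewrite [X in _ --> X](_ : _ = (g x * chi k x * \1_(halfs s) x)%:E); last first.
      by rewrite patchE indicE; case: ifP => _; rewrite ?mulr1 ?mulr0.
    apply: cvg_EFin; first exact: nearW.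
    rewrite [X in X @ _ --> _](_ : _ = fun m => g x * chi k x * hbump m s x); last first.
      by apply/funext => m; rewrite /= mulrCA mulrC.
    by apply: cvgM; [exact: cvg_cst|exact: (@hbump_cvg R n s x)].
  - exact: integrable_abse.
  - apply: aeW => x m _; rewrite !abse_EFin lee_fin mulrCA normrM.
    by rewrite ler_piMl// ger0_norm ?hbump_ge0 ?hbump_le1.
  move=> _ _; have -> : (fun m => \int[mu]_x (g x * (hbump m s x * chi k x))%:E)%E = fun=> 0%E.
    by apply/funext => m; apply: loc_integrable_test_ereal => //; exact: H.
  by move=> /(cvg_unique (@ereal_hausdorff R)) E; have := E _ (cvg_cst _) => <-.
have /ae_foralln K := key.
apply: filterS2 (ae_neq0 n0) K => x x0 hx.
have /cvgr_gt : chi k x @[k --> \oo] --> (1 : R) by exact: chi_cvg.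
move=> /(_ 0 ltr01)[k _ /(_ k (leqnn k)) /= k0].
by have /eqP := hx k; rewrite mulf_eq0 (gt_eqF k0) orbF => /eqP.
Qed.

Lemma weak_gradient_ae u G G' : (0 < n)%N -> is_weak_gradient u G -> is_weak_gradient u G' ->
  {ae mu, forall x, G x = G' x}.
Proof.
move=> n0 [lu HG] [_ HG'].
have key i : {ae mu, forall x, G x ord0 i = G' x ord0 i}.
  have [lG EG] := HG i; have [lG' EG'] := HG' i.
  suff : {ae mu, forall x, G x ord0 i - G' x ord0 i = 0}.
    by apply: filterS => x /eqP; rewrite subr_eq0 => /eqP.
  apply: weak_zero_ae => //.
    move=> K cK K0; have := integrableB _ (lG K cK K0) (lG' K cK K0); apply.
    rewrite -[K]setCK; apply: measurableC; apply: open_measurable_rV; apply: closed_openC.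
    exact: compact_closed (@norm_hausdorff _ _) cK.
  move=> psi tpsi.
  have h1 := loc_integrable_test lG tpsi; have h2 := loc_integrable_test lG' tpsi.
  under eq_Rintegral do rewrite mulrBl.
  rewrite RintegralB//; apply/eqP; rewrite subr_eq0 -eqr_opp; apply/eqP.
  by rewrite -EG// -EG'.
have : {ae mu, forall x, forall i, G x ord0 i = G' x ord0 i}.
  exact: filter_forall key.
by apply: filterS => x hx; apply/rowP.
Qed.
End weak_gradients.

(** * Classical gradients off the origin are weak gradients *)

Section C1_off_origin.
Context {R : realType} {n : nat}.
Implicit Types (f g psi u v : 'rV[R]_n -> R) (G : 'rV[R]_n -> 'rV[R]_n) (x : 'rV[R]_n).
Local Notation mu := (lebesgue_rV R n).

Definition C1off f G := (forall x, 0 < sqn x -> {for x, continuous f}) /\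
  forall i x, 0 < sqn x -> is_derive x (delta_mx ord0 i) f (G x ord0 i) /\
    {for x, continuous (fun y => G y ord0 i)}.

Lemma hasC1_off f df : hasC1 f df -> C1off f (fun x => \row_i df i x).
Proof.
move=> [cf Hf]; split => [x _|i x _]; first exact: cf.
split; first by rewrite mxE; exact: (Hf i).1.
have c : continuous (fun y => (\row_j df j y) ord0 i : R).
  by under eq_fun do rewrite mxE; exact: (Hf i).2.
exact: c.
Qed.

Lemma C1off_mul f G l M psi : C1off f G -> C1c l M psi ->
  hasC1 (fun x => psi x * f x) (fun i x => psi x * G x ord0 i + f x * partial i psi x).
Proof.
move=> [cf HG] [l0 hpsi psi0].
have [cp Hp] := hpsi.
have p0 x : sqn x < l -> psi x = 0 by move=> h; apply: psi0; left.
have dp0 := hasC1_near0 hpsi p0.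
have N (k : 'rV[R]_n -> R) x : sqn x < l -> (forall y, sqn y < l -> k y = 0) ->
    \forall y \near x, k y = 0.
  by move=> xl k0; apply: filterS (near_sqn_lt xl) => y; exact: k0.
split.
  move=> x; have [xl|lx] := ltP (sqn x) l; last first.
    exact: continuousM (cp x) (cf _ (lt_le_trans l0 lx)).
  by apply: continuous_near0; apply: N => // y yl; rewrite p0// mul0r.
move=> i; split => x; have [xl|lx] := ltP (sqn x) l.
- rewrite p0// dp0// mul0r mulr0 addr0; apply: (@near_eq_is_derive _ _ _ (cst 0)) (is_derive_cst _ _ _).
  by apply: filterS (near_sqn_lt xl) => y yl; rewrite p0// mul0r.
- exact: (is_deriveM ((Hp i).1 x) (HG i x (lt_le_trans l0 lx)).1).
- by apply: continuous_near0; apply: N => // y yl; rewrite p0// dp0// mul0r mulr0 addr0.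
- have x0 := lt_le_trans l0 lx.
  exact: continuousD (continuousM (cp x) (HG i x x0).2) (continuousM (cf x x0) ((Hp i).2 x)).
Qed.

Lemma C1c_mul f G l M psi : C1off f G -> C1c l M psi ->
  C1c l M (fun x => psi x * f x) /\
  forall x, grad (fun x => psi x * f x) x = psi x *: G x + f x *: grad psi x.
Proof.
move=> hf hpsi; have H := C1off_mul hf hpsi; have [l0 _ psi0] := hpsi.
have [_ E] := hasC1P H; split.
  split => //; last by move=> x /psi0 ->; rewrite mul0r.
  split; first by case: H.
  by move=> i; rewrite E; have [_] := H; apply.
by move=> x; apply/rowP => i; rewrite !mxE E.
Qed.

(** The product with a test function is continuously differentiable on the whole space, so the
    integral of its partial derivative is 0; the product rule splits that integral. *)
Lemma C1off_weak f G : C1off f G -> is_weak_gradient f G.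
Proof.
move=> hf; have lf : loc_integrable f by apply: off_loc_integrable; case: hf.
have lG i : loc_integrable (fun x => G x ord0 i).
  by apply: off_loc_integrable => x x0; exact: (hf.2 i x x0).2.
split => // i; split => // psi tpsi; have [l [M hpsi]] := test_C1c tpsi.
have H := C1off_mul hf hpsi; have [C1pf E] := hasC1P H.
have [l0 [cpsi Hpsi] psi0] := hpsi.
have h1 : rint mu (fun x => G x ord0 i * psi x) by exact: loc_integrable_test.
have h2 : rint mu (fun x => f x * partial i psi x).
  apply: (loc_integrableM lf (Hpsi i).2 l0).
  by have [_ hp _] := hpsi; exact: off0_partial hp psi0.
have z : forall x, ~ cube n M x -> psi x * f x = 0.
  by move=> x xM; rewrite psi0 ?mul0r//; right.
have I0 : \int[mu]_x (f x * partial i psi x + G x ord0 i * psi x) = 0.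
  have := integral_partial i C1pf z; rewrite E /Rintegral => I1; rewrite -[RHS]/(fine 0) -I1.
  by congr fine; apply: eq_integral => x _; rewrite addrC [G x _ _ * _]mulrC.
by move: I0; rewrite rintegralD// => /eqP; rewrite addr_eq0 => /eqP.
Qed.

Lemma loc_integrable_lin f g (k : R) : loc_integrable f -> loc_integrable g ->
  loc_integrable (fun x => f x + k * g x).
Proof.
move=> lf lg K cK K0.
have mK : measurable K.
  rewrite -[K]setCK; apply: measurableC; apply: open_measurable_rV; apply: closed_openC.
  exact: compact_closed (@norm_hausdorff _ _) cK.
have h := integrableD mK (lf K cK K0) (integrableZl mK k (lg K cK K0)).
by apply: eq_integrable h.
Qed.

Lemma weak_gradient_lin u v G G' (k : R) : is_weak_gradient u G -> is_weak_gradient v G' ->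
  is_weak_gradient (fun x => u x + k * v x) (fun x => G x + k *: G' x).
Proof.
move=> [lu HG] [lv HG']; split; first exact: loc_integrable_lin.
move=> i; have [lG EG] := HG i; have [lG' EG'] := HG' i; split.
  by under eq_fun do rewrite !mxE; exact: loc_integrable_lin.
move=> psi tpsi; have [l [M [l0 hpsi psi0]]] := test_C1c tpsi.
have dp f : loc_integrable f -> rint mu (fun x => f x * partial i psi x).
  move=> lf; apply: (loc_integrableM lf (hpsi.2 i).2 l0); exact: off0_partial hpsi psi0.
have tp f : loc_integrable f -> rint mu (fun x => f x * psi x).
  by move=> lf; exact: loc_integrable_test.
have L f g h : rint mu (fun x => f x * h x) -> rint mu (fun x => g x * h x) ->
    \int[mu]_x ((f x + k * g x) * h x) = \int[mu]_x (f x * h x) + k * \int[mu]_x (g x * h x).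
  move=> hf hg; rewrite -(rintegralZ k hg) -rintegralD//; last exact: rintZ.
  by apply: eq_Rintegral => x _; rewrite mulrDl mulrA.
rewrite L; [|exact: dp|exact: dp].
under [X in _ = - X]eq_Rintegral do rewrite !mxE.
rewrite L; [|exact: tp|exact: tp].
by rewrite EG// EG'// opprD mulrN.
Qed.

Lemma weak_gradientP u G : is_weak_gradient u G -> is_weak_gradient u (weak_gradient u).
Proof. by move=> h; exact: (@getPex _ [set G | is_weak_gradient u G] (ex_intro _ G h)). Qed.

Lemma test_weak_gradient psi : test_fun psi -> is_weak_gradient psi (grad psi).
Proof. by move=> /test_C1c[l [M [_ h _]]]; apply: C1off_weak; exact: hasC1_off h. Qed.

Lemma measurable_l2norm G : (forall i, measurable_fun setT (fun x => G x ord0 i)) ->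
  measurable_fun setT (fun x => l2norm (G x)).
Proof.
move=> mG; have mc := continuous_measurable_rV (@continuous_l2norm R n).
apply: (measurableT_comp mc); exact: measurable_fun_rVP.
Qed.

Lemma weak_gradient_measurable u G : is_weak_gradient u G ->
  forall i, measurable_fun setT (fun x => G x ord0 i).
Proof. by move=> [_ H] i; apply: loc_integrable_measurable; exact: (H i).1. Qed.
End C1_off_origin.

(** * Weighted Lebesgue norms *)

Section weighted_Lp.
Context {R : realType} {n : nat}.
Implicit Types (f g : 'rV[R]_n -> R) (x : 'rV[R]_n) (s p t C : R).
Local Notation mu := (lebesgue_rV R n).

Definition wfun s p f x : R := l2norm x `^ s * `|f x| `^ p.
(** The p-th power of the weighted norm. Working with it avoids roots, and [LwD] with its free
    weight [t] plays the role of the triangle inequality. *)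
Definition wn s p f : R := \int[mu]_x wfun s p f x.
Definition Lw s p f := measurable_fun setT f /\ rint mu (wfun s p f).

Lemma wfun_ge0 s p f x : 0 <= wfun s p f x.
Proof. by rewrite mulr_ge0 ?powR_ge0. Qed.

Lemma wn_ge0 s p f : 0 <= wn s p f.
Proof. by apply: Rintegral_ge0 => x _; exact: wfun_ge0. Qed.

Lemma measurable_l2normX s : measurable_fun setT (fun x => l2norm x `^ s).
Proof.
apply: (@measurableT_comp _ _ _ _ _ _ (fun r : R => r `^ s)); first exact: measurable_powR.
exact: continuous_measurable_rV (@continuous_l2norm R n).
Qed.

Lemma measurable_wfun s p f : measurable_fun setT f -> measurable_fun setT (wfun s p f).
Proof.
move=> mf; apply: measurable_funM; first exact: measurable_l2normX.
apply: (@measurableT_comp _ _ _ _ _ _ (fun r : R => r `^ p)); first exact: measurable_powR.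
exact: measurableT_comp.
Qed.

Lemma rint_le (h k : 'rV[R]_n -> R) : measurable_fun setT h ->
  {ae mu, forall x, 0 <= h x <= k x} -> rint mu k ->
  rint mu h /\ \int[mu]_x h x <= \int[mu]_x k x.
Proof.
move=> mh hk ik; have mk : measurable_fun setT k by apply/measurable_EFinP; exact: measurable_int ik.
have le : (\int[mu]_x `|(h x)%:E| <= \int[mu]_x `|(k x)%:E|)%E.
  apply: ae_ge0_le_integral => //.
  - by apply: measurableT_comp => //; exact/measurable_EFinP.
  - by apply: measurableT_comp => //; exact/measurable_EFinP.
  - apply: filterS hk => x /andP[h0 hk] _; rewrite !abse_EFin lee_fin !ger0_norm//.
    exact: le_trans hk.
have ih : rint mu h.
  apply/integrableP; split; first exact/measurable_EFinP.
  by apply: le_lt_trans le _; case/integrableP: ik.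
split => //; rewrite -lee_fin -!EFin_Rintegral//.
have E (g : 'rV[R]_n -> R) : measurable_fun setT g -> {ae mu, forall x, 0 <= g x} ->
    (\int[mu]_x (g x)%:E = \int[mu]_x `|(g x)%:E|)%E.
  move=> mg g0; apply: ae_eq_integral => //; first exact/measurable_EFinP.
    by apply: measurableT_comp => //; exact/measurable_EFinP.
  by apply: filterS g0 => x g0 _; rewrite abse_EFin ger0_norm.
rewrite E//; last by apply: filterS hk => x /andP[].
by rewrite [leRHS]E//; apply: filterS hk => x /andP[]; exact: le_trans.
Qed.

Lemma Lw_le s p f g C : 0 <= p -> 0 <= C -> measurable_fun setT f ->
  {ae mu, forall x, `|f x| <= C * `|g x|} -> Lw s p g ->
  Lw s p f /\ wn s p f <= C `^ p * wn s p g.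
Proof.
move=> p0 C0 mf fg [mg ig].
have H : {ae mu, forall x, 0 <= wfun s p f x <= C `^ p * wfun s p g x}.
  apply: filterS fg => x fg; rewrite wfun_ge0/= /wfun mulrCA ler_wpM2l ?powR_ge0//.
  rewrite -powRM// ge0_ler_powR ?nnegrE// mulr_ge0//.
have [h1 h2] := rint_le (measurable_wfun s p mf) H (rintZ (C `^ p) ig).
by split; [exact: conj mf h1|rewrite -rintegralZ].
Qed.

Lemma LwD s p t f g : 1 <= p -> 0 < t < 1 -> Lw s p f -> Lw s p g ->
  Lw s p (fun x => f x + g x) /\
  wn s p (fun x => f x + g x) <= (1 - t) `^ (1 - p) * wn s p f + t `^ (1 - p) * wn s p g.
Proof.
move=> p1 t01 [mf fi] [mg gi].
have i1 := rintZ ((1 - t) `^ (1 - p)) fi; have i2 := rintZ (t `^ (1 - p)) gi.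
have mfg : measurable_fun setT (fun x => f x + g x) by exact: measurable_funD.
have := @rint_le (wfun s p (fun x => f x + g x))
  (fun x => (1 - t) `^ (1 - p) * wfun s p f x + t `^ (1 - p) * wfun s p g x).
case => //; first exact: measurable_wfun.
  apply: aeW => x; rewrite wfun_ge0/= /wfun !(mulrCA _ (l2norm x `^ s)) -mulrDr ler_wpM2l ?powR_ge0//.
  apply: le_trans (powRD_convex p1 (normr_ge0 (f x)) (normr_ge0 (g x)) t01).
  by rewrite ge0_ler_powR ?nnegrE ?addr_ge0 ?ler_normD// (le_trans ler01).
  exact: rintD.
by move=> h1 h2; split; [exact: conj mfg h1|apply: le_trans h2 _; rewrite rintegralD// !rintegralZ].
Qed.

Lemma LwD2 s p f g : 1 <= p -> Lw s p f -> Lw s p g ->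
  Lw s p (fun x => f x + g x) /\
  wn s p (fun x => f x + g x) <= 2 `^ (p - 1) * (wn s p f + wn s p g).
Proof.
move=> p1 hf hg; have := @LwD s p 2^-1 f g p1 ltac:(lra) hf hg.
have -> : 1 - 2^-1 = 2^-1 :> R by field.
rewrite -powR_inv1// -powRrM mulN1r opprB => -[h1 h2]; split; first exact: h1.
by rewrite mulrDr.
Qed.

Lemma LwZ s p f (k : R) : 0 <= p -> Lw s p f ->
  Lw s p (fun x => k * f x) /\ wn s p (fun x => k * f x) = `|k| `^ p * wn s p f.
Proof.
move=> p0 [mf fi]; have E : wfun s p (fun x => k * f x) = fun x => `|k| `^ p * wfun s p f x.
  by apply/funext => x; rewrite /wfun normrM powRM// mulrCA.
split; last by rewrite /wn E rintegralZ.
by split; [apply: measurable_funM|rewrite E; exact: rintZ].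
Qed.

Lemma LwB2 s p f g : 1 <= p -> Lw s p f -> Lw s p g ->
  Lw s p (fun x => f x - g x) /\
  wn s p (fun x => f x - g x) <= 2 `^ (p - 1) * (wn s p f + wn s p g).
Proof.
move=> p1 hf hg; have p0 : 0 <= p := le_trans ler01 p1.
have [h1 h2] := LwZ (- 1) p0 hg; move: h1 h2; rewrite normrN1 powR1 mul1r => h1 h2.
rewrite -h2; have E : (fun x => f x - g x) = fun x => f x + -1 * g x.
  by apply/funext => x; rewrite mulN1r.
by rewrite E; exact: LwD2.
Qed.

Lemma Lw_weight s s1 s2 p (A B : R) f : (0 < n)%N -> 0 <= A -> 0 <= B ->
  (forall r : R, 0 < r -> r `^ s <= A * r `^ s1 + B * r `^ s2) ->
  Lw s1 p f -> Lw s2 p f ->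
  Lw s p f /\ wn s p f <= A * wn s1 p f + B * wn s2 p f.
Proof.
move=> n0 A0 B0 H [mf f1] [_ f2].
have := @rint_le (wfun s p f) (fun x => A * wfun s1 p f x + B * wfun s2 p f x).
case.
- exact: measurable_wfun.
- apply: filterS (ae_neq0 n0) => x x0; rewrite wfun_ge0/= /wfun !mulrA -mulrDl.
  by rewrite ler_wpM2r ?powR_ge0// H// l2norm_gt0.
- by apply: rintD; exact: rintZ.
move=> h1 h2; split; first exact: conj mf h1.
apply: le_trans h2 _; rewrite rintegralD ?rintegralZ//; exact: rintZ.
Qed.

Lemma cvg_norm_powR p (a : nat -> R) (l : R) : 0 < p -> a k @[k --> \oo] --> l ->
  `|a k| `^ p @[k --> \oo] --> `|l| `^ p.
Proof.
move=> p0 al; apply: (@continuous_cvg _ _ _ _ _ _ (fun t : R => `|t| `^ p)) al.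
exact: continuous_norm_powR.
Qed.

(** Dominated convergence for multipliers; it is applied with [1 - chi k] and with
    [|x| ^ 2 dchi k]. *)
Lemma Lw_dominated s p C f (xi : nat -> 'rV[R]_n -> R) : (0 < n)%N -> 0 < p -> 0 <= C ->
  Lw s p f -> (forall k, measurable_fun setT (xi k)) ->
  (forall k x, x != 0 -> `|xi k x| <= C) ->
  (forall x, x != 0 -> xi k x @[k --> \oo] --> (0 : R)) ->
  (forall k, Lw s p (fun x => xi k x * f x)) /\
  wn s p (fun x => xi k x * f x) @[k --> \oo] --> (0 : R).
Proof.
move=> n0 p0 C0 [mf fi] mxi xiC xi0.
have mk k : measurable_fun setT (fun x => xi k x * f x) by exact: measurable_funM.
have lk k : Lw s p (fun x => xi k x * f x).
  apply: (proj1 (Lw_le (ltW p0) C0 (mk k) _ (conj mf fi))).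
  by apply: filterS (ae_neq0 n0) => x x0; rewrite normrM ler_wpM2r// xiC.
split; first exact: lk.
have ig : mu.-integrable setT (fun x => (C `^ p * wfun s p f x)%:E) by exact: rintZ.
have := @dominated_convergence _ _ _ mu setT measurableT
  (fun k x => (wfun s p (fun x => xi k x * f x) x)%:E) (cst 0%E) (fun x => (C `^ p * wfun s p f x)%:E).
case => //.
- by move=> k; apply/measurable_EFinP; exact: measurable_wfun.
- apply: filterS (ae_neq0 n0) => x x0 _; apply: cvg_EFin; first exact: nearW.
  have h : xi k x * f x @[k --> \oo] --> (0 : R).
    by rewrite -[0 in X in _ --> X](mul0r (f x)); apply: cvgM (xi0 x x0) (cvg_cst _).
  have h2 : `|xi k x * f x| `^ p @[k --> \oo] --> (0 : R).
    by have := cvg_norm_powR p0 h; rewrite normr0 powR0// gt_eqF.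
  rewrite -[0 in X in _ --> X](mulr0 (l2norm x `^ s)).
  by apply: cvgM h2; exact: cvg_cst.
- apply: filterS (ae_neq0 n0) => x x0 k _; rewrite abse_EFin lee_fin ger0_norm ?wfun_ge0//.
  rewrite /wfun mulrCA ler_wpM2l ?powR_ge0// -powRM// ge0_ler_powR ?nnegrE ?(ltW p0) ?mulr_ge0//.
  by rewrite normrM ler_wpM2r// xiC.
move=> _ _; rewrite integral_cst// mul0e => h.
exact: (@fine_cvg _ _ _ _ _ 0 h).
Qed.

Lemma Lw_fatou s p f (fk : nat -> 'rV[R]_n -> R) (B : R) : 0 < p -> measurable_fun setT f ->
  (forall k, Lw s p (fk k)) -> (forall k, wn s p (fk k) <= B) ->
  {ae mu, forall x, fk k x @[k --> \oo] --> f x} ->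
  Lw s p f /\ wn s p f <= B.
Proof.
move=> p0 mf lf fB cv.
pose g k x := (wfun s p (fk k) x)%:E.
have mg k : measurable_fun setT (g k) by apply/measurable_EFinP; apply: measurable_wfun; case: (lf k).
have g0 k x : setT x -> (0 <= g k x)%E by rewrite lee_fin wfun_ge0.
have F := fatou mu measurableT mg g0.
have E : (\int[mu]_x (wfun s p f x)%:E = \int[mu]_x limn_einf (g ^~ x))%E.
  apply: ae_eq_integral => //.
  - by apply/measurable_EFinP; exact: measurable_wfun.
  - have mN k : measurable_fun setT (fun x => - g k x)%E by exact: measurableT_comp.
    by apply: measurableT_comp => //; exact: (measurable_fun_limn_esup mN).
  apply: filterS cv => x cx _.
  have h : `|fk k x| `^ p @[k --> \oo] --> `|f x| `^ p.
    exact: cvg_norm_powR p0 cx.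
  have h2 : g k x @[k --> \oo] --> (wfun s p f x)%:E.
    apply: cvg_EFin; first exact: nearW.
    by apply: cvgM h; exact: cvg_cst.
  by have [<- _] := cvg_limn_einf_sup h2.
have le : (\int[mu]_x (wfun s p f x)%:E <= B%:E)%E.
  rewrite E; apply: le_trans F _; rewrite limn_einf_lim; apply: lime_le.
    exact: is_cvg_einfs.
  apply: nearW => m; apply: (@le_trans _ _ (\int[mu]_x g m x)%E).
    by apply: ereal_inf_lbound; exists m => /=.
  by rewrite EFin_Rintegral ?lee_fin ?fB//; case: (lf m).
have ifs : rint mu (wfun s p f).
  apply/integrableP; split; first by apply/measurable_EFinP; exact: measurable_wfun.
  rewrite (_ : (fun x => `|(EFin \o wfun s p f) x|)%E = EFin \o wfun s p f).
    by apply: le_lt_trans le _; rewrite ltry.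
  by apply/funext => x /=; rewrite ger0_norm ?wfun_ge0.
by split; [exact: conj mf ifs|rewrite -lee_fin -EFin_Rintegral].
Qed.

(** With [A = (1 - t) ^ (1 - p)], [B = t ^ (1 - p)] and [d] the p-th power of the distance, [LwD]
    used in both directions bounds the difference of the p-th powers by [A (A - 1) F + A B d]. First
    [t] is taken small, then [k] large. *)
Lemma Lw_cvg s p f (fk : nat -> 'rV[R]_n -> R) : 1 <= p -> Lw s p f ->
  (forall k, Lw s p (fk k)) -> wn s p (fun x => f x - fk k x) @[k --> \oo] --> (0 : R) ->
  wn s p (fk k) @[k --> \oo] --> wn s p f.
Proof.
move=> p1 lf lfk d0; have p0 := le_trans ler01 p1.
set F := wn s p f; pose d k := wn s p (fun x => f x - fk k x).
have key k t : 0 < t < 1 -> wn s p (fk k) <= (1 - t) `^ (1 - p) * F + t `^ (1 - p) * d k /\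
    F <= (1 - t) `^ (1 - p) * wn s p (fk k) + t `^ (1 - p) * d k.
  move=> t01; have [hd _] := LwB2 p1 lf (lfk k).
  have [hN EN] := LwZ (- 1) p0 hd; split.
    have [_] := LwD p1 t01 lf hN; rewrite EN normrN1 powR1 mul1r.
    rewrite (_ : (fun x => f x + _) = fk k)//.
    by apply/funext => x; rewrite mulN1r opprB addrC subrK.
  have [_] := LwD p1 t01 (lfk k) hd.
  by rewrite (_ : (fun x => fk k x + _) = f)//; apply/funext => x; rewrite addrC subrK.
have ca : {for 0, continuous (fun t : R => (1 - t) `^ (1 - p))}.
  apply: (@continuous_comp _ _ _ (fun t : R => 1 - t) (fun s => s `^ (1 - p))).
    by apply: continuousB; [exact: cst_continuous|].
  by apply: continuous_powR; rewrite subr0.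
have cb : {for 0, continuous (fun t : R => ((1 - t) `^ (1 - p)) * ((1 - t) `^ (1 - p) - 1) * F)}.
  have ca1 := ca; have ca2 := ca.
  exact: continuousM (continuousM ca1 (continuousB ca2 (@cst_continuous _ _ (1 : R) 0))) (@cst_continuous _ _ F 0).
apply/cvgrPdist_le => e e0.
have [t t01 te] : exists2 t : R, 0 < t < 1 & ((1 - t) `^ (1 - p)) * ((1 - t) `^ (1 - p) - 1) * F <= e / 2.
  have : \forall t \near (0 : R)^'+, ((1 - t) `^ (1 - p)) * ((1 - t) `^ (1 - p) - 1) * F < e / 2.
    have := cb; rewrite /prop_for /continuous_at subr0 powR1 subrr mulr0 mul0r => cb0.
    have /cvgr_lt : (fun t : R => ((1 - t) `^ (1 - p)) * ((1 - t) `^ (1 - p) - 1) * F) @ 0^'+ --> (0 : R).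
      exact: cvg_within_filter cb0.
    by apply; rewrite divr_gt0.
  move=> H; have H1 : \forall t \near (0 : R)^'+, 0 < t < 1.
    by near=> t; apply/andP; split; near: t; [exact: nbhs_right_gt|exact: nbhs_right_lt].
  have [t [] ] := @filter_ex _ _ _ _ (filterI H H1).
  by move=> h1 h2; exists t => //; exact: ltW.
have [t0 t1] := andP t01; set a := (1 - t) `^ (1 - p) in te.
set b := t `^ (1 - p).
have a1 : 1 <= a.
  rewrite /a (_ : 1 - p = - (p - 1)); last by ring.
  rewrite powRN invr_ge1 ?unitfE ?gt_eqF ?powR_gt0 ?subr_gt0//.
  have := @ge0_ler_powR R (p - 1); rewrite subr_ge0 => /(_ p1 (1 - t) 1).
  by rewrite !nnegrE subr_ge0 (ltW t1) ler01 powR1 => -> //; rewrite gerBl ltW.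
have b0 : 0 < b by rewrite powR_gt0.
have ab0 : 0 < a * b by rewrite mulr_gt0// (lt_le_trans ltr01).
have : \forall k \near \oo, d k < e / 2 / (a * b).
  by move/cvgr_lt: d0; apply; rewrite !divr_gt0.
apply: filterS => k dk; have [K1 K2] := key k t t01.
have dk0 : 0 <= d k := wn_ge0 _ _ _.
have dk2 : a * b * d k <= e / 2 by rewrite mulrC -ler_pdivlMr// ltW.
have a10 : 0 <= a - 1 by rewrite subr_ge0.
have h1 := mulr_ge0 a10 (wn_ge0 s p f : 0 <= F).
have h2 := ler_wpM2l a10 K1.
have h3 := mulr_ge0 a10 (mulr_ge0 (ltW b0) dk0).
have h4 := mulr_ge0 a10 h1.
move: K1 K2 h1 h2 h3 h4 te dk2; rewrite -/a -/b; move: (wn s p (fk k)) => Fk.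
rewrite ler_norml; clear; move=> *; apply/andP; split; lra.
Unshelve. all: by end_near. Qed.
End weighted_Lp.

(** * Integrability of radial functions near the origin *)

Section radial_integrability.
Context {R : realType} {n : nat}.
Implicit Types (x : 'rV[R]_n) (s t r : R).
Local Notation mu := (lebesgue_rV R n).

Lemma bump_mono (r t : R) : r <= t -> bump r <= bump t.
Proof.
move=> rt; have [r0|r0] := lerP r 0; first by rewrite (bump0 r0) bump_ge0.
have t0 := lt_le_trans r0 rt.
by rewrite !bumpE r0 t0 ler_expR lerN2 lef_pV2 ?posrE.
Qed.

Lemma dbump_bump (r : R) : dbump r = r^-1 ^+ 2 * bump r.
Proof. by rewrite dbumpE bumpE; case: ifP => // _; rewrite mulr0. Qed.

Lemma dbump_ge0 (r : R) : 0 <= dbump r.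
Proof. by rewrite dbump_bump mulr_ge0 ?bump_ge0// sqr_ge0. Qed.

(** [C1c_by_parts] with exponent 2 for a function of [|x| ^ 2]; this identity stands in for polar
    coordinates. *)
Lemma radial_by_parts s (g g' : R -> R) l M : 0 < l -> (forall k, dk setT k g) ->
  (forall t : R, is_derive t 1 g (g' t)) -> off0 l M (fun x => g (sqn x)) ->
  [/\ rint mu (fun x => l2norm x `^ s * (2 * sqn x * (g (sqn x) * g' (sqn x)))),
   Lw s 2 (fun x => g (sqn x)) &
   \int[mu]_x (l2norm x `^ s * (2 * sqn x * (g (sqn x) * g' (sqn x)))) =
    - ((n%:R + s) / 2) * wn s 2 (fun x => g (sqn x))].
Proof.
move=> l0 dg hg g0.
have p1 : 1 < 2 :> R by rewrite ltr1n.
have hu : C1c l M (fun x => g (sqn x)).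
  by split => //; apply: smooth_hasC1; exact: smooth_radial.
have E : (fun x => l2norm x `^ s * (2 * sqn x * (g (sqn x) * g' (sqn x)))) =
   fun x => l2norm x `^ s * (spow 2 (g (sqn x)) * dot x (grad (fun y => g (sqn y)) x)).
  apply/funext => x; congr (_ * _).
  have -> : grad (fun y => g (sqn y)) x = (2 * g' (sqn x)) *: x.
    apply/rowP => i; rewrite !mxE.
    have [_ D] := is_derive_chain (((hasC1_sqn n).2 i).1 x) (hg (sqn x)).
    by apply: (etrans D); ring.
  rewrite dotC dotZl dotxx -spow_powR// subrr powRr0 mul1r; ring.
split.
- by rewrite E; exact: C1c_int_dot p1 hu.
- split; first by apply: continuous_measurable_rV; have [_ []] := hu.
  by apply: (C1c_int_fun s _ hu).
- by rewrite E; exact: C1c_by_parts p1 hu.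
Qed.

Lemma chi_mul_radial s (h h' : R -> R) k : (forall k, dk setT k h) ->
  (forall t : R, is_derive t 1 h (h' t)) ->
  let c := cutf k.+1%:R^-1 in let c' := dcutf k.+1%:R^-1 in
  [/\ rint mu (fun x => l2norm x `^ s * (2 * sqn x * ((h (sqn x) * c (sqn x)) *
        (h (sqn x) * c' (sqn x) + c (sqn x) * h' (sqn x))))),
   Lw s 2 (fun x => h (sqn x) * c (sqn x)) &
   \int[mu]_x (l2norm x `^ s * (2 * sqn x * ((h (sqn x) * c (sqn x)) *
        (h (sqn x) * c' (sqn x) + c (sqn x) * h' (sqn x))))) =
    - ((n%:R + s) / 2) * wn s 2 (fun x => h (sqn x) * c (sqn x))].
Proof.
move=> dh hh c c'; have k0 : 0 < (k.+1%:R^-1 : R) by rewrite invr_gt0.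
apply: (@radial_by_parts s (fun t => h t * c t) (fun t => h t * c' t + c t * h' t)
  k.+1%:R^-1 k.+1%:R) => //.
- by move=> j; apply: dkM => //; exact: dk_cutf.
- by move=> t; exact: (is_deriveM (hh t) (is_derive_cutf _ t)).
- by move=> x /(@chi_off0 R n k) H; rewrite -[c _]/(chi k x) H mulr0.
Qed.

Let dk_sub (rho : R) k : dk setT k (fun t => bump (rho - t)).
Proof.
apply: (@dk_comp R setT setT k bump) => //; first exact: dk_bumpq.
apply: (@dkD R setT k (fun=> rho)); first exact: dk_cst.
rewrite (_ : -%R = fun t : R => -1 * t); last by apply/funext => t; rewrite mulN1r.
apply: dkM; [exact: dk_cst|exact: dk_id].
Qed.

Let is_derive_sub (rho t : R) : is_derive t 1 (fun t => bump (rho - t)) (- dbump (rho - t)).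
Proof.
have d2 : is_derive t 1 (fun t => rho - t) (- 1).
  by have := is_deriveB (is_derive_cst (rho : R) t 1) (is_derive_id t 1); rewrite sub0r.
by have := is_derive_chain d2 (is_derive_bump (rho - t)); rewrite mulrN1.
Qed.

Lemma measurable_bump_sqn (rho : R) : measurable_fun setT (fun x => bump (rho - sqn x)).
Proof.
apply: continuous_measurable_rV => x.
apply: (@continuous_comp _ _ _ (fun x => rho - sqn x) bump); last exact: continuous_bumpq.
exact: continuousB (@cst_continuous _ _ rho x) (@continuous_sqn R n x).
Qed.

Lemma Lw_origin_ge0 s rho : 0 <= s -> Lw s 2 (fun x => bump (rho - sqn x)).
Proof.
move=> s0; split; first exact: measurable_bump_sqn.
apply: (@continuous_support_integrable R n (1 + `|rho|)).
  move=> x; have c1 : {for x, continuous (fun x => l2norm x `^ s)}.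
    have [->|sN] := eqVneq s 0.
      have -> : (fun x => l2norm x `^ 0) = fun=> 1 by apply/funext => y; rewrite powRr0.
      exact: cst_continuous.
    by apply: continuous_l2norm_powR; rewrite lt_def sN.
  have c2 : {for x, continuous (fun x => `|bump (rho - sqn x)| `^ 2)}.
    have p2 : 0 < 2 :> R by [].
    apply: (@continuous_comp _ _ _ (fun x => bump (rho - sqn x)) (fun t : R => `|t| `^ 2)).
      apply: (@continuous_comp _ _ _ (fun x => rho - sqn x) bump); last exact: continuous_bumpq.
      exact: continuousB (@cst_continuous _ _ rho x) (@continuous_sqn R n x).
    exact: continuous_norm_powR p2 _.
  exact: continuousM c1 c2.
move=> x xM; rewrite /wfun bump0 ?normr0 ?powR0 ?mulr0// subr_le0 leNgt; apply/negP => h.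
apply: xM => i; rewrite -(@ler_pXn2r _ 2)// ?nnegrE ?addr_ge0// real_normK ?num_real//.
apply: le_trans (sqr_coord_le x i) _; apply: le_trans (ltW h) _.
apply: le_trans (ler_norm rho) _; have := normr_ge0 rho; move: `|rho| => q q0.
by rewrite expr2; nra.
Qed.

Lemma powR2 (v : R) : `|v| `^ 2 = v ^+ 2.
Proof. by rewrite powR_mulrn// real_normK ?num_real. Qed.

Lemma rintegral_le (h k : 'rV[R]_n -> R) : (0 < n)%N -> rint mu h -> rint mu k ->
  (forall x, x != 0 -> h x <= k x) -> \int[mu]_x h x <= \int[mu]_x k x.
Proof.
move=> n0 hi ki hk; rewrite -subr_ge0 -mulN1r -rintegralZ// -rintegralD//; last exact: rintZ.
have H : {ae mu, forall x, 0 <= k x + -1 * h x}.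
  by apply: filterS (ae_neq0 n0) => x x0; rewrite mulN1r subr_ge0 hk.
have i1 := rintD ki (rintZ (-1) hi).
have m1 : measurable_fun setT (fun x => k x + -1 * h x).
  by apply/measurable_EFinP; exact: measurable_int i1.
rewrite (_ : \int[mu]_x _ = \int[mu]_x `|k x + -1 * h x|); first by apply: Rintegral_ge0.
rewrite /Rintegral; congr fine; apply: ae_eq_integral => //.
- exact/measurable_EFinP.
- by apply/measurable_EFinP; exact: measurableT_comp.
- by apply: filterS H => x h0 _; rewrite ger0_norm.
Qed.

(* Integration by parts gives (n + s) |u|_s^2 <= C |u'|_(s + 2)^2 for cut off bumps, which
   raises the exponent of the weight until it is nonnegative *)
Lemma Lw_origin s rho : (0 < n)%N -> 0 < n%:R + s -> 0 < rho -> Lw s 2 (fun x => bump (rho - sqn x)).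
Proof.
move=> n0; have [k] : exists k : nat, 0 <= s + 2 * k%:R.
  exists (Num.trunc `|s|).+1; have := Num.Theory.truncnS_gt `|s|; have := ler_normr (- s) `|s|.
  have := ler_norm (- s); rewrite normrN; have := normr_ge0 s; lra.
elim: k s rho => [|k IH] s rho; first by rewrite mulr0 addr0 => s0 _ _; exact: Lw_origin_ge0.
move=> sk ns rho0.
(* The bound [rho] on [|x| ^ 2] is doubled so that this bump is at least [bump rho] wherever
   [bump (rho - sqn x)] is nonzero; it then dominates every bounded error term there. *)
have LF : Lw (s + 2) 2 (fun x => bump (2 * rho - sqn x)).
  apply: IH; [|lra|lra].
  by move: sk; rewrite -natr1; lra.
have [C1 C10 H1] := @bumpq_bounded R 'X^2.
have db (r : R) : dbump r <= C1 by apply: le_trans (ler_norm _) (H1 r).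
have [e eE] : exists e : R, e = expR 1 by eexists.
have e0 : 0 < e by rewrite eE expR_gt0.
have [br brE] : exists br : R, br = bump rho by eexists.
have br0 : 0 < br by rewrite brE bump_gt0.
pose K := 2 * (e * (e * C1) + e * e * C1) / br ^+ 2.
have E0 : 0 <= e * (e * C1) + e * e * C1.
  exact: addr_ge0 (mulr_ge0 (ltW e0) (mulr_ge0 (ltW e0) C10)) (mulr_ge0 (mulr_ge0 (ltW e0) (ltW e0)) C10).
have K0 : 0 <= K := divr_ge0 (mulr_ge0 (ler0n _ 2) E0) (sqr_ge0 br).
pose c k : R -> R := cutf k.+1%:R^-1; pose c' k : R -> R := dcutf k.+1%:R^-1.
pose h (t : R) := bump (rho - t); pose h' (t : R) := - dbump (rho - t).
(* Only an upper bound on [- c'] matters: the inner edge becomes steep as [j] grows, but the cut-off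
   increases there and its contribution has the favourable sign. *)
have c'l j (t : R) : - c' j t <= e * C1.
  have s0 : 0 < (j.+1%:R^-1 : R) by rewrite invr_gt0.
  have s1 : (j.+1%:R^-1 : R) <= 1 by rewrite invf_le1// ler1n.
  rewrite /c' /dcutf -eE -mulrN ler_wpM2l ?(ltW e0)// opprD mulrN mulrN opprK.
  move: (j.+1%:R^-1 : R) s0 s1 => v s0 s1.
  have i1 := bump_ge0 (t / v - 1); have i2 := bump_le1 (t / v - 1).
  have i3 := dbump_ge0 (1 - t * v); have i4 := db (1 - t * v).
  have j1 : 0 <= bump (1 - t * v) * (dbump (t / v - 1) / v).
    by rewrite mulr_ge0 ?bump_ge0// mulr_ge0 ?dbump_ge0// invr_ge0 ltW.
  have j2 : dbump (1 - t * v) * v <= C1.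
    by rewrite -[C1]mulr1 ler_pM ?(ltW s0).
  have j3 : bump (t / v - 1) * (dbump (1 - t * v) * v) <= C1.
    by rewrite -[C1]mul1r ler_pM ?mulr_ge0 ?(ltW s0).
  by move: j1 j3; clear; lra.
have pt j x : x != 0 -> - 1 * (l2norm x `^ s * (2 * sqn x * ((h (sqn x) * c j (sqn x)) *
        (h (sqn x) * c' j (sqn x) + c j (sqn x) * h' (sqn x))))) <=
    K * wfun (s + 2) 2 (fun x => bump (2 * rho - sqn x)) x.
  move=> x0; rewrite /wfun powR2 -(l2norm_powRM s 2 x0) powR_mulrn ?l2norm_ge0// sqr_l2norm.
  have t0 := sqn_ge0 x; move: (c'l j (sqn x)); move: (sqn x) t0 => t t0 c't.
  have w0 := powR_ge0 (l2norm x) s; move: (l2norm x `^ s) w0 => w w0.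
  have ci : 0 <= c j t <= e by rewrite eE cutf_ge0 cutf_le.
  have hi : 0 <= h t <= 1 by rewrite bump_ge0 bump_le1.
  have h'i : 0 <= - h' t <= C1 by rewrite opprK dbump_ge0 db.
  have [rt|tr] := lerP rho t.
    rewrite /h bump0 ?subr_le0// !mul0r !mulr0.
    exact: mulr_ge0 K0 (mulr_ge0 (mulr_ge0 w0 t0) (sqr_ge0 _)).
  have bb : br ^+ 2 <= bump (2 * rho - t) ^+ 2.
    by rewrite ler_sqr ?nnegrE ?bump_ge0 ?(ltW br0)// brE bump_mono//; lra.
  have main : - ((h t * c j t) * (h t * c' j t + c j t * h' t)) <= e * (e * C1) + e * e * C1.
    move: ci hi h'i c't; move: (c j t) (c' j t) (h t) (h' t) => cc dd hh h2.
    move=> /andP[a1 a2] /andP[a3 a4] /andP[a5 a6] a7; rewrite mulrDr opprD; apply: lerD.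
      rewrite -mulrN -mulrN; have [dn|dp] := lerP 0 (- dd); last first.
        have ec := mulr_ge0 (ltW e0) (mulr_ge0 (ltW e0) C10); apply: le_trans ec.
        by rewrite mulr_ge0_le0 ?mulr_ge0// mulr_ge0_le0// ltW.
      apply: ler_pM; rewrite ?mulr_ge0//; first by rewrite -[e]mul1r ler_pM.
      by rewrite -[e * C1]mul1r ler_pM.
    rewrite -mulrN -mulrN mulrA; apply: ler_pM; rewrite ?mulr_ge0//.
    by apply: ler_pM; rewrite ?mulr_ge0// -[e]mul1r ler_pM.
  have K2 : 2 * (e * (e * C1) + e * e * C1) <= K * bump (2 * rho - t) ^+ 2.
    rewrite /K [leRHS]mulrAC ler_pdivlMr ?exprn_gt0//.
    exact: (ler_wpM2l (mulr_ge0 (ler0n _ 2) E0) bb).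
  have := ler_wpM2l (mulr_ge0 w0 t0) main.
  have := ler_wpM2l (mulr_ge0 w0 t0) K2.
  move: (e * (e * C1) + e * e * C1) (bump (2 * rho - t) ^+ 2) ((h t * c j t) * (h t * c' j t + c j t * h' t)).
  clear => E B X; rewrite (_ : w * t * (K * B) = K * (w * t * B)); last by ring.
  rewrite (_ : -1 * (w * (2 * t * X)) = 2 * (w * t * - X)); last by ring.
  by rewrite (_ : w * t * (2 * E) = 2 * (w * t * E)); [lra|ring].
pose f j x := h (sqn x) * c j (sqn x).
have [B HB] : exists B, forall j, wn s 2 (f j) <= B.
  exists (2 / (n%:R + s) * (K * wn (s + 2) 2 (fun x => bump (2 * rho - sqn x)))) => j.
  have [i1 i2 i3] := @chi_mul_radial s h h' j (dk_sub rho) (is_derive_sub rho).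
  have [_ i4] := LF.
  have := rintegral_le n0 (rintZ (-1) i1) (rintZ K i4) (pt j).
  rewrite !rintegralZ// i3 -/(wn _ _ _) mulN1r mulNr opprK => le.
  rewrite -[X in X <= _](_ : 2 / (n%:R + s) * ((n%:R + s) / 2 * wn s 2 (f j)) = _).
    by rewrite ler_wpM2l// divr_ge0// ltW.
  by field; rewrite gt_eqF.
have p2 : 0 < 2 :> R by [].
apply: (proj1 (@Lw_fatou R n s 2 _ f B p2 (measurable_bump_sqn rho) _ HB _)).
  by move=> j; have [_ i2 _] := @chi_mul_radial s h h' j (dk_sub rho) (is_derive_sub rho).
apply: filterS (ae_neq0 n0) => x x0; rewrite -[X in _ --> X]mulr1.
by apply: cvgM (chi_cvg x0); exact: cvg_cst.
Qed.
End radial_integrability.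

(** * Integrability at infinity and of powers times exponentials *)

Section exponential_integrability.
Context {R : realType} {n : nat}.
Implicit Types (x : 'rV[R]_n) (s t r : R).
Local Notation mu := (lebesgue_rV R n).

Let dk_shift k : dk setT k (fun t : R => bump (t - 1)).
Proof.
apply: (@dk_comp R setT setT k bump) => //; first exact: dk_bumpq.
by apply: (@dkD R setT k id (fun=> - 1)); [exact: dk_id|exact: dk_cst].
Qed.

Let is_derive_shift (t : R) : is_derive t 1 (fun t => bump (t - 1)) (dbump (t - 1)).
Proof.
have d2 : is_derive t 1 (fun t : R => t - 1) 1.
  by have := is_deriveB (is_derive_id t 1) (is_derive_cst (1 : R) t 1); rewrite subr0.
by have := is_derive_chain d2 (is_derive_bump (t - 1)); rewrite mulr1.
Qed.

Lemma measurable_bump_sqn1 : measurable_fun setT (fun x => bump (sqn x - 1)).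
Proof.
apply: continuous_measurable_rV => x.
apply: (@continuous_comp _ _ _ (fun x => sqn x - 1) bump); last exact: continuous_bumpq.
exact: continuousB (@continuous_sqn R n x) (@cst_continuous _ _ (1 : R) x).
Qed.

(* Far from the origin the logarithmic derivative of the cut off bump is bounded, hence
   integration by parts absorbs it when the weight decays fast enough *)
Lemma Lw_infinity : (0 < n)%N -> Lw (- (n%:R + 18)) 2 (fun x => bump (sqn x - 1)).
Proof.
(* This gives [- (n + s) / 2 = 9], one more than the coefficient 8 of the same integral on the right
   of the pointwise bound [pt], so absorption leaves a coefficient 1. *)
move=> n0; set s := - (n%:R + 18).
have LF : Lw 0 2 (fun x => bump (4 - sqn x)) by exact: Lw_origin_ge0.
have [C1 C10 H1] := @bumpq_bounded R 'X^2.
have db (r : R) : dbump r <= C1 by apply: le_trans (ler_norm _) (H1 r).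
have [e eE] : exists e : R, e = expR 1 by eexists.
have e0 : 0 < e by rewrite eE expR_gt0.
have [br brE] : exists br : R, br = bump 2 by eexists.
have br0 : 0 < br by rewrite brE bump_gt0.
pose K := 4 * (C1 * (e * e)) / br ^+ 2.
have K0 : 0 <= K.
  exact: divr_ge0 (mulr_ge0 (ler0n _ 4) (mulr_ge0 C10 (mulr_ge0 (ltW e0) (ltW e0)))) (sqr_ge0 br).
(* The shift to [k.+2] makes the parameter at most 1/2. For [t > 1] the inner edge then contributes
   at most [2 * c] to [t * c'], and the outer edge, where the cut-off decreases, contributes a
   nonpositive term. *)
pose c k : R -> R := cutf k.+2%:R^-1; pose c' k : R -> R := dcutf k.+2%:R^-1.
pose h (t : R) := bump (t - 1); pose h' (t : R) := dbump (t - 1).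
have c'l j (t : R) : 1 < t -> t * c' j t <= 2 * c j t.
  move=> t1; have s0 : 0 < (j.+2%:R^-1 : R) by rewrite invr_gt0.
  have s1 : (j.+2%:R^-1 : R) <= 2^-1 by rewrite lef_pV2 ?posrE// ler_nat.
  rewrite /c' /dcutf /c /cutf -eE; move: (j.+2%:R^-1 : R) s0 s1 => v s0 s1.
  rewrite mulrCA [2 * _]mulrCA ler_wpM2l ?(ltW e0)// dbump_bump [dbump (t / v - 1)]dbump_bump.
  have v1 : v != 0 by rewrite gt_eqF.
  have tv : 0 < t - v by lra.
  have -> : (t / v - 1)^-1 = v / (t - v) by field; rewrite ?mulN1r v1/= gt_eqF.
  have i1 := bump_ge0 (t / v - 1); have i2 := bump_ge0 (1 - t * v).
  move: (bump (t / v - 1)) (bump (1 - t * v)) i1 i2 => B1 B2 i1 i2.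
  have i3 : 0 <= B1 * ((1 - t * v)^-1 ^+ 2 * B2 * v).
    by apply: mulr_ge0 => //; apply: mulr_ge0 (ltW s0); apply: mulr_ge0 => //; exact: sqr_ge0.
  rewrite mulrDr; apply: (@le_trans _ _ (t * (B2 * ((v / (t - v)) ^+ 2 * B1 * v^-1)))).
    by rewrite gerDr !mulrN oppr_le0; apply: mulr_ge0 => //; lra.
  rewrite (_ : t * _ = (t * v / (t - v) ^+ 2) * (B1 * B2)); last first.
    by field; rewrite ?mulN1r v1/= gt_eqF.
  rewrite ler_wpM2r ?mulr_ge0// ler_pdivrMr ?exprn_gt0//.
  have : 0 <= (1 - 2 * v) * (t * (t - v)) by rewrite mulr_ge0// ?mulr_ge0//; lra.
  have : 0 <= t * (t - 1) by rewrite mulr_ge0//; lra.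
  have : 0 <= v * t by rewrite mulr_ge0//; lra.
  by clear -s0 s1 t1 tv; nra.
have pt j x : x != 0 -> l2norm x `^ s * (2 * sqn x * ((h (sqn x) * c j (sqn x)) *
        (h (sqn x) * c' j (sqn x) + c j (sqn x) * h' (sqn x)))) <=
    8 * wfun s 2 (fun x => h (sqn x) * c j (sqn x)) x +
    K * wfun 0 2 (fun x => bump (4 - sqn x)) x.
  move=> x0; rewrite /wfun !powR2 powRr0 mul1r.
  have r0 : 0 < l2norm x by rewrite l2norm_gt0.
  have w1 : 1 < sqn x -> l2norm x `^ s <= 1.
    move=> t1; rewrite l2norm_powR -[leRHS](powRr0 (sqn x)) ler_powR ?(ltW t1)//.
    by rewrite /s; have := ler0n R n; lra.
  have t0 := sqn_ge0 x; move: (c'l j (sqn x)) w1; move: (sqn x) t0 => t t0 c't w1.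
  have w0 := powR_ge0 (l2norm x) s; move: (l2norm x `^ s) w0 w1 => w w0 w1.
  have ci : 0 <= c j t <= e by rewrite eE cutf_ge0 cutf_le.
  have hi : 0 <= h t <= 1 by rewrite bump_ge0 bump_le1.
  have h'i : 0 <= h' t <= C1 by rewrite dbump_ge0 db.
  have KB : 0 <= K * bump (4 - t) ^+ 2 := mulr_ge0 K0 (sqr_ge0 _).
  have [t1|t1] := lerP t 1.
    by rewrite /h bump0 ?subr_le0// !mul0r !mulr0 expr0n/= !mulr0 add0r.
  have h'le : t * (h t * h' t) <= 2 * h t ^+ 2 \/ t < 2.
    have [t2|t2] := lerP 2 t; [left|by right].
    rewrite /h' dbump_bump -/(h t) (_ : t * _ = t * (t - 1)^-1 ^+ 2 * h t ^+ 2); last by ring.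
    rewrite ler_wpM2r ?sqr_ge0// exprVn ler_pdivrMr ?exprn_gt0 ?subr_gt0//.
    by clear -t2; nra.
  have [ci0 ci1] := andP ci; have [hi0 hi1] := andP hi; have [h'0 h'1] := andP h'i.
  have {}c't := c't t1; have {}w1 := w1 t1.
  have a1 : h t ^+ 2 * c j t * (t * c' j t) <= h t ^+ 2 * c j t * (2 * c j t).
    by rewrite ler_wpM2l// mulr_ge0 ?sqr_ge0.
  have a2 : c j t ^+ 2 * (t * (h t * h' t)) <=
      2 * (h t ^+ 2 * c j t ^+ 2) + 2^-1 * (K * bump (4 - t) ^+ 2).
    case: h'le => [le|t2].
      have := ler_wpM2l (sqr_ge0 (c j t)) le; move: KB.
      by rewrite (_ : c j t ^+ 2 * (2 * _) = 2 * (h t ^+ 2 * c j t ^+ 2)); [lra|ring].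
    have bb : br ^+ 2 <= bump (4 - t) ^+ 2.
      by rewrite ler_sqr ?nnegrE ?bump_ge0 ?(ltW br0)// brE bump_mono//; lra.
    have K2 : 4 * (C1 * (e * e)) <= K * bump (4 - t) ^+ 2.
      rewrite /K [leRHS]mulrAC ler_pdivlMr ?exprn_gt0//.
      exact: (ler_wpM2l (mulr_ge0 (ler0n _ 4) (mulr_ge0 C10 (mulr_ge0 (ltW e0) (ltW e0)))) bb).
    have k1 : c j t ^+ 2 * (t * (h t * h' t)) <= (e * e) * (2 * C1).
      have q1 : h t * h' t <= C1 by rewrite -[C1]mul1r; exact: (ler_pM hi0 h'0 hi1 h'1).
      have q2 := ler_pM t0 (mulr_ge0 hi0 h'0) (ltW t2) q1.
      rewrite expr2; exact: (ler_pM (mulr_ge0 ci0 ci0) (mulr_ge0 t0 (mulr_ge0 hi0 h'0)) (ler_pM ci0 ci0 ci1 ci1) q2).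
    have k2 : 0 <= h t ^+ 2 * c j t ^+ 2 by rewrite mulr_ge0 ?sqr_ge0.
    by move: K2 k1 k2; clear; lra.
  have a3 := ler_wpM2l w0 (lerD a1 a2).
  have a4 : w * (K * bump (4 - t) ^+ 2) <= K * bump (4 - t) ^+ 2.
    by rewrite ler_piMl.
  move: a3 a4; move: (c j t) (c' j t) (h t) (h' t) (K * bump (4 - t) ^+ 2); clear => cc dd hh h2 B a3 a4.
  rewrite (_ : w * (2 * t * _) = 2 * (w * (hh ^+ 2 * cc * (t * dd) + cc ^+ 2 * (t * (hh * h2)))));
    last by ring.
  have -> : 8 * (w * (hh * cc) ^+ 2) = 2 * (w * (hh ^+ 2 * cc * (2 * cc) + 2 * (hh ^+ 2 * cc ^+ 2)));
    first by ring.
  by move: a3; rewrite (_ : w * (_ + (_ + 2^-1 * B)) = w * (hh ^+ 2 * cc * (2 * cc) + 2 * (hh ^+ 2 * cc ^+ 2)) + 2^-1 * (w * B)); [lra|ring].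
pose f j x := h (sqn x) * c j (sqn x).
have HB j : wn s 2 (f j) <= K * wn 0 2 (fun x => bump (4 - sqn x)).
  have [i1 i2 i3] := @chi_mul_radial R n s h h' j.+1 dk_shift is_derive_shift.
  have [_ i4] := LF; have [_ i5] := i2.
  have := rintegral_le n0 i1 (rintD (rintZ 8 i5) (rintZ K i4)) (pt j).
  rewrite rintegralD ?rintegralZ//; [|exact: rintZ|exact: rintZ].
  have alg (W V : R) : - ((n%:R + s) / 2) * W <= 8 * W + K * V -> W <= K * V.
    rewrite (_ : - ((n%:R + s) / 2) = 9); last by rewrite /s; field.
    by clear; lra.
  rewrite i3; exact: alg.
have p2 : 0 < 2 :> R by [].
apply: (proj1 (@Lw_fatou R n s 2 _ f _ p2 measurable_bump_sqn1 _ HB _)).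
  by move=> j; have [_ i2 _] := @chi_mul_radial R n s h h' j.+1 dk_shift is_derive_shift.
apply: filterS (ae_neq0 n0) => x x0; rewrite -[X in _ --> X]mulr1.
apply: cvgM; first exact: cvg_cst.
by have := chi_cvg x0; rewrite -cvg_shiftS.
Qed.

Lemma powR_expR_bounded (a k g : R) : 0 < k -> 0 < g ->
  exists2 C, 0 <= C & forall r : R, 1 <= r -> r `^ a * expR (- (k * r `^ g)) <= C.
Proof.
move=> k0 g0; pose m := (Num.trunc (`|a| / g)).+1.
have [C C0 H] := poly_le_expR 'X^m k0; exists C; first exact: C0.
move=> r r1; have r0 := lt_le_trans ltr01 r1.
rewrite expRN ler_pdivrMr ?expR_gt0//; apply: le_trans (H (r `^ g) (powR_gt0 _ r0)).
rewrite hornerXn ger0_norm ?exprn_ge0 ?powR_ge0// -powR_mulrn ?powR_ge0// -powRrM.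
rewrite ler_powR//; have := Num.Theory.truncnS_gt (`|a| / g); rewrite ltr_pdivrMr// mulrC => h.
by apply: le_trans (ler_norm a) (ltW h).
Qed.

(** For [|x| ^ 2 <= 2] the integrand is dominated by the bump of [Lw_origin]; beyond, the
    exponential beats every power and the bump of [Lw_infinity] dominates. *)
Lemma rint_powR_expR (s k g : R) : (0 < n)%N -> 0 < n%:R + s -> 0 < k -> 0 < g ->
  rint mu (fun x => l2norm x `^ s * expR (- (k * l2norm x `^ g))).
Proof.
move=> n0 ns k0 g0.
have [_ i1] := Lw_origin (rho := 4) n0 ns ltac:(lra); have [_ i2] := Lw_infinity n0.
have [C C0 HC] := powR_expR_bounded (s + (n%:R + 18)) k0 g0.
have [b2 b2E] : exists b2 : R, b2 = bump 2 by eexists.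
have [b1 b1E] : exists b1 : R, b1 = bump 1 by eexists.
have b20 : 0 < b2 by rewrite b2E bump_gt0.
have b10 : 0 < b1 by rewrite b1E bump_gt0.
have := @rint_le R n (fun x => l2norm x `^ s * expR (- (k * l2norm x `^ g)))
  (fun x => b2 ^- 2 * wfun s 2 (fun x => bump (4 - sqn x)) x +
    (C / b1 ^+ 2) * wfun (- (n%:R + 18)) 2 (fun x => bump (sqn x - 1)) x).
case=> //.
- apply: measurable_funM; first exact: measurable_l2normX.
  apply: measurableT_comp => //; apply: measurableT_comp => //.
  by apply: measurable_funM => //; exact: measurable_l2normX.
- apply: filterS (ae_neq0 n0) => x x0; rewrite mulr_ge0 ?powR_ge0 ?expR_ge0//=.
  have r0 : 0 < l2norm x by rewrite l2norm_gt0.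
  rewrite /wfun !powR2; have tE := sqr_l2norm x.
  have w1 := powR_ge0 (l2norm x) s; have w2 := powR_ge0 (l2norm x) (- (n%:R + 18)).
  have p1 : 0 <= b2 ^- 2 * (l2norm x `^ s * bump (4 - sqn x) ^+ 2).
    by rewrite mulr_ge0 ?invr_ge0 ?sqr_ge0// mulr_ge0 ?sqr_ge0.
  have p2 : 0 <= C / b1 ^+ 2 * (l2norm x `^ (- (n%:R + 18)) * bump (sqn x - 1) ^+ 2).
    by rewrite mulr_ge0 ?divr_ge0 ?sqr_ge0// mulr_ge0 ?sqr_ge0.
  have [t2|t2] := lerP (sqn x) 2.
    apply: ler_wpDr p2 _; rewrite mulrCA ler_wpM2l//.
    apply: (@le_trans _ _ 1).
      by rewrite -expR0 ler_expR oppr_le0 mulr_ge0 ?powR_ge0// ltW.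
    rewrite mulrC ler_pdivlMr ?exprn_gt0// mul1r ler_sqr ?nnegrE ?bump_ge0 ?(ltW b20)//.
    by rewrite b2E bump_mono//; lra.
  apply: ler_wpDl p1 _.
  have r1 : 1 <= l2norm x by rewrite -(@ler_pXn2r _ 2)// ?nnegrE ?(ltW r0)// tE; lra.
  rewrite mulrCA (_ : s = - (n%:R + 18) + (s + (n%:R + 18))); last by ring.
  rewrite (powRD_gt0 _ _ r0) -mulrA ler_wpM2l//; apply: le_trans (HC _ r1) _.
  rewrite mulrAC ler_pdivlMr ?exprn_gt0// ler_wpM2l// ler_sqr ?nnegrE ?bump_ge0 ?(ltW b10)//.
  by rewrite b1E bump_mono//; lra.
- exact: (rintD (rintZ _ i1) (rintZ _ i2)).
Qed.
End exponential_integrability.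

(** The sum of the series has integral at most 1, so it is finite almost everywhere and its terms
    tend to 0 there. *)
Lemma L1_summable_ae d (T : measurableType d) (R : realType) (mu : {measure set T -> \bar R})
    (g : nat -> T -> R) : (forall j, measurable_fun setT (g j)) ->
  (forall j x, 0 <= g j x) ->
  (forall j, \int[mu]_x (g j x)%:E <= ((2 ^ j.+1)%:R^-1)%:E)%E ->
  {ae mu, forall x, g j x @[j --> \oo] --> (0 : R)}.
Proof.
move=> mg g0 ig; pose S x := (\sum_(0 <= j <oo) (g j x)%:E)%E.
have mgE j : measurable_fun setT (fun x => (g j x)%:E) by exact/measurable_EFinP.
have g0E x j : (0 <= (g j x)%:E)%E by rewrite lee_fin.
have mS : measurable_fun setT S by apply: ge0_emeasurable_sum => // j x _ _; exact: g0E.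
have S0 x : (0 <= S x)%E by apply: nneseries_ge0 => j _ _; exact: g0E.
have iS : (\int[mu]_x S x <= 1%:E)%E.
  rewrite /S integral_nneseries//.
  have := @epsilon_trick R (fun=> 0%E) 1 xpredT (fun=> lexx _) ler01.
  rewrite [X in (_ <= X + _)%E]eseries0// add0e; apply: le_trans; apply: lee_nneseries => [j _ _|j _].
    by apply: integral_ge0 => x _; exact: g0E.
  by rewrite add0e div1r; exact: ig.
have : mu.-integrable setT S.
  apply/integrableP; split => //; under eq_integral do rewrite gee0_abs//.
  by apply: le_lt_trans iS _; rewrite ltry.
move=> /(integrable_ae measurableT); apply: filterS => x /(_ I) Sfin.
apply: cvg_series_cvg_0; apply: nondecreasing_is_cvgn.
  by apply/nondecreasing_series => j _ _; exact: g0.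
exists (fine (S x)) => _ [m _ <-]; rewrite -lee_fin fineK// /series/= -sumEFin.
by apply: nneseries_lim_ge => j _ _; exact: g0E.
Qed.

(** * From extended real norms to p-th powers of integrals *)

Section norms.
Context {R : realType} {n : nat}.
Implicit Types (u v : 'rV[R]_n -> R) (G : 'rV[R]_n -> 'rV[R]_n) (p a b s : R).
Local Notation mu := (lebesgue_rV R n).

Lemma normL_powR p a u : p != 0 ->
  (normL p a u `^ p = \int[mu]_x (wfun (- (p * a)) p u x)%:E)%E.
Proof.
move=> p0; rewrite /normL -poweRrM mulVf// poweRe1//.
by apply: integral_ge0 => x _; rewrite lee_fin wfun_ge0.
Qed.

Definition gnorm G x := l2norm (G x).

Lemma wfun_gnorm s p G x : wfun s p (gnorm G) x = l2norm x `^ s * l2norm (G x) `^ p.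
Proof. by rewrite /wfun ger0_norm ?l2norm_ge0. Qed.

Lemma measurable_gnorm u G : is_weak_gradient u G -> measurable_fun setT (gnorm G).
Proof. by move=> /weak_gradient_measurable H; exact: measurable_l2norm. Qed.

(** [normH] is defined through a chosen weak gradient; since two weak gradients agree almost
    everywhere, any [G] computes it. *)
Lemma normH_powR p b u G : (0 < n)%N -> p != 0 -> is_weak_gradient u G ->
  (normH p b u `^ p = \int[mu]_x (wfun (- (p * b)) p (gnorm G) x)%:E)%E.
Proof.
move=> n0 p0 hG; rewrite /normH -poweRrM mulVf// poweRe1; last first.
  by apply: integral_ge0 => x _; rewrite lee_fin mulr_ge0 ?powR_ge0.
have hW := weak_gradientP hG; have ae := weak_gradient_ae n0 hW hG.
have mW := measurable_wfun (- (p * b)) p (measurable_gnorm hW).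
have mG := measurable_wfun (- (p * b)) p (measurable_gnorm hG).
rewrite (eq_integral (fun x => (wfun (- (p * b)) p (gnorm (weak_gradient u)) x)%:E)); last first.
  by move=> x _; rewrite wfun_gnorm.
apply: ae_eq_integral; [exact: measurableT|exact/measurable_EFinP|exact/measurable_EFinP|].
by apply: filterS ae => x E _; rewrite /wfun /gnorm E.
Qed.

Lemma Lw_powR s p f (z : \bar R) : 0 < p -> measurable_fun setT f -> (0 <= z)%E ->
  (z `^ p = \int[mu]_x (wfun s p f x)%:E)%E -> (z < +oo)%E ->
  Lw s p f /\ fine z `^ p = wn s p f.
Proof.
move=> p0 mf z0 zE zoo.
have E : (\int[mu]_x (wfun s p f x)%:E = (fine z `^ p)%:E)%E.
  by rewrite -zE -[in LHS](@fineK _ z) ?ge0_fin_numE// poweR_EFin.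
split; last by rewrite /wn /Rintegral E.
split => //; apply/integrableP; split; first by apply/measurable_EFinP; exact: measurable_wfun.
rewrite (_ : (fun x => `|(EFin \o wfun s p f) x|)%E = fun x => (wfun s p f x)%:E).
  by rewrite E ltry.
by apply/funext => x /=; rewrite ger0_norm ?wfun_ge0.
Qed.

Lemma powR_Lw s p f (z : \bar R) : 0 < p -> (0 <= z)%E ->
  (z `^ p = \int[mu]_x (wfun s p f x)%:E)%E -> Lw s p f ->
  (z < +oo)%E /\ fine z `^ p = wn s p f.
Proof.
move=> p0 z0 zE lf.
have zoo : (z < +oo)%E.
  have : (z `^ p < +oo)%E by rewrite zE EFin_Rintegral ?ltry//; case: lf.
  rewrite !ltey; apply: contra => /eqP ->; by rewrite poweRyr// gt_eqF.
by split => //; have [] := Lw_powR p0 lf.1 z0 zE zoo.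
Qed.

Lemma normL_ge0 p a u : (0 <= normL p a u)%E.
Proof. exact: poweR_ge0. Qed.

Lemma normH_ge0 p b u : (0 <= normH p b u)%E.
Proof. exact: poweR_ge0. Qed.

Lemma ecvg0_near (z : nat -> \bar R) (e : R) : (forall k, 0 <= z k)%E -> 0 < e ->
  z k @[k --> \oo] --> 0%E -> \forall k \near \oo, (z k < +oo)%E /\ fine (z k) <= e.
Proof.
move=> z0 e0 /fine_cvgP[fz /cvgrPdist_le/(_ e e0) H].
near=> k; split.
  by rewrite -ge0_fin_numE//; near: k.
have : `|0 - (fine \o z) k| <= e by near: k.
by rewrite sub0r normrN /=; apply: le_trans; exact: ler_norm.
Unshelve. all: by end_near. Qed.

Lemma powR_root (p e : R) : 0 < p -> 0 < e -> exists2 r : R, 0 < r & forall z, 0 <= z -> z <= r -> z `^ p <= e.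
Proof.
move=> p0 e0; exists (e `^ p^-1); first by rewrite powR_gt0.
move=> z z0 zr; rewrite -[leRHS](powRr1 (ltW e0)) -(mulVf (lt0r_neq0 p0)) powRrM.
by rewrite ge0_ler_powR ?nnegrE ?powR_ge0 ?(ltW p0).
Qed.

Lemma grad_lin u v (k : R) : hasC1 u (partial^~ u) -> hasC1 v (partial^~ v) ->
  forall x, grad (fun x => u x + k * v x) x = grad u x + k *: grad v x.
Proof.
move=> hu hv x; apply/rowP => i; rewrite !mxE.
have dk := is_deriveM (is_derive_cst k x (delta_mx ord0 i)) ((hv.2 i).1 x).
have [_ E] := is_deriveD ((hu.2 i).1 x) dk; apply: (etrans E).
by rewrite scaler0 addr0.
Qed.

Lemma test_lin u v (k : R) : test_fun u -> test_fun v -> test_fun (fun x => u x + k * v x).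
Proof. by move=> tu tv; apply: testD => //; apply: test_mulr => //; exact: smooth_cst. Qed.

(* The L^1_loc limit is upgraded to an almost everywhere one along a subsequence which
   converges fast on an exhaustion by annuli *)
Lemma spaceH_sequence p b u : (0 < n)%N -> 0 < p -> spaceH p b u ->
  exists G psi, [/\ is_weak_gradient u G, forall j, test_fun (psi j),
    forall j, Lw (- (p * b)) p (gnorm (fun x => G x - grad (psi j) x)) /\
      wn (- (p * b)) p (gnorm (fun x => G x - grad (psi j) x)) <= j.+1%:R^-1 &
    {ae mu, forall x, psi j x @[j --> \oo] --> u x}].
Proof.
move=> n0 p0 [mu_ [G hG] [phi [tphi cphi nphi]]].
pose A (j : nat) : set 'rV[R]_n := annulus j.+1%:R^-1 j.+1%:R.
have mA j : measurable (A j) by exact: measurable_annulus.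
have cA j : compact (A j) by exact: compact_annulus.
have A0 j : ~ A j 0 by apply: annulus_off0; rewrite invr_gt0.
(* An index at which the gradients are within [1 / (j + 1)] and the functions within [2 ^ - (j + 1)]
   on [A j]. The second rate is summable, which gives convergence almost everywhere. *)
have key j : exists k, (Lw (- (p * b)) p (gnorm (fun x => G x - grad (phi k) x)) /\
      wn (- (p * b)) p (gnorm (fun x => G x - grad (phi k) x)) <= j.+1%:R^-1) /\
      (\int[mu]_(x in A j) `|u x - phi k x|%:E <= ((2 ^ j.+1)%:R^-1)%:E)%E.
  have j0 : 0 < (j.+1%:R^-1 : R) by rewrite invr_gt0.
  have j2 : 0 < ((2 ^ j.+1)%:R^-1 : R) by rewrite invr_gt0 ltr0n expn_gt0.
  have [r r0 Hr] := powR_root p0 j0.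
  have N1 := ecvg0_near (fun k => normH_ge0 p b (u \- phi k)) r0 nphi.
  have h0 k : (0 <= \int[mu]_(x in A j) `|u x - phi k x|%:E)%E.
    by apply: integral_ge0 => x _; rewrite lee_fin.
  have N2 := ecvg0_near h0 j2 (cphi (A j) (cA j) (A0 j)).
  have [k [[h1 h2] [h3 h4]]] := filter_ex (filterI N1 N2).
  exists k; split.
    have hW : is_weak_gradient (u \- phi k) (fun x => G x - grad (phi k) x).
      have := weak_gradient_lin (-1) hG (test_weak_gradient (tphi k)).
      rewrite (_ : (fun x => u x + -1 * phi k x) = u \- phi k); last first.
        by apply/funext => x; rewrite mulN1r.
      by rewrite (_ : (fun x => G x + -1 *: grad (phi k) x) = (fun x => G x - grad (phi k) x))//;
        apply/funext => x; rewrite scaleN1r.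
    have E := normH_powR b n0 (lt0r_neq0 p0) hW.
    have [h5 h6] := Lw_powR p0 (measurable_gnorm hW) (normH_ge0 _ _ _) E h1.
    by split => //; rewrite -h6; apply: Hr h2; exact: fine_ge0 (normH_ge0 _ _ _).
  by rewrite -(@fineK _ (\int[mu]_(x in A j) _)%E) ?ge0_fin_numE// lee_fin.
have [s Hs] := choice key.
exists G, (fun j => phi (s j)); split => //; first by move=> j; exact: (Hs j).1.
have mphi k : measurable_fun setT (phi k).
  by apply: continuous_measurable_rV; have [l [M [_ []]]] := test_C1c (tphi k).
pose g j x := \1_(A j) x * `|u x - phi (s j) x|.
have : {ae mu, forall x, g j x @[j --> \oo] --> (0 : R)}.
  apply: L1_summable_ae.
  - move=> j; apply: measurable_funM; first exact: measurable_indic.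
    by apply: measurableT_comp => //; exact: measurable_funB.
  - by move=> j x; rewrite mulr_ge0// indicE.
  - move=> j; apply: le_trans _ (Hs j).2; rewrite [leRHS]integral_mkcond.
    rewrite le_eqVlt; apply/orP; left; apply/eqP; apply: eq_integral => x _.
    by rewrite patchE /g indicE; case: ifP => _; rewrite ?mul1r ?mul0r.
apply: filterS2 (ae_neq0 n0) => x x0 gx.
have H : u x - phi (s j) x @[j --> \oo] --> (0 : R).
  apply: norm_cvg0; move: gx; apply: cvg_trans; apply: near_eq_cvg.
  have : [set: 'rV[R]_n] x by []; rewrite setT_annulus => -[/= x00|[m _ Am]].
    by rewrite x00 eqxx in x0.
  exists m => // j /= mj; rewrite /g indicE mem_set ?mul1r//.
  have [/= a1 a2] := Am; split => /=.
    by apply: le_trans a1; rewrite lef_pV2 ?posrE// ler_nat ltnS.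
  by move=> i; apply: le_trans (a2 i) _; rewrite ler_nat ltnS.
rewrite -[X in _ --> X]subr0 (_ : (fun j => phi (s j) x) = fun j => u x - (u x - phi (s j) x)).
  by apply: cvgB H; exact: cvg_cst.
by apply/funext => j; rewrite opprB addrC subrK.
Qed.

Lemma spaceL_Lw p a u : (0 < n)%N -> 1 <= p -> spaceL p a u -> Lw (- (p * a)) p u.
Proof.
move=> n0 p1 [mu_ [phi [tphi nphi]]]; have p0 := lt_le_trans ltr01 p1.
have [k [h1 _]] := filter_ex (ecvg0_near (fun k => normL_ge0 p a (u \- phi k)) ltr01 nphi).
have [l [M hk]] := test_C1c (tphi k).
have lk : Lw (- (p * a)) p (phi k).
  split; first by apply: continuous_measurable_rV; have [_ []] := hk.
  exact: C1c_int_fun p0 hk.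
have mB : measurable_fun setT (u \- phi k) by apply: measurable_funB => //; exact: lk.1.
have [lB _] := Lw_powR p0 mB (normL_ge0 _ _ _) (normL_powR a _ (lt0r_neq0 p0)) h1.
have [+ _] := LwD2 p1 lB lk.
by rewrite (_ : (fun x => _) = u)//; apply/funext => x; rewrite /= subrK.
Qed.
End norms.

(** * Density of test functions *)

Section density.
Context {R : realType} {n : nat}.
Implicit Types (u v : 'rV[R]_n -> R) (G : 'rV[R]_n -> 'rV[R]_n) (p a b s : R).
Local Notation mu := (lebesgue_rV R n).

Lemma Lw_sum3 s p (f f1 f2 f3 : 'rV[R]_n -> R) : 1 <= p -> measurable_fun setT f ->
  (forall x, x != 0 -> `|f x| <= f1 x + (f2 x + f3 x)) -> (0 < n)%N ->
  Lw s p f1 -> Lw s p f2 -> Lw s p f3 ->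
  Lw s p f /\ wn s p f <= 4 `^ (p - 1) * (wn s p f1 + (wn s p f2 + wn s p f3)).
Proof.
move=> p1 mf H n0 l1 l2 l3; have p0 := le_trans ler01 p1.
have [l23 e23] := LwD2 p1 l2 l3; have [l123 e123] := LwD2 p1 l1 l23.
have [lf ef] : Lw s p f /\ wn s p f <= 1 `^ p * wn s p (fun x => f1 x + (f2 x + f3 x)).
  apply: Lw_le => //; apply: filterS (ae_neq0 n0) => x x0; rewrite mul1r.
  by apply: le_trans (H x x0) _; exact: ler_norm.
split; first exact: lf.
have E4 : 4 `^ (p - 1) = 2 `^ (p - 1) * 2 `^ (p - 1) :> R.
  by rewrite -powRM//; congr (_ `^ _); ring.
have P1 : 1 <= 2 `^ (p - 1) :> R.
  by rewrite -[leLHS](powRr0 2) ler_powR ?subr_ge0// ler1n.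
rewrite powR1 mul1r in ef; apply: le_trans ef _; apply: le_trans e123 _.
rewrite E4 -mulrA ler_wpM2l ?powR_ge0// mulrDr lerD//.
by rewrite ler_peMl ?wn_ge0.
Qed.

Lemma Lw_inv p b (f : 'rV[R]_n -> R) : (0 < n)%N -> Lw (- (p * (b + 1))) p f ->
  Lw (- (p * b)) p (fun x => (l2norm x)^-1 * f x) /\
  wn (- (p * b)) p (fun x => (l2norm x)^-1 * f x) <= wn (- (p * (b + 1))) p f.
Proof.
move=> n0 [mf fi].
have mi : measurable_fun setT (fun x => (l2norm x)^-1 * f x).
  apply: measurable_funM => //.
  rewrite (_ : (fun x => _) = fun x => l2norm x `^ (- 1)); first exact: measurable_l2normX.
  by apply/funext => x; rewrite powR_inv1 ?l2norm_ge0.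
have := @rint_le R n _ _ (measurable_wfun (- (p * b)) p mi) _ fi; case.
  apply: filterS (ae_neq0 n0) => x x0; rewrite wfun_ge0/= /wfun normrM normfV.
  have r0 : 0 < l2norm x by rewrite l2norm_gt0.
  rewrite (ger0_norm (ltW r0)) -powR_inv1 ?(ltW r0)// powRM ?powR_ge0// -powRrM mulrA -powRD_gt0//.
  by rewrite mulN1r (_ : - (p * b) + - p = - (p * (b + 1)))//; ring.
by move=> h1 h2; split; [split|].
Qed.

(** Hardy's inequality holds for the test functions [psi i - psi j]; letting [i] tend to infinity,
    Fatou's lemma and the almost everywhere convergence carry it to [u - psi j]. Approximation of
    the gradient thus controls the function in the Hardy norm. *)
Lemma spaceH_hardy p b u : (0 < n)%N -> 1 < p -> n%:R != p * (b + 1) -> spaceH p b u ->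
  exists G psi, [/\ is_weak_gradient u G, Lw (- (p * b)) p (gnorm G),
    Lw (- (p * (b + 1))) p u, forall j, test_fun (psi j) &
    exists2 K, 0 <= K & forall j,
    [/\ Lw (- (p * b)) p (gnorm (fun x => G x - grad (psi j) x)),
      wn (- (p * b)) p (gnorm (fun x => G x - grad (psi j) x)) <= K * j.+1%:R^-1,
      Lw (- (p * (b + 1))) p (fun x => u x - psi j x) &
      wn (- (p * (b + 1))) p (fun x => u x - psi j x) <= K * j.+1%:R^-1]].
Proof.
move=> n0 p1 npb hu; have p0 : 0 < p by lra.
have mu_ : measurable_fun setT u by case: hu.
have [G [psi [hG tpsi Hpsi ae]]] := spaceH_sequence n0 p0 hu.
have [C C0 HC] := hardy p1 npb.
have lpsi j s : Lw s p (psi j).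
  have [l [M hk]] := test_C1c (tpsi j).
  split; first by apply: continuous_measurable_rV; have [_ []] := hk.
  exact: C1c_int_fun p0 hk.
have lgrad v s : test_fun v -> Lw s p (gnorm (grad v)).
  move=> /test_C1c[l [M hk]].
  split; first by apply: measurable_l2norm => i; have [_ [_ Hi] _] := hk;
    under eq_fun do rewrite mxE; apply: continuous_measurable_rV; have [] := Hi i.
  rewrite /rint (_ : EFin \o _ = EFin \o (fun x => l2norm x `^ s * l2norm (grad v x) `^ p)).
    exact: C1c_int_grad0 p0 hk.
  by apply/funext => x; rewrite /= wfun_gnorm.
have mG : measurable_fun setT (gnorm G) := measurable_gnorm hG.
have lG : Lw (- (p * b)) p (gnorm G).
  have [h1 _] := Hpsi 0%N; have h2 := lgrad _ (- (p * b)) (tpsi 0%N).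
  have [h3 _] := LwD2 (ltW p1) h1 h2.
  apply: (proj1 (Lw_le (ltW p0) ler01 mG _ h3)); apply: aeW => x; rewrite mul1r.
  rewrite /gnorm !ger0_norm ?addr_ge0 ?l2norm_ge0//.
  by apply: le_trans (l2normD _ _); rewrite subrK.
have diff j i : wn (- (p * (b + 1))) p (fun x => psi i x - psi j x) <=
    C * (2 `^ (p - 1) * (j.+1%:R^-1 + i.+1%:R^-1)).
  have tij := test_lin (-1) (tpsi i) (tpsi j); have [l [M hij]] := test_C1c tij.
  have E : (fun x => psi i x - psi j x) = fun x => psi i x + -1 * psi j x.
    by apply/funext => x; rewrite mulN1r.
  rewrite E; apply: le_trans (HC l M _ hij) _; rewrite ler_wpM2l ?(ltW C0)//.
  have [hi1 hi2] := Hpsi i; have [hj1 hj2] := Hpsi j.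
  have [h3 h4] := LwD2 (ltW p1) hj1 hi1.
  have g1 x : grad (fun x => psi i x + -1 * psi j x) x = grad (psi i) x - grad (psi j) x.
    have [li [Mi [_ hi _]]] := test_C1c (tpsi i); have [lj [Mj [_ hj _]]] := test_C1c (tpsi j).
    by rewrite grad_lin// scaleN1r.
  have [h5 h6] : Lw (- (p * b)) p (gnorm (grad (fun x => psi i x + -1 * psi j x))) /\
     wn (- (p * b)) p (gnorm (grad (fun x => psi i x + -1 * psi j x))) <= 1 `^ p * wn (- (p * b)) p
       (fun x => gnorm (fun x => G x - grad (psi j) x) x + gnorm (fun x => G x - grad (psi i) x) x).
    apply: (Lw_le (ltW p0) ler01 _ _ h3); first exact: (lgrad _ 0 tij).1.
    apply: aeW => x; rewrite mul1r /gnorm g1 !ger0_norm ?addr_ge0 ?l2norm_ge0//.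
    rewrite -[l2norm (G x - grad (psi i) x)]l2normN; apply: le_trans (l2normD _ _).
    by rewrite opprB [X in _ <= l2norm X]addrC addrA subrK.
  have -> : intH p b (fun x => psi i x + -1 * psi j x) =
      wn (- (p * b)) p (gnorm (grad (fun x => psi i x + -1 * psi j x))).
    by apply: eq_Rintegral => x _; rewrite wfun_gnorm.
  apply: le_trans h6 _; rewrite powR1 mul1r; apply: le_trans h4 _.
  by rewrite ler_wpM2l ?powR_ge0// lerD.
pose K := C * (2 `^ (p - 1) * 2) + 1.
have K0 : 0 <= K by rewrite addr_ge0// mulr_ge0 ?(ltW C0)// mulr_ge0 ?powR_ge0.
have du j : Lw (- (p * (b + 1))) p (fun x => u x - psi j x) /\
    wn (- (p * (b + 1))) p (fun x => u x - psi j x) <= K * j.+1%:R^-1.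
  (* Starting the sequence at [j] keeps the distance between its terms and [psi j] of order
     [1 / (j + 1)]. *)
  apply: (@Lw_fatou R n _ p _ (fun i x => psi (i + j)%N x - psi j x)) => //.
  - by apply: measurable_funB => //; exact: (lpsi j 0).1.
  - by move=> i; exact: (LwB2 (ltW p1) (lpsi _ _) (lpsi _ _)).1.
  - move=> i; apply: le_trans (diff _ _) _; rewrite /K mulrDl -!mulrA ler_wpDr ?mul1r ?invr_ge0//.
    rewrite ler_wpM2l ?(ltW C0)// ler_wpM2l ?powR_ge0// mulr2n mulrDl mul1r lerD//.
    by rewrite lef_pV2 ?posrE// ler_nat ltnS leq_addl.
  - apply: filterS ae => x ax; apply: cvgB; last exact: cvg_cst.
    by rewrite (cvg_shiftn j (fun i => psi i x)).
exists G, psi; split => //.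
  have [h1 _] := LwD2 (ltW p1) (du 0%N).1 (lpsi 0%N _).
  by move: h1; rewrite (_ : (fun x => _) = u)//; apply/funext => x; rewrite subrK.
exists K; first exact: K0.
move=> j; have [h1 h2] := Hpsi j; have [h3 h4] := du j; split; [exact: h1| |exact: h3|exact: h4].
apply: le_trans h2 _; rewrite /K mulrDl mul1r lerDr mulr_ge0 ?invr_ge0//.
by rewrite mulr_ge0 ?(ltW C0)// mulr_ge0 ?powR_ge0.
Qed.

Lemma small_quotient (A e : R) : 0 <= A -> 0 < e -> exists j : nat, A * j.+1%:R^-1 <= e.
Proof.
move=> A0 e0; exists (Num.trunc (A / e)).
rewrite ler_pdivrMr ?ltr0n// [leRHS]mulrC -ler_pdivrMr//.
exact: ltW (Num.Theory.truncnS_gt _).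
Qed.

Lemma density_arith (M P c1 c2 v x1 x2 x3 x4 r e : R) : 0 <= M -> 0 <= P -> 0 <= c1 ->
  0 <= c2 -> 0 <= v -> 0 <= x1 -> 0 <= x2 -> 0 <= x3 -> 0 <= x4 -> 0 <= r ->
  (M * (c1 + P * c2) + P * r + P * c1) * v <= e / 2 ->
  M * (x1 + P * x2) + P * x3 + P * x4 <= e / 2 ->
  [/\ M * (c1 * v + (x1 + P * (x2 + c2 * v))) <= e, P * (r * v + x3) <= e &
     P * (c1 * v + x4) <= e].
Proof.
move=> M0 P0 c10 c20 v0 x10 x20 x30 x40 r0.
have f1 := mulr_ge0 M0 (addr_ge0 x10 (mulr_ge0 P0 x20)).
have f2 := mulr_ge0 P0 x30; have f3 := mulr_ge0 P0 x40.
have f4 := mulr_ge0 (mulr_ge0 M0 (addr_ge0 c10 (mulr_ge0 P0 c20))) v0.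
have f5 := mulr_ge0 (mulr_ge0 P0 r0) v0; have f6 := mulr_ge0 (mulr_ge0 P0 c10) v0.
by move: f1 f2 f3 f4 f5 f6; clear; move=> *; split; lra.
Qed.

Lemma lim4 (c d : R) (f1 f2 f3 f4 : nat -> R) :
  f1 k @[k --> \oo] --> (0 : R) -> f2 k @[k --> \oo] --> (0 : R) ->
  f3 k @[k --> \oo] --> (0 : R) -> f4 k @[k --> \oo] --> (0 : R) ->
  c * (f1 k + d * f2 k) + d * f3 k + d * f4 k @[k --> \oo] --> (0 : R).
Proof.
move=> h1 h2 h3 h4.
have cM (r : R) (f : nat -> R) (l : R) : f k @[k --> \oo] --> l -> r * f k @[k --> \oo] --> r * l.
  by move=> h; apply: cvgM h; exact: cvg_cst.
rewrite -[X in _ --> X](_ : c * (0 + d * 0) + d * 0 + d * 0 = 0); last by rewrite !(mulr0, addr0).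
exact: cvgD (cvgD (cM c (fun k => f1 k + d * f2 k) _ (cvgD h1 (cM d f2 0 h2))) (cM d f3 0 h3)) (cM d f4 0 h4).
Qed.

Lemma continuous_dcutf (s : R) : continuous (dcutf s).
Proof.
move=> t; have cid : {for t, continuous (fun t : R => t)} by [].
have c1 : {for t, continuous (fun t : R => t / s - 1)}.
  exact: continuousB (continuousM cid (@cst_continuous _ _ (s^-1) t)) (@cst_continuous _ _ (1 : R) t).
have c2 : {for t, continuous (fun t : R => 1 - t * s)}.
  exact: continuousB (@cst_continuous _ _ (1 : R) t) (continuousM cid (@cst_continuous _ _ s t)).
have d1 (q : {poly R}) : {for t, continuous (fun t : R => bumpq q (t / s - 1))}.
  by apply: (@continuous_comp _ _ _ (fun t : R => t / s - 1) (bumpq q)); [exact: c1|exact: continuous_bumpq].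
have d2 (q : {poly R}) : {for t, continuous (fun t : R => bumpq q (1 - t * s))}.
  by apply: (@continuous_comp _ _ _ (fun t : R => 1 - t * s) (bumpq q)); [exact: c2|exact: continuous_bumpq].
have e1 := continuousM (d1 1) (continuousM (d2 'X^2) (@cst_continuous _ _ (- s) t)).
have e2 := continuousM (d2 1) (continuousM (d1 'X^2) (@cst_continuous _ _ s^-1 t)).
exact: (continuousM (@cst_continuous _ _ (expR 1 : R) t) (continuousD e1 e2)).
Qed.

(* psi_j approximates u in the gradient norm only; cutting it off makes the weight |x|^(- p a)
   comparable with the Hardy weight |x|^(- p (b + 1)) *)
Lemma density p a b u : (0 < n)%N -> 1 < p -> n%:R != p * (b + 1) -> a < b + 1 ->
  spaceH p b u -> spaceL p a u ->
  exists2 G, [/\ is_weak_gradient u G, Lw (- (p * b)) p (gnorm G),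
    Lw (- (p * (b + 1))) p u & Lw (- (p * a)) p u] &
  forall e : R, 0 < e -> exists w, [/\ test_fun w,
    wn (- (p * b)) p (gnorm (fun x => G x - grad w x)) <= e,
    wn (- (p * a)) p (fun x => u x - w x) <= e &
    wn (- (p * (b + 1))) p (fun x => u x - w x) <= e].
Proof.
move=> n0 p1 npb ab hH hL; have p0 : 0 < p by lra.
have la := spaceL_Lw n0 (ltW p1) hL.
have [G [psi [hG lG lu tpsi [K K0 Hpsi]]]] := spaceH_hardy n0 p1 npb hH.
exists G; first by [].
have [Cd Cd0 HCd] := @dchi_bounded R n.
have e10 : 0 < expR 1 :> R := expR_gt0 _.
have cchi k : continuous (@chi R n k) by have [] := smooth_hasC1 (@smooth_chi R n k).
have mchi k : measurable_fun setT (@chi R n k) by exact: continuous_measurable_rV.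
have xi1 k : measurable_fun setT (fun x => 1 - @chi R n k x) by exact: measurable_funB.
have xi1b k (x : 'rV[R]_n) : x != 0 -> `|1 - chi k x| <= 1 + expR 1.
  move=> _; apply: le_trans (ler_normB _ _) _; rewrite normr1 lerD2l.
  by rewrite ger0_norm ?chi_ge0// chi_le.
have xi1c (x : 'rV[R]_n) : x != 0 -> 1 - chi k x @[k --> \oo] --> (0 : R).
  by move=> x0; rewrite -[0 in X in _ --> X](subrr 1); apply: cvgB (chi_cvg x0); exact: cvg_cst.
have xi2 k : measurable_fun setT (fun x => sqn x * @dchi R n k x).
  apply: measurable_funM; first exact: continuous_measurable_rV (@continuous_sqn R n).
  apply: measurable_funM => //.
  apply: continuous_measurable_rV => x.
  apply: (@continuous_comp _ _ _ (@sqn R n) (dcutf k.+1%:R^-1)); first exact: continuous_sqn.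
  exact: continuous_dcutf.
have xi2c (x : 'rV[R]_n) : x != 0 -> sqn x * dchi k x @[k --> \oo] --> (0 : R) by exact: dchi_cvg.
have [LA2 A2] := Lw_dominated n0 p0 (addr_ge0 ler01 (ltW e10)) lG xi1 xi1b xi1c.
have [LA3 A3] := Lw_dominated n0 p0 Cd0 lu xi2 (fun k x _ => HCd k x) xi2c.
have [LB B] := Lw_dominated n0 p0 (addr_ge0 ler01 (ltW e10)) la xi1 xi1b xi1c.
have [LD D] := Lw_dominated n0 p0 (addr_ge0 ler01 (ltW e10)) lu xi1 xi1b xi1c.
have [M4 M4E] : exists M4 : R, M4 = 4 `^ (p - 1) by eexists.
have [P PE] : exists P : R, P = 2 `^ (p - 1) by eexists.
have [c1 c1E] : exists c1 : R, c1 = expR 1 `^ p by eexists.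
have [c2 c2E] : exists c2 : R, c2 = Cd `^ p by eexists.
have M40 : 0 <= M4 by rewrite M4E powR_ge0.
have P0 : 0 <= P by rewrite PE powR_ge0.
have c10 : 0 <= c1 by rewrite c1E powR_ge0.
have c20 : 0 <= c2 by rewrite c2E powR_ge0.
move=> e e0.
pose a2 k := wn (- (p * b)) p (fun x => (1 - @chi R n k x) * gnorm G x).
pose a3 k := wn (- (p * (b + 1))) p (fun x => sqn x * @dchi R n k x * u x).
pose bk k := wn (- (p * a)) p (fun x => (1 - @chi R n k x) * u x).
pose dk k := wn (- (p * (b + 1))) p (fun x => (1 - @chi R n k x) * u x).
have X0 : M4 * (a2 k + P * a3 k) + P * bk k + P * dk k @[k --> \oo] --> (0 : R).
  exact: lim4 A2 A3 B D.
(* The cut-off index [k] is fixed before the approximation index [j], because the constant [Rk] in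
   the comparison of weights on the support of [chi k] depends on [k]. *)
have [k Xk] : exists k, M4 * (a2 k + P * a3 k) + P * bk k + P * dk k <= e / 2.
  have /cvgr_lt/(_ (e / 2)) := X0; rewrite divr_gt0// => /(_ isT) H.
  by have [k hk] := filter_ex H; exists k; exact: ltW.
have [Rk Rk0 HRk] : exists2 Rk : R, 0 <= Rk & forall f : 'rV[R]_n -> R, Lw (- (p * (b + 1))) p f ->
    Lw (- (p * a)) p (fun x => chi k x * f x) /\
    wn (- (p * a)) p (fun x => chi k x * f x) <= Rk * wn (- (p * (b + 1))) p f.
  (* The weight [|x| ^ (- p a)] is [|x| ^ (p (b + 1 - a))] times the Hardy weight, and [chi k]
     vanishes for [|x| ^ 2 > k + 1]. *)
  exists (c1 * k.+1%:R `^ (p * (b + 1 - a) / 2)); first by rewrite mulr_ge0 ?powR_ge0.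
  move=> f [mf fi].
  have mcf : measurable_fun setT (fun x => chi k x * f x) by exact: measurable_funM.
  have := @rint_le R n _ _ (measurable_wfun (- (p * a)) p mcf) _
    (rintZ (c1 * k.+1%:R `^ (p * (b + 1 - a) / 2)) fi); case.
    apply: filterS (ae_neq0 n0) => x x0; rewrite wfun_ge0/= /wfun.
    have r0 : 0 < l2norm x by rewrite l2norm_gt0.
    have [t1|t1] := ltP (k.+1%:R) (sqn x).
      have -> : chi k x = 0.
        by apply: cutf0r; rewrite ?invr_gt0// div1r invrK.
      rewrite mul0r normr0 powR0 ?gt_eqF// mulr0.
      by rewrite !mulr_ge0 ?powR_ge0.
    rewrite normrM powRM// (_ : - (p * a) = p * (b + 1 - a) + - (p * (b + 1))); last by ring.
    rewrite (powRD_gt0 _ _ r0) l2norm_powR.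
    have h1 : sqn x `^ (p * (b + 1 - a) / 2) <= k.+1%:R `^ (p * (b + 1 - a) / 2).
      apply: ge0_ler_powR; rewrite ?nnegrE ?sqn_ge0//.
      by rewrite divr_ge0// mulr_ge0 ?(ltW p0)// subr_ge0 ltW.
    have h2 : `|chi k x| `^ p <= c1.
      by rewrite c1E ge0_ler_powR ?nnegrE ?(ltW p0) ?(ltW e10)// ger0_norm ?chi_ge0 ?chi_le.
    have h3 := ler_pM (powR_ge0 _ _) (powR_ge0 _ _) h2 h1.
    have w0 : 0 <= l2norm x `^ (- (p * (b + 1))) * `|f x| `^ p by rewrite mulr_ge0 ?powR_ge0.
    have := ler_wpM2r w0 h3; congr (_ <= _); ring.
  move=> h1 h2; split; first exact: conj mcf h1.
  by apply: le_trans h2 _; rewrite rintegralZ.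
pose Y := M4 * (c1 + P * c2) + P * Rk + P * c1.
have Y0 : 0 <= Y by rewrite !addr_ge0// ?mulr_ge0// addr_ge0// mulr_ge0.
have [j Yj] : exists j : nat, Y * (K * j.+1%:R^-1) <= e / 2.
  have e20 : 0 < e / 2 by rewrite divr_gt0.
  by have [j hj] := small_quotient (mulr_ge0 Y0 K0) e20; exists j; rewrite mulrA.
have [hd1 hd2 hh1 hh2] := Hpsi j.
have [v vE] : exists v : R, v = K * j.+1%:R^-1 by eexists.
rewrite -vE in Yj hd2 hh2.
have v0 : 0 <= v by rewrite vE mulr_ge0 ?invr_ge0.
have [Q1 Q2 Q3] := density_arith M40 P0 c10 c20 v0 (wn_ge0 _ _ _ : 0 <= a2 k)
  (wn_ge0 _ _ _ : 0 <= a3 k) (wn_ge0 _ _ _ : 0 <= bk k) (wn_ge0 _ _ _ : 0 <= dk k) Rk0 Yj Xk.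
pose w x := psi j x * chi k x.
have tw : test_fun w.
  rewrite (_ : w = fun x => chi k x * psi j x); last by apply/funext => x; rewrite /w mulrC.
  by apply: test_mulr => //; exact: smooth_chi.
have mpsi : measurable_fun setT (psi j).
  by apply: continuous_measurable_rV; have [l [M [_ []]]] := test_C1c (tpsi j).
have gw x : grad w x = psi j x *: (dchi k x *: x) + chi k x *: grad (psi j) x.
  have [l [M hpsi]] := test_C1c (tpsi j).
  have [_ ->] := C1c_mul (hasC1_off (smooth_hasC1 (@smooth_chi R n k))) hpsi.
  by congr (_ *: _ + _); apply/rowP => i; rewrite !mxE partial_chi.
exists w; split => //.
- have l1 := (LwZ (expR 1) (ltW p0) hd1).
  have l3 : Lw (- (p * (b + 1))) p (fun x => sqn x * dchi k x * psi j x) /\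
      wn (- (p * (b + 1))) p (fun x => sqn x * dchi k x * psi j x) <= P * (a3 k + c2 * v).
    have [q1 q2] : Lw (- (p * (b + 1))) p (fun x => sqn x * dchi k x * (u x - psi j x)) /\
       wn (- (p * (b + 1))) p (fun x => sqn x * dchi k x * (u x - psi j x)) <= c2 * wn (- (p * (b + 1))) p (fun x => u x - psi j x).
      rewrite c2E; apply: Lw_le => //; first exact: ltW.
        by apply: measurable_funM => //; exact: hh1.1.
      by apply: aeW => x; rewrite normrM ler_wpM2r.
    have [q3 q4] := LwB2 (ltW p1) (LA3 k) q1.
    have E : (fun x => sqn x * dchi k x * u x - sqn x * dchi k x * (u x - psi j x)) =
        fun x => sqn x * dchi k x * psi j x.
      by apply/funext => x; rewrite -mulrBr opprB addrC subrK.
    rewrite E in q3 q4; split; first exact: q3.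
    apply: le_trans q4 _; rewrite PE ler_wpM2l ?powR_ge0// lerD2l; apply: le_trans q2 _.
    by rewrite ler_wpM2l.
  have [l4 l5] := Lw_inv n0 l3.1.
  have nB (f : 'rV[R]_n -> R) s : Lw s p f -> Lw s p (fun x => `|f x|) /\ wn s p (fun x => `|f x|) = wn s p f.
    move=> [mf fi]; have E : wfun s p (fun x => `|f x|) = wfun s p f.
      by apply/funext => x; rewrite /wfun normr_id.
    by rewrite /wn E; split => //; split; [exact: measurableT_comp|rewrite E].
  have [n1 m1] := nB _ _ (LA2 k); have [n2 m2] := nB _ _ l4.
  have mgw : measurable_fun setT (gnorm (fun x => G x - grad w x)).
    apply: (@measurable_gnorm R n (fun x => u x + -1 * w x)).
    have := weak_gradient_lin (-1) hG (test_weak_gradient tw).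
    by rewrite (_ : (fun x => G x + -1 *: grad w x) = (fun x => G x - grad w x))//;
      apply/funext => x; rewrite scaleN1r.
  have bnd x : x != 0 -> `|gnorm (fun x => G x - grad w x) x| <=
      expR 1 * gnorm (fun x => G x - grad (psi j) x) x + (`|(1 - chi k x) * gnorm G x| +
      `|(l2norm x)^-1 * (sqn x * dchi k x * psi j x)|).
    move=> x0.
    rewrite /gnorm gw ger0_norm ?l2norm_ge0//.
    have r0 : 0 < l2norm x by rewrite l2norm_gt0.
    (* Three errors: approximation of the gradient, its truncation, and the gradient of the cut-off,
       which the Hardy norm controls. *)
    have -> : G x - (psi j x *: (dchi k x *: x) + chi k x *: grad (psi j) x) =
        chi k x *: (G x - grad (psi j) x) + ((1 - chi k x) *: G x - (psi j x * dchi k x) *: x).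
      by apply/rowP => i; rewrite !mxE; ring.
    apply: le_trans (l2normD _ _) _; apply: lerD.
      rewrite l2normZ (ger0_norm (chi_ge0 k x)); apply: ler_wpM2r; [exact: l2norm_ge0|exact: chi_le].
    apply: le_trans (l2normD _ _) _; apply: lerD.
      by rewrite l2normZ normrM [`|l2norm _|]ger0_norm ?l2norm_ge0.
    rewrite l2normN l2normZ !normrM normfV (ger0_norm (ltW r0)) -sqr_l2norm normrX (ger0_norm (ltW r0)).
    by rewrite le_eqVlt; apply/orP; left; apply/eqP; field; rewrite gt_eqF.
  have [_ h] := Lw_sum3 (ltW p1) mgw bnd n0 l1.1 n1 n2.
  apply: le_trans h _; rewrite l1.2 m1 m2 (ger0_norm (ltW e10)) -M4E -c1E.
  have h1 := ler_wpM2l c10 hd2; have h2 := le_trans l5 l3.2.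
  have h3 := ler_wpM2l M40 (lerD h1 (lerD (lexx (a2 k)) h2)).
  exact: le_trans h3 Q1.
- have [l1 e1] := HRk _ hh1; have [_ h] := LwD2 (ltW p1) l1 (LB k).
  rewrite (_ : (fun x => u x - w x) = fun x => chi k x * (u x - psi j x) + (1 - chi k x) * u x); last first.
    by apply/funext => x; rewrite /w; ring.
  apply: le_trans h _; rewrite -PE -/(bk k).
  have h2 := ler_wpM2l Rk0 hh2; have h3 := ler_wpM2l P0 (lerD (le_trans e1 h2) (lexx (bk k))).
  exact: le_trans h3 Q2.
- have [l1 e1] : Lw (- (p * (b + 1))) p (fun x => chi k x * (u x - psi j x)) /\
      wn (- (p * (b + 1))) p (fun x => chi k x * (u x - psi j x)) <= c1 * wn (- (p * (b + 1))) p (fun x => u x - psi j x).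
    rewrite c1E; apply: (Lw_le (ltW p0) (ltW e10)) => //.
      by apply: measurable_funM => //; exact: hh1.1.
    by apply: aeW => x; rewrite normrM ler_wpM2r// ger0_norm ?chi_ge0 ?chi_le.
  have [_ h] := LwD2 (ltW p1) l1 (LD k).
  rewrite (_ : (fun x => u x - w x) = fun x => chi k x * (u x - psi j x) + (1 - chi k x) * u x); last first.
    by apply/funext => x; rewrite /w; ring.
  apply: le_trans h _; rewrite -PE -/(dk k).
  have h2 := ler_wpM2l c10 hh2; have h3 := ler_wpM2l P0 (lerD (le_trans e1 h2) (lexx (dk k))).
  exact: le_trans h3 Q3.
Qed.
End density.

(** * Local estimates and the extremal profile *)

Section local_estimates.
Context {R : realType} {n : nat}.
Implicit Types (u f g : 'rV[R]_n -> R) (x : 'rV[R]_n).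
Local Notation mu := (lebesgue_rV R n).

Definition zn l M p f : R := \int[mu]_x (\1_(annulus l M) x * `|f x| `^ p).

Lemma measurable_norm_powR p f : measurable_fun setT f ->
  measurable_fun setT (fun x => `|f x| `^ p).
Proof.
move=> mf; apply: (@measurableT_comp _ _ _ _ _ _ (fun r : R => r `^ p)).
  exact: measurable_powR.
exact: measurableT_comp.
Qed.

Lemma zn_rint l M p f : measurable_fun setT f -> rint mu (wfun 0 p f) ->
  rint mu (fun x => \1_(annulus l M) x * `|f x| `^ p).
Proof.
move=> mf fi.
have := @rint_le R n (fun x => \1_(annulus l M) x * `|f x| `^ p) (wfun 0 p f); case => //.
- apply: measurable_funM; first by apply: measurable_indic; exact: measurable_annulus.
  exact: measurable_norm_powR.
- apply: aeW => x; rewrite /wfun powRr0 ler_wpM2r ?powR_ge0// ?indicE ?mulr_ge0 ?powR_ge0//.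
Qed.

(** Since [s] lies strictly between [s1] and [s2], the weight is small against [|x| ^ s1] near 0 and
    against [|x| ^ s2] near infinity; the radii [d1] and [1 / d2] mark where the ratios reach [e] at
    most. *)
Lemma weight_interpolation (s s1 s2 e : R) : s1 < s -> s < s2 -> 0 < e ->
  exists l M C : R, [/\ 0 < l, 0 <= C & forall x, x != 0 ->
    l2norm x `^ s <= e * l2norm x `^ s1 + (e * l2norm x `^ s2 + C * \1_(annulus l M) x)].
Proof.
move=> s1s ss2 e0.
have [d1 d10 H1] := powR_root (ltac:(by rewrite subr_gt0) : 0 < s - s1) e0.
have [d2 d20 H2] := powR_root (ltac:(by rewrite subr_gt0) : 0 < s2 - s) e0.
exists (d1 ^+ 2), d2^-1, (d1 `^ s + d2^-1 `^ s); split.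
- by rewrite exprn_gt0.
- by rewrite addr_ge0 ?powR_ge0.
move=> x x0; have r0 : 0 < l2norm x by rewrite l2norm_gt0.
have i0 : 0 <= \1_(annulus (d1 ^+ 2) d2^-1) x :> R by rewrite indicE; case: (_ \in _).
have c0 : 0 <= d1 `^ s + d2^-1 `^ s by rewrite addr_ge0 ?powR_ge0.
have w1 := mulr_ge0 (ltW e0) (powR_ge0 (l2norm x) s1).
have w2 := mulr_ge0 (ltW e0) (powR_ge0 (l2norm x) s2).
have w3 := mulr_ge0 c0 i0.
have [h|h] := lerP (l2norm x) d1.
  apply: ler_wpDr; first exact: addr_ge0.
  rewrite (_ : l2norm x `^ s = l2norm x `^ (s - s1) * l2norm x `^ s1); last by rewrite -powRD_gt0// subrK.
  by rewrite ler_wpM2r ?powR_ge0// H1// ltW.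
have [h2|h2] := lerP (l2norm x)^-1 d2.
  apply: ler_wpDl => //; apply: ler_wpDr => //.
  rewrite (_ : l2norm x `^ s = (l2norm x)^-1 `^ (s2 - s) * l2norm x `^ s2).
    by rewrite ler_wpM2r ?powR_ge0// H2// invr_ge0 ltW.
  rewrite -powR_inv1 ?(ltW r0)// -powRrM -powRD_gt0//; congr (_ `^ _); ring.
apply: ler_wpDl => //; apply: ler_wpDl => //.
have rd : l2norm x <= d2^-1 by rewrite -[leLHS]invrK lef_pV2 ?posrE ?invr_gt0// ltW.
rewrite indicE mem_set ?mulr1.
  have [s0|s0] := lerP 0 s.
    by apply: ler_wpDl; [exact: powR_ge0|rewrite ge0_ler_powR ?nnegrE ?(ltW r0) ?invr_ge0 ?(ltW d20)].
  apply: ler_wpDr; first exact: powR_ge0.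
  rewrite -[s]opprK !(powRN _ (- s)) lef_pV2 ?posrE ?powR_gt0//.
  by rewrite ge0_ler_powR ?nnegrE ?oppr_ge0 ?(ltW s0) ?(ltW r0) ?(ltW d10) ?(ltW h).
split => /=; first by rewrite -sqr_l2norm ler_sqr ?nnegrE ?(ltW r0) ?(ltW d10)// ltW.
by move=> i; apply: le_trans (l2norm_coord x i) rd.
Qed.

(** The condition [a < b + 1] puts c strictly between [a] and [b + 1], so the integral with exponent
    c is a small part of the energy, by Hardy, plus the mass on an annulus. *)
Lemma energy_local p a b S0 al : (0 < n)%N -> 2 <= p -> 0 < S0 -> n%:R != p * (b + 1) -> a < b + 1 ->
  (forall e : R, 0 < e -> exists2 C : R, 0 <= C & forall l M u, C1c l M u ->
    intH p b u + (p - 1) * intL p a u <= p * S0 * intL p (CKN_exponent p a b) u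
      + e * intL p a u + C * intD p b (kern al 1 a b) u) ->
  exists l0 M0 C : R, [/\ 0 < l0, 0 <= C & forall l M u, C1c l M u ->
    intH p b u + (p - 1) * intL p a u <= C * (intD p b (kern al 1 a b) u + zn l0 M0 p u)].
Proof.
move=> n0 p2 S00 npb ab HU; have p1 : 1 < p by lra.
have p0 : 0 < p by lra.
have [CH CH0 hh] := hardy p1 npb.
have cE := @CKN_exponentE R p a b (lt0r_neq0 p0).
(* This makes [p * S0 * e] and [p * S0 * e * CH] at most 1/4. Together with the 1/4 taken in the
   reverse expansion, at most half of the energy is absorbed, as [p - 1 >= 1]. *)
pose e := (4 * (p * S0) * (1 + CH))^-1.
have pS : 0 < p * S0 by rewrite mulr_gt0.
have e0 : 0 < e by rewrite invr_gt0 !mulr_gt0// addr_gt0.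
have [||l0 [M0 [C2 [l00 C20 Hw]]]] := @weight_interpolation (- (p * CKN_exponent p a b)) (- (p * (b + 1))) (- (p * a)) e _ _ e0.
- rewrite cE ltrN2; have : 0 < (p - 1) * (b + 1 - a) by rewrite mulr_gt0// subr_gt0.
  by clear; lra.
- by rewrite cE ltrN2; move: ab; clear; lra.
have [C1 C10 H1] := HU 4^-1 ltac:(by rewrite invr_gt0).
exists l0, M0, (2 * (p * S0 * C2 + C1)); split; first exact: l00.
  by rewrite mulr_ge0// addr_ge0// mulr_ge0// ltW.
move=> l M u hu.
have iW s : rint mu (wfun s p u) by exact: C1c_int_fun p0 hu.
have mu_ : measurable_fun setT u by apply: continuous_measurable_rV; have [_ []] := hu.
have iZ := zn_rint l0 M0 mu_ (iW 0).
have LC : intL p (CKN_exponent p a b) u <=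
    e * intL p (b + 1) u + (e * intL p a u + C2 * zn l0 M0 p u).
  have i1 := rintZ e (iW (- (p * (b + 1)))); have i2 := rintZ e (iW (- (p * a))).
  have i3 := rintZ C2 iZ.
  have ptw x : x != 0 -> wfun (- (p * CKN_exponent p a b)) p u x <=
      e * wfun (- (p * (b + 1))) p u x + (e * wfun (- (p * a)) p u x +
      C2 * (\1_(annulus l0 M0) x * `|u x| `^ p)).
    have alg2 (w w1 w2 z v : R) : 0 <= v -> w <= e * w1 + (e * w2 + C2 * z) ->
        w * v <= e * (w1 * v) + (e * (w2 * v) + C2 * (z * v)).
      by move=> v0 h; have := ler_wpM2r v0 h; rewrite !mulrDl !mulrA.
    by move=> x0; exact: alg2 (powR_ge0 _ _) (Hw x x0).
  have le := rintegral_le n0 (iW (- (p * CKN_exponent p a b))) (rintD i1 (rintD i2 i3)) ptw.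
  apply: (le_trans le); rewrite rintegralD ?rintegralZ//; last exact: rintD.
  by rewrite rintegralD ?rintegralZ//.
have H2 := H1 l M u hu; have H3 := hh l M u hu.
have D0 : 0 <= intD p b (kern al 1 a b) u := wint_ge0 _ _ _.
have H0 : 0 <= intH p b u := wint_ge0 _ _ _; have A0 : 0 <= intL p a u := wint_ge0 _ _ _.
have Z0 : 0 <= zn l0 M0 p u.
  by apply: Rintegral_ge0 => x _; rewrite indicE mulr_ge0 ?powR_ge0.
have alg (y C : R) : 0 < y -> 0 < C -> y * (4 * y * (1 + C))^-1 <= 4^-1 /\ y * (4 * y * (1 + C))^-1 * C <= 4^-1.
  clear => y0 C0; have C1 : 0 < 1 + C by rewrite addr_gt0.
  have -> : y * (4 * y * (1 + C))^-1 = 4^-1 / (1 + C) by field; rewrite !gt_eqF.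
  split; first by rewrite ler_pdivrMr// ler_peMr// lerDl ltW.
  by rewrite mulrAC ler_pdivrMr// ler_wpM2l// lerDr.
have [pe peC] := alg _ _ pS CH0; rewrite -/e in pe peC.
have H4 := ler_wpM2l (ltW pS) LC.
have H5 := ler_wpM2l (mulr_ge0 (ltW pS) (ltW e0)) H3.
have H6 := ler_wpM2r H0 peC; have H7 := ler_wpM2r A0 pe.
have H8 := mulr_ge0 (mulr_ge0 (ltW pS) C20) D0; have H9 := mulr_ge0 C10 Z0.
have H10 : 0 <= (p - 2) * intL p a u by rewrite mulr_ge0// subr_ge0.
move: H0 H2 H4 H5 H6 H7 H8 H9 H10; move: (intH p b u) (intL p a u) (intL p (b + 1) u)
  (intL p (CKN_exponent p a b) u) (zn l0 M0 p u) (intD p b _ u) => h A B L Z D.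
clear; lra.
Qed.

(** The extremal profile at scale lambda = 1; [g] stands for [b + 1 - a]. *)
Definition prof (al g : R) x : R := l2norm x `^ al * expR (- (l2norm x `^ g / g)).

Lemma prof_gt0 (al g : R) x : x != 0 -> 0 < prof al g x.
Proof. by move=> x0; rewrite mulr_gt0 ?expR_gt0// powR_gt0// l2norm_gt0. Qed.

(* 1 / prof as a function of |x|^2, and its derivative *)
Definition iprof (al g t : R) : R := t `^ (- (al / 2)) * expR (t `^ (g / 2) / g).
Definition diprof (al g t : R) : R :=
  iprof al g t * (- (al / 2) * t `^ (- 1) + 2^-1 * t `^ (g / 2 - 1)).

Lemma is_derive_iprof (al g t : R) : 0 < g -> 0 < t -> is_derive t 1 (iprof al g) (diprof al g t).
Proof.
move=> g0 t0; have d1 := is_derive1_powR (- (al / 2)) t0.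
have d2 := is_deriveZ g^-1 (is_derive1_powR (g / 2) t0).
have d3 := is_derive_chain d2 (is_derive_expR _).
have [D1 D2] := is_deriveM d1 d3.
have -> : iprof al g = (fun t => t `^ (- (al / 2))) * (expR \o g^-1 \*: (fun t => t `^ (g / 2))).
  apply/funext => r; change (r `^ (- (al / 2)) * expR (r `^ (g / 2) / g) =
    r `^ (- (al / 2)) * expR (g^-1 * r `^ (g / 2))).
  by rewrite [g^-1 * _]mulrC.
apply: (DeriveDef D1); apply: (etrans D2).
change (t `^ (- (al / 2)) * (expR (g^-1 * t `^ (g / 2)) * (g^-1 * (g / 2 * t `^ (g / 2 - 1)))) +
  expR (g^-1 * t `^ (g / 2)) * (- (al / 2) * t `^ (- (al / 2) - 1)) = diprof al g t).
rewrite /diprof /iprof [g^-1 * t `^ (g / 2)]mulrC.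
rewrite (powRD_gt0 (- (al / 2)) (-1) t0).
move: (t `^ _) (t `^ _) (t `^ _) (expR _) => *; field; by rewrite gt_eqF.
Qed.

Lemma continuous_diprof (al g t : R) : 0 < g -> 0 < t -> {for t, continuous (diprof al g)}.
Proof.
move=> g0 t0; have cm : {for t, continuous (iprof al g)}.
  by apply: differentiable_continuous; apply/derivable1_diffP; have [] := is_derive_iprof al g0 t0.
have k1 := @continuous_powR R (- 1) t t0; have k2 := @continuous_powR R (g / 2 - 1) t t0.
exact: continuousM cm (continuousD (continuousM (@cst_continuous _ _ (- (al / 2) : R) t) k1)
  (continuousM (@cst_continuous _ _ (2^-1 : R) t) k2)).
Qed.

Lemma iprof_ge0 (al g t : R) : 0 <= iprof al g t.
Proof. by rewrite mulr_ge0 ?powR_ge0 ?expR_ge0. Qed.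

(** Radius of a ball around the origin containing the cube of half-side [M]. *)
Definition crad (M : R) : R := Num.sqrt (n%:R * M ^+ 2).

Lemma crad_ge0 M : 0 <= crad M.
Proof. exact: sqrtr_ge0. Qed.

Lemma l2norm_crad M x : 0 < M -> cube n M x -> l2norm x <= crad M.
Proof.
move=> M10 xM; rewrite /l2norm ler_wsqrtr//.
apply: (@le_trans _ _ (\sum_(i < n) M ^+ 2)); last by rewrite sumr_const card_ord mulr_natl.
by apply: ler_sum => i _; rewrite -real_normK ?num_real// ler_sqr ?nnegrE ?(ltW M10)//; exact: xM.
Qed.

Lemma sqn_powR x (q : R) : sqn x `^ q = l2norm x `^ (2 * q).
Proof. by rewrite l2norm_powR; congr (_ `^ _); field. Qed.

Lemma iprofK (al g : R) x : x != 0 -> iprof al g (sqn x) * prof al g x = 1.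
Proof.
move=> x0; have r0 : 0 < l2norm x by rewrite l2norm_gt0.
rewrite /iprof /prof !sqn_powR mulrACA -powRD_gt0// -expRD.
rewrite (_ : 2 * (g / 2) = g); last by field.
by rewrite (_ : 2 * - (al / 2) + al = 0) ?powRr0 ?subrr ?expR0 ?mulr1//; field.
Qed.

(** Here [b - al >= 0] enters: [1 / prof] is [|x| ^ (b - al)] times [|x| ^ (- b)] times an
    exponential, and all but the middle factor are bounded on the cube. The unweighted gradient of
    [u / prof] is thereby controlled up to the origin. *)
Lemma iprof_le (p b al g M : R) x : 0 < p -> 0 < g -> 0 < M -> 0 <= b - al -> x != 0 -> cube n M x ->
  iprof al g (sqn x) `^ p <=
  (crad M `^ (b - al) * expR (crad M `^ g / g)) `^ p * l2norm x `^ (- (p * b)).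
Proof.
move=> p0 g0 M0 bal x0 xM; have r0 : 0 < l2norm x by rewrite l2norm_gt0.
have rR := l2norm_crad M0 xM; have R00 := crad_ge0 M.
rewrite (_ : l2norm x `^ (- (p * b)) = (l2norm x `^ (- b)) `^ p); last first.
  by rewrite -powRrM; congr (_ `^ _); ring.
rewrite -powRM ?mulr_ge0 ?powR_ge0 ?expR_ge0//.
apply: ge0_ler_powR; rewrite ?nnegrE ?iprof_ge0 ?mulr_ge0 ?powR_ge0 ?expR_ge0 ?(ltW p0)//.
rewrite /iprof !sqn_powR (_ : 2 * (g / 2) = g); last by field.
rewrite (_ : 2 * - (al / 2) = (b - al) + - b); last by field.
rewrite (powRD_gt0 (b - al) (- b) r0).
have gg : l2norm x `^ g <= crad M `^ g.
  by apply: ge0_ler_powR rR; rewrite ?nnegrE ?l2norm_ge0 ?(ltW g0).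
have k1 : l2norm x `^ (b - al) <= crad M `^ (b - al).
  by apply: ge0_ler_powR rR; rewrite ?nnegrE ?l2norm_ge0.
have k2 : expR (l2norm x `^ g / g) <= expR (crad M `^ g / g).
  by rewrite ler_expR ler_wpM2r// invr_ge0 ltW.
have alg (A B E C F : R) : 0 <= A -> 0 <= E -> 0 <= B -> A <= C -> E <= F -> A * B * E <= C * F * B.
  by move=> A0 E0 B0 AC EF; rewrite mulrAC; apply: (ler_wpM2r B0); exact: ler_pM.
exact: alg (powR_ge0 _ _) (expR_ge0 _) (powR_ge0 _ _) k1 k2.
Qed.

Lemma prof_le (p al g l0 M : R) x : 0 < p -> 0 < g -> 0 < M -> 0 < l0 -> l0 <= sqn x -> cube n M x ->
  prof al g x `^ p <= (Num.sqrt l0 `^ al + crad M `^ al) `^ p.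
Proof.
move=> p0 g0 M0 l00 lx xM.
have x0 : x != 0 by rewrite -sqn_eq0 gt_eqF// (lt_le_trans l00).
have r0 : 0 < l2norm x by rewrite l2norm_gt0.
have rR := l2norm_crad M0 xM; have R00 := crad_ge0 M.
have lr : Num.sqrt l0 <= l2norm x by rewrite ler_wsqrtr.
have sl0 : 0 < Num.sqrt l0 by rewrite sqrtr_gt0.
apply: ge0_ler_powR; rewrite ?nnegrE ?addr_ge0 ?powR_ge0 ?(ltW p0) ?(ltW (prof_gt0 _ _ x0))//.
apply: (@le_trans _ _ (l2norm x `^ al)).
  by rewrite ler_piMr ?powR_ge0// -expR0 ler_expR oppr_le0 divr_ge0 ?powR_ge0// ltW.
have [s0|s0] := lerP 0 al.
  apply: ler_wpDl; first exact: powR_ge0.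
  by rewrite ge0_ler_powR ?nnegrE ?(ltW r0).
apply: ler_wpDr; first exact: powR_ge0.
rewrite -[al]opprK !(powRN _ (- al)) lef_pV2 ?posrE ?powR_gt0//.
by rewrite ge0_ler_powR ?nnegrE ?oppr_ge0 ?(ltW s0) ?(ltW r0) ?(ltW sl0).
Qed.

Lemma measurable_prof (al g : R) : measurable_fun setT (prof al g).
Proof.
apply: measurable_funM; first exact: measurable_l2normX.
apply: measurableT_comp => //; apply: measurableT_comp => //.
by apply: measurable_funM => //; exact: measurable_l2normX.
Qed.

(** Poincare is applied to [w = u / prof], which vanishes near the origin and has gradient
    [(grad u + u kern x) / prof]. Multiplying [w - k] back by the profile costs a constant on the
    annulus. *)
Lemma poincare_profile p a b al l0 M0 : (0 < n)%N -> 2 <= p -> 0 <= b - al -> a < b + 1 -> 0 < l0 ->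
  exists2 C : R, 0 <= C & forall l M u, C1c l M u -> forall eta : R, 0 < eta ->
  exists k : R, zn l0 M0 p (fun x => u x - k * prof al (b + 1 - a) x) <=
    C * intD p b (kern al 1 a b) u + eta.
Proof.
move=> n0 p2 bal ab l00; have p1 : 1 <= p by lra.
have p0 : 0 < p by lra.
have [g gE] : exists g : R, g = b + 1 - a by eexists.
have g0 : 0 < g by rewrite gE subr_gt0.
rewrite -gE.
(* A cube of positive side containing the annulus, whatever the sign of [M0]. *)
pose M1 := 1 + `|M0|; have M10 : 0 < M1 by rewrite ltr_pwDl.
have [Cp Cp0 HP] := @poincare_cube R n p M1 p1 M10.
pose m := iprof al g; pose R0 := crad M1; have R00 := crad_ge0 M1.
pose Cm := (R0 `^ (b - al) * expR (R0 `^ g / g)) `^ p.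
pose Cf := (Num.sqrt l0 `^ al + R0 `^ al) `^ p.
have Cm0 : 0 <= Cm by rewrite powR_ge0.
have Cf0 : 0 <= Cf by rewrite powR_ge0.
exists (Cf * (Cp * (n%:R * Cm))); first by rewrite !mulr_ge0.
move=> l M u hu eta eta0; have [l1 hC u0] := hu.
have ul x : sqn x < l -> u x = 0 by move=> h; apply: u0; left.
pose w x := u x * m (sqn x).
have Hw := hasC1_mul_radial l1 hC ul (fun t => @is_derive_iprof al g t g0)
  (fun t => @continuous_diprof al g t g0).
have [C1w Ew] := hasC1P Hw.
have [k Hk] := HP w C1w (eta / (Cf + 1)) ltac:(by rewrite divr_gt0// ltr_wpDl).
exists k.
have pw x i : x != 0 -> partial i w x = m (sqn x) * (grad u x + (u x * kern al 1 a b x) *: x) ord0 i.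
  move=> x0; have r0 : 0 < l2norm x by rewrite l2norm_gt0.
  rewrite Ew !mxE /m /diprof /kern mul1r !sqn_powR.
  rewrite (_ : 2 * (g / 2 - 1) = b - a - 1); last by rewrite gE; field.
  rewrite (_ : 2 * -1 = - 2 :> R); last by ring.
  move: (iprof _ _ _) (l2norm x `^ _) (l2norm x `^ _) (partial i u x) (u x) (x ord0 i) => *; by field.
have gb x : cube n M1 x -> \sum_i `|partial i w x| `^ p <=
    n%:R * Cm * (l2norm x `^ (- (p * b)) * l2norm (grad u x + (u x * kern al 1 a b x) *: x) `^ p).
  move=> xM; have [->|x0] := eqVneq x 0.
    rewrite big1 ?mulr_ge0 ?powR_ge0// => i _.
    have -> : partial i w 0 = 0.
      rewrite Ew (hasC1_near0 hC ul) ?sqn0// ul ?sqn0// mul0r mulr0 addr0//.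
    by rewrite normr0 powR0// gt_eqF.
  apply: (@le_trans _ _ (\sum_(i < n) Cm * (l2norm x `^ (- (p * b)) * l2norm (grad u x + (u x * kern al 1 a b x) *: x) `^ p))).
    apply: ler_sum => i _; rewrite pw// normrM powRM// mulrA (ger0_norm (iprof_ge0 _ _ _)).
    apply: ler_pM; rewrite ?powR_ge0//; first exact: (iprof_le p0 g0 M10 bal x0 xM).
    by rewrite ge0_ler_powR ?nnegrE ?l2norm_ge0 ?(ltW p0)// l2norm_coord.
  rewrite sumr_const card_ord -[leLHS]mulr_natl.
  by rewrite le_eqVlt; apply/orP; left; apply/eqP; ring.
have iD := C1c_int_grad (- (p * b)) p0 hu (fun x => @continuous_kern R n al 1 a b x).
have mf : measurable_fun setT (fun x => u x - k * prof al g x).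
  apply: measurable_funB; first by apply: continuous_measurable_rV; case: hC.
  by apply: measurable_funM => //; exact: measurable_prof.
have cw : continuous w by case: C1w.
have mz : measurable_fun setT (fun x => \1_(annulus l0 M0) x * `|u x - k * prof al g x| `^ p).
  apply: measurable_funM; first by apply: measurable_indic; exact: measurable_annulus.
  exact: measurable_norm_powR.
have mwk : measurable_fun setT (fun x => (`|w x - k| `^ p)%:E).
  apply/measurable_EFinP; have mw : measurable_fun setT (fun x => w x - k).
    by apply: measurable_funB => //; exact: continuous_measurable_rV.
  exact: measurable_norm_powR.
have le1 : (\int[mu]_x (\1_(annulus l0 M0) x * `|u x - k * prof al g x| `^ p)%:E <=
    Cf%:E * \int[mu]_(x in cube n M1) (`|w x - k| `^ p)%:E)%E.
  rewrite -ge0_integralZl; [|first [exact: measurable_cube|exact: measurable_funTS|by move=> x _; rewrite lee_fin powR_ge0|by rewrite lee_fin] ..].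
  rewrite [leRHS]integral_mkcond; apply: ge0_le_integral => //.
  - exact/measurable_EFinP.
  - by apply/(measurable_restrictT _ (measurable_cube M1)); apply: measurable_funTS; exact: measurable_funeM.
  move=> x _; rewrite patchE indicE; have [xA|xA] := boolP (x \in annulus l0 M0); last first.
    rewrite mul0r; case: ifP => // _; by rewrite lee_fin mulr_ge0 ?powR_ge0.
  have {}xA : annulus l0 M0 x by rewrite inE in xA.
  have x0 : x != 0 by have [/= lx _] := xA; rewrite -sqn_eq0 gt_eqF// (lt_le_trans l00).
  have xM1 : cube n M1 x.
    by have [_ xM] := xA; move=> i; apply: le_trans (xM i) _; apply: le_trans (ler_norm _) _; rewrite lerDr.
  rewrite ifT; last by rewrite inE.
  rewrite mul1r lee_fin.
  have -> : u x - k * prof al g x = prof al g x * (w x - k).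
    rewrite mulrBr [prof al g x * k]mulrC; congr (_ - _); by rewrite /w /m mulrCA [prof al g x * _]mulrC iprofK// mulr1.
  rewrite normrM powRM ?normr_ge0// (ger0_norm (ltW (prof_gt0 _ _ x0))); apply: ler_wpM2r; first exact: powR_ge0.
  by have [/= lx _] := xA; exact: (prof_le _ p0 g0 M10 l00 lx xM1).
have le2 : (\int[mu]_(x in cube n M1) (\sum_i `|partial i w x| `^ p)%:E <=
    (n%:R * Cm * intD p b (kern al 1 a b) u)%:E)%E.
  have i2 := rintZ (n%:R * Cm) iD.
  rewrite -rintegralZ// -EFin_Rintegral// [leLHS]integral_mkcond; apply: ge0_le_integral; first exact: measurableT.
  - by move=> x _; rewrite patchE; case: ifP => // _; rewrite lee_fin sumr_ge0// => i _; rewrite powR_ge0.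
  - apply/(measurable_restrictT _ (measurable_cube M1)); apply: measurable_funTS; apply/measurable_EFinP.
    apply: measurable_sum => i; have mp : measurable_fun setT (partial i w).
      by apply: continuous_measurable_rV; exact: (C1w.2 i).2.
    exact: measurable_norm_powR.
  - exact: measurable_int i2.
  move=> x _; rewrite patchE; case: ifP => [|_]; first by rewrite inE => xM; rewrite lee_fin gb.
  by rewrite lee_fin mulr_ge0 ?mulr_ge0 ?powR_ge0.
have fin : (\int[mu]_x (\1_(annulus l0 M0) x * `|u x - k * prof al g x| `^ p)%:E <=
    (Cf * (Cp * (n%:R * Cm)) * intD p b (kern al 1 a b) u + eta)%:E)%E.
  apply: le_trans le1 _; have Cf0E : (0 <= Cf%:E)%E by rewrite lee_fin.
  apply: le_trans (lee_wpmul2l Cf0E Hk) _.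
  apply: (@le_trans _ _ (Cf%:E * (Cp%:E * (n%:R * Cm * intD p b (kern al 1 a b) u)%:E + (eta / (Cf + 1))%:E))%E).
    by apply: lee_wpmul2l => //; apply: leeD => //; apply: lee_wpmul2l => //; rewrite lee_fin.
  rewrite -[leLHS]/((Cf * (Cp * (n%:R * Cm * intD p b (kern al 1 a b) u) + eta / (Cf + 1)))%:E) lee_fin mulrDr.
  apply: lerD; first by rewrite !mulrA.
  rewrite mulrA ler_pdivrMr ?ltr_wpDl// mulrC; apply: ler_wpM2l; first exact: ltW.
  by rewrite lerDl.
rewrite -lee_fin; apply: le_trans (fin); rewrite /zn EFin_Rintegral//.
apply/integrableP; split; first exact/measurable_EFinP.
rewrite (_ : (fun x => `|(EFin \o _) x|)%E = fun x => (\1_(annulus l0 M0) x * `|u x - k * prof al g x| `^ p)%:E).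
  by apply: le_lt_trans fin _; rewrite ltry.
by apply/funext => x /=; rewrite ger0_norm// mulr_ge0 ?powR_ge0// indicE.
Qed.
End local_estimates.

(** * Integrability of the profile and convergence of its cut-offs *)

Section profile.
Context {R : realType} {n : nat}.
Implicit Types (u f : 'rV[R]_n -> R) (x : 'rV[R]_n) (p a b al g : R).
Local Notation mu := (lebesgue_rV R n).

Definition rprof al g (t : R) : R := t `^ (al / 2) * expR (- (t `^ (g / 2) / g)).

Lemma profE al g x : prof al g x = rprof al g (sqn x).
Proof. by rewrite /prof /rprof !sqn_powR; congr (_ `^ _ * expR (- (_ `^ _ / _))); field. Qed.

Lemma rprofE al g (t : R) : 0 < t -> rprof al g t = (iprof al g t)^-1.
Proof. by move=> t0; rewrite /rprof /iprof invfM -powRN opprK expRN. Qed.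

Lemma is_derive_rprof al g (t : R) : 0 < g -> 0 < t -> is_derive t 1 (rprof al g)
  (- (rprof al g t * (- (al / 2) * t `^ (- 1) + 2^-1 * t `^ (g / 2 - 1)))).
Proof.
move=> g0 t0.
have i0 : iprof al g t != 0 by rewrite gt_eqF// mulr_gt0 ?expR_gt0 ?powR_gt0.
have := @is_deriveV R (iprof al g) t (diprof al g t) 1 i0 (is_derive_iprof al g0 t0).
rewrite [_ *: _](_ : _ = - (rprof al g t * (- (al / 2) * t `^ (- 1) + 2^-1 * t `^ (g / 2 - 1)))); last first.
  rewrite rprofE// /diprof -[LHS]/(_ * _); move: (iprof al g t) i0 (t `^ _) (t `^ _) => i i0 A B.
  by field.
apply: near_eq_is_derive.
by have := lt_nbhsr t0; apply: filterS => s s0; rewrite rprofE.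
Qed.

Lemma dk_rprof al g k : dk [set t | 0 < t] k (rprof al g).
Proof.
apply: dkM; first exact: dk_powR.
apply: (@dk_comp R [set t | 0 < t] setT k expR) => //; first exact: dk_expR.
have -> : (fun t : R => - (t `^ (g / 2) / g)) = fun t => t `^ (g / 2) * - g^-1.
  by apply/funext => t; rewrite mulrN.
by apply: dkM; [exact: dk_powR|exact: dk_cst].
Qed.

(** The gradient of the profile off the origin; the kernel is defined so that this formula holds. *)
Definition dprof al a b x : 'rV[R]_n := (- (prof al (b + 1 - a) x * kern al 1 a b x)) *: x.

Lemma prof_C1off al a b : a < b + 1 -> C1off (prof al (b + 1 - a)) (dprof al a b).
Proof.
move=> ab; have g0 : 0 < b + 1 - a by rewrite subr_gt0.
have cs := @continuous_sqn R n.
have cr (t : R) : 0 < t -> {for t, continuous (rprof al (b + 1 - a))}.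
  move=> t0; apply: differentiable_continuous; apply/derivable1_diffP.
  by have [] := is_derive_rprof al g0 t0.
have pE : prof al (b + 1 - a) = fun x => rprof al (b + 1 - a) (sqn x).
  by apply/funext => x; exact: profE.
have cp x : 0 < sqn x -> {for x, continuous (prof al (b + 1 - a))}.
  move=> x0; rewrite pE.
  by apply: (@continuous_comp _ _ _ (@sqn R n) (rprof al (b + 1 - a))); [exact: cs|exact: cr].
split; first exact: cp.
move=> i x x0; split; last first.
  have -> : (fun y : 'rV[R]_n => dprof al a b y ord0 i) =
      fun y => - (prof al (b + 1 - a) y * kern al 1 a b y) * y ord0 i.
    by apply/funext => y; rewrite mxE.
  have k1 := continuousM (cp x x0) (@continuous_kern R n al 1 a b x x0).
  have k2 : {for x, continuous (fun y => - (prof al (b + 1 - a) y * kern al 1 a b y))} by exact: continuousN.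
  exact: continuousM k2 (@continuous_coord R n i x).
have := is_derive_chain (((hasC1_sqn n).2 i).1 x) (is_derive_rprof al g0 x0).
rewrite [_ * (2 * _)](_ : _ = dprof al a b x ord0 i); last first.
  rewrite mxE /kern profE !sqn_powR mul1r.
  rewrite (_ : 2 * ((b + 1 - a) / 2 - 1) = b - a - 1); last by field.
  rewrite (_ : 2 * -1 = - 2 :> R); last by ring.
  by move: (rprof _ _ _) (l2norm x `^ _) (l2norm x `^ _) => *; field.
by rewrite pE.
Qed.

Lemma Lw_prof s p al g : (0 < n)%N -> 0 < p -> 0 < g -> 0 < n%:R + (s + p * al) ->
  Lw s p (@prof R n al g).
Proof.
move=> n0 p0 g0 ns; have mp := @measurable_prof R n al g; split; first exact: mp.
have kp : 0 < p / g by rewrite divr_gt0.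
have i1 := rint_powR_expR n0 ns kp g0.
apply: (proj1 (rint_le (measurable_wfun s p mp) _ i1)).
apply: filterS (ae_neq0 n0) => x x0; rewrite wfun_ge0/= /wfun ger0_norm ?(ltW (prof_gt0 _ _ x0))//.
have r0 : 0 < l2norm x by rewrite l2norm_gt0.
rewrite /prof powRM ?powR_ge0 ?expR_ge0// -powRrM mulrA [al * p]mulrC -(powRD_gt0 _ _ r0).
by rewrite ler_wpM2l ?powR_ge0// /powR gt_eqF ?expR_gt0// expRK ler_expR mulrN mulrA [p * _ / _]mulrAC.
Qed.

Definition chiprof al a b j x : R := chi j x * prof al (b + 1 - a) x.

Lemma test_chiprof al a b j : a < b + 1 -> test_fun (chiprof al a b j).
Proof.
move=> ab; have j0 : 0 < (j.+1%:R^-1 : R) by rewrite invr_gt0.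
apply: (@C1c_test R n j.+1%:R^-1 j.+1%:R) => //.
  have -> : chiprof al a b j = fun x => cutf j.+1%:R^-1 (sqn x) * rprof al (b + 1 - a) (sqn x).
    by apply/funext => x; rewrite /chiprof profE.
  apply: (@smooth_radial R n (fun t => cutf j.+1%:R^-1 t * rprof al (b + 1 - a) t)) => k.
  apply: (@dk_extend R k j.+1%:R^-1) => //.
    by move=> t tl; rewrite cutf0l// mul0r.
  apply: dkM; last exact: dk_rprof.
  by elim: k (cutf _) (@dk_cutf R j.+1%:R^-1 k) => // k IH h [h' H1 H2]; exists h'; [move=> t _; exact: H1|exact: IH].
by move=> x /(@chi_off0 R n j) H; rewrite /chiprof H mul0r.
Qed.

Lemma grad_chi j x : grad (@chi R n j) x = dchi j x *: x.
Proof. by apply/rowP => i; rewrite !mxE partial_chi. Qed.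

Lemma grad_chiprof al a b j x : a < b + 1 ->
  grad (chiprof al a b j) x = chi j x *: dprof al a b x + (prof al (b + 1 - a) x * dchi j x) *: x.
Proof.
move=> ab; have [l [M hchi]] := test_C1c (@test_chi R n j).
have [_ ->] := C1c_mul (prof_C1off al ab) hchi.
by rewrite grad_chi scalerA.
Qed.

Lemma dchi_measurable j : measurable_fun setT (fun x => sqn x * @dchi R n j x).
Proof.
apply: measurable_funM; first exact: continuous_measurable_rV (@continuous_sqn R n).
apply: measurable_funM => //; apply: continuous_measurable_rV => x.
apply: (@continuous_comp _ _ _ (@sqn R n) (dcutf j.+1%:R^-1)); first exact: continuous_sqn.
exact: continuous_dcutf.
Qed.

Lemma chi_measurable j : measurable_fun setT (@chi R n j).
Proof. by apply: continuous_measurable_rV; have [] := smooth_hasC1 (@smooth_chi R n j). Qed.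

Lemma Lw_chi_cvg s p f : (0 < n)%N -> 0 < p -> Lw s p f ->
  (forall j, Lw s p (fun x => (1 - chi j x) * f x)) /\
  wn s p (fun x => (1 - chi j x) * f x) @[j --> \oo] --> (0 : R).
Proof.
move=> n0 p0 lf; apply: (Lw_dominated n0 p0 (addr_ge0 ler01 (expR_ge0 1)) lf).
- by move=> j; apply: measurable_funB => //; exact: chi_measurable.
- move=> j x _; apply: le_trans (ler_normB _ _) _; rewrite normr1 lerD2l.
  by rewrite ger0_norm ?chi_ge0// chi_le.
- by move=> x x0; rewrite -[0 in X in _ --> X](subrr 1); apply: cvgB (chi_cvg x0); exact: cvg_cst.
Qed.

Lemma Lw_dchi_cvg p b f : (0 < n)%N -> 0 < p -> Lw (- (p * (b + 1))) p f ->
  (forall j, Lw (- (p * b)) p (fun x => (l2norm x)^-1 * (sqn x * dchi j x * f x))) /\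
  wn (- (p * b)) p (fun x => (l2norm x)^-1 * (sqn x * dchi j x * f x)) @[j --> \oo] --> (0 : R).
Proof.
move=> n0 p0 lf; have [Cd Cd0 HCd] := @dchi_bounded R n.
have [l1 c1] := Lw_dominated n0 p0 Cd0 lf dchi_measurable (fun k x _ => HCd k x) (@dchi_cvg R n).
split; first by move=> j; exact: (Lw_inv n0 (l1 j)).1.
apply: (squeeze_cvgr _ (cvg_cst 0) c1); apply: nearW => j.
by rewrite wn_ge0; exact: (Lw_inv n0 (l1 j)).2.
Qed.

Lemma l2norm_dchi j x (v : R) : l2norm ((v * dchi j x) *: x) = `|(l2norm x)^-1 * (sqn x * dchi j x * v)|.
Proof.
have [->|x0] := eqVneq x 0; first by rewrite scaler0 l2norm0 invr0 mul0r normr0.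
have r0 : 0 < l2norm x by rewrite l2norm_gt0.
rewrite l2normZ !normrM normfV (ger0_norm (ltW r0)) -sqr_l2norm normrX (ger0_norm (ltW r0)).
by field; rewrite gt_eqF.
Qed.

Lemma Lw_norm s p f : Lw s p f -> Lw s p (fun x => `|f x|) /\ wn s p (fun x => `|f x|) = wn s p f.
Proof.
move=> [mf fi]; have E : wfun s p (fun x => `|f x|) = wfun s p f.
  by apply/funext => x; rewrite /wfun normr_id.
by rewrite /wn E; split => //; split; [exact: measurableT_comp|rewrite E].
Qed.

Lemma prof_weak al a b : a < b + 1 -> is_weak_gradient (@prof R n al (b + 1 - a)) (dprof al a b).
Proof. by move=> ab; apply: C1off_weak; exact: prof_C1off. Qed.

(** The kernel has two terms. One turns the weight with exponent [b] into the one with [a], the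
    other into the Hardy weight; [p * (b - al + 1) < n] is the integrability of the latter at the
    origin. *)
Lemma Lw_dprof p a b al : (0 < n)%N -> 1 <= p -> a < b + 1 -> p * (b - al + 1) < n%:R ->
  Lw (- (p * b)) p (gnorm (dprof al a b)).
Proof.
move=> n0 p1 ab pn; have p0 := lt_le_trans ltr01 p1; have g0 : 0 < b + 1 - a by rewrite subr_gt0.
have l1 : Lw (- (p * (b + 1))) p (@prof R n al (b + 1 - a)) by apply: Lw_prof => //; lra.
have pab : p * a <= p * (b + 1) by rewrite ler_pM2l// ltW.
have l2 : Lw (- (p * a)) p (@prof R n al (b + 1 - a)) by apply: Lw_prof => //; lra.
have l3 : Lw (- (p * b)) p (fun x => l2norm x `^ (b - a) * prof al (b + 1 - a) x).
  have m3 : measurable_fun setT (fun x => l2norm x `^ (b - a) * prof al (b + 1 - a) x).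
    by apply: measurable_funM; [exact: measurable_l2normX|exact: measurable_prof].
  split; first exact: m3.
  apply: (proj1 (rint_le (measurable_wfun _ p m3) _ l2.2)).
  apply: filterS (ae_neq0 n0) => x x0; rewrite wfun_ge0/= /wfun normrM (ger0_norm (powR_ge0 _ _)).
  have r0 : 0 < l2norm x by rewrite l2norm_gt0.
  rewrite powRM ?powR_ge0// -powRrM mulrA -(powRD_gt0 _ _ r0).
  by rewrite (_ : - (p * b) + (b - a) * p = - (p * a))//; ring.
have l4 := LwZ al (ltW p0) (Lw_inv n0 l1).1.
have [l5 _] := Lw_norm l4.1.
apply: (proj1 (Lw_sum3 p1 (measurable_gnorm (prof_weak al ab)) _ n0 l3 l5 l5)).
move=> x x0; have r0 : 0 < l2norm x by rewrite l2norm_gt0.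
rewrite /gnorm ger0_norm ?l2norm_ge0// /dprof l2normZ normrN normrM (ger0_norm (ltW (prof_gt0 _ _ x0))).
have k1 : `|kern al 1 a b x| * l2norm x <= l2norm x `^ (b - a) + `|al| * (l2norm x)^-1.
  rewrite /kern mul1r; apply: le_trans (ler_wpM2r (ltW r0) (ler_normB _ _)) _.
  rewrite mulrDl (ger0_norm (powR_ge0 _ _)) normrM (ger0_norm (powR_ge0 _ _)) -mulrA !powR_mulr1//.
  by rewrite subrK (_ : - 2 + 1 = - 1) ?powR_inv1 ?(ltW r0)//; ring.
have f0 := ltW (prof_gt0 al (b + 1 - a) x0).
have := ler_wpM2l f0 k1; rewrite mulrA => /le_trans; apply.
have i0 : 0 <= (l2norm x)^-1 * prof al (b + 1 - a) x by rewrite mulr_ge0 ?invr_ge0 ?(ltW r0).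
rewrite mulrDr [prof _ _ _ * (l2norm x `^ _)]mulrC lerD2l normrM (ger0_norm i0).
apply: (@le_trans _ _ (`|al| * ((l2norm x)^-1 * prof al (b + 1 - a) x))).
  by rewrite le_eqVlt; apply/orP; left; apply/eqP; ring.
by rewrite lerDl mulr_ge0.
Qed.

(** The error is [(1 - chi j) dprof] minus the profile times the gradient of the cut-off. The first
    part tends to 0 by domination, the second because the profile has a finite Hardy norm. *)
Lemma dprof_cvg p a b al : (0 < n)%N -> 1 <= p -> a < b + 1 -> p * (b - al + 1) < n%:R ->
  (forall j, Lw (- (p * b)) p (gnorm (fun x => dprof al a b x - grad (chiprof al a b j) x))) /\
  wn (- (p * b)) p (gnorm (fun x => dprof al a b x - grad (chiprof al a b j) x)) @[j --> \oo] --> (0 : R).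
Proof.
move=> n0 p1 ab pn; have p0 := lt_le_trans ltr01 p1; have g0 : 0 < b + 1 - a by rewrite subr_gt0.
have l1 : Lw (- (p * (b + 1))) p (@prof R n al (b + 1 - a)) by apply: Lw_prof => //; lra.
have [k1 c1] := Lw_chi_cvg n0 p0 (Lw_dprof n0 p1 ab pn).
have [k2 c2] := Lw_dchi_cvg n0 p0 l1.
have mj j : measurable_fun setT (gnorm (fun x => dprof al a b x - grad (chiprof al a b j) x)).
  apply: (@measurable_gnorm R n (fun x => prof al (b + 1 - a) x + -1 * chiprof al a b j x)).
  have := weak_gradient_lin (-1) (prof_weak al ab) (test_weak_gradient (test_chiprof al j ab)).
  by under [X in is_weak_gradient _ X -> _]eq_fun do rewrite scaleN1r.
have bnd j x : x != 0 -> `|gnorm (fun x => dprof al a b x - grad (chiprof al a b j) x) x| <=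
   `|(1 - chi j x) * gnorm (dprof al a b) x| + (`|(l2norm x)^-1 * (sqn x * dchi j x * prof al (b + 1 - a) x)| +
   `|(l2norm x)^-1 * (sqn x * dchi j x * prof al (b + 1 - a) x)|).
  move=> _; rewrite /gnorm ger0_norm ?l2norm_ge0// grad_chiprof//.
  have -> : dprof al a b x - (chi j x *: dprof al a b x + (prof al (b + 1 - a) x * dchi j x) *: x) =
     (1 - chi j x) *: dprof al a b x - (prof al (b + 1 - a) x * dchi j x) *: x.
    by rewrite scalerBl scale1r opprD addrA.
  apply: le_trans (l2normD _ _) _; rewrite [`|(1 - chi j x) * _|]normrM (ger0_norm (l2norm_ge0 (dprof al a b x))).
  by rewrite l2normN l2norm_dchi l2normZ lerD2l lerDl.
have H j := Lw_sum3 p1 (mj j) (bnd j) n0 (Lw_norm (k1 j)).1 (Lw_norm (k2 j)).1 (Lw_norm (k2 j)).1.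
split; first by move=> j; exact: (H j).1.
have c3 : 4 `^ (p - 1) * (wn (- (p * b)) p (fun x => (1 - chi j x) * gnorm (dprof al a b) x) +
    (wn (- (p * b)) p (fun x => (l2norm x)^-1 * (sqn x * dchi j x * prof al (b + 1 - a) x)) +
     wn (- (p * b)) p (fun x => (l2norm x)^-1 * (sqn x * dchi j x * prof al (b + 1 - a) x)))) @[j --> \oo] --> (0 : R).
  rewrite -[X in _ --> X](_ : 4 `^ (p - 1) * (0 + (0 + 0)) = 0); last by rewrite !addr0 mulr0.
  by apply: cvgM; [exact: cvg_cst|exact: cvgD c1 (cvgD c2 c2)].
apply: (squeeze_cvgr _ (cvg_cst 0) c3); apply: nearW => j; rewrite wn_ge0/=.
apply: le_trans (H j).2 _.
by rewrite (Lw_norm (k1 j)).2 (Lw_norm (k2 j)).2.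
Qed.

Lemma prof_chi_cvg s p a b al : (0 < n)%N -> 0 < p -> a < b + 1 ->
  Lw s p (@prof R n al (b + 1 - a)) ->
  (forall j, Lw s p (fun x => prof al (b + 1 - a) x - chiprof al a b j x)) /\
  wn s p (fun x => prof al (b + 1 - a) x - chiprof al a b j x) @[j --> \oo] --> (0 : R).
Proof.
move=> n0 p0 ab lf; have := Lw_chi_cvg n0 p0 lf.
have E j : (fun x => (1 - @chi R n j x) * prof al (b + 1 - a) x) = fun x => prof al (b + 1 - a) x - chiprof al a b j x.
  by apply/funext => x; rewrite mulrBl mul1r.
by under eq_fun do rewrite E; move=> [h1 h2]; split => // j; rewrite -E.
Qed.
End profile.

Section sums.
Context {R : realType} {n : nat}.
Implicit Types (u f : 'rV[R]_n -> R) (x : 'rV[R]_n) (G : 'rV[R]_n -> 'rV[R]_n) (s p a b : R).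
Local Notation mu := (lebesgue_rV R n).

Lemma gnormD s p G1 G2 : 1 <= p -> measurable_fun setT (gnorm (fun x => G1 x + G2 x)) ->
  Lw s p (gnorm G1) -> Lw s p (gnorm G2) ->
  Lw s p (gnorm (fun x => G1 x + G2 x)) /\
  wn s p (gnorm (fun x => G1 x + G2 x)) <= 2 `^ (p - 1) * (wn s p (gnorm G1) + wn s p (gnorm G2)).
Proof.
move=> p1 mG l1 l2; have [l12 e12] := LwD2 p1 l1 l2.
have p0 : 0 <= p := le_trans ler01 p1.
have [l e] := @Lw_le R n s p (gnorm (fun x => G1 x + G2 x)) (fun x => gnorm G1 x + gnorm G2 x) 1 p0 ler01 mG
  ltac:(by apply: aeW => x; rewrite mul1r !ger0_norm ?addr_ge0 ?l2norm_ge0//; exact: l2normD) l12.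
by split; [exact: l|rewrite powR1 mul1r in e; exact: le_trans e e12].
Qed.

Lemma gnormZ s p k G : 0 <= p -> Lw s p (gnorm G) ->
  Lw s p (gnorm (fun x => k *: G x)) /\
  wn s p (gnorm (fun x => k *: G x)) = `|k| `^ p * wn s p (gnorm G).
Proof.
move=> p0 lG; have E : gnorm (fun x => k *: G x) = fun x => `|k| * gnorm G x.
  by apply/funext => x; rewrite /gnorm l2normZ.
by rewrite E; have [h1 h2] := LwZ `|k| p0 lG; rewrite normr_id in h2.
Qed.

Lemma gnorm_cvg s p G (Gk : nat -> 'rV[R]_n -> 'rV[R]_n) : 1 <= p -> Lw s p (gnorm G) ->
  (forall k, Lw s p (gnorm (Gk k))) -> (forall k, Lw s p (gnorm (fun x => G x - Gk k x))) ->
  wn s p (gnorm (fun x => G x - Gk k x)) @[k --> \oo] --> (0 : R) ->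
  wn s p (gnorm (Gk k)) @[k --> \oo] --> wn s p (gnorm G).
Proof.
move=> p1 lG lk lB d0; apply: (Lw_cvg p1 lG lk); have p0 : 0 <= p := le_trans ler01 p1.
have le k : wn s p (fun x => gnorm G x - gnorm (Gk k) x) <= wn s p (gnorm (fun x => G x - Gk k x)).
  have mB : measurable_fun setT (fun x => gnorm G x - gnorm (Gk k) x).
    by apply: measurable_funB; [exact: lG.1|exact: (lk k).1].
  have [_ e] := @Lw_le R n s p _ (gnorm (fun x => G x - Gk k x)) 1 p0 ler01 mB
    ltac:(apply: aeW => x; rewrite mul1r [leRHS]ger0_norm ?l2norm_ge0// /gnorm ler_norml;
      apply/andP; split; [rewrite lerNl opprB lerBlDr; rewrite -[X in X + _]l2normN opprB;
        apply: le_trans (l2normD _ _); by rewrite subrK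
      |rewrite lerBlDr; apply: le_trans (l2normD _ _); by rewrite subrK]) (lB k).
  by rewrite powR1 mul1r in e.
apply: (@squeeze_cvgr _ _ _ _ (fun=> 0) (fun k => wn s p (gnorm (fun x => G x - Gk k x)))) => //.
- by apply: nearW => k; rewrite wn_ge0/=; exact: le.
- exact: cvg_cst.
Qed.

Lemma test_Lw s p u : 0 < p -> test_fun u -> Lw s p u.
Proof.
move=> p0 tu; have [l [M hk]] := test_C1c tu.
split; first by apply: continuous_measurable_rV; have [_ []] := hk.
exact: C1c_int_fun p0 hk.
Qed.

Lemma intH_wn p b u : intH p b u = wn (- (p * b)) p (gnorm (grad u)).
Proof.
rewrite /intH /wint /wn; congr Rintegral; apply/funext => x.
by rewrite wfun_gnorm.
Qed.

Lemma test_gnorm s p u : 0 < p -> test_fun u -> Lw s p (gnorm (grad u)).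
Proof.
move=> p0 tu; split; first exact: measurable_gnorm (test_weak_gradient tu).
have [l [M hk]] := test_C1c tu; have := C1c_int_grad0 s p0 hk.
rewrite /rint (_ : EFin \o wfun s p (gnorm (grad u)) = EFin \o (fun x => l2norm x `^ s * l2norm (grad u x) `^ p))//.
by apply/funext => x /=; rewrite wfun_gnorm.
Qed.

Lemma l2norm_annulus_le s l0 M x : 0 < M -> 0 < l0 -> l0 <= sqn x -> cube n M x ->
  l2norm x `^ s <= Num.sqrt l0 `^ s + @crad R n M `^ s.
Proof.
move=> M0 l00 lx xM.
have x0 : x != 0 by rewrite -sqn_eq0 gt_eqF// (lt_le_trans l00).
have r0 : 0 < l2norm x by rewrite l2norm_gt0.
have rR := l2norm_crad M0 xM; have R00 := @crad_ge0 R n M.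
have lr : Num.sqrt l0 <= l2norm x by rewrite ler_wsqrtr.
have sl0 : 0 < Num.sqrt l0 by rewrite sqrtr_gt0.
have [s0|s0] := lerP 0 s.
  apply: ler_wpDl; first exact: powR_ge0.
  by rewrite ge0_ler_powR ?nnegrE ?(ltW r0).
apply: ler_wpDr; first exact: powR_ge0.
rewrite -[s]opprK !(powRN _ (- s)) lef_pV2 ?posrE ?powR_gt0//.
by rewrite ge0_ler_powR ?nnegrE ?oppr_ge0 ?(ltW s0) ?(ltW r0) ?(ltW sl0).
Qed.

Lemma zn_wn p l0 M0 f : 0 < p -> zn l0 M0 p f = wn 0 p (fun x => \1_(annulus l0 M0) x * f x).
Proof.
move=> p0; rewrite /zn /wn; congr Rintegral; apply/funext => x.
rewrite /wfun powRr0 mul1r indicE; case: (x \in _); first by rewrite !mul1r.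
by rewrite !mul0r normr0 powR0// gt_eqF.
Qed.

Lemma zn_le s p l0 M0 : 0 < p -> 0 < l0 -> exists2 A : R, 0 <= A &
  forall f, Lw s p f -> Lw 0 p (fun x => \1_(annulus l0 M0) x * f x) /\ zn l0 M0 p f <= A * wn s p f.
Proof.
move=> p0 l00; pose M1 := 1 + `|M0|; have M10 : 0 < M1 by rewrite ltr_pwDl.
pose A := Num.sqrt l0 `^ (- s) + @crad R n M1 `^ (- s).
have A0 : 0 <= A by rewrite addr_ge0 ?powR_ge0.
exists A => // f [mf fi].
have mz : measurable_fun setT (fun x => \1_(annulus l0 M0) x * f x).
  by apply: measurable_funM => //; apply: measurable_indic; exact: measurable_annulus.
have := @rint_le R n (wfun 0 p (fun x => \1_(annulus l0 M0) x * f x)) (fun x => A * wfun s p f x).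
case; first exact: measurable_wfun.
- apply: aeW => x; rewrite wfun_ge0/= {1}/wfun powRr0 mul1r indicE; have [xA|xA] := boolP (x \in _); last first.
    by rewrite mul0r normr0 powR0 ?gt_eqF// mulr_ge0 ?wfun_ge0.
  rewrite inE in xA; have [/= lx xM] := xA.
  have x0 : x != 0 by rewrite -sqn_eq0 gt_eqF// (lt_le_trans l00).
  have xM1 : cube n M1 x.
    by move=> i; apply: le_trans (xM i) _; apply: le_trans (ler_norm _) _; rewrite lerDr.
  rewrite mul1r /wfun mulrA; apply: ler_peMl; first exact: powR_ge0.
  have <- : l2norm x `^ (- s) * l2norm x `^ s = 1 by rewrite l2norm_powRM// addNr powRr0.
  by apply: ler_wpM2r; [exact: powR_ge0|exact: l2norm_annulus_le].
- exact: rintZ.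
by move=> h1 h2; split; [split|rewrite zn_wn// /wn -rintegralZ].
Qed.

End sums.

(** * Stability *)

Section core.
Context {R : realType} {n : nat} (p a b al S0 : R).
Implicit Types (u f : 'rV[R]_n -> R) (x : 'rV[R]_n) (G : 'rV[R]_n -> 'rV[R]_n).
Local Notation mu := (lebesgue_rV R n).
Local Notation phi := (@prof R n al (b + 1 - a)).
Local Notation dphi := (@dprof R n al a b).
Local Notation phij := (@chiprof R n al a b).
Local Notation c := (CKN_exponent p a b).
Context (n0 : (0 < n)%N) (p2 : 2 <= p) (ab : a < b + 1) (bal : 0 <= b - al)
  (pn : p * (b - al + 1) < n%:R) (nb : n%:R != p * (b + 1)) (S00 : 0 < S0).

(** The value of [intD] on the truncated profile, by [intD_chiprof]. *)
Definition chi_error j : R :=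
  wn (- (p * b)) p (fun x => (l2norm x)^-1 * (sqn x * @dchi R n j x * phi x)).
Definition energy f G : R := wn (- (p * b)) p (gnorm G) + (p - 1) * wn (- (p * a)) p f.
Definition excess (lam : R) f G : R := wn (- (p * b)) p (gnorm G) + (p - 1) * lam `^ p * wn (- (p * a)) p f
  - p * lam `^ (p - 1) * S0 * wn (- (p * c)) p f.

Let p0 : 0 < p. Proof. by rewrite (lt_le_trans _ p2). Qed.
Let p1 : 1 <= p. Proof. by rewrite (le_trans _ p2)// ler1n. Qed.
Let p10 : 0 <= p - 1. Proof. by rewrite subr_ge0. Qed.

Lemma Lw_prof_hardy : Lw (- (p * (b + 1))) p phi.
Proof.
apply: Lw_prof => //; first by rewrite subr_gt0.
by move: pn; rewrite -subr_gt0; congr (_ < _); ring.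
Qed.

Lemma Lw_prof_a : Lw (- (p * a)) p phi.
Proof.
apply: Lw_prof => //; first by rewrite subr_gt0.
have : 0 < p * (b + 1 - a) by rewrite mulr_gt0 ?subr_gt0.
by move: pn; nra.
Qed.

Lemma chi_error_cvg : chi_error j @[j --> \oo] --> (0 : R).
Proof. exact: (Lw_dchi_cvg n0 p0 Lw_prof_hardy).2. Qed.

(** The operator [grad + kern x] annihilates the profile itself, so only the gradient of the cut-off
    survives. *)
Lemma chiprof_D j x :
  grad (phij j) x + (phij j x * kern al 1 a b x) *: x = (phi x * dchi j x) *: x.
Proof.
rewrite grad_chiprof// /dprof /chiprof scalerA -addrA -!scalerDl.
by congr (_ *: _); move: (kern _ _ _ _ _) (chi j x) (phi x) (dchi j x) => *; ring.
Qed.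

Lemma intD_chiprof j : intD p b (kern al 1 a b) (phij j) = chi_error j.
Proof.
rewrite /intD /wint /chi_error /wn; congr Rintegral; apply/funext => x.
by rewrite chiprof_D l2norm_dchi.
Qed.

Lemma intD_subtract u j (k : R) : test_fun u ->
  intD p b (kern al 1 a b) (fun x => u x + k * phij j x) <=
  2 `^ (p - 1) * (intD p b (kern al 1 a b) u + `|k| `^ p * chi_error j).
Proof.
move=> tu; have tc : test_fun (phij j) by exact: test_chiprof.
have tg := test_lin k tu tc.
have [l [M hu]] := test_C1c tu; have [l' [M' hc]] := test_C1c tc; have [l'' [M'' hg]] := test_C1c tg.
have iu := C1c_int_grad (- (p * b)) p0 hu (fun x => @continuous_kern R n al 1 a b x).
have ic := C1c_int_grad (- (p * b)) p0 hc (fun x => @continuous_kern R n al 1 a b x).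
have ig := C1c_int_grad (- (p * b)) p0 hg (fun x => @continuous_kern R n al 1 a b x).
set T : R := 2 `^ (p - 1); set K : R := `|k| `^ p; rewrite -intD_chiprof.
pose fu x := l2norm x `^ (- (p * b)) * l2norm (grad u x + (u x * kern al 1 a b x) *: x) `^ p.
pose fc x := l2norm x `^ (- (p * b)) * l2norm (grad (phij j) x + (phij j x * kern al 1 a b x) *: x) `^ p.
have iZ : rint mu (fun x => K * fc x) := rintZ K ic.
have iS : rint mu (fun x => fu x + K * fc x) := rintD iu iZ.
have iT : rint mu (fun x => T * (fu x + K * fc x)) := rintZ T iS.
have -> : T * (intD p b (kern al 1 a b) u + K * intD p b (kern al 1 a b) (phij j)) =
    \int[mu]_x (T * (fu x + K * fc x)).
  by rewrite (rintegralZ T iS) (rintegralD iu iZ) (rintegralZ K ic).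
apply: (le_rintegral ig iT) => x; rewrite /fu /fc.
have [_ hu' _] := hu; have [_ hc' _] := hc.
set A := grad u x + _; set B := grad (phij j) x + _.
have -> : grad (fun x => u x + k * phij j x) x + ((u x + k * phij j x) * kern al 1 a b x) *: x = A + k *: B.
  rewrite (grad_lin k hu' hc') /A /B scalerDr scalerA [k * (_ * _)]mulrA mulrDl scalerDl.
  by rewrite !addrA; congr (_ + _); rewrite -!addrA; congr (_ + _); rewrite addrC.
have h : l2norm (A + k *: B) `^ p <= 2 `^ (p - 1) * (l2norm A `^ p + `|k| `^ p * l2norm B `^ p).
  rewrite -powRM ?l2norm_ge0// -l2normZ; apply: le_trans (powRD_le p1 (l2norm_ge0 _) (l2norm_ge0 _)).
  by rewrite ge0_ler_powR ?nnegrE ?addr_ge0 ?l2norm_ge0 ?(ltW p0)//; exact: l2normD.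
have alg (r s t v w : R) : 0 <= r -> s <= t * (v + w) -> r * s <= t * (r * v + r * w).
  by move=> r0 h'; apply: (le_trans (ler_wpM2l r0 h')); rewrite le_eqVlt; apply/orP; left; apply/eqP; ring.
rewrite [K * (_ * _)]mulrCA; exact: (alg _ _ _ _ _ (powR_ge0 _ _) h).
Qed.

Lemma measurable_gnorm_lin u G v G' (k : R) : is_weak_gradient u G -> is_weak_gradient v G' ->
  measurable_fun setT (gnorm (fun x => G x + k *: G' x)).
Proof. by move=> hu hv; exact: measurable_gnorm (weak_gradient_lin k hu hv). Qed.

Lemma energyD u G v G' (k : R) : is_weak_gradient u G -> is_weak_gradient v G' ->
  Lw (- (p * b)) p (gnorm G) -> Lw (- (p * a)) p u ->
  Lw (- (p * b)) p (gnorm G') -> Lw (- (p * a)) p v ->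
  energy (fun x => u x + k * v x) (fun x => G x + k *: G' x) <=
  2 `^ (p - 1) * (energy u G + `|k| `^ p * energy v G').
Proof.
move=> hu hv lG lu lG' lv; have m := measurable_gnorm_lin k hu hv.
have [l1 e1] := gnormZ k (ltW p0) lG'; have [l2 e2] := LwZ k (ltW p0) lv.
have [_ h1] := gnormD p1 m lG l1; have [_ h2] := LwD2 p1 lu l2.
rewrite e1 in h1; rewrite e2 in h2.
have alg (x y T A B K A' B' : R) : x <= T * (A + K * A') -> y <= T * (B + K * B') ->
  x + (p - 1) * y <= T * (A + (p - 1) * B + K * (A' + (p - 1) * B')).
  move=> hx hy; apply: (le_trans (lerD hx (ler_wpM2l p10 hy))).
  by rewrite le_eqVlt; apply/orP; left; apply/eqP; ring.
exact: alg h1 h2.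
Qed.

(** The reverse expansion with arbitrarily small [e], followed by the forward expansion at every
    scale [lam]. The two regimes of the parameters supply them with different [al] and [S0]. *)
Context (HU : forall e : R, 0 < e -> exists2 C : R, 0 <= C & forall l M u, C1c l M u ->
  intH p b u + (p - 1) * intL p a u <= p * S0 * intL p c u + e * intL p a u + C * intD p b (kern al 1 a b) u).
Context (c0 : R) (c00 : 0 < c0) (HQ : forall (lam : R) l M u, 0 < lam -> C1c l M u ->
  c0 * intD p b (kern al lam a b) u <= intH p b u + (p - 1) * lam `^ p * intL p a u
    - p * lam `^ (p - 1) * S0 * intL p c u).

Lemma excess1 u G : excess 1 u G = energy u G - p * S0 * wn (- (p * c)) p u.
Proof. by rewrite /excess /energy !powR1 !mulr1. Qed.

Lemma test_energy u : energy u (grad u) = intH p b u + (p - 1) * intL p a u.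
Proof. by rewrite intH_wn. Qed.

Lemma test_excess_ge u : test_fun u -> c0 * intD p b (kern al 1 a b) u <= excess 1 u (grad u).
Proof.
move=> tu; have [l [M hu]] := test_C1c tu.
by have := HQ ltr01 hu; rewrite intH_wn.
Qed.

(** [energy_local] is applied to [u - k chi_j phi], which is a test function. Since [k] comes from
    the Poincare inequality for [u] and does not depend on [j], the truncation errors can be made
    small afterwards. *)
Lemma core_test : exists2 C : R, 0 <= C & forall u, test_fun u -> forall eta : R, 0 < eta ->
  exists k : R, energy (fun x => u x + k * phi x) (fun x => grad u x + k *: dphi x) <=
    C * excess 1 u (grad u) + eta.
Proof.
have [l0 [M0 [CL [l00 CL0 HL]]]] := energy_local n0 p2 S00 nb ab HU.
have [CP CP0 HP] := @poincare_profile R n p a b al l0 M0 n0 p2 bal ab l00.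
have [A A0 HA] := @zn_le R n (- (p * a)) p l0 M0 p0 l00.
set T : R := 2 `^ (p - 1); have T0 : 0 <= T by exact: powR_ge0.
have W := @prof_weak R n al a b ab.
have [lGd cGd] := @dprof_cvg R n p a b al n0 p1 ab pn.
have [lfd cfd] := @prof_chi_cvg R n (- (p * a)) p a b al n0 p0 ab Lw_prof_a.
exists (T * CL * T * (1 + CP) / c0); first by rewrite !mulr_ge0 ?invr_ge0 ?(ltW c00) ?addr_ge0.
move=> u tu eta eta0; have [l [M hu]] := test_C1c tu.
pose eta1 := eta / 2 / (T * CL * T + 1).
have TCT : 0 <= T * CL * T by rewrite !mulr_ge0.
have eta10 : 0 < eta1 by rewrite !divr_gt0// ltr_wpDl.
have [k Hk] := HP l M u hu eta1 eta10; exists (- k).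
have K0 : 0 <= `|k| `^ p by exact: powR_ge0.
pose ej j := wn (- (p * b)) p (gnorm (fun x => dphi x - grad (phij j) x)).
pose fj j := wn (- (p * a)) p (fun x => phi x - phij j x).
(* The whole cost of replacing the profile by its cut-off: in the energy, in [intD], and in the mass
   on the annulus. *)
pose st j := T * `|k| `^ p * (ej j + (p - 1) * fj j) + T * CL * T * `|k| `^ p * (chi_error j + A * fj j).
have cst_ : st j @[j --> \oo] --> (0 : R).
  rewrite (_ : (0 : R) = T * `|k| `^ p * (0 + (p - 1) * 0) + T * CL * T * `|k| `^ p * (0 + A * 0)); last by ring.
  apply: cvgD; (apply: cvgM; [exact: cvg_cst|]); apply: cvgD; [exact: cGd| |exact: chi_error_cvg|];
    by apply: cvgM; [exact: cvg_cst|exact: cfd].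
have [j Hj] : exists j, `|0 - st j| <= eta / 2.
  have e2 : 0 < eta / 2 by rewrite divr_gt0.
  by have /cvgrPdist_le/(_ _ e2) H := cst_; exact: filter_ex H.
have {}Hj : st j <= eta / 2 by rewrite sub0r normrN in Hj; exact: le_trans (ler_norm _) Hj.
have tc : test_fun (phij j) by exact: test_chiprof.
have tg := test_lin (- k) tu tc.
have [lg [Mg hg]] := test_C1c tg; have [lc [Mc hc]] := test_C1c tc.
have [_ hu' _] := hu; have [_ hc' _] := hc.
set g := fun x => u x + - k * phij j x in tg hg.
have Wd : is_weak_gradient (fun x => phi x + - 1 * phij j x) (fun x => dphi x + (- 1) *: grad (phij j) x).
  exact: weak_gradient_lin W (test_weak_gradient tc).
have Ed : (fun x => phi x + - 1 * phij j x) = fun x => phi x - phij j x by apply/funext => x; rewrite mulN1r.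
have EG : (fun x => dphi x + (- 1) *: grad (phij j) x) = fun x => dphi x - grad (phij j) x.
  by apply/funext => x; rewrite scaleN1r.
rewrite Ed EG in Wd.
have step1 := @energyD g (grad g) _ _ (- k) (test_weak_gradient tg) Wd
  (test_gnorm _ p0 tg) (test_Lw _ p0 tg) (lGd j) (lfd j).
have Eg : (fun x => g x + - k * (phi x - phij j x)) = fun x => u x + - k * phi x.
  by apply/funext => x; rewrite /g; ring.
have Egg : (fun x => grad g x + - k *: (dphi x - grad (phij j) x)) = fun x => grad u x + - k *: dphi x.
  apply/funext => x; rewrite /g (grad_lin (- k) hu' hc') scalerBr -addrA; congr (_ + _).
  by rewrite addrC subrK.
rewrite Eg Egg normrN -/T in step1.
have step2 : energy g (grad g) <= CL * (intD p b (kern al 1 a b) g + zn l0 M0 p g).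
  by rewrite (test_energy g); exact: (HL lg Mg g hg).
have step3 := @intD_subtract u j (- k) tu; rewrite normrN -/T -/g in step3.
have [lz1 ez1] := HA _ (lfd j).
have lup : Lw (- (p * a)) p (fun x => u x - k * phi x).
  exact: (LwB2 p1 (test_Lw _ p0 tu) (LwZ k (ltW p0) Lw_prof_a).1).1.
have [lz2 _] := HA _ lup.
have step4 : zn l0 M0 p g <= T * (zn l0 M0 p (fun x => u x - k * phi x) + `|k| `^ p * zn l0 M0 p (fun x => phi x - phij j x)).
  have [lz3 ez3] := LwZ k (ltW p0) lz1; have [_ e] := LwD2 p1 lz2 lz3.
  have Eg' : (fun x => \1_(annulus l0 M0) x * (u x - k * phi x) + k * (\1_(annulus l0 M0) x * (phi x - phij j x))) =
      fun x => \1_(annulus l0 M0) x * g x.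
    by apply/funext => x; rewrite /g; move: (\1_(annulus l0 M0) x) (u x) (phi x) (phij j x) => *; ring.
  rewrite Eg' in e; rewrite (@zn_wn R n p l0 M0 g p0) (@zn_wn R n p l0 M0 _ p0).
  by rewrite (@zn_wn R n p l0 M0 (fun x => phi x - phij j x) p0) -ez3; exact: e.
have step5 := test_excess_ge tu.
have D0 : 0 <= intD p b (kern al 1 a b) u by exact: wint_ge0.
have Ede : energy (fun x => phi x - phij j x) (fun x => dphi x - grad (phij j) x) = ej j + (p - 1) * fj j by [].
rewrite Ede in step1; rewrite -/(fj j) in ez1; move: step1 step2 step3 ez1 step4 Hk step5 Hj; rewrite /st.
move: (energy (fun x => u x + - k * phi x) _) (energy g _) => E1 E2.
have c0n : c0 != 0 by rewrite gt_eqF.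
move: (excess _ _ _) => Q; move: D0.
move: (intD _ _ _ u) (intD _ _ _ g) (zn _ _ _ g) (zn _ _ _ (fun x => u x - k * phi x)) => D Dg zg zu.
move: (zn _ _ _ _) (ej j) (fj j) (chi_error j) => zf e f d D0 s1 s2 s3 s4 s5 s6 s7 s8.
have DQ : D <= Q / c0 by rewrite ler_pdivlMr// mulrC.
have h1 : E1 <= T * (CL * (Dg + zg) + `|k| `^ p * (e + (p - 1) * f)).
  by apply: le_trans s1 _; apply: ler_wpM2l => //; rewrite lerD2r.
have h2 : Dg + zg <= T * ((1 + CP) * (Q / c0) + eta1) + T * `|k| `^ p * (d + A * f).
  have h3 : zu + `|k| `^ p * zf <= CP * D + eta1 + `|k| `^ p * (A * f).
    by apply: lerD => //; exact: ler_wpM2l.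
  have h4 := ler_wpM2l T0 h3; have h5 : T * ((1 + CP) * D) <= T * ((1 + CP) * (Q / c0)).
    by apply: ler_wpM2l => //; apply: ler_wpM2l => //; rewrite addr_ge0.
  have h6 := le_trans s5 h4; move: s3 h6 h5; rewrite !mulrDr !mulrDl; lra.
have TCL : 0 <= T * CL by exact: mulr_ge0.
have h3 := ler_wpM2l TCL h2.
have h4 : T * CL * T * eta1 <= eta / 2.
  rewrite /eta1 mulrA ler_pdivrMr ?ltr_wpDl// mulrC; apply: ler_wpM2l; first by rewrite divr_ge0// ltW.
  by rewrite lerDl.
have -> : T * CL * T * (1 + CP) / c0 * Q = T * CL * (T * ((1 + CP) * (Q / c0))) by field.
apply: le_trans h1 _; move: h3 h4 s8; rewrite !mulrDr !mulrDl !mulrA; lra.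
Qed.

(** What the passage to the limit needs: one sequence of test functions converging at once in the
    gradient norm and in the norms with exponents [a] and c. Elements of the spaces and multiples of
    the profile have this property. *)
Definition approximable u G := [/\ is_weak_gradient u G, Lw (- (p * b)) p (gnorm G),
  Lw (- (p * a)) p u, Lw (- (p * c)) p u & exists w : nat -> 'rV[R]_n -> R,
  [/\ forall j, test_fun (w j),
    wn (- (p * b)) p (gnorm (fun x => G x - grad (w j) x)) @[j --> \oo] --> (0 : R),
    wn (- (p * a)) p (fun x => u x - w j x) @[j --> \oo] --> (0 : R) &
    wn (- (p * c)) p (fun x => u x - w j x) @[j --> \oo] --> (0 : R)]].

Let p_neq0 : p != 0. Proof. by rewrite gt_eqF. Qed.

(** The exponent c lies between [a] and [b + 1], so one of the two terms dominates on each side of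
    [r = 1]. *)
Lemma weight_c (r : R) : 0 < r -> r `^ (- (p * c)) <= 1 * r `^ (- (p * a)) + 1 * r `^ (- (p * (b + 1))).
Proof.
move=> r0; rewrite !mul1r CKN_exponentE//; have [r1|r1] := lerP 1 r.
  apply: ler_wpDr; first exact: powR_ge0.
  by apply: ler_powR => //; move: ab p1; lra.
apply: ler_wpDl; first exact: powR_ge0.
rewrite ger_powR ?r0 ?(ltW r1)//.
by have h' := ler_wpM2l p10 (ltW ab); move: h' ab; lra.
Qed.

Lemma density_approximable u : spaceH p b u -> spaceL p a u -> exists G, approximable u G.
Proof.
move=> hu lu; have p1' : 1 < p by rewrite (lt_le_trans _ p2)// ltr1n.
have [G [WG lG lu1 lua] H] := density n0 p1' nb ab hu lu; exists G.
have e0 j : 0 < (j.+1%:R^-1 : R) by rewrite invr_gt0.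
have {}H j := H _ (e0 j); have [w Hw] := choice H.
have mw j : Lw (- (p * a)) p (fun x => u x - w j x) /\ Lw (- (p * (b + 1))) p (fun x => u x - w j x).
  have [tw _ _ _] := Hw j; split.
    exact: (LwB2 p1 lua (test_Lw _ p0 tw)).1.
  exact: (LwB2 p1 lu1 (test_Lw _ p0 tw)).1.
have inv0 : (fun j => j.+1%:R^-1 : R) @ \oo --> (0 : R) := cvg_harmonic.
have inv2 : (fun j => j.+1%:R^-1 + j.+1%:R^-1 : R) @ \oo --> (0 : R).
  by rewrite -[X in _ --> X]addr0; exact: cvgD.
have sq (f g : nat -> R) : (forall j, 0 <= f j <= g j) -> g j @[j --> \oo] --> (0 : R) -> f j @[j --> \oo] --> (0 : R).
  move=> fg g0; apply: (@squeeze_cvgr _ _ _ _ (fun=> 0) g); [by apply: nearW|exact: cvg_cst|exact: g0].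
split; [exact: WG|exact: lG|exact: lua|exact: (Lw_weight n0 ler01 ler01 weight_c lua lu1).1|].
exists w; split.
- by move=> j; have [] := Hw j.
- by apply: sq inv0 => j; have [_ h _ _] := Hw j; rewrite wn_ge0.
- by apply: sq inv0 => j; have [_ _ h _] := Hw j; rewrite wn_ge0.
apply: sq inv2 => j; have [_ _ h1 h2] := Hw j; have [l1 l2] := mw j; rewrite wn_ge0.
have [_ h] := Lw_weight n0 ler01 ler01 weight_c l1 l2.
by apply: (le_trans h); rewrite !mul1r; exact: lerD.
Qed.

Lemma approximable_cvg u G : approximable u G -> exists w : nat -> 'rV[R]_n -> R,
  [/\ forall j, test_fun (w j), intH p b (w j) @[j --> \oo] --> wn (- (p * b)) p (gnorm G),
    intL p a (w j) @[j --> \oo] --> wn (- (p * a)) p u,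
    intL p c (w j) @[j --> \oo] --> wn (- (p * c)) p u &
    energy (fun x => u x + - 1 * w j x) (fun x => G x + - 1 *: grad (w j) x) @[j --> \oo] --> (0 : R)].
Proof.
move=> [WG lG la lc [w [tw cG ca cc]]]; exists w.
have EG j : (fun x => G x + - 1 *: grad (w j) x) = fun x => G x - grad (w j) x.
  by apply/funext => x; rewrite scaleN1r.
have Eu j : (fun x => u x + - 1 * w j x) = fun x => u x - w j x.
  by apply/funext => x; rewrite mulN1r.
have lB j : Lw (- (p * b)) p (gnorm (fun x => G x - grad (w j) x)).
  have m := measurable_gnorm_lin (- 1) WG (test_weak_gradient (tw j)).
  have [l1 _] := gnormZ (- 1) (ltW p0) (test_gnorm (- (p * b)) p0 (tw j)).
  by have [h _] := gnormD p1 m lG l1; rewrite EG in h.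
split; first exact: tw.
- rewrite (_ : (fun j => intH p b (w j)) = fun j => wn (- (p * b)) p (gnorm (grad (w j)))).
    exact: gnorm_cvg p1 lG (fun j => test_gnorm _ p0 (tw j)) lB cG.
  by apply/funext => j; rewrite intH_wn.
- exact: Lw_cvg p1 la (fun j => test_Lw _ p0 (tw j)) ca.
- exact: Lw_cvg p1 lc (fun j => test_Lw _ p0 (tw j)) cc.
rewrite (_ : (fun j => energy _ _) = fun j => wn (- (p * b)) p (gnorm (fun x => G x - grad (w j) x)) + (p - 1) * wn (- (p * a)) p (fun x => u x - w j x)).
  rewrite [X in _ --> X](_ : _ = 0 + (p - 1) * 0); last by ring.
  by apply: cvgD; [exact: cG|apply: cvgM; [exact: cvg_cst|exact: ca]].
by apply/funext => j; rewrite /energy EG Eu.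
Qed.

Lemma excess_cvg (lam A B D : R) (f g h : nat -> R) : f j @[j --> \oo] --> A ->
  g j @[j --> \oo] --> B -> h j @[j --> \oo] --> D ->
  f j + (p - 1) * lam `^ p * g j - p * lam `^ (p - 1) * S0 * h j @[j --> \oo] -->
  A + (p - 1) * lam `^ p * B - p * lam `^ (p - 1) * S0 * D.
Proof.
move=> cf cg ch; apply: cvgB; first (apply: cvgD; first exact: cf);
  by apply: cvgM; [exact: cvg_cst|].
Qed.

(** Limit of the forward expansion along test functions. All scales are kept for the optimization in
    [hoelder_scaled]. *)
Lemma approximable_excess u G (lam : R) : approximable u G -> 0 < lam -> 0 <= excess lam u G.
Proof.
move=> /approximable_cvg[w [tw cH ca cc _]] lam0.
have cv := @excess_cvg lam _ _ _ _ _ _ cH ca cc.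
rewrite /excess; apply: (cvgr_to_ge cv).
apply: nearW => j; have [l [M hw]] := test_C1c (tw j).
apply: le_trans (HQ lam0 hw); apply: mulr_ge0; [exact: ltW|exact: wint_ge0].
Qed.

Lemma approximable_core : exists2 C : R, 0 <= C & forall u G, approximable u G ->
  forall eta : R, 0 < eta ->
  exists k : R, energy (fun x => u x + k * phi x) (fun x => G x + k *: dphi x) <= C * excess 1 u G + eta.
Proof.
have [C C0 HC] := core_test; set T : R := 2 `^ (p - 1); have T0 : 0 <= T by exact: powR_ge0.
exists (T * C); first exact: mulr_ge0.
move=> u G hu eta eta0; have [WG lG la lc _] := hu.
have [w [tw cH ca cc cE]] := approximable_cvg hu.
have W := @prof_weak R n al a b ab.
have lW := @Lw_dprof R n p a b al n0 p1 ab pn.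
have cv := @excess_cvg 1 _ _ _ _ _ _ cH ca cc.
pose st j := T * energy (fun x => u x + - 1 * w j x) (fun x => G x + - 1 *: grad (w j) x) +
  T * C * (excess 1 (w j) (grad (w j)) - excess 1 u G).
have cst_ : st j @[j --> \oo] --> (0 : R).
  rewrite (_ : (0 : R) = T * 0 + T * C * (excess 1 u G - excess 1 u G)); last by ring.
  apply: cvgD; (apply: cvgM; first exact: cvg_cst); first exact: cE.
  apply: cvgB; last exact: cvg_cst.
  rewrite (_ : (fun j => excess 1 (w j) (grad (w j))) = fun j => intH p b (w j) + (p - 1) * 1 `^ p * intL p a (w j) - p * 1 `^ (p - 1) * S0 * intL p c (w j)); first exact: cv.
  by apply/funext => j; rewrite intH_wn.
have e2 : 0 < eta / 2 by rewrite divr_gt0.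
have [j Hj] : exists j, `|0 - st j| <= eta / 2.
  by have /cvgrPdist_le/(_ _ e2) H := cst_; exact: filter_ex H.
have {}Hj : st j <= eta / 2 by rewrite sub0r normrN in Hj; exact: le_trans (ler_norm _) Hj.
pose eta1 := eta / 2 / (T + 1).
have eta10 : 0 < eta1 by rewrite !divr_gt0// ltr_wpDl.
have [k Hk] := HC _ (tw j) _ eta10; exists k.
have W1 := weak_gradient_lin (- 1) WG (test_weak_gradient (tw j)).
have W2 := weak_gradient_lin k (test_weak_gradient (tw j)) W.
have tG := test_gnorm (- (p * b)) p0 (tw j); have ta := test_Lw (- (p * a)) p0 (tw j).
have lG1 := (gnormD p1 (measurable_gnorm W1) lG (gnormZ (- 1) (ltW p0) tG).1).1.
have la1 := (LwD2 p1 la (LwZ (- 1) (ltW p0) ta).1).1.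
have lG2 := (gnormD p1 (measurable_gnorm W2) tG (gnormZ k (ltW p0) lW).1).1.
have la2 := (LwD2 p1 ta (LwZ k (ltW p0) Lw_prof_a).1).1.
have := energyD 1 W1 W2 lG1 la1 lG2 la2.
rewrite (_ : (fun x => _ + 1 * _) = fun x => u x + k * phi x); last first.
  by apply/funext => x; move: (u x) (w j x) (phi x) => *; ring.
rewrite (_ : (fun x => _ + 1 *: _) = fun x => G x + k *: dphi x); last first.
  by apply/funext => x; rewrite scale1r scaleN1r addrA subrK.
rewrite normr1 powR1 mul1r -/T; move: Hk Hj; rewrite /st.
have h4 : T * eta1 <= eta / 2.
  rewrite /eta1 mulrA ler_pdivrMr ?ltr_wpDl// mulrC; apply: ler_wpM2l; first exact: ltW.
  by rewrite lerDl.
move: (energy _ _) (energy _ _) (energy _ _) (excess _ _ _) (excess _ _ _) => E1 E2 E3 Q1 Q2 h1 h2 h3.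
apply: (le_trans h3); have := ler_wpM2l T0 h1; move: h2 h4; rewrite !mulrDr !mulrA; lra.
Qed.

Lemma Lw_prof_c : Lw (- (p * c)) p phi.
Proof. exact: (Lw_weight n0 ler01 ler01 weight_c Lw_prof_a Lw_prof_hardy).1. Qed.

Lemma prof_approximable : approximable phi dphi.
Proof.
split; [exact: prof_weak|exact: Lw_dprof|exact: Lw_prof_a|exact: Lw_prof_c|].
exists phij; split; first by move=> j; exact: test_chiprof.
- exact: (@dprof_cvg R n p a b al n0 p1 ab pn).2.
- exact: (@prof_chi_cvg R n _ p a b al n0 p0 ab Lw_prof_a).2.
exact: (@prof_chi_cvg R n _ p a b al n0 p0 ab Lw_prof_c).2.
Qed.

(** Nonnegativity is the general fact. For the converse the reverse expansion is applied to the
    truncated profiles: their [intD] tends to 0, and then [e] is arbitrary. No integral of the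
    profile is evaluated. *)
Lemma prof_excess : excess 1 phi dphi = 0.
Proof.
apply/eqP; rewrite eq_le; apply/andP; split; last exact: approximable_excess prof_approximable ltr01.
rewrite excess1 subr_le0 /energy; set A := wn _ _ (gnorm dphi); set B := wn _ _ phi; set D := wn _ _ phi.
have B0 : 0 <= B by exact: wn_ge0.
have cA : intH p b (phij j) @[j --> \oo] --> A.
  rewrite (_ : (fun j => intH p b (phij j)) = fun j => wn (- (p * b)) p (gnorm (grad (phij j)))).
    have [l1 c1] := @dprof_cvg R n p a b al n0 p1 ab pn.
    apply: (gnorm_cvg p1 _ _ l1 c1); first exact: Lw_dprof.
    by move=> j; apply: test_gnorm => //; exact: test_chiprof.
  by apply/funext => j; rewrite intH_wn.
have tj s j : Lw s p (phij j) by apply: test_Lw => //; exact: test_chiprof.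
have cB : intL p a (phij j) @[j --> \oo] --> B.
  by have [l1 c1] := @prof_chi_cvg R n _ p a b al n0 p0 ab Lw_prof_a; exact: (Lw_cvg p1 Lw_prof_a (tj _) c1).
have cD : intL p c (phij j) @[j --> \oo] --> D.
  by have [l1 c1] := @prof_chi_cvg R n _ p a b al n0 p0 ab Lw_prof_c; exact: (Lw_cvg p1 Lw_prof_c (tj _) c1).
apply/ler_addgt0Pr => e e0.
have e1 : 0 < e / (B + 1) by rewrite divr_gt0// ltr_wpDl.
have [C C0 HC] := HU e1.
have h : A + (p - 1) * B <= p * S0 * D + e / (B + 1) * B + C * 0.
  have c1 : intH p b (phij j) + (p - 1) * intL p a (phij j) @[j --> \oo] --> A + (p - 1) * B.
    by apply: cvgD; [exact: cA|apply: cvgM; [exact: cvg_cst|exact: cB]].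
  have c2 : p * S0 * intL p c (phij j) + e / (B + 1) * intL p a (phij j) + C * chi_error j @[j --> \oo] -->
      p * S0 * D + e / (B + 1) * B + C * 0.
    apply: cvgD; first apply: cvgD; (apply: cvgM; first exact: cvg_cst);
      [exact: cD|exact: cB|exact: chi_error_cvg].
  apply: (ler_cvg_to c1 c2); apply: nearW => j.
  have tc : test_fun (phij j) by exact: test_chiprof.
  by have [l [M hj]] := test_C1c tc; rewrite -intD_chiprof; exact: HC hj.
apply: (le_trans h); rewrite mulr0 addr0 lerD2l mulrAC ler_pdivrMr ?ltr_wpDl//.
by apply: ler_wpM2l; [exact: ltW|rewrite lerDl].
Qed.

Lemma approximable_scale u G (k : R) : approximable u G ->
  approximable (fun x => k * u x) (fun x => k *: G x).
Proof.
move=> hu; have [WG lG la lc [w [tw cG ca cc]]] := hu.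
have E1 (f : 'rV[R]_n -> R) : (fun x => f x + (k - 1) * f x) = fun x => k * f x.
  by apply/funext => x; ring.
have E2 (F : 'rV[R]_n -> 'rV[R]_n) : (fun x => F x + (k - 1) *: F x) = fun x => k *: F x.
  by apply/funext => x; rewrite scalerBl scale1r addrC subrK.
have lB j : Lw (- (p * b)) p (gnorm (fun x => G x - grad (w j) x)).
  have m := measurable_gnorm_lin (- 1) WG (test_weak_gradient (tw j)).
  have [l1 _] := gnormZ (- 1) (ltW p0) (test_gnorm (- (p * b)) p0 (tw j)).
  have [h _] := gnormD p1 m lG l1; move: h.
  by rewrite (_ : (fun x => G x + - 1 *: _) = fun x => G x - grad (w j) x)//; apply/funext => x; rewrite scaleN1r.
split.
- by have := weak_gradient_lin (k - 1) WG WG; rewrite E1 E2.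
- exact: (gnormZ k (ltW p0) lG).1.
- exact: (LwZ k (ltW p0) la).1.
- exact: (LwZ k (ltW p0) lc).1.
have cK (f : nat -> R) : f j @[j --> \oo] --> (0 : R) -> `|k| `^ p * f j @[j --> \oo] --> (0 : R).
  by move=> f0; rewrite -[X in _ --> X](mulr0 (`|k| `^ p)); apply: cvgM; [exact: cvg_cst|exact: f0].
have eB (f : nat -> 'rV[R]_n -> R) (s : R) : (forall j, Lw s p (fun x => u x - f j x)) ->
    (fun j => wn s p (fun x => k * u x - k * f j x)) = fun j => `|k| `^ p * wn s p (fun x => u x - f j x).
  move=> h; apply/funext => j; rewrite -(LwZ k (ltW p0) (h j)).2; congr (wn s p _).
  by apply/funext => x; rewrite mulrBr.
exists (fun j x => k * w j x); split.
- by move=> j; have := test_lin (k - 1) (tw j) (tw j); rewrite E1.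
- rewrite (_ : (fun j => _) = fun j => `|k| `^ p * wn (- (p * b)) p (gnorm (fun x => G x - grad (w j) x))); first exact: cK.
  apply/funext => j; rewrite -(gnormZ k (ltW p0) (lB j)).2; congr (wn _ p (gnorm _)).
  apply/funext => x; have [l [M hw]] := test_C1c (tw j); have [_ hw' _] := hw.
  have := grad_lin (k - 1) hw' hw' x; rewrite E1 => ->.
  by rewrite scalerBr scalerBl scale1r [grad _ _ + _]addrC subrK.
- by rewrite eB; [exact: cK|move=> j; exact: (LwB2 p1 la (test_Lw _ p0 (tw j))).1].
- by rewrite eB; [exact: cK|move=> j; exact: (LwB2 p1 lc (test_Lw _ p0 (tw j))).1].
Qed.

Lemma approximable_norms u G : approximable u G -> exists A B D : R,
  [/\ [/\ 0 <= A, 0 <= B & 0 <= D],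
    [/\ normH p b u = A%:E, normL p a u = B%:E & normL p c u = D%:E] &
    [/\ A `^ p = wn (- (p * b)) p (gnorm G), B `^ p = wn (- (p * a)) p u & D `^ p = wn (- (p * c)) p u]].
Proof.
move=> [WG lG la lc _].
have [h1 e1] := powR_Lw p0 (normH_ge0 p b u) (normH_powR b n0 p_neq0 WG) lG.
have [h2 e2] := powR_Lw p0 (normL_ge0 p a u) (normL_powR a u p_neq0) la.
have [h3 e3] := powR_Lw p0 (normL_ge0 p c u) (normL_powR c u p_neq0) lc.
exists (fine (normH p b u)), (fine (normL p a u)), (fine (normL p c u)).
have f z : (0 <= z -> z < +oo -> z = (fine z)%:E :> \bar R)%E.
  by move=> z0 z1; rewrite fineK// ge0_fin_numE.
split; split; [exact: fine_ge0 (normH_ge0 p b u)|exact: fine_ge0 (normL_ge0 p a u)|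
  exact: fine_ge0 (normL_ge0 p c u)|exact: f (normH_ge0 p b u) h1|exact: f (normL_ge0 p a u) h2|
  exact: f (normL_ge0 p c u) h3|exact: e1|exact: e2|exact: e3].
Qed.

Lemma root_cvg0 (z : nat -> \bar R) (x : nat -> R) : (forall j, 0 <= z j)%E ->
  (forall j, (z j < +oo)%E /\ fine (z j) `^ p = x j) -> x j @[j --> \oo] --> (0 : R) ->
  z j @[j --> \oo] --> 0%E.
Proof.
move=> z0 zx x0; apply/fine_cvgP; split.
  by apply: nearW => j; rewrite ge0_fin_numE//; exact: (zx j).1.
have pV : 0 < p^-1 by rewrite invr_gt0.
have := cvg_norm_powR pV x0; rewrite normr0 powR0 ?invr_neq0//.
rewrite (_ : (fun k => `|x k| `^ p^-1) = fine \o z)//; apply/funext => j /=.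
have [_ <-] := zx j; rewrite ger0_norm ?powR_ge0// -powRrM mulfV// powRr1//.
exact: fine_ge0.
Qed.

(** On a compact set [K] the distance is the weighted norm with weight 1 and exponent 1 of
    [(1 - chi j)] times the restriction of [k phi] to [K], so the dominated convergence of cut-offs
    applies. *)
Lemma prof_cvg_L1loc (k : R) : cvg_L1loc (fun j x => k * phij j x) (fun x => k * phi x).
Proof.
move=> K cK K0; have mK : measurable K.
  by rewrite -[K]setCK; apply: measurableC; apply: open_measurable_rV; apply: closed_openC; exact: (compact_closed (@norm_hausdorff _ _) cK).
have [loc _] := @prof_weak R n al a b ab.
pose f x := \1_K x * (k * phi x).
have mf : measurable_fun setT f.
  apply: measurable_funM; first exact: measurable_indic.
  by apply: measurable_funM => //; exact: measurable_prof.
have lf : Lw 0 1 f.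
  split; first exact: mf.
  have iK : rint mu (fun x => \1_K x * phi x).
    have := (integrable_mkcond _ mK).1 (loc K cK K0).
    rewrite /rint (_ : (EFin \o phi) \_ K = EFin \o (fun x => \1_K x * phi x))//.
    by apply/funext => x /=; rewrite patchE indicE; case: (x \in K); rewrite ?mul1r ?mul0r.
  have := rint_norm (rintZ k iK); rewrite /rint.
  rewrite (_ : EFin \o (fun x => `|k * (\1_K x * phi x)|) = EFin \o wfun 0 1 f)//.
  by apply/funext => x /=; rewrite /wfun powRr0 mul1r powRr1// /f mulrCA.
have [lj cj] := Lw_chi_cvg n0 ltr01 lf.
rewrite (_ : (fun j => _) = fun j => (wn 0 1 (fun x => (1 - chi j x) * f x))%:E).
  by apply: cvg_EFin; [exact: nearW|exact: cj].
apply/funext => j; rewrite /wn -EFin_Rintegral//; last exact: (lj j).2.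
rewrite [LHS]integral_mkcond; congr (integral _ _ _); apply/funext => x.
rewrite patchE /wfun powRr0 mul1r powRr1// /f indicE /chiprof; case: (x \in K).
  by rewrite mul1r; congr (`|_|%:E); ring.
by rewrite mul0r mulr0 normr0.
Qed.

Lemma prof_space (k : R) : (spaceH p b `&` spaceL p a) (fun x => k * phi x).
Proof.
have m : measurable_fun setT (fun x => k * phi x).
  by apply: measurable_funM => //; exact: measurable_prof.
have tk j : test_fun (fun x => k * phij j x).
  have tc : test_fun (phij j) by exact: test_chiprof.
  have := test_lin (k - 1) tc tc.
  by rewrite (_ : (fun x => _ + _) = fun x => k * phij j x)//; apply/funext => x; ring.
have W := @prof_weak R n al a b ab.
have [l1 c1] := @dprof_cvg R n p a b al n0 p1 ab pn.
have [l2 c2] := @prof_chi_cvg R n _ p a b al n0 p0 ab Lw_prof_a.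
have cK (f : nat -> R) : f j @[j --> \oo] --> (0 : R) -> `|k| `^ p * f j @[j --> \oo] --> (0 : R).
  by move=> f0; rewrite -[X in _ --> X](mulr0 (`|k| `^ p)); apply: cvgM; [exact: cvg_cst|exact: f0].
split; last first.
  split; first exact: m.
  exists (fun j x => k * phij j x); split; first exact: tk.
  apply: (root_cvg0 _ _ (cK _ c2)) => j; first exact: normL_ge0.
  have [h e] := LwZ k (ltW p0) (l2 j); rewrite -e.
  rewrite (_ : (fun x => k * (phi x - phij j x)) = (fun x => k * phi x) \- (fun x => k * phij j x)) in h *; last first.
    by apply/funext => x; rewrite /= mulrBr.
  exact: powR_Lw p0 (normL_ge0 _ _ _) (normL_powR a _ p_neq0) h.
have Wk : is_weak_gradient (fun x => k * phi x) (fun x => k *: dphi x).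
  by have [] := approximable_scale k prof_approximable.
split; [exact: m|by exists (fun x => k *: dphi x)|].
exists (fun j x => k * phij j x); split; [exact: tk|exact: prof_cvg_L1loc|].
apply: (root_cvg0 _ _ (cK _ c1)) => j; first exact: normH_ge0.
have [h e] := gnormZ k (ltW p0) (l1 j); rewrite -e.
have tc : test_fun (phij j) by exact: test_chiprof.
have W1 := weak_gradient_lin (- 1) W (test_weak_gradient tc).
have Wj : is_weak_gradient ((fun x => k * phi x) \- (fun x => k * phij j x)) (fun x => k *: (dphi x - grad (phij j) x)).
  have := weak_gradient_lin (k - 1) W1 W1.
  rewrite (_ : (fun x => _ + (k - 1) * _) = (fun x => k * phi x) \- (fun x => k * phij j x)).
    rewrite (_ : (fun x => _ + (k - 1) *: _) = fun x => k *: (dphi x - grad (phij j) x))//.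
    by apply/funext => x; rewrite scaleN1r scalerBl scale1r addrC subrK.
  by apply/funext => x /=; move: (phi x) (phij j x) => *; ring.
exact: powR_Lw p0 (normH_ge0 _ _ _) (normH_powR b n0 p_neq0 Wj) h.
Qed.

Lemma wn_eq0 s u : Lw s p u -> wn s p u = 0 -> {ae mu, forall x, u x = 0}.
Proof.
move=> [mu_ iu] w0; have mw := measurable_wfun s p mu_.
have mE : measurable_fun setT (EFin \o wfun s p u) by exact/measurable_EFinP.
have h : (\int[mu]_(x in setT) `|(EFin \o wfun s p u) x| = 0)%E.
  rewrite (_ : (fun x => `|(EFin \o wfun s p u) x|%E) = EFin \o wfun s p u).
    by have := EFin_Rintegral measurableT iu; rewrite -/(wn s p u) w0.
  by apply/funext => x /=; rewrite ger0_norm ?wfun_ge0.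
have := (ae_eq_integral_abs mu measurableT mE).1 h.
move=> H; apply: filterS2 (ae_neq0 n0) H => x x0 /(_ I) /= [].
move=> /eqP; rewrite mulf_eq0 => /orP[/eqP r0|/eqP e].
  by have := powR_gt0 s (etrans (l2norm_gt0 x) x0 : is_true (0 < l2norm x)); rewrite r0 ltxx.
by apply/eqP; rewrite -normr_eq0; apply/eqP; exact: (powR_eq0_eq0 e).
Qed.

(** The best scale is [lam = A / B]. As either number may be 0, both are raised by [e], and [e]
    tends to 0 at the end. *)
Lemma hoelder_scaled (A B D : R) : 0 <= A -> 0 <= B ->
  (forall lam : R, 0 < lam -> 0 <= A `^ p + (p - 1) * lam `^ p * B `^ p - p * lam `^ (p - 1) * S0 * D) ->
  S0 * D <= A * B `^ (p - 1).
Proof.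
move=> A0 B0 H; have p10' : 0 < p - 1 by rewrite subr_gt0 (lt_le_trans _ p2)// ltr1n.
have step (e : R) : 0 < e -> S0 * D <= (A + e) * (B + e) `^ (p - 1).
  move=> e0; have [A1 A1E] : exists A1, A1 = A + e by eexists.
  have [B1 B1E] : exists B1, B1 = B + e by eexists.
  rewrite -A1E -B1E; have A10 : 0 < A1 by rewrite A1E ltr_wpDl.
  have B10 : 0 < B1 by rewrite B1E ltr_wpDl.
  (* At this scale [lam ^ p * B1 ^ p = A1 ^ p], so the first two terms add up to at most
     [p * A1 ^ p], which is [p * lam ^ (p - 1)] times the right side. *)
  have [lam lamE] : exists lam, lam = A1 / B1 by eexists.
  have lam0 : 0 < lam by rewrite lamE divr_gt0.
  have eA : lam * B1 = A1 by rewrite lamE divfK// gt_eqF.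
  have h1 : A `^ p <= A1 `^ p.
    by rewrite ge0_ler_powR ?nnegrE ?(ltW p0) ?(ltW A10)// A1E lerDl ltW.
  have h2 : B `^ p <= B1 `^ p.
    by rewrite ge0_ler_powR ?nnegrE ?(ltW p0) ?(ltW B10)// B1E lerDl ltW.
  have h3 : lam `^ p * B1 `^ p = A1 `^ p by rewrite -powRM ?ltW// eA.
  have h4 : A1 `^ p = lam `^ (p - 1) * (A1 * B1 `^ (p - 1)).
    rewrite mulrCA -powRM ?ltW// eA mulrC powR_mulr1// subrK//.
  have l0 : 0 < lam `^ (p - 1) by exact: powR_gt0.
  have h5 := H lam lam0.
  have h6 : (p - 1) * lam `^ p * B `^ p <= (p - 1) * A1 `^ p.
    by rewrite -mulrA -h3; apply: ler_wpM2l => //; apply: ler_wpM2l => //; exact: powR_ge0.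
  have h7 : p * (lam `^ (p - 1) * (S0 * D)) <= p * A1 `^ p.
    move: h5 h6 h1; rewrite !mulrA; move: (A `^ p) (A1 `^ p) (_ * lam `^ p * _) (_ * D) => *; lra.
  by move: h7; rewrite ler_pM2l// h4 ler_pM2l.
have inv0 : (fun j => j.+1%:R^-1 : R) @ \oo --> (0 : R) := cvg_harmonic.
have cA : A + j.+1%:R^-1 @[j --> \oo] --> A.
  by rewrite -[X in _ --> X]addr0; apply: cvgD; [exact: cvg_cst|exact: inv0].
have cB : B + j.+1%:R^-1 @[j --> \oo] --> B.
  by rewrite -[X in _ --> X]addr0; apply: cvgD; [exact: cvg_cst|exact: inv0].
have cv : (fun j : nat => (A + j.+1%:R^-1) * `|B + j.+1%:R^-1| `^ (p - 1)) @ \oo --> A * B `^ (p - 1).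
  by rewrite -[X in _ --> _ * X `^ _](ger0_norm B0); apply: cvgM; [exact: cA|exact: cvg_norm_powR p10' cB].
apply: (cvgr_to_ge cv); apply: nearW => j /=.
have j0 : 0 < (j.+1%:R^-1 : R) by rewrite invr_gt0.
by rewrite ger0_norm ?addr_ge0 ?(ltW j0)//; exact: step.
Qed.

Lemma young_norms (A B : R) : 0 <= A -> 0 <= B ->
  p * (A * B `^ (p - 1)) <= A `^ p + (p - 1) * B `^ p.
Proof.
move=> A0 B0; have p1' : 1 < p by rewrite (lt_le_trans _ p2)// ltr1n.
by have := powR_young p1' A0 B0 ltr01; rewrite powR1 !mul1r.
Qed.

Lemma CKN_real u G (A B D : R) : approximable u G -> 0 <= A -> 0 <= B ->
  A `^ p = wn (- (p * b)) p (gnorm G) -> B `^ p = wn (- (p * a)) p u -> D `^ p = wn (- (p * c)) p u ->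
  S0 * D `^ p <= A * B `^ (p - 1).
Proof.
move=> hu A0 B0 eA eB eD; apply: hoelder_scaled => // lam lam0.
by rewrite eA eB eD; exact: approximable_excess hu lam0.
Qed.

Lemma prof_energy : energy phi dphi = p * S0 * wn (- (p * c)) p phi.
Proof. by apply/eqP; rewrite -subr_eq0 -excess1 prof_excess. Qed.

(** A function that is not almost everywhere 0 witnesses that the measure is nonzero, so the
    positive profile has positive norms. *)
Context (u0 : 'rV[R]_n -> R) (u0N0 : ~ {ae mu, forall x, u0 x = 0}).

Lemma prof_c_gt0 : 0 < wn (- (p * c)) p phi.
Proof.
rewrite lt_def wn_ge0 andbT; apply/eqP => w0; apply: u0N0.
apply: filterS2 (ae_neq0 n0) (wn_eq0 Lw_prof_c w0) => x x0 h.
by have := prof_gt0 al (b + 1 - a) x0; rewrite h ltxx.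
Qed.

(** [S0] is admissible by [CKN_real]. No larger constant is: for the profile, Young's inequality
    gives [p A B ^ (p - 1) <= energy = p S0 D ^ p] with [D ^ p > 0]. *)
Lemma CKN_constant_value : @CKN_constant R n p a b = S0.
Proof.
rewrite /CKN_constant; set E := [set S | _].
have ES0 : E S0.
  move=> u [hu lu]; have [G aG] := density_approximable hu lu.
  have [A [B [D [[A0 B0 D0] [eA eB eD] [fA fB fD]]]]] := approximable_norms aG.
  rewrite eA eB eD !poweR_EFin -!EFinM lee_fin.
  exact: CKN_real aG A0 B0 fA fB fD.
have ubE : ubound E S0.
  move=> S ES; have Xphi : (spaceH p b `&` spaceL p a) phi.
    have := prof_space 1; rewrite (_ : (fun x => 1 * phi x) = phi)//.
    by apply/funext => x; rewrite mul1r.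
  have := ES _ Xphi.
  have [A [B [D [[A0 B0 D0] [eA eB eD] [fA fB fD]]]]] := approximable_norms prof_approximable.
  rewrite eA eB eD !poweR_EFin -!EFinM lee_fin => h1.
  have h2 := young_norms A0 B0; have h3 := prof_energy; rewrite /energy -fA -fB -fD in h3.
  have D1 := prof_c_gt0; rewrite -fD in D1.
  rewrite h3 -mulrA ler_pM2l// in h2.
  by have := le_trans h1 h2; rewrite ler_pM2r.
apply/eqP; rewrite eq_le; apply/andP; split.
- by apply: ge_sup => //; exists S0.
- by apply: ub_le_sup => //; exists S0.
Qed.

Lemma energy_scale u G (k : R) : Lw (- (p * b)) p (gnorm G) -> Lw (- (p * a)) p u ->
  energy (fun x => k * u x) (fun x => k *: G x) = `|k| `^ p * energy u G.
Proof.
move=> lG lu; rewrite /energy (gnormZ k (ltW p0) lG).2 (LwZ k (ltW p0) lu).2.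
by rewrite mulrDr mulrCA.
Qed.

(** Equality is squeezed between the inequality itself and Young's inequality combined with the
    vanishing excess; multiples follow because every term scales by [|k| ^ p]. *)
Lemma prof_minimizer (k : R) : CKN_minimizers p a b (fun x => k * phi x).
Proof.
split; first exact: prof_space.
have ak := approximable_scale k prof_approximable.
have [A [B [D [[A0 B0 D0] [eA eB eD] [fA fB fD]]]]] := approximable_norms ak.
rewrite CKN_constant_value eA eB eD !poweR_EFin -!EFinM; congr (_%:E).
apply/eqP; rewrite eq_le (CKN_real ak A0 B0 fA fB fD)/=.
have h2 := young_norms A0 B0.
have [_ lW la lc _] := prof_approximable.
have h3 := energy_scale k lW la; rewrite prof_energy /energy -fA -fB mulrCA -(LwZ k (ltW p0) lc).2 -fD in h3.
by rewrite h3 -mulrA ler_pM2l// in h2.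
Qed.

Lemma CKN_energyE u G : is_weak_gradient u G -> Lw (- (p * b)) p (gnorm G) -> Lw (- (p * a)) p u ->
  CKN_energy p a b u = energy u G.
Proof.
move=> WG lG lu.
have [_ e1] := powR_Lw p0 (normH_ge0 p b u) (normH_powR b n0 p_neq0 WG) lG.
have [_ e2] := powR_Lw p0 (normL_ge0 p a u) (normL_powR a u p_neq0) lu.
by congr (_ + _ * _); [exact: e1|exact: e2].
Qed.

Lemma CKN_energy_ge0 u : 0 <= CKN_energy p a b u.
Proof. by rewrite addr_ge0 ?powR_ge0// mulr_ge0 ?powR_ge0. Qed.
End core.

(** The deficit is the excess divided by [D ^ p], with [D] the norm with exponent c, while
    [approximable_core] bounds the infimum by a multiple of the excess divided by the energy. The
    two quotients compare because a nonnegative excess means that the energy is at least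
    [p * S0 * D ^ p]. *)
Lemma CKN_stability (R : realType) (n : nat) (p a b al S0 : R) : (0 < n)%N -> 2 <= p -> a < b + 1 ->
  0 <= b - al -> p * (b - al + 1) < n%:R -> n%:R != p * (b + 1) -> 0 < S0 ->
  (forall e : R, 0 < e -> exists2 C : R, 0 <= C & forall l M (u : 'rV[R]_n -> R), C1c l M u ->
    intH p b u + (p - 1) * intL p a u <= p * S0 * intL p (CKN_exponent p a b) u +
      e * intL p a u + C * intD p b (kern al 1 a b) u) ->
  (exists2 c0 : R, 0 < c0 & forall (lam : R) l M (u : 'rV[R]_n -> R), 0 < lam -> C1c l M u ->
    c0 * intD p b (kern al lam a b) u <= intH p b u + (p - 1) * lam `^ p * intL p a u
      - p * lam `^ (p - 1) * S0 * intL p (CKN_exponent p a b) u) ->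
  exists2 C : R, 0 < C & forall u : 'rV[R]_n -> R, (spaceH p b `&` spaceL p a) u ->
    ~ {ae lebesgue_rV R n, forall x, u x = 0} ->
    let I := inf [set CKN_energy p a b (u \- v) / CKN_energy p a b u | v in CKN_minimizers p a b] in
    [/\ 0 <= CKN_deficit p a b u, I <= 1 & I <= C * CKN_deficit p a b u].
Proof.
move=> n0 p2 ab bal pn nb S00 HU [c0 c00 HQ].
have p0 : 0 < p by rewrite (lt_le_trans _ p2).
have p1 : 1 <= p by rewrite (le_trans _ p2)// ler1n.
have [C C0 HC] := approximable_core n0 p2 ab bal pn nb S00 HU c00 HQ.
have pS0 : 0 < p * S0 by exact: mulr_gt0.
(* The division by [p * S0] comes from the lower bound of the energy; adding 1 makes the constant
   positive. *)
exists ((C + 1) / (p * S0)); first by rewrite divr_gt0// ltr_wpDl.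
move=> u [hu lu] uN0 I; rewrite /I {I}.
have [G aG] := density_approximable n0 p2 ab nb hu lu.
have [WG lG la lc _] := aG.
have Q0 := approximable_excess p2 c00 HQ aG ltr01.
have [A [B [D [[A0 B0 D0] [eA eB eD] [fA fB fD]]]]] := approximable_norms n0 p2 aG.
have EE := CKN_energyE n0 p2 WG lG la.
have D1 : 0 < D `^ p.
  rewrite fD lt_def wn_ge0 andbT; apply/eqP => w0; apply: uN0; exact: (wn_eq0 _ lc w0).
have Qe := excess1 p a b S0 u G; rewrite -fD in Qe.
have PS := CKN_constant_value n0 p2 ab pn nb HU c00 HQ uN0.
have mk k := prof_minimizer n0 p2 ab pn nb HU c00 HQ uN0 k.
have dE : CKN_deficit p a b u = excess p a b S0 1 u G / D `^ p.
  rewrite /CKN_deficit PS eD EE /= Qe mulrBl mulfK//; exact: lt0r_neq0.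
set X := [set _ | v in _].
have lbX : has_lbound X.
  exists 0 => x [v _ <-]; apply: mulr_ge0; first exact: CKN_energy_ge0.
  by rewrite invr_ge0; exact: CKN_energy_ge0.
have E0 : 0 < CKN_energy p a b u.
  rewrite EE; move: Qe Q0 (mulr_gt0 pS0 D1).
  by move: (energy p a b u G) (excess p a b S0 1 u G) (p * S0 * D `^ p) => e q d; clear; lra.
have le1 : inf X <= 1.
  (* The zero function is a minimizer as the multiple 0 of the profile, and its quotient is 1. *)
  apply: (ge_inf lbX); exists (fun x => 0 * prof al (b + 1 - a) x); first exact: mk.
  rewrite (_ : u \- _ = u); first by rewrite divff// gt_eqF.
  by apply/funext => x /=; rewrite mul0r subr0.
split; [|exact: le1|].
  by rewrite dE divr_ge0// ltW.
have H : inf X * CKN_energy p a b u <= C * excess p a b S0 1 u G.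
  apply/ler_addgt0Pr => eta eta0; have [k Hk] := HC u G aG eta eta0.
  have W := weak_gradient_lin k WG (@prof_weak R n al a b ab).
  have lW := @Lw_dprof R n p a b al n0 p1 ab pn.
  have lpa := @Lw_prof_a R n p a b al n0 p2 ab pn.
  have l1 := (gnormD p1 (measurable_gnorm W) lG (gnormZ k (ltW p0) lW).1).1.
  have l2 := (LwD2 p1 la (LwZ k (ltW p0) lpa).1).1.
  rewrite -(CKN_energyE n0 p2 W l1 l2) in Hk; apply: le_trans Hk.
  rewrite -ler_pdivlMr//; apply: (ge_inf lbX).
  exists (fun x => - k * prof al (b + 1 - a) x); first exact: mk.
  rewrite (_ : u \- _ = fun x => u x + k * prof al (b + 1 - a) x)//.
  by apply/funext => x /=; rewrite mulNr opprK.
rewrite dE; move: H; rewrite -ler_pdivlMr// => H; apply: (le_trans H).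
set Q := excess _ _ _ _ _ _ _ in Q0 Qe *.
have Eg : p * S0 * D `^ p <= CKN_energy p a b u.
  by rewrite EE; move: Qe Q0; move: Q (energy p a b u G) (p * S0 * D `^ p) => q e d; clear; lra.
have h1 : C * Q / CKN_energy p a b u <= C * Q / (p * S0 * D `^ p).
  apply: ler_wpM2l; first exact: mulr_ge0.
  by rewrite lef_pV2 ?posrE//; exact: mulr_gt0.
apply: (le_trans h1).
rewrite (_ : (C + 1) / (p * S0) * (Q / D `^ p) = (C + 1) * Q / (p * S0 * D `^ p)).
  apply: ler_wpM2r; first by rewrite invr_ge0 ltW// mulr_gt0.
  by apply: ler_wpM2r => //; rewrite lerDl.
by rewrite [in RHS]invfM; move: ((p * S0)^-1) ((D `^ p)^-1) => s d; ring.
Qed.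

(** For [d <= 1] the root only increases [d]; for [d > 1] the right side is at least 1. *)
Lemma CKN_stability_powR (R : realType) (I C p d : R) : 2 <= p -> 0 <= C -> 0 <= d ->
  I <= 1 -> I <= C * d -> I <= (C + 1) * d `^ p^-1.
Proof.
move=> p2 C0 d0 I1 ICd; have pV : 0 <= p^-1 by rewrite invr_ge0 (le_trans _ p2).
have [d1|d1] := lerP d 1.
  apply: (le_trans ICd); apply: (@le_trans _ _ ((C + 1) * d)).
    by apply: ler_wpM2r => //; rewrite lerDl.
  apply: ler_wpM2l; first by rewrite addr_ge0.
  have [->|dN0] := eqVneq d 0; first exact: powR_ge0.
  have d00 : 0 < d by rewrite lt_def dN0.
  rewrite -[leLHS](powRr1 d0) ger_powR ?d00//.
  by rewrite invf_le1 ?(lt_le_trans _ p2)// (le_trans _ p2)// ler1n.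
apply: (le_trans I1); have h : 1 <= d `^ p^-1.
  by rewrite -[leLHS](powRr0 d) ler_powR// ltW.
have := ler_wpM2l C0 h; move: h C0; rewrite mulrDl mul1r mulr1; lra.
Qed.

(** Here [al = 0] and [p * S0 = n - p c]. The upper bound on [b], read as [p * b < n - p], gives the
    integrability of the profile, [n != p * (b + 1)], and [S0 > 0] because
    [p c = p b n / (n - p) < n]. *)
Lemma CKN_stability_small_b (R : realType) (n : nat) (p a b : R) : (0 < n)%N -> 2 <= p -> 0 <= b ->
  b < (n%:R - p) / p -> a < n%:R * b / (n%:R - p) ->
  (p - 1) * a + b + 1 = p * b * n%:R / (n%:R - p) ->
  exists2 C : R, 0 < C & forall u : 'rV[R]_n -> R, (spaceH p b `&` spaceL p a) u ->
    ~ {ae lebesgue_rV R n, forall x, u x = 0} ->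
    let I := inf [set CKN_energy p a b (u \- v) / CKN_energy p a b u | v in CKN_minimizers p a b] in
    [/\ 0 <= CKN_deficit p a b u, I <= 1 & I <= C * CKN_deficit p a b u].
Proof.
move=> n0 p2 b0 bn an ce; have p0 : 0 < p by rewrite (lt_le_trans _ p2).
have pN0 : p != 0 by rewrite gt_eqF.
have bp : p * b < n%:R - p by move: bn; rewrite ltr_pdivlMr// mulrC.
have m0 : 0 < n%:R - p by apply: le_lt_trans bp; rewrite mulr_ge0// ltW.
have ab : a < b + 1.
  (* The equation makes the right side [p] times the upper bound of [a]. *)
  have h : p * a < (p - 1) * a + b + 1.
    by rewrite ce -mulrA -mulrA ltr_pM2l// mulrA [b * _]mulrC.
  by move: h; lra.
have pn : p * (b - 0 + 1) < n%:R by move: bp; lra.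
have nb : n%:R != p * (b + 1) by rewrite gt_eqF//; move: bp; lra.
have nn : 0 < (n%:R : R) by rewrite ltr0n.
pose S0 := (n%:R - p * CKN_exponent p a b) / p.
have pS : p * S0 = n%:R - p * CKN_exponent p a b by rewrite /S0 mulrCA divff// mulr1.
have S00 : 0 < S0.
  rewrite divr_gt0// CKN_exponentE// ce subr_gt0 ltr_pdivrMr// mulrC ltr_pM2l//.
have p1' : 1 < p by rewrite (lt_le_trans _ p2)// ltr1n.
apply: (@CKN_stability R n p a b 0 S0) => //; first by rewrite subr0.
- move=> e e0; have [C C0 HC] := @energy_upper R n p p2 e e0; exists C; first exact: C0.
  move=> l M u hu.
  by rewrite pS; exact: HC hu.
have [c0 c00 H] := @energy_lower R n p p2; exists c0; first exact: c00.
move=> lam l M u lam0 hu.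
have := H a b lam l M u lam0 hu; rewrite -pS.
by rewrite (_ : lam `^ (p - 1) * (p * S0) = p * lam `^ (p - 1) * S0)// mulrA [_ * p]mulrC.
Qed.

(** Here [al = 2 b + 2 - n], and the expansion is an identity, so both expansion constants are 1.
    The condition [b <= n - 2] is [b - al >= 0], and [n - 2 < 2 b] is the integrability of the
    profile. The equation reads [(n - 2) (b + 1 - a) = 2 (2 b - (n - 2))], whence [a < b + 1]; and
    [2 S0] is the sum of [b + 1 - a] and [2 b - (n - 2)], both positive. *)
Lemma CKN_stability_large_b (R : realType) (n : nat) (a b : R) : (0 < n)%N ->
  (n%:R - 2) / 2 < b -> b <= n%:R - 2 -> n%:R * (b - a + 3) = 2 * (3 * b - a + 3) ->
  exists2 C : R, 0 < C & forall u : 'rV[R]_n -> R, (spaceH 2 b `&` spaceL 2 a) u ->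
    ~ {ae lebesgue_rV R n, forall x, u x = 0} ->
    let I := inf [set CKN_energy 2 a b (u \- v) / CKN_energy 2 a b u | v in CKN_minimizers 2 a b] in
    [/\ 0 <= CKN_deficit 2 a b u, I <= 1 & I <= C * CKN_deficit 2 a b u].
Proof.
move=> n0 nb bn e; have nb' : n%:R - 2 < 2 * b by move: nb; rewrite ltr_pdivrMr// mulrC.
have m0 : 0 < (n%:R : R) - 2 by move: nb' bn; lra.
have ab : a < b + 1.
  have h : 0 < (n%:R - 2) * (b + 1 - a).
    rewrite (_ : _ * _ = 2 * (2 * b - (n%:R - 2))); first by rewrite mulr_gt0// subr_gt0.
    have -> : (n%:R - 2) * (b + 1 - a) = n%:R * (b - a + 3) - 2 * n%:R - 2 * (b + 1 - a) by ring.
    by rewrite e; ring.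
  by move: h; rewrite pmulr_rgt0// subr_gt0.
pose S0 := (3 * b - a - n%:R + 3) / 2 : R.
have S2 : 3 * b - a - n%:R + 3 = 2 * S0 by rewrite /S0; field.
have S00 : 0 < S0 by rewrite divr_gt0//; move: ab nb'; lra.
have E2 (lam : R) : 0 < lam -> lam `^ 2 = lam ^+ 2 /\ lam `^ (2 - 1) = lam.
  move=> l0; split; first by rewrite (powR_mulrn 2 (ltW l0)).
  by rewrite (_ : 2 - 1 = 1 :> R) ?powRr1 ?(ltW l0)//; ring.
apply: (@CKN_stability R n 2 a b (2 * b + 2 - n%:R) S0) => //.
- by move: bn; lra.
- by move: nb'; lra.
- by rewrite lt_eqF//; move: nb'; lra.
- move=> eps e0; exists 1; first exact: ler01.
  move=> l M u hu.
  have := @energy_square R n a b (2 * b + 2 - n%:R) 1 l M u hu erefl; rewrite S2 expr1n mul1r mul1r => ->.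
  have := mulr_ge0 (ltW e0) (wint_ge0 (- (2 * a)) 2 (fun x => `|u x|)); rewrite -/(intL 2 a u).
  by move: (intL _ _ u) (intH _ _ u) (intL _ _ u) (eps * _) => *; lra.
exists 1; first exact: ltr01.
move=> lam l M u lam0 hu; have [-> ->] := E2 lam lam0.
have := @energy_square R n a b (2 * b + 2 - n%:R) lam l M u hu erefl; rewrite S2 mul1r => ->.
rewrite le_eqVlt; apply/orP; left; apply/eqP.
by move: (intL _ _ u) (intH _ _ u) (intL _ _ u) => *; ring.
Qed.

Theorem theorem1p10 (R : realType) (N : nat) (p a b : R) (hN : (1 <= N)%N)
    (hpab :
      (* (A) *)
      [/\ p = 2, 0 <= b, b < (N%:R - 2) / 2, a < N%:R * b / (N%:R - 2) &
          a + b + 1 = 2 * b * N%:R / (N%:R - 2)] \/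
      (* (B) *)
      [/\ p = 2, (N%:R - 2) / 2 < b, b <= N%:R - 2 &
          N%:R * (b - a + 3) = 2 * (3 * b - a + 3)] \/
      (* (C) *)
      [/\ 2 < p, 0 <= b, b < (N%:R - p) / p, a < N%:R * b / (N%:R - p) &
          (p - 1) * a + b + 1 = p * b * N%:R / (N%:R - p)]) :
  exists2 C : R, 0 < C &
    forall u : 'rV[R]_N -> R,
      (spaceH p b `&` spaceL p a) u ->
      ~ {ae lebesgue_rV R N, forall x, u x = 0} ->
      (2 < p ->
         inf [set CKN_energy p a b (u \- v) / CKN_energy p a b u
             | v in CKN_minimizers p a b]
           <= C * CKN_deficit p a b u `^ p^-1) /\
      (p = 2 ->
         inf [set CKN_energy 2 a b (u \- v) / CKN_energy 2 a b u
             | v in CKN_minimizers 2 a b]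
           <= C * CKN_deficit 2 a b u).
Proof.
have n0 : (0 < N)%N := hN.
have [C C0 H] : exists2 C : R, 0 < C & forall u : 'rV[R]_N -> R, (spaceH p b `&` spaceL p a) u ->
    ~ {ae lebesgue_rV R N, forall x, u x = 0} ->
    let I := inf [set CKN_energy p a b (u \- v) / CKN_energy p a b u | v in CKN_minimizers p a b] in
    [/\ 0 <= CKN_deficit p a b u, I <= 1 & I <= C * CKN_deficit p a b u].
  case: hpab => [[p2 b0 bN aN ce]|[[p2 bN bN' ce]|[p2 b0 bN aN ce]]].
  - subst p; apply: CKN_stability_small_b => //.
    by rewrite -[2 * b * _ / _]ce; ring.
  - by subst p; exact: CKN_stability_large_b.
  - by apply: CKN_stability_small_b => //; exact: ltW.
(* One constant for both conclusions: the passage to the root for [p > 2] asks for [C + 1]. *)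
exists (C + 1); first by rewrite addr_gt0.
move=> u hu uN0; have [d0 I1 Id] := H u hu uN0; split=> [p2|p2].
  exact: CKN_stability_powR (ltW p2) (ltW C0) d0 I1 Id.
subst p; apply: (le_trans Id); apply: (ler_wpM2r d0); by rewrite lerDl.
Qed.
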